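(* Let $(X,d,\mathfrak m)$ be an essentially non-branching (geodesic) metric measure space, and $G$ a compact Lie group acting by isometries on $X$. Assume that the orbit space $(X^\ast,d^\ast)$ is isometric to $[-1,1]$, $[0,\infty)$, $\mathbb R$, or $\mathbf S^1$. Let $H$ denote the isotropy group of points in orbits over the interior of $X^\ast$ (unique up to conjugation). Then: (a) When $X^\ast$ is homeomorphic to $[0,1]$, then $X$ is equivariantly homeomorphic to the union of two cone bundles over the singular orbits, glued along their boundary. (b) When $X^\ast$ is homeomorphic to $[0,\infty)$, then $X$ is homeomorphic to a cone bundle. (c) When $X^\ast$ is homeomorphic to $\mathbf S^1$, then $X$ is the total space of a fiber bundle with homogeneous fiber $G/H$, and structure group $N_G(H)/H$. (d) When $X^\ast$ is homeomorphic to $\mathbb R$, then $X$ is homeomorphic to $\mathbb R\times G/H$.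
   Context: A metric measure space is a complete separable metric space with a non-negative Borel measure finite on balls; $\mathrm{Geo}(X)$ is the space of curves $\gamma:[0,1]\to X$ with $d(\gamma_t,\gamma_s)=|t-s|d(\gamma_0,\gamma_1)$, and $X$ is geodesic if any two points are joined by such a curve. Essentially non-branching: for all $\mu_0,\mu_1\in\mathbb P_2(X)$ (Borel probability measures with finite second moment) absolutely continuous with respect to $\mathfrak m$, every probability measure $\eta$ on $\mathrm{Geo}(X)$ such that $(e_0,e_1)_\#\eta$ is an optimal coupling of $\mu_0,\mu_1$ for the cost $d^2$ ($e_t(\gamma)=\gamma_t$) is concentrated on a set $\Gamma$ of non-branching geodesics, i.e. two elements of $\Gamma$ coinciding on $[0,t]$ for some $t\in(0,1)$ are equal. $X^\ast=X/G$ carries the metric $d^\ast(x^\ast,y^\ast)=d(G(x),G(y))$. The singular orbits are those over boundary points of $X^\ast$. A cone bundle over an orbit $G(x)\cong G/G_x$ is a fiber bundle over it whose fibers are topological cones, of the form $G\times_{G_x}S_x$ with $S_x$ a slice at $x$; in (b) the base is the unique singular orbit. $N_G(H)$ is the normalizer of $H$ in $G$.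
   Formalization: Uniqueness up to conjugation of the isotropy group H over the interior of X* is assumed rather than derived: it can fail under the stated hypotheses (a tripod with a Dirac measure and Z/2 swapping two legs), and then H is undefined and (a) is false. *)

(* Defs.v *)
From HB Require Import structures.
From Stdlib Require Import Relation_Operators.
From mathcomp Require Import all_boot all_order all_algebra.
From mathcomp Require Import all_classical all_reals all_analysis.
Import Order.TTheory GRing.Theory Num.Theory.
Import numFieldTopology.Exports numFieldNormedType.Exports.

Set Implicit Arguments.
Unset Strict Implicit.
Unset Printing Implicit Defensive.

Local Open Scope classical_set_scope.
Local Open Scope quotient_scope.
Local Open Scope ring_scope.

Definition is_homeo (S T : topologicalType) (f : S -> T) : Prop :=
  continuous f /\
  exists g : T -> S, [/\ cancel f g, cancel g f & continuous g].

Definition homeomorphic (S T : topologicalType) : Prop :=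
  exists f : S -> T, is_homeo f.

Section generated_quotient.
Variables (T : choiceType) (e : T -> T -> Prop).

Let rst (x y : T) : bool := `[< clos_refl_sym_trans T e x y >].

Let rst_refl : reflexive rst.
Proof. by move=> x; apply/asboolP; exact: rst_refl. Qed.

Let rst_sym : symmetric rst.
Proof. by move=> x y; apply/asboolP/asboolP; exact: rst_sym. Qed.

Let rst_trans : transitive rst.
Proof.
by move=> y x z /asboolP xy /asboolP yz; apply/asboolP/(rst_trans _ _ _ _ _ xy).
Qed.

Definition generated_equiv := EquivRel rst rst_refl rst_sym rst_trans.

Definition quot := {eq_quot generated_equiv}.

Lemma quotP (x y : T) :
  \pi_quot x = \pi_quot y <-> clos_refl_sym_trans T e x y.
Proof. by split=> [/eqmodP/asboolP//|xy]; apply/eqmodP/asboolP. Qed.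

End generated_quotient.

Definition topquot (T : topologicalType) (e : T -> T -> Prop) :
  topologicalType := quotient_topology (quot e).

Definition cls (T : topologicalType) (e : T -> T -> Prop) (x : T) :
  topquot e := \pi_(quot e) x.

Definition rep (T : topologicalType) (e : T -> T -> Prop) (c : topquot e) : T :=
  repr (c : quot e).

Lemma clsP (T : topologicalType) (e : T -> T -> Prop) (x y : T) :
  cls e x = cls e y <-> clos_refl_sym_trans T e x y.
Proof. exact: quotP. Qed.

Lemma repK (T : topologicalType) (e : T -> T -> Prop) :
  cancel (@rep T e) (@cls T e).
Proof. exact: (@reprK _ (quot e)). Qed.

Lemma cls_continuous (T : topologicalType) (e : T -> T -> Prop) :
  continuous (@cls T e).
Proof. exact: (@pi_continuous T (quot e)). Qed.

(* Boundary points of a 1-dimensional topological manifold with boundary. *)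
Definition is_boundary (R : realType) (T : topologicalType) (b : T) : Prop :=
  exists U : set T, [/\ open U, U b &
    exists2 f : U -> `[0%R, 1%R[%classic : set R, is_homeo f &
      forall u : U, set_val u = b -> set_val (f u) = 0].

Definition is_fiber_bundle (E B F : topologicalType) (p : E -> B) : Prop :=
  continuous p /\
  forall b : B, exists U : set B, [/\ open U, U b &
    exists2 h : (U * F)%type -> p @^-1` U, is_homeo h &
      forall u f, p (set_val (h (u, f))) = set_val u].

(* [r] is meant to be an effective action of [Gam] on [F]; the cocycle condition
   on the transition functions [t] is then automatic. *)
Definition is_fiber_bundle_with_group (E B F Gam : topologicalType)
    (r : Gam -> F -> F) (p : E -> B) : Prop :=
  continuous p /\
  exists (I : Type) (U : I -> set B)
         (h : forall i, (U i * F)%type -> p @^-1` (U i)),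
    [/\ forall i, open (U i),
        \bigcup_i U i = setT,
        forall i, is_homeo (h i) /\
          forall u f, p (set_val (h i (u, f))) = set_val u &
        forall i j, exists2 t : (U i `&` U j) -> Gam, continuous t &
          forall (u : U i `&` U j) (ui : U i) (uj : U j) (f : F),
            set_val ui = set_val u -> set_val uj = set_val u ->
            set_val (h i (ui, f)) = set_val (h j (uj, r (t u) f))].

HB.mixin Record isTopologicalGroup G & Topological G & Group G := {
  mulg_continuous : continuous (fun p : G * G => (p.1 * p.2)%g) ;
  invg_continuous : continuous (fun g : G => (g^-1)%g)
}.

#[short(type="topGroupType")]
HB.structure Definition TopGroup :=
  {G of Topological G & Group G & isTopologicalGroup G}.

Section smooth.
Variables (R : realType) (V W : normedModType R).

(* For finite-dimensional [V]: all iterated directional derivatives of order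
   at most [k] exist and are continuous on the open set [U]. *)
Fixpoint Ck (k : nat) (U : set V) (f : V -> W) : Prop :=
  (forall x, U x -> {for x, continuous f}) /\
  match k with
  | 0 => True
  | k'.+1 => forall v, (forall x, U x -> derivable f x v) /\
                       Ck k' U (fun x => 'D_v f x)
  end.

Definition smooth (U : set V) (f : V -> W) : Prop := forall k, Ck k U f.

End smooth.

Record chart (R : realType) (n : nat) (M : topologicalType) := Chart {
  chart_dom : set M ;
  chart_cod : set 'rV[R]_n ;
  chart_map : M -> 'rV[R]_n ;
  chart_inv : 'rV[R]_n -> M ;
  chart_dom_open : open chart_dom ;
  chart_cod_open : open chart_cod ;
  chart_mapP : forall x, chart_dom x -> chart_cod (chart_map x) ;
  chart_invP : forall v, chart_cod v -> chart_dom (chart_inv v) ;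
  chart_mapK : forall x, chart_dom x -> chart_inv (chart_map x) = x ;
  chart_invK : forall v, chart_cod v -> chart_map (chart_inv v) = v ;
  chart_map_continuous :
    forall x, chart_dom x -> {for x, continuous chart_map} ;
  chart_inv_continuous :
    forall v, chart_cod v -> {for v, continuous chart_inv}
}.

Section lie_atlas.
Variables (R : realType) (n : nat) (G : topGroupType).
Implicit Types (a b c : chart R n G).

Definition transition_smooth a b : Prop :=
  smooth [set v | chart_cod a v /\ chart_dom b (chart_inv a v)]
         (fun v => chart_map b (chart_inv a v)).

Definition mulg_smooth a b c : Prop :=
  smooth [set p : 'rV[R]_n * 'rV[R]_n |
            [/\ chart_cod a p.1, chart_cod b p.2 &
                chart_dom c (chart_inv a p.1 * chart_inv b p.2)%g]]
         (fun p => chart_map c (chart_inv a p.1 * chart_inv b p.2)%g).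

Definition invg_smooth a b : Prop :=
  smooth [set v | chart_cod a v /\ chart_dom b (chart_inv a v)^-1%g]
         (fun v => chart_map b (chart_inv a v)^-1%g).

Definition is_lie_atlas (C : set (chart R n G)) : Prop :=
  [/\ forall g : G, exists2 a, C a & chart_dom a g,
      forall a b, C a -> C b -> transition_smooth a b,
      forall a b c, C a -> C b -> C c -> mulg_smooth a b c &
      forall a b, C a -> C b -> invg_smooth a b].

End lie_atlas.

HB.mixin Record isCompactLie (R : realType) G & TopGroup G := {
  lie_hausdorff : hausdorff_space G ;
  lie_second_countable : @second_countable G ;
  lie_compact : compact [set: G] ;
  lie_atlas : exists n (C : set (chart R n G)), is_lie_atlas C
}.

#[short(type="compactLieGroupType")]
HB.structure Definition CompactLieGroup (R : realType) :=
  {G of TopGroup G & isCompactLie R G}.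

Section subgroups.
Variables (G : topGroupType) (H : set G).

Definition conj_set (g : G) : set G := [set (g * h * g^-1)%g | h in H].

Definition normalizer : set G := [set n | conj_set n = H].

(* [G/H], the space of left cosets. *)
Definition coset_space : topologicalType :=
  topquot (fun g g' : G => exists2 h, H h & g' = (g * h)%g).

(* [N_G(H)/H]. *)
Definition weyl_group : topologicalType :=
  topquot (fun n n' : normalizer =>
             exists2 h, H h & set_val n' = (set_val n * h)%g).

(* [nH] acts on [G/H] by [gH |-> g n^-1 H]. *)
Definition weyl_act (w : weyl_group) (c : coset_space) : coset_space :=
  cls _ (rep c * (set_val (rep w))^-1)%g.

End subgroups.

#[short(type="completeMetricType")]
HB.structure Definition CompleteMetric (R : realType) :=
  {X of Complete X & Metric R X}.

Definition separable (T : topologicalType) : Prop :=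
  exists2 D : set T, countable D & dense D.

Definition borel (T : ptopologicalType) := g_sigma_algebraType (@open T).
HB.instance Definition _ (T : ptopologicalType) := Measurable.on (borel T).

Definition finite_on_balls (R : realType) (X : completeMetricType R)
    (m : {measure set (borel X) -> \bar R}) : Prop :=
  forall (x : X) (r : R), (m (ball x r) < +oo)%E.

Section geodesics.
Variables (R : realType) (X : completeMetricType R).

Record Geo := MkGeo {
  geo_fun :> {i01 R} -> X ;
  geoP : forall s t, mdist (geo_fun s) (geo_fun t) =
    `|s%:num - t%:num| * mdist (geo_fun 0%:i01) (geo_fun 1%:i01)
}.

HB.instance Definition _ := gen_eqMixin Geo.
HB.instance Definition _ := gen_choiceMixin Geo.

Lemma cst_geoP (x : X) (s t : {i01 R}) :
  mdist x x = `|s%:num - t%:num| * mdist x x :> R.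
Proof. by rewrite mdistxx mulr0. Qed.

HB.instance Definition _ := isPointed.Build Geo (MkGeo (cst_geoP point)).

(* Open sets for the topology of uniform convergence. *)
Definition geo_open : set (set Geo) := [set O : set Geo | forall c, O c ->
  exists2 e : R, 0 < e &
    forall c' : Geo, (forall t, mdist (c t) (c' t) < e) -> O c'].

Definition borelGeo := g_sigma_algebraType geo_open.
HB.instance Definition _ := Measurable.on borelGeo.

Definition ends (c : borelGeo) : borel X * borel X :=
  (c 0%:i01, c 1%:i01).

Definition geodesic_space : Prop :=
  forall x y : X, exists c : Geo, c 0%:i01 = x /\ c 1%:i01 = y.

Definition non_branching (S : set Geo) : Prop :=
  forall c c', S c -> S c' ->
    (exists t : {i01 R}, [/\ 0 < t%:num, t%:num < 1 &
       forall s : {i01 R}, s%:num <= t%:num -> c s = c' s]) ->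
    c = c'.

Definition P2 (mu : probability (borel X) R) : Prop :=
  exists x0 : X, (\int[mu]_x (mdist (x : X) x0 ^+ 2)%:E < +oo)%E.

Definition is_coupling (mu0 mu1 : probability (borel X) R)
    (pi : probability (borel X * borel X)%type R) : Prop :=
  forall B : set (borel X), measurable B ->
    pushforward pi fst B = mu0 B /\ pushforward pi snd B = mu1 B.

Definition cost (pi : probability (borel X * borel X)%type R) : \bar R :=
  (\int[pi]_p (mdist (p.1 : X) (p.2 : X) ^+ 2)%:E)%E.

Definition is_optimal (mu0 mu1 : probability (borel X) R)
    (pi : probability (borel X * borel X)%type R) : Prop :=
  is_coupling mu0 mu1 pi /\
  forall pi', is_coupling mu0 mu1 pi' -> (cost pi <= cost pi')%E.

Definition essentially_non_branching
    (m : {measure set (borel X) -> \bar R}) : Prop :=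
  forall mu0 mu1 : probability (borel X) R,
    P2 mu0 -> P2 mu1 -> mu0 `<< m -> mu1 `<< m ->
  forall (eta : probability borelGeo R)
         (pi : probability (borel X * borel X)%type R),
    (forall B, measurable B -> pi B = pushforward eta ends B) ->
    is_optimal mu0 mu1 pi ->
  exists S : set Geo, eta.-negligible (~` S) /\ non_branching S.

End geodesics.

Record isometric_action (R : realType) (G : topGroupType) (X : metricType R) :=
  IsometricAction {
    act :> G -> X -> X ;
    act1 : forall x, act 1%g x = x ;
    actM : forall g h x, act (g * h)%g x = act g (act h x) ;
    act_isom : forall g x y, mdist (act g x) (act g y) = mdist x y ;
    act_continuous : continuous (fun p : G * X => act p.1 p.2)
  }.

Section orbit_space.
Variables (R : realType) (G : compactLieGroupType R) (X : metricType R).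
Variable A : isometric_action G X.

Definition orbit_set (x : X) : set X := range (fun g => A g x).

Definition isotropy (x : X) : set G := [set g | A g x = x].

Definition orbit_space := quot (fun x y : X => exists g, y = A g x).

Definition orb (x : X) : orbit_space := \pi_orbit_space x.

Definition orbit_dist (o o' : orbit_space) : R :=
  inf [set mdist x y | x in orb @^-1` [set o] & y in orb @^-1` [set o']].

Lemma orbP (x y : X) : orb x = orb y <-> exists g, y = A g x.
Proof.
rewrite quotP; split=> [|[g ->]]; last by apply: rst_step; exists g.
elim=> {x y} [x y//|x|x y _ [g ->]|x y z _ [g ->] _ [h ->]].
- by exists 1%g; rewrite act1.
- by exists g^-1%g; rewrite -actM mulVg act1.
- by exists (h * g)%g; rewrite actM.
Qed.

Lemma orbK (o : orbit_space) : orb (repr o) = o.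
Proof. exact: reprK. Qed.

Lemma orb_act g x : orb (A g x) = orb x.
Proof. by apply/esym/orbP; exists g. Qed.

Let D (o o' : orbit_space) :=
  [set mdist x y | x in orb @^-1` [set o] & y in orb @^-1` [set o']].

Let D_lb o o' : lbound (D o o') 0.
Proof. by move=> _ [x _ [y _ <-]]; exact: mdist_ge0. Qed.

Let D_has_lb o o' : has_lbound (D o o').
Proof. by exists 0; exact: D_lb. Qed.

Let D_ne o o' : D o o' !=set0.
Proof.
exists (mdist (repr o) (repr o')).
by exists (repr o); [exact: orbK|exists (repr o'); first exact: orbK].
Qed.

Lemma orbit_dist_le x y : orbit_dist (orb x) (orb y) <= mdist x y.
Proof. by apply: (ge_inf (D_has_lb _ _)); exists x => //; exists y. Qed.

Lemma orbit_dist_adherent x y (e : R) : 0 < e ->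
  exists g, mdist x (A g y) < orbit_dist (orb x) (orb y) + e.
Proof.
move=> e0; have [_ [x' /esym/orbP[g ->]] [y' /esym/orbP[h ->] <-] lte] :=
  inf_adherent e0 (conj (D_ne (orb x) (orb y)) (D_has_lb (orb x) (orb y))).
exists (g^-1 * h)%g; rewrite -(act_isom A g).
by rewrite -actM mulgA mulgV mul1g.
Qed.

Lemma orbit_distxx o : orbit_dist o o = 0.
Proof.
apply/eqP; rewrite eq_le; apply/andP; split; last first.
  exact: (lb_le_inf (D_ne _ _) (@D_lb _ _)).
by rewrite -(orbK o) (le_trans (orbit_dist_le _ _))// mdistxx.
Qed.

Lemma orbit_dist_sym o o' : orbit_dist o o' = orbit_dist o' o.
Proof.
by congr inf; apply/seteqP; split=> _ [x ox [y oy <-]];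
  exists y => //; exists x => //; rewrite metric_sym.
Qed.

Lemma orbit_dist_triangle o' o o'' :
  orbit_dist o o'' <= orbit_dist o o' + orbit_dist o' o''.
Proof.
rewrite -(orbK o) -(orbK o') -(orbK o'').
set x := repr o; set y := repr o'; set z := repr o''.
apply/ler_addgt0Pl => e e0.
have e20 : 0 < e / 2 by rewrite divr_gt0.
have [g xy] := orbit_dist_adherent x y e20.
have [h yz] := orbit_dist_adherent y z e20.
have {1}-> : orb z = orb (A g (A h z)) by rewrite !orb_act.
apply: le_trans (orbit_dist_le _ _) _.
apply: le_trans (metric_triangle _ (A g y) _) _; rewrite act_isom.
apply: le_trans (lerD (ltW xy) (ltW yz)) _.
by rewrite addrACA -splitr addrC.
Qed.

Lemma orbit_dist_positivity o o' : orbit_dist o o' = 0 -> o = o'.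
Proof.
rewrite -(orbK o) -(orbK o'); set x := repr o; set y := repr o' => xy0.
have cO : compact (orbit_set y).
  apply: continuous_compact; last exact: lie_compact.
  apply: continuous_subspaceT => g.
  apply: (@continuous_comp _ _ _ (fun g => (g, y)) (fun p => A p.1 p.2)).
    by apply: cvg_pair => //; exact: cvg_cst.
  exact: act_continuous.
have : closed (orbit_set y).
  by apply: compact_closed => //; exact: metric_hausdorff.
move=> /closure_id OE; have : orbit_set y x.
  rewrite OE => B /nbhs_ballP[e /= e0 eB].
  have [g] := orbit_dist_adherent x y e0; rewrite xy0 add0r => xgy.
  by exists (A g y); split; [exists g|apply: eB; rewrite ballEmdist].
by move=> [g _ <-]; rewrite orb_act.
Qed.

HB.instance Definition _ := Choice.on orbit_space.
HB.instance Definition _ := isMetric.Build R orbit_space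
  orbit_distxx orbit_dist_positivity orbit_dist_sym orbit_dist_triangle.

End orbit_space.

Definition isometric (R : realType) (S : metricType R) (T : Type)
    (d : T -> T -> R) : Prop :=
  exists2 f : S -> T, (forall t, exists s, f s = t) &
    forall s s', d (f s) (f s') = mdist s s'.

Definition subset_dist (R : realType) (D : set R) (s t : D) : R :=
  `|set_val s - set_val t|.

Definition circle (R : realType) : set (R * R) :=
  [set p | p.1 ^+ 2 + p.2 ^+ 2 = 1].
Arguments circle : clear implicits.

(* Arc length, not the chordal distance, which is not geodesic. *)
Definition arc_dist (R : realType) (p q : circle R) : R :=
  acos ((set_val p).1 * (set_val q).1 + (set_val p).2 * (set_val q).2).

Definition one_dimensional_model (R : realType) (S : metricType R) : Prop :=
  [\/ isometric S (@subset_dist R `[(-1)%R, 1%R]),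
      isometric S (@subset_dist R `[0%R, +oo[),
      isometric S (@subset_dist R setT) |
      isometric S (@arc_dist R)].

Section cone_bundles.
Variables (R : realType) (G : compactLieGroupType R) (X : metricType R).
Variable A : isometric_action G X.

Definition singular (x : X) : Prop := is_boundary R (orb A x).

(* [H] is the isotropy group of a point over the interior of the orbit space,
   well defined up to conjugation. *)
Definition is_principal_isotropy (H : set G) : Prop :=
  (exists x, ~ singular x /\ isotropy A x = H) /\
  forall x, ~ singular x -> exists g, isotropy A x = conj_set H g.

(* [G x_K S]: [(g k, s)] is identified with [(g, k s)] for [k] in [K]. *)
Definition twisted_rel (K : set G) (S : set X) (p q : G * S) : Prop :=
  exists2 k, K k & p.1 = (q.1 * k)%g /\ set_val q.2 = A k (set_val p.2).

Definition twisted (K : set G) (S : set X) : topologicalType :=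
  topquot (@twisted_rel K S).

Definition tw (K : set G) (S : set X) (g : G) (s : S) : twisted K S :=
  cls (@twisted_rel K S) (g, s).

Definition tw_act (K : set G) (S : set X) (g : G) (c : twisted K S) :
  twisted K S := tw K (g * (rep c).1)%g (rep c).2.

(* [S] is a slice at [x]: [[g, s] |-> g s] identifies [G x_{G_x} S] with a
   neighbourhood [U] of the orbit of [x].  [U] is not required to be open, so
   that slices may be closed cones. *)
Definition is_slice (x : X) (S : set X) : Prop :=
  [/\ S x,
      forall k s, isotropy A x k -> S s -> S (A k s) &
      exists U : set X, (forall y, orbit_set A x y -> nbhs y U) /\
        exists2 f : twisted (isotropy A x) S -> U, is_homeo f &
          forall g s, set_val (f (tw _ g s)) = A g (set_val s)].

(* The cone [F x J / F x {0}] over [F], for an interval [J] with endpoint 0: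
   a closed cone for [J = [0,1]], an open one for [J = [0,+oo[]. *)
Definition cone_rel (F : topologicalType) (J : set R) (p q : F * J) : Prop :=
  set_val p.2 = 0 /\ set_val q.2 = 0.

Definition cone (F : topologicalType) (J : set R) : topologicalType :=
  topquot (@cone_rel F J).

Definition cone_pt (F : topologicalType) (J : set R) (f : F) (t : J) :
  cone F J := cls (@cone_rel F J) (f, t).

(* A cone bundle over the orbit of [x]: the bundle [G x_{G_x} S] over that
   orbit, with [S] a slice at [x] which is, [G_x]-equivariantly, a cone with
   apex [x] over a [G_x]-space. *)
Record cone_bundle (J : set R) (x : X) := ConeBundle {
  cb_slice : set X ;
  cb_sliceP : is_slice x cb_slice ;
  cb_link : topologicalType ;
  cb_act : G -> cb_link -> cb_link ;
  cb_act1 : forall f, cb_act 1%g f = f ;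
  cb_actM : forall k k' f, isotropy A x k -> isotropy A x k' ->
    cb_act (k * k')%g f = cb_act k (cb_act k' f) ;
  cb_act_continuous :
    continuous (fun p : isotropy A x * cb_link => cb_act (set_val p.1) p.2) ;
  cb_cone : cone cb_link J -> cb_slice ;
  cb_cone_homeo : is_homeo cb_cone ;
  cb_cone_apex : forall f (t : J), set_val t = 0 ->
    set_val (cb_cone (cone_pt f t)) = x ;
  cb_cone_equivariant : forall k f t, isotropy A x k ->
    set_val (cb_cone (cone_pt (cb_act k f) t)) =
    A k (set_val (cb_cone (cone_pt f t))) ;
  cb_proj : twisted (isotropy A x) cb_slice -> orbit_set A x ;
  cb_projE : forall g s, set_val (cb_proj (tw _ g s)) = A g x ;
  cb_bundle : is_fiber_bundle cb_slice cb_proj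
}.
Arguments cb_cone {J x} _ _.

Definition cb_total (J : set R) (x : X) (E : cone_bundle J x) :
  topologicalType := twisted (isotropy A x) (cb_slice E).

Definition closed_cone_bundle (x : X) := cone_bundle `[0%R, 1%R] x.
Definition open_cone_bundle (x : X) := cone_bundle `[0%R, +oo[ x.

(* The union of the bases [F x {1}] of the fibres. *)
Definition cb_boundary (x : X) (E : closed_cone_bundle x) : set (cb_total E) :=
  [set c | exists g f (t : `[0%R, 1%R]%classic), set_val t = 1 /\
             c = tw (isotropy A x) g (cb_cone E (cone_pt f t))].
Arguments cb_boundary {x} _.

Definition glue_rel (x : bool -> X) (E : forall b, closed_cone_bundle (x b))
    (phi : cb_boundary (E false) -> cb_boundary (E true))
    (p q : {b : bool & cb_total (E b)}) : Prop :=
  exists c, p = existT _ false (set_val c) /\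
            q = existT _ true (set_val (phi c)).

Definition glue (x : bool -> X) (E : forall b, closed_cone_bundle (x b))
    (phi : cb_boundary (E false) -> cb_boundary (E true)) : topologicalType :=
  topquot (glue_rel phi).

Definition glue_in (x : bool -> X) (E : forall b, closed_cone_bundle (x b))
    (phi : cb_boundary (E false) -> cb_boundary (E true))
    (b : bool) (c : cb_total (E b)) : glue phi :=
  cls (glue_rel phi) (existT (fun b => cb_total (E b)) b c).

Definition boundary_equivariant (x : bool -> X)
    (E : forall b, closed_cone_bundle (x b))
    (phi : cb_boundary (E false) -> cb_boundary (E true)) : Prop :=
  forall g (c c' : cb_boundary (E false)),
    set_val c' = tw_act g (set_val c) ->
    set_val (phi c') = tw_act g (set_val (phi c)).

Definition equivariant_from_glue (x : bool -> X)
    (E : forall b, closed_cone_bundle (x b))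
    (phi : cb_boundary (E false) -> cb_boundary (E true))
    (f : glue phi -> X) : Prop :=
  forall g b (c : cb_total (E b)),
    f (glue_in phi (tw_act g c)) = A g (f (glue_in phi c)).

Definition union_of_two_cone_bundles : Prop :=
  exists x : bool -> X,
    [/\ forall b, singular (x b),
        orb A (x false) <> orb A (x true),
        forall y, singular y -> exists b, orb A y = orb A (x b) &
        exists (E : forall b, closed_cone_bundle (x b))
               (phi : cb_boundary (E false) -> cb_boundary (E true)),
          [/\ is_homeo phi, boundary_equivariant phi &
              exists2 f : glue phi -> X, is_homeo f & equivariant_from_glue f]].

Definition is_a_cone_bundle : Prop :=
  exists x : X,
    [/\ singular x, forall y, singular y -> orb A y = orb A x &
        exists E : open_cone_bundle x, homeomorphic X (cb_total E)].

End cone_bundles.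

(* Main.v *)
Require Import Defs.
From HB Require Import structures.
From mathcomp Require Import all_boot all_order all_algebra.
From mathcomp Require Import all_classical all_reals all_analysis.
From mathcomp Require Import ring lra.
Import Order.TTheory GRing.Theory Num.Theory.
Import numFieldTopology.Exports numFieldNormedType.Exports.

(** A geodesic between nearest points of two orbits meets every orbit at most
    once, for otherwise the orbits would be closer to each other
    ([orbit_geodesic]). Hence such geodesics lift segments, or small arcs, of
    the orbit space to paths in [X] ([lift_path]). All isotropy groups over the
    interior are conjugate to [H]. The proof consists in moving the lift within
    the orbits so that the isotropy group becomes constant, in such a way that
    the lift still converges at a boundary point of the orbit space.

    Such a section [s] determines the topology of [X], because a function that
    is selected by a closed condition among the elements of a compact space is
    continuous ([closed_rel_continuous]). Where the isotropy group is [H]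
    throughout, [(t, gH) |-> g s(t)] is a homeomorphism ([product_chart]). If
    [s] ends at a point [x] with a larger isotropy group [K], the slice [S]
    swept out by [K] from [s] is a cone over the orbit of [s(1)] under [K], and
    the orbits that meet [s] form the bundle [G x_K S] ([tube_homeo],
    [slice_homeo]). A line carries one product; a half-line is one cone bundle;
    a segment is covered by two, which meet in the orbit over its midpoint
    ([glue_homeo]); on a circle two local sections over the same point differ
    by an element of the normalizer of [H], unique modulo [H]
    ([circle_case]). That boundary points are exactly the ends of the
    orbit space follows from the fact that an interior point of an interval
    separates its neighbourhoods ([not_boundary]).

    To make the isotropy group constant near an interior point, one needs a
    transversal [T] to the normalizer [N] of [H]: each isotropy group near a
    given one is the conjugate of [H] by a single element of [T], which depends
    continuously on the point ([local_section]). These local sections can be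
    continued along an interval, since [N] acts transitively on the points of
    an orbit with isotropy group exactly [H] ([section_on_segment]). At an end,
    let [x] be the limit of the lift. By compactness some conjugate of [H] is
    the isotropy group of points of the nearby orbits arbitrarily close to [x]
    ([limit_conjugate]); replace [H] by it. A section with isotropy group [H]
    that starts close to [x] could still drift away inside the orbits. But the
    points near [x] in the orbit of [x] that are fixed by [H] are the
    images of [x] under small elements of [N] ([fixed_near_point]). So a section
    whose distance from [x] is not yet too large can be brought back to [x] by
    small elements of [N], which are joined to 1 by small paths in [N]
    ([fixed_gap], [tracking]), and this yields a section that converges to [x]
    ([straight_section]).

    The facts on Lie groups behind this are the existence of a transversal to a
    closed subgroup [K] that is invariant under conjugation by [K]
    ([invariant_transversal]) and the existence of small paths in [K]
    ([closed_subgroup_paths]). They rest on a single estimate for the product in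
    coordinates [c] at the identity, namely that [c(gh)] differs from
    [c(g) + c(h)] by at most a multiple of [|c(g)| |c(h)|]
    ([mixed_difference_bound]). It gives the exponential map as a limit of
    powers, the tangent space of a closed subgroup and its exponentials
    ([exp_tangent]), and the linearity of the adjoint action ([Ad_mx]). A
    complement of the tangent space of [K] that is invariant under [K] is found
    as a fixed point of a bounded group of maps of a convex set
    ([bounded_group_fixed_point]); the exponentials of its small vectors make
    up the transversal. *)

Local Open Scope classical_set_scope.
Local Open Scope ring_scope.

Set Implicit Arguments.
Unset Strict Implicit.
Unset Printing Implicit Defensive.

(** * Mean value inequalities *)

Lemma rV_norm_le (R : realType) n (v : 'rV[R]_n) (B : R) :
  0 <= B -> (forall i, `|v 0 i| <= B) -> `|v| <= B.
Proof.
move=> B0 vB; rewrite /Num.norm/= mx_normrE; apply/bigmax_leP; split => //.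
by move=> [i j] _ /=; rewrite ord1.
Qed.

Lemma rV_coord_le (R : realType) n (v : 'rV[R]_n) i : `|v 0 i| <= `|v|.
Proof.
rewrite [leRHS]/Num.norm/= mx_normrE; apply/bigmax_geP; right.
by exists (ord0, i).
Qed.

Lemma is_derive_line (R : realType) (V : normedModType R) n (f : V -> 'rV[R]_n)
    (x e : V) (s : R) i :
  derivable f (x + s *: e) e ->
  is_derive s 1 (fun t : R => f (x + t *: e) 0 i : R) ('D_e f (x + s *: e) 0 i).
Proof.
move=> df.
have cv : (h^-1 *: ((fun t : R => f (x + t *: e) 0 i : R) (h *: 1 + s) -
    f (x + s *: e) 0 i)) @[h --> 0^'] --> ('D_e f (x + s *: e) 0 i : R).
  have := @cvg_comp _ _ _ _ (fun M : 'rV[R]_n => M 0 i : R) _ _ _ df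
    (@coord_continuous _ _ _ 0 i _).
  apply: cvg_trans; apply: near_eq_cvg; near=> h => /=.
  rewrite !mxE /= scaler1 scalerDl addrCA; congr (_ * (_ - _)).
apply: DeriveDef; first by apply/cvg_ex; eexists; exact: cv.
by apply: cvg_lim => //; exact: cv.
Unshelve. all: by end_near. Qed.

Lemma line_lipschitz (R : realType) (V : normedModType R) n (f : V -> 'rV[R]_n)
    (x e : V) (a M : R) : 0 <= M ->
  (forall s, `|s| <= `|a| -> derivable f (x + s *: e) e /\
    `|'D_e f (x + s *: e)| <= M) ->
  `|f (x + a *: e) - f x| <= M * `|a|.
Proof.
move=> M0 fM; apply: rV_norm_le; first by rewrite mulr_ge0.
move=> i; rewrite !mxE.
pose phi t := f (x + t *: e) 0 i : R.
have key u v : u <= v -> (forall s, s \in `[u, v] -> `|s| <= `|a|) ->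
    `|phi v - phi u| <= M * (v - u).
  move=> uv uva; have [||c cuv ->] := @MVT_segment R phi
      (fun s => 'D_e f (x + s *: e) 0 i) u v uv.
  - move=> s suv; apply: is_derive_line.
    by apply: (fM s _).1; apply: uva; apply: subset_itv_oo_cc suv.
  - apply: continuous_in_subspaceT => s; rewrite inE => suv.
    apply/differentiable_continuous/derivable1_diffP.
    by apply: ex_derive; apply: is_derive_line; apply: (fM s _).1; exact: uva.
  - rewrite normrM (ger0_norm (_ : 0 <= v - u)) ?subr_ge0//.
    apply: ler_wpM2r; first by rewrite subr_ge0.
    by apply: le_trans (rV_coord_le _ _) _; apply: (fM c _).2; exact: uva.
have -> : f x 0 i = phi 0 by rewrite /phi scale0r addr0.
rewrite -/(phi a); have [a0|a0] := leP 0 a.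
  have := key 0 a a0; rewrite subr0 (ger0_norm a0); apply => s.
  by rewrite in_itv/= => /andP[s0 sa]; rewrite ger0_norm.
have := key a 0 (ltW a0); rewrite distrC sub0r (ltr0_norm a0); apply => s.
by rewrite in_itv/= => /andP[s0 sa]; rewrite ler0_norm// lerN2.
Qed.

(** Moving one coordinate at a time turns bounds on the partial derivatives
    into a Lipschitz bound; only bounds along the axes are required, so the
    derivative need not be known to be linear in the direction. *)
Lemma axes_lipschitz (R : realType) n k (f : 'rV[R]_n -> 'rV[R]_k)
    (r M : R) (y : 'rV[R]_n) : 0 <= M -> `|y| <= r ->
  (forall i x, `|x| <= r -> derivable f x (delta_mx 0 i) /\
    `|'D_(delta_mx 0 i) f x| <= M) ->
  `|f y - f 0| <= n%:R * (M * `|y|).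
Proof.
move=> M0 yr fM.
pose tr (j : nat) : 'rV[R]_n := \row_i (if (i < j)%N then y 0 i else 0).
have key (j : nat) : (j <= n)%N -> `|f (tr j) - f 0| <= j%:R * (M * `|y|).
  elim: j => [_|j ih jn].
    have -> : tr 0%N = 0 by apply/rowP => i; rewrite !mxE.
    by rewrite subrr normr0 mul0r.
  pose jj := Ordinal jn.
  have trS : tr j.+1 = tr j + y 0 jj *: delta_mx 0 jj.
    apply/rowP => i; rewrite !mxE eqxx/= ltnS leq_eqVlt -val_eqE /=.
    have [ij|ij] := eqVneq (val i) j.
      have -> : i = jj by apply/val_inj.
      by rewrite /= ltnn add0r mulr1.
    by rewrite mulr0 addr0.
  rewrite -(subrK (f (tr j)) (f (tr j.+1))) -addrA.
  apply: le_trans (ler_normD _ _) _.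
  rewrite -natr1 mulrDl mul1r [leRHS]addrC; apply: lerD; last by apply: ih; exact: ltnW.
  rewrite trS; apply: le_trans (line_lipschitz (M := M) M0 _) _; last first.
    by rewrite ler_wpM2l// rV_coord_le.
  move=> s sj; apply: fM; apply: rV_norm_le.
    by apply: le_trans yr.
  move=> i; rewrite !mxE eqxx/=.
  have [->|ij] := eqVneq i jj; last first.
    rewrite mulr0 addr0; case: ifP => _; last by rewrite normr0 (le_trans _ yr).
    by rewrite (le_trans (rV_coord_le _ _)).
  by rewrite ltnn add0r mulr1 (le_trans sj)// (le_trans (rV_coord_le _ _)).
have trn : tr n = y by apply/rowP => i; rewrite mxE ltn_ord.
by have := key n (leqnn n); rewrite trn.
Qed.

Lemma near_norm_le (R : realType) (V W : normedModType R) (f : V -> W) x (M : R) :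
  {for x, continuous f} -> `|f x| + 1 <= M -> \forall p \near x, `|f p| <= M.
Proof.
move=> /cvgrPdist_lt/(_ 1 ltr01) cf fM; apply: filterS cf => p fxp.
apply: le_trans fM; rewrite -[f p](subrK (f x)) addrC.
by apply: le_trans (ler_normD _ _) _; rewrite lerD2l distrC ltW.
Qed.

Lemma fin_bounded (R : realType) (I : finType) (b : I -> R) :
  exists2 M, 0 <= M & forall i, b i <= M.
Proof.
exists (\sum_i `|b i|); first by rewrite sumr_ge0.
move=> i; rewrite (bigD1 i)//=; apply: le_trans (ler_norm _) _.
by rewrite lerDl sumr_ge0.
Qed.

Lemma derivable_sub (R : realType) (V W : normedModType R) (f g : V -> W) x v :
  derivable f x v -> derivable g x v ->
  derivable (fun x => f x - g x) x v /\
  'D_v (fun x => f x - g x) x = 'D_v f x - 'D_v g x.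
Proof. by move=> df dg; split; [exact: (derivableB df dg)|exact: (deriveB df dg)]. Qed.

Lemma derivable_slice1 (R : realType) n k (f : 'rV[R]_n * 'rV[R]_n -> 'rV[R]_k)
    (x y e : 'rV[R]_n) : derivable f (x, y) (e, 0) ->
  derivable (fun x => f (x, y)) x e /\
  'D_e (fun x => f (x, y)) x = 'D_(e, 0) f (x, y).
Proof.
have E : (fun h : R => h^-1 *: (((fun x => f (x, y)) \o shift x) (h *: e) - f (x, y))) =
    (fun h : R => h^-1 *: ((f \o shift (x, y)) (h *: (e, 0)) - f (x, y))).
  apply/funext => h /=; congr (_ *: (f _ - _)).
  by apply: injective_projections => /=; rewrite ?scaler0 ?add0r.
by rewrite /derivable /derive E.
Qed.

Lemma derivable_slice2 (R : realType) n k (f : 'rV[R]_n * 'rV[R]_n -> 'rV[R]_k)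
    (x y e : 'rV[R]_n) : derivable f (x, y) (0, e) ->
  derivable (fun y => f (x, y)) y e /\
  'D_e (fun y => f (x, y)) y = 'D_(0, e) f (x, y).
Proof.
have E : (fun h : R => h^-1 *: (((fun y => f (x, y)) \o shift y) (h *: e) - f (x, y))) =
    (fun h : R => h^-1 *: ((f \o shift (x, y)) (h *: (0, e)) - f (x, y))).
  apply/funext => h /=; congr (_ *: (f _ - _)).
  by apply: injective_projections => /=; rewrite ?scaler0 ?add0r.
by rewrite /derivable /derive E.
Qed.

Lemma second_slot_lipschitz (R : realType) n k
    (h : 'rV[R]_n * 'rV[R]_n -> 'rV[R]_k) (r M : R) (z y : 'rV[R]_n) :
  0 <= M -> `|y| <= r ->
  (forall j w, `|w| <= r -> derivable h (z, w) (0, delta_mx 0 j) /\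
    `|'D_(0, delta_mx 0 j) h (z, w)| <= M) ->
  `|h (z, y) - h (z, 0)| <= n%:R * (M * `|y|).
Proof.
move=> M0 yr hM.
refine (@axes_lipschitz R n k (fun y => h (z, y)) r M y M0 yr _) => j w wr.
by have [dh hw] := hM j w wr; have [dd ->] := derivable_slice2 dh.
Qed.

(** A function of two vectors that is C^2 near the origin differs from the sum
    of its restrictions to the two axes by a term bilinear in size.  For the
    multiplication of a Lie group in a chart this is the only consequence of
    smoothness that is used. *)
Lemma mixed_difference_bound (R : realType) n k
    (f : 'rV[R]_n * 'rV[R]_n -> 'rV[R]_k) (U : set ('rV[R]_n * 'rV[R]_n)) :
  nbhs (0 : 'rV[R]_n * 'rV[R]_n) U -> Ck 2 U f ->
  exists r M : R, [/\ 0 < r, 0 <= M & forall x y, `|x| <= r -> `|y| <= r ->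
    `|f (x, y) - f (x, 0) - (f (0, y) - f (0, 0))| <= M * (`|x| * `|y|)].
Proof.
move=> U0 [_ f2].
have df1 i p : U p -> derivable f p (delta_mx 0 i, 0) by exact: (f2 _).1.
have df2 i j p : U p -> derivable ('D_(delta_mx 0 i, 0) f) p (0, delta_mx 0 j).
  by apply: ((f2 _).2.2 _).1.
pose D i j := 'D_(0, delta_mx 0 j) ('D_(delta_mx 0 i, 0) f).
have [M0 M00 DM'] := fin_bounded (fun ij : 'I_n * 'I_n => `|D ij.1 ij.2 0| + 1).
have {DM'} DM i j : `|D i j 0| + 1 <= M0 by exact: (DM' (i, j)).
have : \forall p \near (0 : 'rV[R]_n * 'rV[R]_n),
    U p /\ forall i j, `|D i j p| <= M0.
  near=> p; split; first by near: p.
  near: p; apply: filter_forall => i; apply: filter_forall => j.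
  have cD : {for 0, continuous (D i j)}.
    by apply: ((f2 _).2.2 _).2.1; exact: nbhs_singleton U0.
  exact: near_norm_le cD (DM i j).
case/nbhs_ballP => r0 /= r00 rP; pose r := r0 / 2.
have r_gt0 : 0 < r by rewrite divr_gt0.
have {}rP x y : `|x| <= r -> `|y| <= r -> U (x, y) /\ forall i j, `|D i j (x, y)| <= M0.
  move=> xr yr; apply: rP; split => /=; rewrite -ball_normE/= sub0r normrN.
    by rewrite (le_lt_trans xr)// ltr_pdivrMr// ltr_pMr// ltr1n.
  by rewrite (le_lt_trans yr)// ltr_pdivrMr// ltr_pMr// ltr1n.
exists r, (n%:R * (n%:R * M0)); split => //; first by rewrite !mulr_ge0.
move=> x y xr yr.
pose g x := f (x, y) - f (x, 0).
have -> : f (x, y) - f (x, 0) - (f (0, y) - f (0, 0)) = g x - g 0 by [].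
have -> : n%:R * (n%:R * M0) * (`|x| * `|y|) = n%:R * ((n%:R * (M0 * `|y|)) * `|x|).
  by ring.
apply: (axes_lipschitz (r := r)) => //; first by rewrite !mulr_ge0.
move=> i z zr.
have d y' : `|y'| <= r -> derivable f (z, y') (delta_mx 0 i, 0).
  by move=> y'r; apply: df1; apply: (rP _ _ _ _).1.
have z0 : `|0 : 'rV[R]_n| <= r by rewrite normr0 ltW.
have [dy Dy] := derivable_slice1 (d y yr).
have [d0 D0] := derivable_slice1 (d 0 z0).
have [dg ->] := derivable_sub dy d0; split; first exact: dg.
rewrite Dy D0.
refine (@second_slot_lipschitz R n k ('D_(delta_mx 0 i, 0) f) r M0 z y M00 yr _) => j w wr.
by have [Uw Dw] := rP _ _ zr wr; split; [exact: df2|exact: Dw].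
Unshelve. all: by end_near. Qed.

(** * Coordinates near the identity of a Lie group *)

Lemma shift_continuous (R : realType) (V : normedModType R) (b : V) :
  continuous (fun x : V => x + b).
Proof. by move=> x; apply: cvgD; [exact: cvg_id|exact: cvg_cst]. Qed.

Lemma continuous_at_comp (S T U : topologicalType) (f : S -> T) (g : T -> U) x :
  {for x, continuous f} -> {for f x, continuous g} ->
  {for x, continuous (fun y => g (f y))}.
Proof. exact: continuous_comp. Qed.

Lemma mulg_continuous_at (V : topologicalType) (G : topGroupType) (f g : V -> G) x :
  {for x, continuous f} -> {for x, continuous g} ->
  {for x, continuous (fun y => (f y * g y)%g)}.
Proof.
move=> cf cg; apply: (@continuous_at_comp _ _ _ (fun y => (f y, g y)) (fun q : G * G => (q.1 * q.2)%g)).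
  exact: cvg_pair.
exact: mulg_continuous.
Qed.

Lemma invg_continuous_at (V : topologicalType) (G : topGroupType) (f : V -> G) x :
  {for x, continuous f} -> {for x, continuous (fun y => (f y)^-1%g)}.
Proof.
move=> cf; apply: (@continuous_at_comp _ _ _ f (fun q : G => q^-1%g)) => //.
exact: invg_continuous.
Qed.

Lemma near_pair (S T : topologicalType) (x : S) (y : T) (P : set S) (Q : set T) :
  nbhs x P -> nbhs y Q -> nbhs (x, y) [set p | P p.1 /\ Q p.2].
Proof. by move=> xP yQ; exists (P, Q). Qed.

Lemma continuous_at_pair1 (S T U : topologicalType) (f : S -> U) (x : S) (y : T) :
  {for x, continuous f} -> {for (x, y), continuous (fun p => f p.1)}.
Proof.
by move=> cf; apply: (@continuous_at_comp _ _ _ fst f (x, y)) => //; exact: cvg_fst.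
Qed.

Lemma continuous_at_pair2 (S T U : topologicalType) (f : T -> U) (x : S) (y : T) :
  {for y, continuous f} -> {for (x, y), continuous (fun p => f p.2)}.
Proof.
by move=> cf; apply: (@continuous_at_comp _ _ _ snd f (x, y)) => //; exact: cvg_snd.
Qed.

Lemma Ck_shift (R : realType) (V W : normedModType R) k (U : set V) (f : V -> W)
    (b : V) : Ck k U f -> Ck k [set x | U (x + b)] (fun x => f (x + b)).
Proof.
have E (g : V -> W) x v : (fun h : R => h^-1 *: (((fun x => g (x + b)) \o shift x) (h *: v) - g (x + b))) =
    (fun h : R => h^-1 *: ((g \o shift (x + b)) (h *: v) - g (x + b))).
  by apply/funext => h /=; rewrite addrA.
have cf (g : V -> W) x : {for x + b, continuous g} ->
    {for x, continuous (fun x : V => g (x + b))}.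
  exact: (@continuous_at_comp _ _ _ (fun x => x + b) g x (@shift_continuous R V b x)).
elim: k f => [|k ih] f /= [cU fU]; split => //.
- by move=> x Ux; apply: cf; exact: cU.
- by move=> x Ux; apply: cf; exact: cU.
move=> v; have [dv Dv] := fU v; split.
  by move=> x Ux; rewrite /derivable E; exact: dv.
have -> : (fun x => 'D_v (fun x => f (x + b)) x) = (fun x => 'D_v f (x + b)).
  by apply/funext => x; rewrite /derive E.
exact: (ih _ Dv).
Qed.

Lemma absorb (R : realType) (M x y r e : R) :
  0 <= M -> x <= r -> 0 <= y -> M * r <= e -> M * (x * y) <= e * y.
Proof. by move=> M0 xr y0 Mr; rewrite mulrA ler_wpM2r// (le_trans _ Mr)// ler_wpM2l. Qed.

(** Coordinates centred at the identity in which the group law is addition up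
    to an error controlled by the product of the norms. *)
Record lie_coord (R : realType) (G : topGroupType) := LieCoord {
  lc_dim : nat ;
  lc : G -> 'rV[R]_lc_dim ;
  lc_inv : 'rV[R]_lc_dim -> G ;
  lc_dom : set G ;
  lc_rad : R ;
  lc_cst : R ;
  lc_rad_gt0 : 0 < lc_rad ;
  lc_cst_ge0 : 0 <= lc_cst ;
  lc_small : lc_cst * lc_rad <= 16^-1 ;
  lc_dom_open : open lc_dom ;
  lc_dom1 : lc_dom 1%g ;
  lc1 : lc 1%g = 0 ;
  lc_invK : forall g, lc_dom g -> lc_inv (lc g) = g ;
  lcK : forall v, `|v| <= lc_rad -> lc_dom (lc_inv v) /\ lc (lc_inv v) = v ;
  lc_continuous : forall g, lc_dom g -> {for g, continuous lc} ;
  lc_inv_continuous : forall v, `|v| <= lc_rad -> {for v, continuous lc_inv} ;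
  lcM : forall g h, lc_dom g -> lc_dom h -> `|lc g| <= lc_rad ->
    `|lc h| <= lc_rad -> lc_dom (g * h)%g /\
    `|lc (g * h)%g - lc g - lc h| <= lc_cst * (`|lc g| * `|lc h|) ;
  lcV : forall g, lc_dom g -> `|lc g| <= lc_rad ->
    lc_dom g^-1%g /\ `|lc g^-1%g| <= 2 * `|lc g|
}.

Arguments lc_inv {R G} l _.

Lemma lie_coord_exists (R : realType) n (G : topGroupType) (C : set (chart R n G)) :
  is_lie_atlas C -> exists L : lie_coord R G, True.
Proof.
move=> [Ccov _ CM _].
have [a Ca a1] := Ccov 1%g.
pose b : 'rV[R]_n := chart_map a 1%g.
have bcod : chart_cod a b by exact: chart_mapP.
pose c (g : G) : 'rV[R]_n := chart_map a g - b.
pose ci (v : 'rV[R]_n) : G := chart_inv a (v + b).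
have cif (v : 'rV[R]_n) : {for v + b, continuous (chart_inv a)} -> {for v, continuous ci}.
  move=> cg.
  exact: (continuous_at_comp (@shift_continuous R 'rV[R]_n b v) cg).
have ci0 : ci 0 = 1%g by rewrite /ci add0r chart_mapK.
have cod0 : \forall v \near (0 : 'rV[R]_n), chart_cod a (v + b).
  have := @shift_continuous R 'rV[R]_n b 0.
  by apply; rewrite add0r; apply: open_nbhs_nbhs; split => //; exact: chart_cod_open.
have cci0 : {for 0, continuous ci} by apply: cif; rewrite add0r; exact: chart_inv_continuous.
have dom1 : nbhs (1%g : G) (chart_dom a).
  by apply: open_nbhs_nbhs; split => //; exact: chart_dom_open.
have prodn : \forall p \near (0 : 'rV[R]_n * 'rV[R]_n), [/\ chart_cod a (p.1 + b),
    chart_cod a (p.2 + b) & chart_dom a (ci p.1 * ci p.2)%g].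
  have cm : {for (0 : 'rV[R]_n * 'rV[R]_n), continuous (fun p : 'rV[R]_n * 'rV[R]_n => (ci p.1 * ci p.2)%g)}.
    apply: mulg_continuous_at; first exact: continuous_at_pair1 cci0.
    exact: continuous_at_pair2 cci0.
  have h2 : nbhs (0 : 'rV[R]_n * 'rV[R]_n) [set p | chart_dom a (ci p.1 * ci p.2)%g].
    by apply: cm; rewrite /= ci0 mulg1; exact: dom1.
  have h1 : nbhs (0 : 'rV[R]_n * 'rV[R]_n) [set p | chart_cod a (p.1 + b) /\ chart_cod a (p.2 + b)].
    exact: (near_pair cod0 cod0).
  by apply: filterS (filterI h1 h2) => p [[? ?] ?].
pose bb : 'rV[R]_n * 'rV[R]_n := (b, b).
have sm := Ck_shift bb (CM a a a Ca Ca Ca 2).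
have [r [M [r0 M0 rM]]] := mixed_difference_bound prodn sm.
have ball0 (P : set 'rV[R]_n) : (\forall v \near (0 : 'rV[R]_n), P v) ->
    exists2 e, 0 < e & forall v, `|v| <= e -> P v.
  case/nbhs_ballP => e /= e0 eP; exists (e / 2); first by rewrite divr_gt0.
  move=> v ve; apply: eP; rewrite -ball_normE/= sub0r normrN.
  by rewrite (le_lt_trans ve)// ltr_pdivrMr// ltr_pMr// ltr1n.
have domn : \forall v \near (0 : 'rV[R]_n), [/\ chart_cod a (v + b),
    chart_dom a (ci v) & `|c (ci v)^-1%g| <= r /\ chart_dom a (ci v)^-1%g].
  have cV : {for (0 : 'rV[R]_n), continuous (fun v => (ci v)^-1%g)}.
    exact: invg_continuous_at cci0.
  have cc : {for (1%g : G), continuous (fun g => c g)}.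
    by apply: cvgB; [exact: chart_map_continuous|exact: cvg_cst].
  have c1 : c 1%g = 0 by rewrite /c subrr.
  have nr : nbhs (c 1%g) [set v : 'rV[R]_n | `|v| <= r].
    rewrite c1; apply/nbhs_ballP; exists r => //= v.
    by rewrite -ball_normE/= sub0r normrN => /ltW.
  pose P : set G := [set h | `|c h| <= r /\ chart_dom a h].
  have nP : nbhs (ci 0)^-1%g P.
    have nc : nbhs (1%g : G) [set g | `|c g| <= r] by exact: cc _ nr.
    by rewrite ci0 invg1; exact: (filterI nc dom1).
  have nD : nbhs (ci 0) (chart_dom a) by rewrite ci0.
  have nD' : nbhs (0 : 'rV[R]_n) [set v | chart_dom a (ci v)] by exact: cci0 _ nD.
  have nP' : nbhs (0 : 'rV[R]_n) [set v | P (ci v)^-1%g] by exact: cV _ nP.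
  by apply: filterS (filterI cod0 (filterI nD' nP')) => v [? [? ?]].
have [r1 r10 r1P] := ball0 _ domn.
have [r2 r20 r2P] : exists2 e, 0 < e & forall v w : 'rV[R]_n, `|v| <= e -> `|w| <= e ->
    [/\ chart_cod a (v + b), chart_cod a (w + b) & chart_dom a (ci v * ci w)%g].
  case/nbhs_ballP : prodn => e /= e0 eP; exists (e / 2); first by rewrite divr_gt0.
  move=> v w ve we; apply: (eP (v, w)); split => /=; rewrite -ball_normE/= sub0r normrN.
    by rewrite (le_lt_trans ve)// ltr_pdivrMr// ltr_pMr// ltr1n.
  by rewrite (le_lt_trans we)// ltr_pdivrMr// ltr_pMr// ltr1n.
pose rho := Num.min (Num.min r r1) (Num.min r2 (16^-1 / (M + 1))).
have M1 : 0 < M + 1 by lra.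
have rho0 : 0 < rho by rewrite !lt_min r0 r10 r20 divr_gt0// invr_gt0.
have rhor : rho <= r by rewrite !ge_min lexx.
have rhor1 : rho <= r1 by rewrite !ge_min lexx orbT.
have rhor2 : rho <= r2 by rewrite !ge_min lexx !orbT.
have Mrho : M * rho <= 16^-1.
  have : rho <= 16^-1 / (M + 1) by rewrite !ge_min lexx !orbT.
  by rewrite ler_pdivlMr//; nra.
have c1 : c 1%g = 0 by rewrite /c subrr.
have cK g : chart_dom a g -> ci (c g) = g.
  by move=> ag; rewrite /ci /c subrK chart_mapK.
have ciK v : chart_cod a (v + b) -> c (ci v) = v.
  by move=> av; rewrite /c /ci chart_invK// addrK.
have est g h : chart_dom a g -> chart_dom a h -> `|c g| <= r -> `|c h| <= r ->
    `|c (g * h)%g - c g - c h| <= M * (`|c g| * `|c h|).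
  move=> ag ah gr hr; have := rM _ _ gr hr.
  have e0 : chart_inv a b = 1%g by rewrite -[b]add0r.
  have eg : chart_inv a (c g + b) = g by exact: cK.
  have eh : chart_inv a (c h + b) = h by exact: cK.
  rewrite /= !add0r e0 eg eh mulg1 !mul1g.
  apply: le_trans; rewrite le_eqVlt; apply/orP; left; apply/eqP; congr (`| _ |).
  by rewrite /c -/b; apply/rowP => i; rewrite !mxE; ring.
have ltp u v : u <= rho -> rho <= v -> u <= v := @le_trans _ _ _ _ _.
have H1 v : `|v| <= rho -> chart_dom a (ci v) /\ c (ci v) = v.
  move=> vr; have [vc vd _] := r1P _ (ltp _ _ vr rhor1).
  by split => //; exact: ciK.
have H2 g : chart_dom a g -> {for g, continuous c}.
  by move=> ag; apply: cvgB; [exact: chart_map_continuous|exact: cvg_cst].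
have H3 v : `|v| <= rho -> {for v, continuous ci}.
  move=> vr; have [vc _ _] := r1P _ (ltp _ _ vr rhor1).
  by apply: cif; exact: chart_inv_continuous.
have H4 g h : chart_dom a g -> chart_dom a h -> `|c g| <= rho -> `|c h| <= rho ->
    chart_dom a (g * h)%g /\
    `|c (g * h)%g - c g - c h| <= M * (`|c g| * `|c h|).
  move=> ag ah gr hr; split; last by apply: est => //; exact: ltp rhor.
  rewrite -(cK _ ag) -(cK _ ah).
  by have [] := r2P _ _ (ltp _ _ gr rhor2) (ltp _ _ hr rhor2).
have H5 g : chart_dom a g -> `|c g| <= rho ->
    chart_dom a g^-1%g /\ `|c g^-1%g| <= 2 * `|c g|.
  move=> ag gr; have [_ _] := r1P _ (ltp _ _ gr rhor1).
  rewrite cK// => -[gVr ad]; split => //.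
  have := est _ _ ag ad (ltp _ _ gr rhor) gVr.
  rewrite mulgV c1 sub0r -opprD normrN.
  have := ler_normB (c g + c g^-1%g) (c g); rewrite addrAC subrr add0r.
  have := normr_ge0 (c g); have := normr_ge0 (c g^-1%g).
  have := absorb M0 gr (normr_ge0 (c g^-1%g)) Mrho.
  lra.
by exists (@LieCoord R G n c ci (chart_dom a) rho M rho0 M0 Mrho
  (chart_dom_open a) a1 c1 cK H1 H2 H3 H4 H5).
Qed.

Section local_estimates.
Variables (R : realType) (G : topGroupType) (L : lie_coord R G).
Implicit Types (g h x z : G).

Let c := lc L.
Let ci := lc_inv L.
Let rho := lc_rad L.
Let C := lc_cst L.
Let V := 'rV[R]_(lc_dim L).

Definition lc_ball (s : R) : set G := [set g | lc_dom L g /\ `|lc L g| <= s].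
Let B := lc_ball.

Let rho0 : 0 < rho. Proof. exact: lc_rad_gt0. Qed.
Let C0 : 0 <= C. Proof. exact: lc_cst_ge0. Qed.
Let Crho : C * rho <= 16^-1. Proof. exact: lc_small. Qed.

Lemma norm_split2 (a b d : V) : a = b + d -> `|a| <= `|b| + `|d|.
Proof. by move=> ->; exact: ler_normD. Qed.

Lemma norm_split3 (a b d e : V) : a = b + d + e -> `|a| <= `|b| + `|d| + `|e|.
Proof.
move=> ->; apply: le_trans (ler_normD _ _) _.
by rewrite lerD2r; exact: ler_normD.
Qed.

Lemma lc_ballS s t : s <= t -> lc_ball s `<=` lc_ball t.
Proof. by move=> st g [dg gs]; split => //; exact: le_trans gs st. Qed.

Lemma lc_mulP g h : B rho g -> B rho h -> [/\ lc_dom L (g * h)%g,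
  `|c (g * h)%g - (c g + c h)| <= C * (`|c g| * `|c h|) &
  `|c (g * h)%g| <= 2 * (`|c g| + `|c h|)].
Proof.
move=> [dg gr] [dh hr]; have [dgh E] := lcM dg dh gr hr.
rewrite -/c -/C in E gr hr *; rewrite opprD addrA; split => //.
have E' := absorb C0 gr (normr_ge0 (c h)) Crho.
have := @norm_split3 (c (g * h)%g) (c (g * h)%g - c g - c h) (c g) (c h).
rewrite addrAC !subrK => /(_ erefl).
have := normr_ge0 (c h); have := normr_ge0 (c g).
lra.
Qed.

Lemma lc_VP g s : s <= rho -> B s g -> B (2 * s) g^-1%g.
Proof.
move=> sr [dg gs]; have [dV Vs] := lcV dg (le_trans gs sr).
split => //; have : `|lc L g| <= s by []. move: Vs; lra.
Qed.

Lemma lc_divP g h : B (rho / 8) g -> B (rho / 8) h ->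
  [/\ lc_dom L (g * h^-1)%g, `|c (g * h^-1)%g| <= 2 * `|c g - c h| &
  `|c (g * h^-1)%g - (c g - c h)| <= 2 * C * (`|c g - c h| * `|c h|)].
Proof.
move=> Bg Bh.
have r8 : rho / 8 <= rho by have := rho0; lra.
have BV : B (2 * (rho / 8)) h^-1%g by apply: lc_VP.
have r4 : 2 * (rho / 8) <= rho by have := rho0; lra.
have [d _ n] := lc_mulP (lc_ballS r8 Bg) (lc_ballS r4 BV).
have Bz : B rho (g * h^-1)%g.
  split => //; apply: le_trans n _.
  have := Bg.2; have := BV.2; rewrite -/c; lra.
have [_] := lc_mulP Bz (lc_ballS r8 Bh); rewrite mulgVK.
set z := (g * h^-1)%g => E _.
have E' : `|c z - (c g - c h)| <= C * (`|c z| * `|c h|).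
  apply: le_trans E; rewrite le_eqVlt -normrN; apply/orP; left; apply/eqP.
  by congr (`| _ |); apply/rowP => i; rewrite !mxE; ring.
have E2 := absorb C0 (lc_ballS r8 Bh).2 (normr_ge0 (c z)) Crho.
rewrite [_ * `|c z|]mulrC -/c in E2.
have n2 : `|c z| <= 2 * `|c g - c h|.
  have := @norm_split2 (c z) (c z - (c g - c h)) (c g - c h).
  rewrite subrK => /(_ erefl).
  have := normr_ge0 (c z); have := normr_ge0 (c g - c h); lra.
split => //; apply: le_trans E' _.
have -> : 2 * C * (`|c g - c h| * `|c h|) = C * (2 * `|c g - c h| * `|c h|) by ring.
by apply: ler_wpM2l => //; rewrite ler_wpM2r.
Qed.

Lemma lc_conjP x z : B (rho / 16) x -> B (rho / 16) z ->
  [/\ lc_dom L (x * z * x^-1)%g, `|c (x * z * x^-1)%g| <= 2 * `|c z| &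
  `|c (x * z * x^-1)%g - c z| <= 3 * C * (`|c x| * `|c z|)].
Proof.
move=> Bx Bz; have r0 := rho0.
have r16 : rho / 16 <= rho by lra.
have BV : B (2 * (rho / 16)) x^-1%g by apply: lc_VP.
have r8 : 2 * (rho / 16) <= rho by lra.
have [dxz Exz nxz] := lc_mulP (lc_ballS r16 Bx) (lc_ballS r16 Bz).
have Bxz : B rho (x * z)%g.
  split => //; apply: le_trans nxz _; have := Bx.2; have := Bz.2; rewrite -/c; lra.
have [dy _ ny] := lc_mulP Bxz (lc_ballS r8 BV).
have By : B rho (x * z * x^-1)%g.
  split => //; apply: le_trans ny _.
  have := Bx.2; have := Bz.2; have := BV.2; rewrite -/c; lra.
have [_] := lc_mulP By (lc_ballS r16 Bx); rewrite mulgVK.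
set y := (x * z * x^-1)%g => E _.
have Cx : C * `|c x| <= 16^-1.
  by apply: le_trans Crho; apply: ler_wpM2l => //; apply: le_trans Bx.2 _; lra.
have E2 : `|c y - c z| <= C * `|c x| * (`|c y| + `|c z|).
  have := @norm_split2 (c y - c z) (c (x * z)%g - (c x + c z)) (- (c (x * z)%g - (c y + c x))).
  rewrite normrN => h.
  have {h} := h ltac:(by apply/rowP => i; rewrite !mxE; ring).
  have -> : C * `|c x| * (`|c y| + `|c z|) = C * (`|c x| * `|c z|) + C * (`|c y| * `|c x|).
    ring.
  lra.
have ny2 : `|c y| <= 2 * `|c z|.
  have := @norm_split2 (c y) (c y - c z) (c z); rewrite subrK => /(_ erefl).
  have := normr_ge0 (c y); have := normr_ge0 (c z).
  have : C * `|c x| * (`|c y| + `|c z|) <= 16^-1 * (`|c y| + `|c z|).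
    by rewrite ler_wpM2r// addr_ge0.
  lra.
split => //; apply: le_trans E2 _.
have -> : 3 * C * (`|c x| * `|c z|) = C * `|c x| * (2 * `|c z| + `|c z|) by ring.
by apply: ler_wpM2l; [rewrite mulr_ge0|lra].
Qed.

Lemma lc_powP g m : lc_dom L g -> m%:R * `|c g| <= rho / 4 ->
  forall i, (i <= m)%N -> [/\ lc_dom L (g ^+ i)%g,
    `|c (g ^+ i)%g - i%:R *: c g| <= C * (i%:R ^+ 2 * `|c g| ^+ 2) &
    `|c (g ^+ i)%g| <= 2 * (i%:R * `|c g|)].
Proof.
move=> dg mg; have r0 := rho0; have x0 := normr_ge0 (c g).
have key (i : nat) : (i <= m)%N ->
    `|c (g ^+ i)%g - i%:R *: c g| <= C * (i%:R ^+ 2 * `|c g| ^+ 2) ->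
    `|c (g ^+ i)%g| <= 2 * (i%:R * `|c g|).
  move=> im E; have := @norm_split2 (c (g ^+ i)%g) (c (g ^+ i)%g - i%:R *: c g) (i%:R *: c g).
  rewrite subrK normrZ normr_nat => /(_ erefl).
  have ix : i%:R * `|c g| <= rho.
    apply: (@le_trans _ _ (m%:R * `|c g|)); first by rewrite ler_wpM2r// ler_nat.
    lra.
  have ix0 : 0 <= i%:R * `|c g| by rewrite mulr_ge0.
  have := absorb C0 ix ix0 Crho; rewrite -expr2 exprMn; lra.
elim=> [_|i ih im].
  have E : `|c (g ^+ 0)%g - 0%:R *: c g| <= C * (0%:R ^+ 2 * `|c g| ^+ 2).
    by rewrite expg0 /c lc1 scale0r subrr normr0 expr0n/= mul0r mulr0.
  by split; [rewrite expg0; exact: lc_dom1|exact: E|exact: key].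
have im' := ltnW im; have [di Ei ni] := ih im'.
have ixm : i.+1%:R * `|c g| <= rho / 4.
  by apply: le_trans mg; rewrite ler_wpM2r// ler_nat.
rewrite -natr1 mulrDl mul1r in ixm.
have ix0 : 0 <= i%:R * `|c g| by rewrite mulr_ge0.
have [d E _] := @lc_mulP (g ^+ i)%g g ltac:(split => //; rewrite -/c; lra) ltac:(split => //; rewrite -/c; lra).
have E' : `|c (g ^+ i.+1)%g - i.+1%:R *: c g| <= C * (i.+1%:R ^+ 2 * `|c g| ^+ 2).
  have := @norm_split2 (c (g ^+ i.+1)%g - i.+1%:R *: c g)
     (c (g ^+ i * g)%g - (c (g ^+ i)%g + c g)) (c (g ^+ i)%g - i%:R *: c g).
  have -> : (g ^+ i.+1 = g ^+ i * g)%g by rewrite expgSr.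
  move=> h; have {h} := h ltac:(by apply/rowP => j; rewrite !mxE -natr1; ring).
  move=> h; apply: le_trans h _; apply: le_trans (lerD E Ei) _.
  have : C * (`|c (g ^+ i)%g| * `|c g|) <= C * (2 * (i%:R * `|c g|) * `|c g|).
    by apply: ler_wpM2l => //; rewrite ler_wpM2r.
  have : 0 <= C * `|c g| ^+ 2 by rewrite mulr_ge0// exprn_ge0.
  rewrite -natr1; nra.
by split; [rewrite expgSr|exact: E'|exact: key].
Qed.

(** Powers depend on the element as multiplication by the exponent does: writing
    z = g / h, the quotient g^m / h^m is the product of the conjugates of z by
    the g^i with i < m, each of which is close to z. *)
Lemma lc_pow_quot g h m (mu : R) : lc_dom L g -> lc_dom L h ->
  `|c g| <= mu -> `|c h| <= mu -> m%:R * mu <= rho / 64 -> mu <= rho / 64 ->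
  forall i, (i <= m)%N -> let z := (g * h^-1)%g in
  [/\ lc_dom L (g ^+ i * (h ^+ i)^-1)%g,
    `|c (g ^+ i * (h ^+ i)^-1)%g - i%:R *: c z| <= 11 * C * (i%:R ^+ 2 * mu * `|c z|) &
    `|c (g ^+ i * (h ^+ i)^-1)%g| <= 2 * (i%:R * `|c z|)].
Proof.
move=> dg dh gmu hmu mmu mur; have r0 := rho0.
have mu0 : 0 <= mu := le_trans (normr_ge0 _) gmu.
have [dz nz Ez] : [/\ lc_dom L (g * h^-1)%g, `|c (g * h^-1)%g| <= 2 * `|c g - c h| &
  `|c (g * h^-1)%g - (c g - c h)| <= 2 * C * (`|c g - c h| * `|c h|)].
  by apply: lc_divP; split => //; rewrite -/c; lra.
set z := (g * h^-1)%g in dz nz Ez *.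
have z0 := normr_ge0 (c z).
have zmu : `|c z| <= 4 * mu.
  have := @norm_split2 (c g - c h) (c g) (- c h) erefl; rewrite normrN; lra.
have key (i : nat) : (i <= m)%N ->
    `|c (g ^+ i * (h ^+ i)^-1)%g - i%:R *: c z| <= 11 * C * (i%:R ^+ 2 * mu * `|c z|) ->
    `|c (g ^+ i * (h ^+ i)^-1)%g| <= 2 * (i%:R * `|c z|).
  move=> im E; set w := (g ^+ i * _)%g in E *.
  have := @norm_split2 (c w) (c w - i%:R *: c z) (i%:R *: c z).
  rewrite subrK normrZ normr_nat => /(_ erefl).
  have imu : i%:R * mu <= rho.
    apply: (@le_trans _ _ (m%:R * mu)); first by rewrite ler_wpM2r// ler_nat.
    lra.
  have iz0 : 0 <= i%:R * `|c z| by rewrite mulr_ge0.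
  have imu64 : i%:R * mu <= rho / 64.
    by apply: le_trans mmu; rewrite ler_wpM2r// ler_nat.
  have Cs : C * (rho / 64) <= 1024^-1 by move: Crho; lra.
  have := absorb C0 imu64 iz0 Cs.
  have -> : C * (i%:R * mu * (i%:R * `|c z|)) = C * (i%:R ^+ 2 * mu * `|c z|) by ring.
  by move: E iz0; lra.
elim=> [_|i ih im].
  have e1 : (g ^+ 0 * (h ^+ 0)^-1 = 1)%g by rewrite !expg0 mulgV.
  have E : `|c (g ^+ 0 * (h ^+ 0)^-1)%g - 0%:R *: c z| <= 11 * C * (0%:R ^+ 2 * mu * `|c z|).
    by rewrite e1 /c lc1 scale0r subrr normr0 expr0n/= !mul0r mulr0.
  by split; [rewrite e1; exact: lc_dom1|exact: E|exact: key].
have im' := ltnW im; have [dw Ew nw] := ih im'.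
set w := (g ^+ i * (h ^+ i)^-1)%g in dw Ew nw.
have imu : i%:R * mu <= rho / 64.
  by apply: le_trans mmu; rewrite ler_wpM2r// ler_nat.
have mgr : m%:R * `|c g| <= rho / 4.
  by apply: (@le_trans _ _ (m%:R * mu)); [rewrite ler_wpM2l|lra].
have [dgi _ ngi] := lc_powP dg mgr im'.
have igmu : i%:R * `|c g| <= i%:R * mu by rewrite ler_wpM2l.
have [dy ny Ey] := @lc_conjP (g ^+ i)%g z ltac:(split => //; rewrite -/c; lra)
  ltac:(split => //; rewrite -/c; lra).
set y := (g ^+ i * z * _)%g in dy ny Ey.
have iz : i%:R * `|c z| <= 4 * (i%:R * mu).
  have : i%:R * `|c z| <= i%:R * (4 * mu) by rewrite ler_wpM2l.
  lra.
have [dyw Eyw _] := @lc_mulP y w ltac:(split => //; rewrite -/c; lra)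
  ltac:(split => //; rewrite -/c; lra).
have yw : (y * w = g ^+ i.+1 * (h ^+ i.+1)^-1)%g.
  by rewrite /y /w /z !expgSr invgM !mulgA mulgVK.
rewrite yw in dyw Eyw.
have E' : `|c (g ^+ i.+1 * (h ^+ i.+1)^-1)%g - i.+1%:R *: c z| <=
    11 * C * (i.+1%:R ^+ 2 * mu * `|c z|).
  have := @norm_split3 (c (g ^+ i.+1 * (h ^+ i.+1)^-1)%g - i.+1%:R *: c z)
     (c (g ^+ i.+1 * (h ^+ i.+1)^-1)%g - (c y + c w)) (c y - c z) (c w - i%:R *: c z).
  move=> h'; have {h'} := h' ltac:(by apply/rowP => j; rewrite !mxE -natr1; ring).
  move=> h'; apply: le_trans h' _; apply: le_trans (lerD (lerD Eyw Ey) Ew) _.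
  have h1 : C * (`|c y| * `|c w|) <= C * (2 * `|c z| * (8 * (i%:R * mu))).
    apply: ler_wpM2l => //; apply: ler_pM => //; lra.
  have h2 : 3 * C * (`|c (g ^+ i)%g| * `|c z|) <= 3 * C * (2 * (i%:R * mu) * `|c z|).
    apply: ler_wpM2l; first by rewrite mulr_ge0.
    by apply: ler_wpM2r => //; lra.
  have h3 : 0 <= C * mu * `|c z| by rewrite !mulr_ge0.
  apply: le_trans (lerD (lerD h1 h2) (lexx _)) _; rewrite -[i.+1%:R]natr1.
  have -> : 11 * C * ((i%:R + 1) ^+ 2 * mu * `|c z|) =
    C * (2 * `|c z| * (8 * (i%:R * mu))) + 3 * C * (2 * (i%:R * mu) * `|c z|) +
    11 * C * (i%:R ^+ 2 * mu * `|c z|) + 11 * (C * mu * `|c z|) by ring.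
  by rewrite lerDl mulr_ge0.
by split; [exact: dyw|exact: E'|exact: key].
Qed.

Lemma lc_pow_diff g h m (mu : R) : lc_dom L g -> lc_dom L h ->
  `|c g| <= mu -> `|c h| <= mu -> m%:R * mu <= rho / 64 ->
  `|c (g ^+ m)%g - c (h ^+ m)%g - m%:R *: (c g - c h)| <=
    32 * C * (m%:R ^+ 2 * mu * `|c g - c h|).
Proof.
move=> dg dh gmu hmu mmu; have r0 := rho0.
have mu0 : 0 <= mu := le_trans (normr_ge0 _) gmu.
have [->|m_gt0] := posnP m.
  by rewrite !expg0 subrr scale0r subrr normr0 expr0n/= !mul0r mulr0.
have m1 : 1 <= m%:R :> R by rewrite ler1n.
have mur : mu <= rho / 64.
  by apply: le_trans mmu; rewrite -[leLHS]mul1r ler_wpM2r.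
have [dz nz Ez] : [/\ lc_dom L (g * h^-1)%g, `|c (g * h^-1)%g| <= 2 * `|c g - c h| &
  `|c (g * h^-1)%g - (c g - c h)| <= 2 * C * (`|c g - c h| * `|c h|)].
  by apply: lc_divP; split => //; rewrite -/c; lra.
have [dw Ew nw] := lc_pow_quot dg dh gmu hmu mmu mur (leqnn m).
set z := (g * h^-1)%g in dz nz Ez Ew nw; set w := (_ * _)%g in dw Ew nw.
have mhr : m%:R * `|c h| <= m%:R * mu by rewrite ler_wpM2l.
have [dhm _ nhm] := lc_powP dh (m := m) ltac:(lra) (leqnn m).
have d0 := normr_ge0 (c g - c h).
have dmu : `|c g - c h| <= 2 * mu.
  have := @norm_split2 (c g - c h) (c g) (- c h) erefl; rewrite normrN; lra.
have md : m%:R * `|c z| <= m%:R * (2 * `|c g - c h|) by rewrite ler_wpM2l.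
have md' : m%:R * `|c g - c h| <= m%:R * (2 * mu) by rewrite ler_wpM2l.
have [_ Ewh _] := @lc_mulP w (h ^+ m)%g ltac:(split => //; rewrite -/c; lra)
  ltac:(split => //; rewrite -/c; lra).
have wh : (w * h ^+ m = g ^+ m)%g by rewrite /w mulgVK.
rewrite wh in Ewh.
have := @norm_split3 (c (g ^+ m)%g - c (h ^+ m)%g - m%:R *: (c g - c h))
  (c (g ^+ m)%g - (c w + c (h ^+ m)%g)) (c w - m%:R *: c z) (m%:R *: (c z - (c g - c h))).
move=> h'; have {h'} := h' ltac:(by apply/rowP => j; rewrite !mxE; ring).
rewrite normrZ normr_nat => h'; apply: le_trans h' _.
set d := `|c g - c h| in nz Ez d0 dmu md md' *.
have h1 : C * (`|c w| * `|c (h ^+ m)%g|) <= C * (4 * (m%:R * d) * (2 * (m%:R * mu))).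
  by apply: ler_wpM2l => //; apply: ler_pM => //; lra.
have h2 : 11 * C * (m%:R ^+ 2 * mu * `|c z|) <= 11 * C * (m%:R ^+ 2 * mu * (2 * d)).
  by apply: ler_wpM2l; [rewrite mulr_ge0|rewrite ler_wpM2l// mulr_ge0// exprn_ge0].
have h3 : m%:R * `|c z - (c g - c h)| <= m%:R * (2 * C * (d * mu)).
  apply: ler_wpM2l => //; apply: le_trans Ez _.
  by apply: ler_wpM2l; [rewrite mulr_ge0|rewrite ler_wpM2l].
have h4 : m%:R * (2 * C * (d * mu)) <= m%:R * (m%:R * (2 * C * (d * mu))).
  apply: ler_wpM2l => //; rewrite -[leLHS]mul1r; apply: ler_wpM2r => //.
  by rewrite !mulr_ge0.
apply: le_trans (lerD (lerD (le_trans Ewh h1) (le_trans Ew h2)) (le_trans h3 h4)) _.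
by rewrite le_eqVlt; apply/orP; left; apply/eqP; ring.
Qed.

Lemma lc_pow_lipschitz g h m (mu : R) : lc_dom L g -> lc_dom L h ->
  `|c g| <= mu -> `|c h| <= mu -> m%:R * mu <= rho / 64 ->
  `|c (g ^+ m)%g - c (h ^+ m)%g| <= 2 * m%:R * `|c g - c h| /\
  m%:R * `|c g - c h| <= 2 * `|c (g ^+ m)%g - c (h ^+ m)%g|.
Proof.
move=> dg dh gmu hmu mmu; have r0 := rho0.
have E := lc_pow_diff dg dh gmu hmu mmu.
have md0 : 0 <= m%:R * `|c g - c h| by rewrite mulr_ge0.
have Cs : C * (rho / 64) <= 1024^-1 by move: Crho; lra.
have := absorb C0 mmu md0 Cs.
have -> : C * (m%:R * mu * (m%:R * `|c g - c h|)) = C * (m%:R ^+ 2 * mu * `|c g - c h|) by ring.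
move=> A.
have := @norm_split2 (c (g ^+ m)%g - c (h ^+ m)%g)
  (c (g ^+ m)%g - c (h ^+ m)%g - m%:R *: (c g - c h)) (m%:R *: (c g - c h)).
rewrite subrK => /(_ erefl).
have := @norm_split2 (m%:R *: (c g - c h)) (c (g ^+ m)%g - c (h ^+ m)%g)
  (- (c (g ^+ m)%g - c (h ^+ m)%g - m%:R *: (c g - c h))).
rewrite opprB [X in _ = X]addrC subrK => /(_ erefl).
rewrite -opprB !normrN normrZ normr_nat.
move: E A md0; split; lra.
Qed.

End local_estimates.

(** * The exponential map *)

Section exponential.
Variables (R : realType) (G : topGroupType) (L : lie_coord R G).

Let c := lc L.
Let ci := lc_inv L.
Let rho := lc_rad L.
Let C := lc_cst L.
Let V := 'rV[R]_(lc_dim L).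
Implicit Types (v w : V) (g h : G).

Let rho0 : 0 < rho. Proof. exact: lc_rad_gt0. Qed.
Let C0 : 0 <= C. Proof. exact: lc_cst_ge0. Qed.
Let Crho : C * rho <= 16^-1. Proof. exact: lc_small. Qed.

Definition exp_rad : R := lc_rad L / 128.

Lemma exp_rad_gt0 : 0 < exp_rad.
Proof. by rewrite /exp_rad; have := rho0; rewrite /rho; lra. Qed.

(** The approximation of the exponential of [v] by powers. *)
Definition exp_approx v (m : nat) : V := c (ci (m%:R^-1 *: v) ^+ m)%g.

Lemma lc_inv_scale v m : `|v| <= exp_rad -> (0 < m)%N ->
  [/\ lc_dom L (ci (m%:R^-1 *: v)), c (ci (m%:R^-1 *: v)) = m%:R^-1 *: v &
      `|m%:R^-1 *: v| = m%:R^-1 * `|v|].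
Proof.
move=> vr m0; have mV : 0 <= m%:R^-1 :> R by [].
have E : `|m%:R^-1 *: v| = m%:R^-1 * `|v| by rewrite normrZ ger0_norm.
suff h : `|m%:R^-1 *: v| <= lc_rad L by have [] := lcK h.
rewrite E; apply: (@le_trans _ _ `|v|).
  by rewrite ler_piMl// invf_le1 ?ltr0n// ler1n.
by apply: le_trans vr _; have := rho0; rewrite /exp_rad /rho; lra.
Qed.

Lemma exp_approx_refine v m k : `|v| <= exp_rad -> (0 < m)%N -> (0 < k)%N ->
  `|exp_approx v (k * m)%N - exp_approx v m| <= 2 * C * `|v| ^+ 2 / m%:R.
Proof.
move=> vr m0 k0; have r0 := rho0.
have M0 : m%:R != 0 :> R by rewrite pnatr_eq0 -lt0n.
have K0 : k%:R != 0 :> R by rewrite pnatr_eq0 -lt0n.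
have Mp : 0 < m%:R :> R by rewrite ltr0n.
have km0 : (0 < k * m)%N by rewrite muln_gt0 k0.
have [dg cg ng] := lc_inv_scale vr km0.
have [dh ch nh] := lc_inv_scale vr m0.
rewrite /exp_approx expgnA; set g := ci _ in dg cg *; set h := ci _ in dh ch *.
have kg : k%:R * `|c g| = m%:R^-1 * `|v|.
  by rewrite cg ng natrM invfM; field; rewrite K0 M0.
have mvr : m%:R^-1 * `|v| <= `|v| by rewrite ler_piMl// invf_le1// ler1n.
have vr' : `|v| <= rho / 128 by [].
have [dgk Egk ngk] := lc_powP dg (m := k) ltac:(rewrite -/c kg -/rho; lra) (leqnn k).
have Ed : `|c (g ^+ k)%g - c h| <= C * (m%:R^-1 * `|v|) ^+ 2.
  rewrite ch; rewrite -exprMn kg in Egk.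
  suff -> : m%:R^-1 *: v = k%:R *: c g by [].
  by rewrite cg scalerA; congr (_ *: _); rewrite natrM; field; rewrite K0 M0.
rewrite kg in ngk.
have mv0 : 0 <= m%:R^-1 * `|v| by rewrite mulr_ge0.
have nh2 : `|c h| <= 2 * (m%:R^-1 * `|v|) by rewrite ch nh; lra.
have mmu : m%:R * (2 * (m%:R^-1 * `|v|)) <= rho / 64.
  by rewrite mulrCA mulVKf//; lra.
have [A _] := lc_pow_lipschitz dgk dh ngk nh2 mmu.
apply: le_trans A _.
apply: le_trans (ler_wpM2l _ Ed) _; first by rewrite mulr_ge0.
by rewrite le_eqVlt; apply/orP; left; apply/eqP; field.
Qed.

Lemma exp_approx_dist v m j : `|v| <= exp_rad -> (0 < m)%N -> (0 < j)%N ->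
  `|exp_approx v j - exp_approx v m| <=
  2 * C * `|v| ^+ 2 / j%:R + 2 * C * `|v| ^+ 2 / m%:R.
Proof.
move=> vr m0 j0.
have A := exp_approx_refine vr m0 j0; have B := exp_approx_refine vr j0 m0.
rewrite mulnC in B.
have := @norm_split2 _ _ L (exp_approx v j - exp_approx v m)
  (- (exp_approx v (j * m)%N - exp_approx v j)) (exp_approx v (j * m)%N - exp_approx v m).
move=> h; apply: le_trans (h _) _.
  by apply/rowP => i; rewrite !mxE; ring.
by rewrite normrN; exact: lerD.
Qed.

Definition lc_e v : V := lim (exp_approx v n.+1 @[n --> \oo]).

Lemma lc_e_approx v m : `|v| <= exp_rad -> (0 < m)%N ->
  `|lc_e v - exp_approx v m| <= 2 * C * `|v| ^+ 2 / m%:R.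
Proof.
move=> vr m0; set K := 2 * C * `|v| ^+ 2.
have K0 : 0 <= K by rewrite !mulr_ge0// exprn_ge0.
have small e : 0 < e -> \forall n \near \oo, K / n.+1%:R < e.
  move=> e0; have e1 : 0 < e / (K + 1) by rewrite divr_gt0// ltr_wpDl.
  have := near_infty_natSinv_lt (PosNum e1); apply: filterS => n /= nlt.
  apply: (@le_lt_trans _ _ ((K + 1) / n.+1%:R)).
    by rewrite ler_wpM2r// lerDl.
  by rewrite mulrC -ltr_pdivlMr// ltr_wpDl.
have cv : cvg (exp_approx v n.+1 @[n --> \oo]).
  apply: cauchy_cvg; apply/cauchy_exP => e e0.
  have e2 : 0 < e / 2 by lra.
  have [N _ NP] := small _ e2.
  exists (exp_approx v N.+1); exists N => // n /= Nn.
  rewrite -ball_normE /=; apply: le_lt_trans (exp_approx_dist vr _ _) _ => //.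
  have /= := NP _ (leqnn N); have /= := NP _ Nn; rewrite -/K.
  move: (K / _) (K / _) => a b; lra.
apply/ler_addgt0Pr => e e0; have e2 : 0 < e / 2 by lra.
have near2 : \forall n \near \oo, `|lc_e v - exp_approx v n.+1| < e / 2.
  by move/cvgrPdist_lt : cv; apply.
have [n [n1 n2]] := @filter_ex _ \oo _ _ (filterI (small _ e2) near2).
have := @norm_split2 _ _ L (lc_e v - exp_approx v m) (lc_e v - exp_approx v n.+1)
  (exp_approx v n.+1 - exp_approx v m).
rewrite addrA subrK => /(_ erefl).
have := exp_approx_dist vr m0 (ltn0Sn n); rewrite -/K.
move: n1 n2 => /=; move: (K / n.+1%:R) (K / m%:R) => a b; lra.
Qed.

Definition lc_exp v : G := ci (lc_e v).

Lemma exp_radP m v : `|v| <= exp_rad -> 0 <= m -> m <= 128 -> m * `|v| <= rho.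
Proof.
move=> vr m0 m128; apply: (@le_trans _ _ (128 * exp_rad)); last first.
  by rewrite /exp_rad /rho; lra.
by apply: ler_pM.
Qed.

Lemma lc_e_near v : `|v| <= exp_rad -> `|lc_e v - v| <= 2 * C * `|v| ^+ 2.
Proof.
move=> vr; have := lc_e_approx vr (ltn0Sn 0).
rewrite /exp_approx expg1 !invr1 scale1r mulr1.
have rr : exp_rad <= lc_rad L by have := rho0; rewrite /exp_rad /rho; lra.
by have [_ E] := lcK (le_trans vr rr); rewrite /c /ci E.
Qed.

Lemma lc_e_pow g m : lc_dom L g -> m%:R * `|c g| <= exp_rad ->
  `|lc_e (m%:R *: c g) - c (g ^+ m)%g| <= 2 * C * (m%:R * `|c g| ^+ 2).
Proof.
move=> dg mg; have [->|m0] := posnP m.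
  have := @lc_e_near 0; rewrite normr0 expr0n/= mulr0 subr0 scale0r => /(_ (ltW exp_rad_gt0)).
  by rewrite expg0 /c lc1 subr0 mul0r mulr0.
have M0 : m%:R != 0 :> R by rewrite pnatr_eq0 -lt0n.
have nm : `|m%:R *: c g| = m%:R * `|c g| by rewrite normrZ normr_nat.
have := @lc_e_approx (m%:R *: c g) m; rewrite nm => /(_ mg m0).
rewrite /exp_approx scalerA mulVf// scale1r.
have -> : ci (c g) = g by exact: lc_invK.
by move=> h; apply: le_trans h _; rewrite le_eqVlt; apply/orP; left; apply/eqP; field.
Qed.

(** The estimate for differences of powers is uniform in the exponent, hence
    passes to the limit: the exponential map is strictly differentiable at 0,
    with derivative the identity. *)
Lemma lc_e_diff v w mu : `|v| <= mu -> `|w| <= mu -> mu <= exp_rad ->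
  `|lc_e v - lc_e w - (v - w)| <= 32 * C * (mu * `|v - w|).
Proof.
move=> vm wm mr; have vr := le_trans vm mr; have wr := le_trans wm mr.
have mu0 : 0 <= mu := le_trans (normr_ge0 _) vm.
set K := 2 * C * mu ^+ 2.
have K0 : 0 <= K by rewrite !mulr_ge0// exprn_ge0.
apply/ler_addgt0Pr => e e0.
have e1 : 0 < e / (2 * K + 1) by rewrite divr_gt0// ltr_wpDl// mulr_ge0.
have [n ne] := @filter_ex _ \oo _ _ (near_infty_natSinv_lt (PosNum e1)).
move: ne => /=; set m := n.+1; have m0 : (0 < m)%N by [].
have M0 : m%:R != 0 :> R by rewrite pnatr_eq0 -lt0n.
have MV0 : 0 <= m%:R^-1 :> R by [].
move=> me; have Kme : 2 * (K / m%:R) <= e.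
  apply: (@le_trans _ _ ((2 * K + 1) / m%:R)).
    by rewrite mulrA; apply: ler_wpM2r => //; rewrite lerDl.
  by rewrite mulrC -ler_pdivlMr ?ltW// ltr_wpDl// mulr_ge0.
have [dg cg ng] := lc_inv_scale vr m0; have [dh ch nh] := lc_inv_scale wr m0.
have Ev : `|lc_e v - exp_approx v m| <= K / m%:R.
  apply: le_trans (lc_e_approx vr m0) _; apply: ler_wpM2r => //.
  by apply: ler_wpM2l; rewrite ?mulr_ge0// lerXn2r// ?nnegrE.
have Ew : `|lc_e w - exp_approx w m| <= K / m%:R.
  apply: le_trans (lc_e_approx wr m0) _; apply: ler_wpM2r => //.
  by apply: ler_wpM2l; rewrite ?mulr_ge0// lerXn2r// ?nnegrE.
have E : `|exp_approx v m - exp_approx w m - (v - w)| <= 32 * C * (mu * `|v - w|).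
  have gm : `|c (ci (m%:R^-1 *: v))| <= m%:R^-1 * mu by rewrite cg ng ler_wpM2l.
  have hm : `|c (ci (m%:R^-1 *: w))| <= m%:R^-1 * mu by rewrite ch nh ler_wpM2l.
  have mm : m%:R * (m%:R^-1 * mu) <= lc_rad L / 64.
    rewrite mulrA mulfV// mul1r; apply: le_trans mr _.
    by have := rho0; rewrite /exp_rad /rho; lra.
  have := lc_pow_diff dg dh gm hm mm.
  rewrite -/c cg ch -/(exp_approx v m) -/(exp_approx w m) -scalerBr scalerA mulfV// scale1r.
  move=> h; apply: le_trans h _; rewrite normrZ (ger0_norm MV0) le_eqVlt.
  by apply/orP; left; apply/eqP; rewrite -/C; field.
have := @norm_split3 _ _ L (lc_e v - lc_e w - (v - w)) (lc_e v - exp_approx v m)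
  (- (lc_e w - exp_approx w m)) (exp_approx v m - exp_approx w m - (v - w)).
rewrite normrN => h; have {h} := h ltac:(by apply/rowP => i; rewrite !mxE; ring).
move: Ev Ew E Kme; move: (K / _) => k; lra.
Qed.

Lemma lc_e_lipschitz v w : `|v| <= exp_rad -> `|w| <= exp_rad ->
  `|lc_e v - lc_e w| <= 2 * `|v - w| /\ `|v - w| <= 2 * `|lc_e v - lc_e w|.
Proof.
move=> vr wr; have E := lc_e_diff vr wr (lexx _).
have Cs : C * exp_rad <= 1024^-1.
  by move: Crho; have := rho0; rewrite /exp_rad /rho; lra.
have := @absorb R C exp_rad `|v - w| exp_rad _ C0 (lexx _) (normr_ge0 _) Cs => A.
have := @norm_split2 _ _ L (lc_e v - lc_e w) (lc_e v - lc_e w - (v - w)) (v - w).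
rewrite subrK => /(_ erefl).
have := @norm_split2 _ _ L (v - w) (- (lc_e v - lc_e w - (v - w))) (lc_e v - lc_e w).
rewrite normrN => h; have {h} := h ltac:(by apply/rowP => i; rewrite !mxE; ring).
have := normr_ge0 (v - w); move: E A; split; lra.
Qed.

Lemma lc_e0 : lc_e 0 = 0.
Proof.
have := @lc_e_near 0; rewrite normr0 expr0n/= mulr0 subr0 => /(_ (ltW exp_rad_gt0)).
by rewrite normr_le0 => /eqP.
Qed.

Lemma lc_exp_dom v : `|v| <= exp_rad ->
  [/\ lc_dom L (lc_exp v), c (lc_exp v) = lc_e v & `|c (lc_exp v)| <= 2 * `|v|].
Proof.
move=> vr; have z : `|0 : V| <= exp_rad by rewrite normr0 ltW// exp_rad_gt0.
have [] := lc_e_lipschitz vr z; rewrite lc_e0 !subr0 => h _.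
have h' : `|lc_e v| <= lc_rad L.
  by apply: le_trans h _; apply: exp_radP => //; lra.
by have [d E] := lcK h'; rewrite /lc_exp /c /ci E.
Qed.

Lemma lc_exp0 : lc_exp 0 = 1%g.
Proof.
by rewrite /lc_exp lc_e0 -(lc1 L) /ci lc_invK//; exact: lc_dom1.
Qed.

Lemma lc_dom_inj g h : lc_dom L g -> lc_dom L h -> c g = c h -> g = h.
Proof.
by move=> dg dh E; rewrite -(lc_invK dg) -(lc_invK dh) -/c E.
Qed.

Lemma lc_expMn v k : k%:R * `|v| <= exp_rad -> `|v| <= exp_rad ->
  lc_exp (k%:R *: v) = (lc_exp v ^+ k)%g.
Proof.
have [->|k0] := posnP k; first by rewrite scale0r lc_exp0 expg0.
move=> kr vr; have nk : `|k%:R *: v| = k%:R * `|v| by rewrite normrZ normr_nat.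
have [dv cv nv] := lc_exp_dom vr.
have kr' : `|k%:R *: v| <= exp_rad by rewrite nk.
have [dkv ckv nkv] := lc_exp_dom kr'.
have r0 := rho0; have rE : exp_rad = rho / 128 by [].
have [dp _ _] := lc_powP dv (m := k)
  ltac:(apply: (@le_trans _ _ (k%:R * (2 * `|v|))); [by rewrite ler_wpM2l|move: kr; rewrite rE -/rho; lra]) (leqnn k).
apply: lc_dom_inj => //; apply/eqP; rewrite -subr_eq0 -normr_le0.
apply/ler_addgt0Pr => e e0; rewrite add0r.
set K := 6 * C * k%:R * `|v| ^+ 2.
have K0 : 0 <= K by rewrite !mulr_ge0// exprn_ge0.
have e1 : 0 < e / (K + 1) by rewrite divr_gt0// ltr_wpDl.
have [n ne] := @filter_ex _ \oo _ _ (near_infty_natSinv_lt (PosNum e1)).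
move: ne => /=; set m := n.+1; have m0 : (0 < m)%N by [].
have M0 : m%:R != 0 :> R by rewrite pnatr_eq0 -lt0n.
have MV0 : 0 <= m%:R^-1 :> R by [].
move=> me; have Kme : K / m%:R <= e.
  apply: (@le_trans _ _ ((K + 1) / m%:R)).
    by apply: ler_wpM2r => //; rewrite lerDl.
  by rewrite mulrC -ler_pdivlMr ?ltW// ltr_wpDl.
apply: le_trans Kme.
have [dg cg ng] := lc_inv_scale vr m0; set g := ci _ in dg cg.
have mg : m%:R *: c g = v by rewrite cg scalerA mulfV// scale1r.
have mgn : m%:R * `|c g| = `|v| by rewrite -mg normrZ normr_nat.
have kmg : (m * k)%:R * `|c g| = k%:R * `|v| by rewrite -mgn natrM; ring.
have gn : `|c g| = m%:R^-1 * `|v| by rewrite cg.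
have A := @lc_e_pow g m dg ltac:(rewrite mgn; exact: vr).
have B := @lc_e_pow g (m * k)%N dg ltac:(rewrite kmg; exact: kr).
have mkE : (m * k)%:R *: c g = k%:R *: v by rewrite -mg scalerA -natrM mulnC.
rewrite mkE expgnA in B; rewrite mg in A.
have [dgm _ ngm] := lc_powP dg (m := m) ltac:(rewrite -/c mgn -/rho; move: vr; rewrite rE; have := normr_ge0 v; lra) (leqnn m).
have ngm' : `|c (g ^+ m)%g| <= 2 * `|v| by rewrite -mgn.
have kk : k%:R * (2 * `|v|) <= lc_rad L / 64 by move: kr; rewrite rE /rho; lra.
have [D _] := lc_pow_lipschitz dv dgm nv ngm' kk.
rewrite -/c cv in D.
have := @norm_split2 _ _ L (c (lc_exp (k%:R *: v)) - c (lc_exp v ^+ k)%g)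
  (lc_e (k%:R *: v) - c ((g ^+ m) ^+ k)%g) (- (c (lc_exp v ^+ k)%g - c ((g ^+ m) ^+ k)%g)).
rewrite ckv normrN => h; have {h} := h ltac:(by apply/rowP => i; rewrite !mxE; ring).
move=> h; apply: le_trans h _; apply: le_trans (lerD B D) _.
have D2 : 2 * k%:R * `|lc_e v - c (g ^+ m)%g| <= 2 * k%:R * (2 * C * (m%:R * `|c g| ^+ 2)).
  by apply: ler_wpM2l => //; rewrite mulr_ge0.
apply: le_trans (lerD (lexx _) D2) _.
by rewrite gn natrM le_eqVlt; apply/orP; left; apply/eqP; rewrite /K; field.
Qed.

End exponential.

(** * The tangent space of a closed subgroup *)

Definition is_subgroup (G : groupType) (K : set G) : Prop :=
  [/\ K 1%g, forall g h, K g -> K h -> K (g * h)%g & forall g, K g -> K g^-1%g].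

Lemma subgroupX (G : groupType) (K : set G) g m : is_subgroup K -> K g -> K (g ^+ m)%g.
Proof.
move=> [K1 KM _] Kg; elim: m => [|m ih]; first by rewrite expg0.
by rewrite expgS; exact: KM.
Qed.

Section tangent.
Variables (R : realType) (G : topGroupType) (L : lie_coord R G).

Let c := lc L.
Let ci := lc_inv L.
Let rho := lc_rad L.
Let C := lc_cst L.
Let V := 'rV[R]_(lc_dim L).
Implicit Types (v w : V) (g h : G) (K : set G).

Let rho0 : 0 < rho. Proof. exact: lc_rad_gt0. Qed.
Let C0 : 0 <= C. Proof. exact: lc_cst_ge0. Qed.
Let Crho : C * rho <= 16^-1. Proof. exact: lc_small. Qed.
Let er := exp_rad L.
Let er0 : 0 < er. Proof. exact: exp_rad_gt0. Qed.
Let erE : er = rho / 128. Proof. by []. Qed.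

(** The tangent space of K at the identity: the directions along which elements
    of K tend to the identity. *)
Definition tangent K : set V := [set v | forall e, 0 < e -> exists g (m : nat),
  [/\ K g, lc_dom L g, `|lc L g| <= e & `|m%:R *: lc L g - v| <= e]].

Lemma tangent_natmul K v e : tangent K v -> 0 < e -> exists g (m : nat),
  [/\ K g, lc_dom L g, `|lc L g| <= e, `|m%:R *: lc L g - v| <= e &
      m%:R * `|lc L g| <= `|v| + e].
Proof.
move=> Kv e0; have [g [m [Kg dg ge mge]]] := Kv e e0; exists g, m; split => //.
have := @norm_split2 _ _ L (m%:R *: c g) v (m%:R *: c g - v).
rewrite addrC subrK normrZ normr_nat => /(_ erefl).
move: mge; rewrite -/c; lra.
Qed.

Lemma tangent0 K : is_subgroup K -> tangent K 0.
Proof.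
move=> [K1 _ _] e e0; exists 1%g, 0%N; split => //; first exact: lc_dom1.
  by rewrite lc1 normr0 ltW.
by rewrite scale0r subrr normr0 ltW.
Qed.

Lemma tangentZ_ge0 K v t : 0 <= t -> tangent K v -> tangent K (t *: v).
Proof.
move=> t0 Kv e e0; have t1 : 0 < t + 1 by lra.
have e1 : 0 < e / (t + 1) by rewrite divr_gt0.
have [g [m [Kg dg ge mge]]] := Kv _ e1.
have /andP[m1 m2] := truncn_itv (mulr_ge0 t0 (ler0n R m)).
set m' := Num.truncn _ in m1 m2.
have et : (t + 1) * (e / (t + 1)) = e by field; lra.
exists g, m'; split => //.
  by apply: le_trans ge _; rewrite ler_pdivrMr// ler_peMr//; [exact: ltW|lra].
have := @norm_split2 _ _ L (m'%:R *: c g - t *: v) ((m'%:R - t * m%:R) *: c g)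
  (t *: (m%:R *: c g - v)).
move=> h; have {h} := h ltac:(by apply/rowP => i; rewrite !mxE; ring).
rewrite !normrZ (ger0_norm t0) => h; apply: le_trans h _.
have n1 : `|m'%:R - t * m%:R| <= 1.
  rewrite -natr1 in m2; rewrite ler_norml; move: m1 m2.
  by move: (m'%:R) (t * _) => a b; lra.
have h1 : `|m'%:R - t * m%:R| * `|c g| <= 1 * (e / (t + 1)) by apply: ler_pM.
have h2 : t * `|m%:R *: c g - v| <= t * (e / (t + 1)) by apply: ler_wpM2l.
rewrite -[leRHS]et mulrDl addrC; exact: lerD.
Qed.

Lemma lc_invP g : lc_dom L g -> `|c g| <= rho / 8 ->
  [/\ lc_dom L g^-1%g, `|c g^-1%g| <= 2 * `|c g| &
      `|c g^-1%g + c g| <= 2 * C * `|c g| ^+ 2].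
Proof.
move=> dg gr; have r0 := rho0.
have B1 : lc_ball L (lc_rad L / 8) 1%g.
  by split; [exact: lc_dom1|rewrite lc1 normr0 -/rho; lra].
have [d n E] := lc_divP B1 (conj dg gr).
by move: d n E; rewrite mul1g lc1 !sub0r normrN opprK -expr2.
Qed.

Lemma tangentN K v : is_subgroup K -> tangent K v -> tangent K (- v).
Proof.
move=> [K1 KM KV] Kv e e0.
pose M := 4 * C * (`|v| + 1) + 2.
have M2 : 2 <= M by rewrite /M lerDr !mulr_ge0// addr_ge0.
have M0 : 0 < M by lra.
pose e1 := Num.min (e / M) (Num.min 1 (rho / 8)).
have r0 := rho0.
have e10 : 0 < e1 by rewrite !lt_min ltr01 !divr_gt0.
have e1r : e1 <= rho / 8 by rewrite !ge_min lexx !orbT.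
have e11 : e1 <= 1 by rewrite !ge_min lexx !orbT.
have e1e : M * e1 <= e by rewrite mulrC -ler_pdivlMr// !ge_min lexx.
have [g [m [Kg dg ge mge mg]]] := tangent_natmul Kv e10.
have [dV nV EV] := lc_invP dg (le_trans ge e1r).
exists g^-1%g, m; split; [exact: KV|by []| |].
  apply: le_trans nV _; apply: le_trans (ler_wpM2l _ ge) _ => //.
  by apply: le_trans e1e; rewrite ler_wpM2r// ltW.
have := @norm_split2 _ _ L (m%:R *: c g^-1%g - - v) (m%:R *: (c g^-1%g + c g))
  (- (m%:R *: c g - v)).
move=> h; have {h} := h ltac:(by apply/rowP => i; rewrite !mxE; ring).
rewrite normrN normrZ normr_nat => h; apply: le_trans h _.
apply: le_trans e1e; rewrite /M mulrDl; apply: lerD; last by rewrite -/c in mge *; lra.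
apply: (@le_trans _ _ (m%:R * (2 * C * `|c g| ^+ 2))); first by rewrite ler_wpM2l.
have -> : m%:R * (2 * C * `|c g| ^+ 2) = 2 * C * ((m%:R * `|c g|) * `|c g|) by ring.
have -> : 4 * C * (`|v| + 1) * e1 = 2 * C * (2 * (`|v| + 1) * e1) by ring.
apply: ler_wpM2l; first by rewrite mulr_ge0.
apply: ler_pM => //.
by apply: le_trans mg _; have := normr_ge0 v; lra.
Qed.

Lemma lc_inv_near v (O : set G) : `|v| <= rho -> nbhs (ci v) O ->
  exists2 d, 0 < d & forall w, `|w - v| <= d -> O (ci w).
Proof.
move=> vr Ov; have := lc_inv_continuous vr Ov.
case/nbhs_ballP => d /= d0 dP; exists (d / 2); first by rewrite divr_gt0.
move=> w wd; apply: dP; rewrite -ball_normE/= distrC.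
by apply: le_lt_trans wd _; lra.
Qed.

(** Closedness enters here: powers of small elements of K approximate the
    one-parameter subgroup in a tangent direction. *)
Lemma exp_tangent K v : is_subgroup K -> closed K -> tangent K v ->
  2 * `|v| <= er -> K (lc_exp v).
Proof.
move=> sK cK Kv vr; apply: cK => O nO.
have v0 := normr_ge0 v; have r0 := rho0; have e0' := er0.
have vr' : `|v| <= er by lra.
have [_ _ ne] := lc_exp_dom vr'.
have er' : `|lc_e v| <= rho.
  have [_ ce _] := lc_exp_dom vr'; rewrite -ce; apply: le_trans ne _.
  by rewrite erE in vr; lra.
have [d d0 dP] := lc_inv_near er' nO.
pose M := 2 * C * er + 2.
have M2 : 2 <= M by rewrite /M lerDr !mulr_ge0// ltW.
have M0 : 0 < M by lra.
pose e1 := Num.min (d / M) (er / 2).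
have e10 : 0 < e1 by rewrite lt_min !divr_gt0.
have e1r : e1 <= er / 2 by rewrite ge_min lexx orbT.
have e1e : M * e1 <= d by rewrite mulrC -ler_pdivlMr// ge_min lexx.
have [g [m [Kg dg ge mge mg]]] := tangent_natmul Kv e10.
have mger : m%:R * `|c g| <= er by apply: le_trans mg _; lra.
have [dgm _ _] := lc_powP dg (m := m) ltac:(apply: le_trans mger _; rewrite erE -/rho; lra) (leqnn m).
exists (g ^+ m)%g; split; first exact: subgroupX.
have -> : (g ^+ m)%g = ci (c (g ^+ m)%g) by rewrite /ci lc_invK.
apply: dP.
have A := lc_e_pow dg mger.
have nmg : `|m%:R *: c g| <= er by rewrite normrZ normr_nat.
have [B _] := lc_e_lipschitz nmg vr'.
have := @norm_split2 _ _ L (c (g ^+ m)%g - lc_e v) (- (lc_e (m%:R *: c g) - c (g ^+ m)%g))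
  (lc_e (m%:R *: c g) - lc_e v).
move=> h; have {h} := h ltac:(by apply/rowP => i; rewrite !mxE; ring).
rewrite normrN => h; apply: le_trans h _; apply: le_trans e1e; rewrite /M mulrDl.
apply: lerD; last by apply: le_trans B _; rewrite ler_wpM2l.
apply: le_trans A _; rewrite expr2 [m%:R * _]mulrA -[leRHS]mulrA.
apply: ler_wpM2l; first by rewrite mulr_ge0.
by apply: ler_pM => //; rewrite mulr_ge0.
Qed.

Lemma tangent_exp K v : `|v| <= er ->
  (forall t, 0 <= t -> t <= 1 -> K (lc_exp (t *: v))) -> tangent K v.
Proof.
move=> vr Kv e e0.
have K0 : 0 <= 2 * `|v| + 2 * C * `|v| ^+ 2.
  by rewrite addr_ge0// !mulr_ge0// exprn_ge0.
set k := 2 * `|v| + _ in K0.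
have e1 : 0 < e / (k + 1) by rewrite divr_gt0// ltr_wpDl.
have [n ne] := @filter_ex _ \oo _ _ (near_infty_natSinv_lt (PosNum e1)).
move: ne => /=; set m := n.+1; have m0 : (0 < m)%N by [].
have M0 : m%:R != 0 :> R by rewrite pnatr_eq0 -lt0n.
have MV0 : 0 <= m%:R^-1 :> R by [].
have MV1 : m%:R^-1 <= 1 :> R by rewrite invf_le1 ?ltr0n// ler1n.
move=> me; have Kme : k / m%:R <= e.
  apply: (@le_trans _ _ ((k + 1) / m%:R)).
    by apply: ler_wpM2r => //; rewrite lerDl.
  by rewrite mulrC -ler_pdivlMr ?ltW// ltr_wpDl.
have nw : `|m%:R^-1 *: v| = m%:R^-1 * `|v| by rewrite normrZ ger0_norm.
have wr : `|m%:R^-1 *: v| <= er by rewrite nw (le_trans _ vr)// ler_piMl.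
have [dw cw nE] := lc_exp_dom wr.
have En := lc_e_near wr; rewrite nw in nE En.
exists (lc_exp (m%:R^-1 *: v)), m; split; [exact: Kv|by []| |].
  apply: le_trans nE _; apply: le_trans Kme.
  by rewrite mulrCA mulrC; apply: ler_wpM2r => //; rewrite lerDl !mulr_ge0// exprn_ge0.
rewrite cw; have -> : m%:R *: lc_e (m%:R^-1 *: v) - v = m%:R *: (lc_e (m%:R^-1 *: v) - m%:R^-1 *: v).
  by rewrite scalerBr scalerA mulfV// scale1r.
rewrite normrZ normr_nat; apply: le_trans (ler_wpM2l _ En) _ => //.
apply: le_trans Kme.
have -> : m%:R * (2 * lc_cst L * (m%:R^-1 * `|v|) ^+ 2) = 2 * C * `|v| ^+ 2 / m%:R by rewrite -/C; field.
by apply: ler_wpM2r => //; rewrite /k lerDr mulr_ge0.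
Qed.

(** The products of the exponentials of v/m and w/m belong to K and tend to the
    identity in the direction of v + w. *)
Lemma tangentD_small K v w : is_subgroup K -> closed K ->
  tangent K v -> tangent K w -> 2 * `|v| <= er -> 2 * `|w| <= er ->
  tangent K (v + w).
Proof.
move=> sK cK Kv Kw vr wr e e0.
have r0 := rho0; have er0' := er0.
have K0 : 0 <= 2 * `|v| + 2 * `|w| + C * (2 * `|v| * (2 * `|w|)) + 2 * C * `|v| ^+ 2 + 2 * C * `|w| ^+ 2 + 2 * `|v| + 2 * `|w|.
  by rewrite !addr_ge0// !mulr_ge0// exprn_ge0.
set k := _ + _ in K0.
have e1 : 0 < e / (k + 1) by rewrite divr_gt0// ltr_wpDl.
have [n ne] := @filter_ex _ \oo _ _ (near_infty_natSinv_lt (PosNum e1)).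
move: ne => /=; set m := n.+1; have m0 : (0 < m)%N by [].
have M0 : m%:R != 0 :> R by rewrite pnatr_eq0 -lt0n.
have MV0 : 0 <= m%:R^-1 :> R by [].
have MV1 : m%:R^-1 <= 1 :> R by rewrite invf_le1 ?ltr0n// ler1n.
move=> me; have Kme : k / m%:R <= e.
  apply: (@le_trans _ _ ((k + 1) / m%:R)).
    by apply: ler_wpM2r => //; rewrite lerDl.
  by rewrite mulrC -ler_pdivlMr ?ltW// ltr_wpDl.
have part u : tangent K u -> 2 * `|u| <= er ->
    [/\ K (lc_exp (m%:R^-1 *: u)), lc_ball L rho (lc_exp (m%:R^-1 *: u)),
     c (lc_exp (m%:R^-1 *: u)) = lc_e (m%:R^-1 *: u),
     `|c (lc_exp (m%:R^-1 *: u))| <= 2 * `|u| / m%:R &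
     `|lc_e (m%:R^-1 *: u) - m%:R^-1 *: u| <= 2 * C * `|u| ^+ 2 / m%:R / m%:R].
  move=> Ku ur; have nw : `|m%:R^-1 *: u| = m%:R^-1 * `|u| by rewrite normrZ ger0_norm.
  have u0 := normr_ge0 u.
  have mu : m%:R^-1 * `|u| <= `|u| by rewrite ler_piMl.
  have ur1 : `|m%:R^-1 *: u| <= er by rewrite nw; lra.
  have [dw cw nE] := lc_exp_dom ur1.
  have En := lc_e_near ur1; rewrite nw in nE En.
  split => //.
  - apply: exp_tangent => //; first exact: tangentZ_ge0.
    by rewrite nw; lra.
  - by split => //; apply: le_trans nE _; rewrite erE in ur; lra.
  - by apply: le_trans nE _; rewrite -mulrA [`|u| / _]mulrC.
  - by apply: le_trans En _; rewrite le_eqVlt; apply/orP; left; apply/eqP; rewrite -/C; field.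
have [Kv' Bv cv nv Ev] := part _ Kv vr; have [Kw' Bw cw nw Ew] := part _ Kw wr.
have [dg Eg ng] := lc_mulP Bv Bw.
set a := lc_exp (m%:R^-1 *: v) in Kv' Bv cv nv dg Eg ng.
set b := lc_exp (m%:R^-1 *: w) in Kw' Bw cw nw dg Eg ng.
exists (a * b)%g, m; split => //.
- by have [_ KM _] := sK; exact: KM.
- apply: le_trans ng _; apply: le_trans Kme.
  apply: (@le_trans _ _ (2 * (2 * `|v| / m%:R + 2 * `|w| / m%:R))).
    by apply: ler_wpM2l => //; exact: lerD.
  have -> : 2 * (2 * `|v| / m%:R + 2 * `|w| / m%:R) = (2 * `|v| + 2 * `|w| + 2 * `|v| + 2 * `|w|) / m%:R.
    by ring.
  apply: ler_wpM2r => //; rewrite /k.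
  have : 0 <= C * (2 * `|v| * (2 * `|w|)) by rewrite !mulr_ge0.
  have : 0 <= 2 * C * `|v| ^+ 2 by rewrite !mulr_ge0// exprn_ge0.
  have : 0 <= 2 * C * `|w| ^+ 2 by rewrite !mulr_ge0// exprn_ge0.
  lra.
have := @norm_split3 _ _ L (m%:R *: c (a * b)%g - (v + w))
  (m%:R *: (c (a * b)%g - (c a + c b))) (m%:R *: (lc_e (m%:R^-1 *: v) - m%:R^-1 *: v))
  (m%:R *: (lc_e (m%:R^-1 *: w) - m%:R^-1 *: w)).
move=> h; have {h} := h ltac:(by rewrite -cv -cw; apply/rowP => i; rewrite !mxE; field).
rewrite !normrZ normr_nat => h; apply: le_trans h _; apply: le_trans Kme.
have h1 : m%:R * `|c (a * b)%g - (c a + c b)| <= m%:R * (C * (2 * `|v| / m%:R * (2 * `|w| / m%:R))).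
  apply: ler_wpM2l => //; apply: le_trans Eg _; apply: ler_wpM2l => //.
  exact: ler_pM.
have h2 := ler_wpM2l (ler0n R m) Ev; have h3 := ler_wpM2l (ler0n R m) Ew.
apply: le_trans (lerD (lerD h1 h2) h3) _.
have -> : m%:R * (C * (2 * `|v| / m%:R * (2 * `|w| / m%:R))) +
   m%:R * (2 * C * `|v| ^+ 2 / m%:R / m%:R) + m%:R * (2 * C * `|w| ^+ 2 / m%:R / m%:R) =
   (C * (2 * `|v| * (2 * `|w|)) + 2 * C * `|v| ^+ 2 + 2 * C * `|w| ^+ 2) / m%:R by field.
apply: ler_wpM2r => //; rewrite /k.
by have := normr_ge0 v; have := normr_ge0 w; lra.
Qed.

Lemma tangentD K v w : is_subgroup K -> closed K ->
  tangent K v -> tangent K w -> tangent K (v + w).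
Proof.
move=> sK cK Kv Kw; have e0 := er0.
pose s := er / (2 * (`|v| + `|w| + 1)).
have D0 : 0 < `|v| + `|w| + 1 by rewrite ltr_wpDl// addr_ge0.
have s0 : 0 < s by rewrite divr_gt0// mulr_gt0.
have sn u : `|u| <= `|v| + `|w| + 1 -> 2 * `|s *: u| <= er.
  move=> un; rewrite normrZ (gtr0_norm s0).
  have -> : er = 2 * (s * (`|v| + `|w| + 1)) by rewrite /s; field; exact: lt0r_neq0.
  by apply: ler_wpM2l => //; apply: ler_wpM2l => //; exact: ltW.
have : tangent K (s *: v + s *: w).
  have := normr_ge0 v; have := normr_ge0 w => w0 v0.
  apply: tangentD_small => //; try (by apply: tangentZ_ge0 => //; exact: ltW).
  - by apply: sn; lra.
  - by apply: sn; lra.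
move/(@tangentZ_ge0 _ _ s^-1 (ltW (etrans (invr_gt0 _) s0))).
by rewrite -scalerDr scalerA mulVf ?scale1r// gt_eqF.
Qed.

Lemma tangentZ K v t : is_subgroup K -> closed K -> tangent K v -> tangent K (t *: v).
Proof.
move=> sK cK Kv; have [t0|t0] := leP 0 t; first exact: tangentZ_ge0.
rewrite -[t]opprK scaleNr; apply: tangentN => //; apply: tangentZ_ge0 => //.
by rewrite oppr_ge0 ltW.
Qed.

End tangent.

(** * Product decompositions near the identity *)

Lemma mulmx_norm_bound (R : realType) n (A : 'M[R]_n) :
  exists2 N, 0 <= N & forall u : 'rV[R]_n, `|u *m A| <= N * `|u|.
Proof.
have [N N0 NA] := fin_bounded (fun ij : 'I_n * 'I_n => `|A ij.1 ij.2|).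
exists (n%:R * N); first by rewrite mulr_ge0.
move=> u; apply: rV_norm_le; first by rewrite !mulr_ge0.
move=> i; rewrite mxE; apply: le_trans (ler_norm_sum _ _ _) _.
apply: (@le_trans _ _ (\sum_(j < n) N * `|u|)).
  apply: ler_sum => j _; rewrite normrM mulrC; apply: ler_pM => //.
    exact: (NA (j, i)).
  exact: rV_coord_le.
by rewrite sumr_const card_ord -mulrA mulr_natl.
Qed.

(** The closest value to y that is attained is y itself, since one step of the
    Newton iteration u - (f u - y) would otherwise improve on it. *)
Lemma near_id_onto (R : realType) n (f : 'rV[R]_n -> 'rV[R]_n) (d : R) :
  0 < d -> f 0 = 0 ->
  (forall u v, `|u| <= d -> `|v| <= d -> `|f u - f v - (u - v)| <= 2^-1 * `|u - v|) ->
  forall y, `|y| <= d / 2 -> exists2 u, `|u| <= d & f u = y.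
Proof.
move=> d0 f0 fid y yd.
pose A := [set u : 'rV[R]_n | `|u| <= d].
have cA : compact A.
  apply: bounded_closed_compact.
    by exists d; split; [exact: num_real|move=> M dM u /= ud; apply: le_trans ud _; exact: ltW].
  apply: (@closed_comp _ _ (fun u : 'rV[R]_n => `|u|) [set x | x <= d]).
    by move=> u _; exact: norm_continuous.
  exact: closed_le.
have cf : {within A, continuous (fun u => `|f u - y|)}.
  apply/subspace_continuousP => u Au.
  apply/cvgrPdist_lt => e e0; rewrite near_withinE.
  have e2 : 0 < e / 2 by lra.
  apply/nbhs_ballP; exists (e / 2) => //= v.
  rewrite -ball_normE/= => uv Av.
  apply: le_lt_trans (ler_dist_dist _ _) _.
  have -> : f u - y - (f v - y) = (f u - f v - (u - v)) + (u - v).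
    by apply/rowP => i; rewrite !mxE; ring.
  apply: le_lt_trans (ler_normD _ _) _; have := fid _ _ Au Av.
  have := normr_ge0 (u - v); lra.
have [|u Au umin] := compact_EVT_min _ cA cf.
  by exists 0; rewrite /A /= normr0 ltW.
exists u; first by rewrite inE in Au.
have {}Au : `|u| <= d by rewrite inE in Au.
apply/eqP; rewrite -subr_eq0 -normr_le0; set w := f u - y.
have Av : `|u - w| <= d.
  have z : `|0 : 'rV[R]_n| <= d by rewrite normr0 ltW.
  have := fid _ _ Au z; rewrite f0 !subr0.
  have -> : u - w = - (f u - u) + y by rewrite /w; apply/rowP => i; rewrite !mxE; ring.
  have := ler_normD (- (f u - u)) y; rewrite normrN; lra.
have := umin (u - w); rewrite inE => /(_ Av).
have := fid _ _ Av Au.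
have -> : f (u - w) - f u - (u - w - u) = f (u - w) - y.
  by rewrite /w; apply/rowP => i; rewrite !mxE; ring.
have -> : u - w - u = - w by apply/rowP => i; rewrite !mxE; ring.
rewrite normrN -/w; have := normr_ge0 w; lra.
Qed.

Lemma small_factor (R : realType) (a b : R) : 0 <= a -> 0 < b ->
  exists d, [/\ 0 < d, d <= b & a * d <= 1].
Proof.
move=> a0 b0; have a1 : 0 < a + 1 by rewrite ltr_wpDl.
exists (Num.min b (a + 1)^-1); split.
- by rewrite lt_min b0 invr_gt0.
- by rewrite ge_min lexx.
apply: (@le_trans _ _ ((a + 1) * (a + 1)^-1)); last by rewrite mulfV// gt_eqF.
apply: ler_pM => //; [by rewrite le_min (ltW b0) invr_ge0 ltW|by rewrite lerDl|].
by rewrite ge_min lexx orbT.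
Qed.

Section decomposition.
Variables (R : realType) (G : topGroupType) (L : lie_coord R G).

Let c := lc L.
Let ci := lc_inv L.
Let rho := lc_rad L.
Let C := lc_cst L.
Let n := lc_dim L.
Let V := 'rV[R]_n.
Implicit Types (u v w : V) (g h : G) (K : set G) (Q : 'M[R]_n).

Let rho0 : 0 < rho. Proof. exact: lc_rad_gt0. Qed.
Let C0 : 0 <= C. Proof. exact: lc_cst_ge0. Qed.
Let Crho : C * rho <= 16^-1. Proof. exact: lc_small. Qed.
Let er := exp_rad L.
Let er0 : 0 < er. Proof. exact: exp_rad_gt0. Qed.
Let erE : er = rho / 128. Proof. by []. Qed.

Lemma lc_ball_nbhs s : 0 < s -> nbhs 1%g (lc_ball L s).
Proof.
move=> s0; apply: filterI.
  by apply: open_nbhs_nbhs; split; [exact: lc_dom_open|exact: lc_dom1].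
have nr : nbhs (c 1%g) [set v : V | `|v| <= s].
  rewrite /c lc1; apply/nbhs_ballP; exists s => //= v.
  by rewrite -ball_normE/= sub0r normrN => /ltW.
exact: (lc_continuous (lc_dom1 L) nr).
Qed.

Lemma nbhs_lc_ball (O : set G) : nbhs 1%g O -> exists2 s, 0 < s & lc_ball L s `<=` O.
Proof.
move=> O1; have r0 := rho0.
have z : `|0 : V| <= rho by rewrite normr0 ltW.
have e1 : ci 0 = 1%g by rewrite -(lc1 L) /ci lc_invK//; exact: lc_dom1.
have [|d d0 dP] := @lc_inv_near _ _ L 0 O z; first by rewrite -/ci e1.
exists d => // g [dg gd]; rewrite -(lc_invK dg); apply: dP.
by rewrite subr0.
Qed.

Lemma lc_ldivP g h : lc_ball L (rho / 8) g -> lc_ball L (rho / 8) h ->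
  [/\ lc_dom L (h^-1 * g)%g, `|c (h^-1 * g)%g| <= 2 * `|c g - c h| &
  `|c (h^-1 * g)%g - (c g - c h)| <= 2 * C * (`|c g - c h| * `|c h|)].
Proof.
move=> Bg Bh.
have r8 : rho / 8 <= rho by have := rho0; lra.
have BV : lc_ball L (2 * (rho / 8)) h^-1%g by apply: lc_VP.
have r4 : 2 * (rho / 8) <= rho by have := rho0; lra.
have [d _ nn] := lc_mulP (lc_ballS r4 BV) (lc_ballS r8 Bg).
have Bz : lc_ball L rho (h^-1 * g)%g.
  split => //; apply: le_trans nn _.
  have := Bg.2; have := BV.2; rewrite -/c; lra.
have [_] := lc_mulP (lc_ballS r8 Bh) Bz; rewrite mulVKg.
set z := (h^-1 * g)%g => E _.
have E' : `|c z - (c g - c h)| <= C * (`|c z| * `|c h|).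
  rewrite [`|c z| * _]mulrC.
  apply: le_trans E; rewrite le_eqVlt -normrN; apply/orP; left; apply/eqP.
  by congr (`| _ |); apply/rowP => i; rewrite !mxE -/c; ring.
have E2 := absorb C0 (lc_ballS r8 Bh).2 (normr_ge0 (c z)) Crho.
rewrite [_ * `|c z|]mulrC -/c in E2.
have n2 : `|c z| <= 2 * `|c g - c h|.
  have := @norm_split2 _ _ L (c z) (c z - (c g - c h)) (c g - c h).
  rewrite subrK => /(_ erefl).
  have := normr_ge0 (c z); have := normr_ge0 (c g - c h); lra.
split => //; apply: le_trans E' _.
have -> : 2 * C * (`|c g - c h| * `|c h|) = C * (2 * `|c g - c h| * `|c h|) by ring.
by apply: ler_wpM2l => //; rewrite ler_wpM2r.
Qed.

Lemma lc_mul_diff a a' b b' s : s <= rho / 64 ->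
  lc_ball L s a -> lc_ball L s a' -> lc_ball L s b -> lc_ball L s b' ->
  `|c (a * b)%g - c (a' * b')%g - ((c a - c a') + (c b - c b'))| <=
  16 * C * s * (`|c a - c a'| + `|c b - c b'|).
Proof.
move=> sr Ba Ba' Bb Bb'; have r0 := rho0.
have s0 : 0 <= s := le_trans (normr_ge0 _) Ba.2.
have s8 : s <= rho / 8 by lra.
have sr' : s <= rho by lra.
have [dz nz Ez] := lc_divP (lc_ballS s8 Ba) (lc_ballS s8 Ba').
have [dz' nz' Ez'] := lc_ldivP (lc_ballS s8 Bb) (lc_ballS s8 Bb').
have prod x y : lc_ball L s x -> lc_ball L s y -> lc_dom L (x * y)%g /\ `|c (x * y)%g| <= 4 * s.
  move=> Bx By; have [d _ nn] := lc_mulP (lc_ballS sr' Bx) (lc_ballS sr' By).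
  split => //; apply: le_trans nn _; have := Bx.2; have := By.2; rewrite -/c; lra.
have [d1 n1] := prod _ _ Ba' Bb; have [d2 n2] := prod _ _ Ba' Bb'.
have d10 := normr_ge0 (c a - c a'); have d20 := normr_ge0 (c b - c b').
have da : `|c a - c a'| <= 2 * s.
  have := @norm_split2 _ _ L (c a - c a') (c a) (- c a') erefl; rewrite normrN.
  have := Ba.2; have := Ba'.2; rewrite -/c; lra.
have db : `|c b - c b'| <= 2 * s.
  have := @norm_split2 _ _ L (c b - c b') (c b) (- c b') erefl; rewrite normrN.
  have := Bb.2; have := Bb'.2; rewrite -/c; lra.
have s4 : 4 * s <= lc_rad L by rewrite -/rho; lra.
have Bz : lc_ball L (lc_rad L) (a / a')%g.
  by split => //; apply: le_trans nz _; apply: le_trans s4; lra.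
have Bz' : lc_ball L (lc_rad L) (b'^-1 * b)%g.
  by split => //; apply: le_trans nz' _; apply: le_trans s4; lra.
have [_ E1 _] := lc_mulP Bz (conj d1 (le_trans n1 s4)).
have [_ E2 _] := lc_mulP (conj d2 (le_trans n2 s4)) Bz'.
rewrite -/c mulgA mulgVK -/C in E1; rewrite -/c !mulgA mulgK -/C in E2.
have E1' : C * (`|c (a / a')%g| * `|c (a' * b)%g|) <= C * (2 * `|c a - c a'| * (4 * s)).
  by apply: ler_wpM2l => //; exact: ler_pM.
have E2' : C * (`|c (a' * b')%g| * `|c (b'^-1 * b)%g|) <= C * (4 * s * (2 * `|c b - c b'|)).
  by apply: ler_wpM2l => //; exact: ler_pM.
have Ez1 : 2 * C * (`|c a - c a'| * `|c a'|) <= 2 * C * (`|c a - c a'| * s).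
  by apply: ler_wpM2l; [rewrite mulr_ge0|rewrite ler_wpM2l//; exact: Ba'.2].
have Ez2 : 2 * C * (`|c b - c b'| * `|c b'|) <= 2 * C * (`|c b - c b'| * s).
  by apply: ler_wpM2l; [rewrite mulr_ge0|rewrite ler_wpM2l//; exact: Bb'.2].
have := @norm_split3 _ _ L (c (a * b)%g - c (a' * b')%g - ((c a - c a') + (c b - c b')))
  ((c (a * b)%g - (c (a / a')%g + c (a' * b)%g)) + (c (a / a')%g - (c a - c a')))
  (c (a' * b)%g - (c (a' * b')%g + c (b'^-1 * b)%g)) (c (b'^-1 * b)%g - (c b - c b')).
move=> h; have {h} := h ltac:(by apply/rowP => i; rewrite !mxE; ring).
move=> h; apply: le_trans h _.
apply: le_trans (lerD (lerD (le_trans (ler_normD _ _) (lerD (le_trans E1 E1') (le_trans Ez Ez1))) (le_trans E2 E2')) (le_trans Ez' Ez2)) _.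
have p1 : 0 <= C * s * `|c a - c a'| by rewrite !mulr_ge0.
have p2 : 0 <= C * s * `|c b - c b'| by rewrite !mulr_ge0.
have -> : 16 * C * s * (`|c a - c a'| + `|c b - c b'|) =
  16 * (C * s * `|c a - c a'|) + 16 * (C * s * `|c b - c b'|) by ring.
have -> : C * (2 * `|c a - c a'| * (4 * s)) + 2 * C * (`|c a - c a'| * s) +
  C * (4 * s * (2 * `|c b - c b'|)) + 2 * C * (`|c b - c b'| * s) =
  10 * (C * s * `|c a - c a'|) + 10 * (C * s * `|c b - c b'|) by ring.
by apply: lerD; apply: ler_wpM2r => //; rewrite ler_nat.
Qed.

(** Coordinates of the second kind for the decomposition of the space of vectors
    by a linear projection Q. *)
Definition exp_split Q u : G := (lc_exp (u - u *m Q) * lc_exp (u *m Q))%g.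

Lemma exp_split_sub Q u v :
  u - v = (u - u *m Q - (v - v *m Q)) + (u *m Q - v *m Q).
Proof. by move: (u *m Q) (v *m Q) => x y; apply/rowP => i; rewrite !mxE; ring. Qed.

Lemma exp_split_diff Q : exists2 d, 0 < d & forall u v, `|u| <= d -> `|v| <= d ->
  [/\ 4 * `|u - u *m Q| <= er, 4 * `|u *m Q| <= er, lc_dom L (exp_split Q u) &
  `|c (exp_split Q u) - c (exp_split Q v) - (u - v)| <= 2^-1 * `|u - v|].
Proof.
have [N N0 NQ] := mulmx_norm_bound Q; have r0 := rho0; have er0' := er0.
pose M := N + 1; have M1 : 1 <= M by rewrite lerDr.
have M0 : 0 < M by lra.
have MQ u : `|u *m Q| <= M * `|u|.
  by apply: le_trans (NQ u) _; rewrite ler_wpM2r// lerDl.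
have MP u : `|u - u *m Q| <= M * `|u|.
  apply: le_trans (ler_normB _ _) _; rewrite /M mulrDl mul1r addrC lerD2r.
  exact: NQ.
pose k := 2 * (16 * C * 2 * 4 * M * M + 2 * (32 * C * M * M)).
have k0 : 0 <= k by rewrite !(mulr_ge0, addr_ge0)// ltW.
have M4 : 0 < er / (4 * M) by rewrite divr_gt0// mulr_gt0.
have [d [d0 d1' d2]] := small_factor k0 M4.
have d1 : 4 * (M * d) <= er.
  by move: d1'; rewrite ler_pdivlMr ?mulr_gt0// mulrC mulrA.
exists d => // u v ud vd.
have bd w : `|w| <= d -> 4 * `|w - w *m Q| <= er /\ 4 * `|w *m Q| <= er /\
    `|w - w *m Q| <= M * d /\ `|w *m Q| <= M * d.
  move=> wd; have h : M * `|w| <= M * d by rewrite ler_wpM2l// ltW.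
  have := MP w; have := MQ w; lra.
have [u1 [u2 [u3 u4]]] := bd _ ud; have [v1 [v2 [v3 v4]]] := bd _ vd.
have Mdr : M * d <= er by have := mulr_ge0 (ltW M0) (ltW d0); lra.
have bl w : `|w| <= M * d -> lc_ball L (2 * (M * d)) (lc_exp w) /\ c (lc_exp w) = lc_e w.
  move=> wd; have [dw cw nw] := lc_exp_dom (le_trans wd Mdr); split => //.
  by split => //; apply: le_trans nw _; rewrite ler_wpM2l.
have [Bu1 cu1] := bl _ u3; have [Bu2 cu2] := bl _ u4.
have [Bv1 cv1] := bl _ v3; have [Bv2 cv2] := bl _ v4.
have sr : 2 * (M * d) <= rho / 64 by move: d1; rewrite erE; lra.
have sr' : 2 * (M * d) <= rho by lra.
split => //; first by have [] := lc_mulP (lc_ballS sr' Bu1) (lc_ballS sr' Bu2).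
have E := lc_mul_diff sr Bu1 Bv1 Bu2 Bv2.
rewrite -/c cu1 cu2 cv1 cv2 in E.
have E1 := lc_e_diff u3 v3 Mdr; have E2 := lc_e_diff u4 v4 Mdr.
have q1 : `|u - u *m Q - (v - v *m Q)| <= M * `|u - v|.
  have -> : u - u *m Q - (v - v *m Q) = (u - v) - (u - v) *m Q.
    by rewrite mulmxBl; apply/rowP => i; rewrite !mxE; ring.
  exact: MP.
have q2 : `|u *m Q - v *m Q| <= M * `|u - v| by rewrite -mulmxBl; exact: MQ.
have := @norm_split3 _ _ L (c (exp_split Q u) - c (exp_split Q v) - (u - v))
  (c (exp_split Q u) - c (exp_split Q v) - (lc_e (u - u *m Q) - lc_e (v - v *m Q) + (lc_e (u *m Q) - lc_e (v *m Q))))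
  (lc_e (u - u *m Q) - lc_e (v - v *m Q) - (u - u *m Q - (v - v *m Q)))
  (lc_e (u *m Q) - lc_e (v *m Q) - (u *m Q - v *m Q)).
have vs (A B1 B2 p q w : V) : w = p + q ->
    A - w = A - (B1 + B2) + (B1 - p) + (B2 - q).
  by move=> ->; apply/rowP => i; rewrite !mxE; ring.
move=> h; have {h} := h (vs _ _ _ _ _ _ (exp_split_sub Q u v)).
move=> h; apply: le_trans h _; apply: le_trans (lerD (lerD E E1) E2) _.
set x := `|u - v| in q1 q2 *.
have x0 : 0 <= x by exact: normr_ge0.
have [l1 _] := lc_e_lipschitz (le_trans u3 Mdr) (le_trans v3 Mdr).
have [l2 _] := lc_e_lipschitz (le_trans u4 Mdr) (le_trans v4 Mdr).
have K1 : 0 <= 16 * C * (2 * (M * d)) by rewrite !mulr_ge0// ltW.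
have K2 : 0 <= 32 * C by rewrite mulr_ge0.
have Md0 : 0 <= M * d by rewrite mulr_ge0// ltW.
have h1 : 16 * C * (2 * (M * d)) * (`|lc_e (u - u *m Q) - lc_e (v - v *m Q)| +
    `|lc_e (u *m Q) - lc_e (v *m Q)|) <= 16 * C * (2 * (M * d)) * (2 * (M * x) + 2 * (M * x)).
  apply: ler_wpM2l => //; apply: lerD.
    by apply: le_trans l1 _; apply: ler_wpM2l.
  by apply: le_trans l2 _; apply: ler_wpM2l.
have h2 : 32 * lc_cst L * (M * d * `|u - u *m Q - (v - v *m Q)|) <= 32 * C * (M * d * (M * x)).
  by apply: ler_wpM2l => //; apply: ler_wpM2l.
have h3 : 32 * lc_cst L * (M * d * `|u *m Q - v *m Q|) <= 32 * C * (M * d * (M * x)).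
  by apply: ler_wpM2l => //; apply: ler_wpM2l.
apply: le_trans (lerD (lerD h1 h2) h3) _.
have -> : 16 * C * (2 * (M * d)) * (2 * (M * x) + 2 * (M * x)) + 32 * C * (M * d * (M * x)) +
  32 * C * (M * d * (M * x)) = 2^-1 * (k * d * x) by rewrite /k; field.
by apply: ler_wpM2l => //; rewrite -[leRHS]mul1r; apply: ler_wpM2r.
Qed.

Lemma exp_split0 Q : exp_split Q 0 = 1%g.
Proof. by rewrite /exp_split mul0mx subr0 lc_exp0 mulg1. Qed.

Lemma exp_split_nbhs Q d : 0 < d ->
  nbhs 1%g [set g | exists2 u, `|u| <= d & g = exp_split Q u].
Proof.
move=> d0; have [d1 d10 dP] := exp_split_diff Q.
pose e := Num.min d d1; have e0 : 0 < e by rewrite lt_min d0.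
have ed : e <= d by rewrite ge_min lexx.
have ed1 : e <= d1 by rewrite ge_min lexx orbT.
have f0 : c (exp_split Q 0) = 0 by rewrite exp_split0 /c lc1.
have fid u v : `|u| <= e -> `|v| <= e ->
    `|c (exp_split Q u) - c (exp_split Q v) - (u - v)| <= 2^-1 * `|u - v|.
  by move=> ue ve; have [] := dP _ _ (le_trans ue ed1) (le_trans ve ed1).
have e20 : 0 < e / 2 by lra.
apply: filterS (lc_ball_nbhs e20) => g [dg ge].
have [u ue cu] := near_id_onto e0 f0 fid ge.
exists u; first exact: le_trans ue ed.
have [_ _ du _] := dP _ _ (le_trans ue ed1) (le_trans ue ed1).
exact/esym/(lc_dom_inj du dg).
Qed.

End decomposition.

(** * Transversals to a closed subgroup *)

Section transversal.
Variables (R : realType) (G : topGroupType) (L : lie_coord R G).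

Let c := lc L.
Let ci := lc_inv L.
Let rho := lc_rad L.
Let C := lc_cst L.
Let n := lc_dim L.
Let V := 'rV[R]_n.
Implicit Types (u v w : V) (g h : G) (K : set G) (Q : 'M[R]_n).

Let rho0 : 0 < rho. Proof. exact: lc_rad_gt0. Qed.
Let C0 : 0 <= C. Proof. exact: lc_cst_ge0. Qed.
Let er := exp_rad L.
Let er0 : 0 < er. Proof. exact: exp_rad_gt0. Qed.
Let erE : er = rho / 128. Proof. by []. Qed.

Lemma sphere_compact : compact [set u : V | `|u| = 1].
Proof.
apply: bounded_closed_compact.
  by exists 1; split; [exact: num_real|move=> M M1 u /= ->; exact: ltW].
apply: (@closed_comp _ _ (fun u : V => `|u|) [set x | x = 1]).
  by move=> u _; exact: norm_continuous.
exact: closed_eq.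
Qed.

Lemma compl_bound Q : exists2 M, 1 <= M & forall u : V, `|u - u *m Q| <= M * `|u|.
Proof.
have [N N0 NQ] := mulmx_norm_bound Q; exists (N + 1); first by rewrite lerDr.
move=> u; apply: le_trans (ler_normB _ _) _; rewrite mulrDl mul1r addrC lerD2r.
exact: NQ.
Qed.

(** Otherwise the normalized coordinates of a sequence of elements of K would
    accumulate, on the unit sphere, at a tangent vector that Q moves. *)
Lemma subgroup_near_tangent K Q eta :
  (forall v, tangent K v -> v *m Q = v) -> 0 < eta ->
  exists2 d, 0 < d & forall k, K k -> lc_dom L k -> `|c k| <= d ->
    `|c k - c k *m Q| <= eta * `|c k|.
Proof.
move=> KQ eta0; apply: contrapT => nd.
have ex (j : nat) : exists k, [/\ K k, lc_dom L k, `|c k| <= j.+1%:R^-1 &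
    eta * `|c k| < `|c k - c k *m Q|].
  apply: contrapT => nk; apply: nd; exists j.+1%:R^-1; first by rewrite invr_gt0.
  move=> k Kk dk ck; rewrite leNgt; apply/negP => lt.
  by apply: nk; exists k.
have [k kP] := choice ex.
have ck0 j : c (k j) != 0.
  apply/eqP => c0; have [_ _ _] := kP j.
  by rewrite c0 mul0mx subr0 normr0 mulr0 ltxx.
pose u j := `|c (k j)|^-1 *: c (k j).
have u1 j : `|u j| = 1.
  by rewrite normrZ normfV normr_id mulVf// normr_eq0.
have : (u @ \oo) [set v | `|v| = 1] by exists 0%N => // j _ /=.
move/(@sphere_compact (u @ \oo) _) => [w [w1 wcl]].
have [M M1 MQ] := compl_bound Q.
have M0 : 0 < M by lra.
have near (e : R) : 0 < e -> exists j, `|c (k j)| <= e /\ `|u j - w| <= e.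
  move=> e0.
  have A : (u @ \oo) (u @` [set j | j.+1%:R^-1 < e]).
    have [N _ NP] := near_infty_natSinv_lt (PosNum e0).
    by exists N => // j /= Nj; exists j => //; exact: NP.
  have Bw : nbhs w [set v | `|v - w| <= e].
    apply/nbhs_ballP; exists e => //= v; rewrite -ball_normE/= distrC => /ltW//.
  have [_ [[j je <-] /= jw]] := wcl _ _ A Bw.
  exists j; split => //; have [_ _ ck _] := kP j.
  by apply: le_trans ck _; exact: ltW.
have Kw : tangent K w.
  move=> e e0; have e2 : 0 < e / 2 by lra.
  have [j [j1 j2]] := near _ e2.
  have cp : 0 < `|c (k j)| by rewrite normr_gt0.
  have /andP[m1 m2] := truncn_itv (ltW (etrans (invr_gt0 _) cp)).
  set m := Num.truncn _ in m1 m2.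
  have [Kk dk _ _] := kP j.
  exists (k j), m; split => //; first by apply: le_trans j1 _; lra.
  have := @norm_split2 _ _ L (m%:R *: c (k j) - w) (m%:R *: c (k j) - u j) (u j - w).
  move=> h; have {h} := h ltac:(by rewrite addrA subrK).
  move=> h; apply: le_trans h _.
  have : `|m%:R *: c (k j) - u j| <= `|c (k j)|.
    rewrite /u -scalerBl normrZ -[leRHS]mul1r; apply: ler_wpM2r => //.
    rewrite -natr1 in m2; rewrite ler_norml; move: m1 m2.
    by move: (m%:R) (_^-1) => a b; lra.
  by move: j1 j2; rewrite /=; lra.
have e0 : 0 < eta / (2 * M) by rewrite divr_gt0// mulr_gt0.
have [j [_ j2]] := near _ e0.
have [_ _ _ lt0] := kP j.
have cp : 0 < `|c (k j)| by rewrite normr_gt0.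
have cE : c (k j) = `|c (k j)| *: u j by rewrite /u scalerA mulfV ?scale1r// gt_eqF.
have lt : eta < `|u j - u j *m Q|.
  rewrite -(ltr_pM2l cp) mulrC; apply: lt_le_trans lt0 _.
  rewrite {1 2}cE -scalemxAl -scalerBr normrZ normr_id; exact: lexx.
have := MQ (u j - w); rewrite mulmxBl (KQ _ Kw) opprB addrA subrK.
move=> le1; have : M * `|u j - w| <= eta / 2.
  apply: le_trans (ler_wpM2l (ltW M0) j2) _.
  by rewrite le_eqVlt; apply/orP; left; apply/eqP; field; rewrite gt_eqF.
lra.
Qed.

(** The coordinates of the quotient of exp p and exp q are q - p up to a small
    multiple of its size. If the quotient belongs to K, they are close to the
    tangent space as well, whereas q - p lies in the complement. *)
Lemma transversal_inj K Q :
  (forall v, tangent K v -> v *m Q = v) ->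
  exists2 d, 0 < d & forall p q : V, `|p| <= d -> `|q| <= d ->
    p *m Q = 0 -> q *m Q = 0 -> K ((lc_exp p)^-1 * lc_exp q)%g -> p = q.
Proof.
move=> KQ; have eta0 : 0 < 16^-1 :> R by rewrite invr_gt0.
have [d0 d00 d0P] := subgroup_near_tangent KQ eta0.
have [M M1 MQ] := compl_bound Q.
have b0 : 0 < Num.min (d0 / 8) (er / 4) by rewrite lt_min !divr_gt0.
have k0 : 0 <= 4 * (M * (40 * C)) by rewrite !mulr_ge0//; lra.
have [d [d_gt0 d1 d2]] := small_factor k0 b0; exists d => // p q pd qd pQ qQ Kpq.
have [d3 d4] : d <= d0 / 8 /\ d <= er / 4 by move: d1; rewrite le_min => /andP.
have der : d <= er by have := er0; lra.
have pr := le_trans pd der; have qr := le_trans qd der.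
have [dp cp np] := lc_exp_dom pr; have [dq cq nq] := lc_exp_dom qr.
have r8 : 2 * d <= rho / 8 by rewrite erE in d4; have := rho0; lra.
have [dk nk Ek] := @lc_ldivP _ _ L (lc_exp q) (lc_exp p)
  (conj dq (le_trans nq (le_trans (ler_wpM2l (ler0n _ 2) qd) r8)))
  (conj dp (le_trans np (le_trans (ler_wpM2l (ler0n _ 2) pd) r8))).
set k := (_^-1 * _)%g in Kpq dk nk Ek.
rewrite cp cq -/c in nk Ek.
have [l1 _] := lc_e_lipschitz qr pr.
have l2 := lc_e_diff qd pd der.
set x := `|q - p| in l1 l2.
have x0 : 0 <= x by exact: normr_ge0.
have xd : x <= 2 * d.
  by apply: le_trans (ler_normB _ _) _; lra.
have nk4 : `|c k| <= 4 * x by apply: le_trans nk _; lra.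
have kd : `|c k| <= d0 by lra.
have near := d0P _ Kpq dk kd.
have np' : `|lc_e p| <= 2 * d by rewrite -cp; apply: le_trans np _; rewrite ler_wpM2l.
have E : `|c k - (q - p)| <= 40 * C * d * x.
  have := @norm_split2 _ _ L (c k - (q - p)) (c k - (lc_e q - lc_e p)) (lc_e q - lc_e p - (q - p)).
  rewrite addrA subrK => /(_ erefl) h; apply: le_trans h _.
  apply: le_trans (lerD Ek l2) _.
  have : 2 * C * (`|lc_e q - lc_e p| * `|lc_e p|) <= 2 * C * (2 * x * (2 * d)).
    by apply: ler_wpM2l; [rewrite mulr_ge0|exact: ler_pM].
  rewrite -/C; have -> : 40 * C * d * x = 2 * C * (2 * x * (2 * d)) + 32 * C * (d * x) by ring.
  by move=> h2; rewrite lerD2r.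
have PE := MQ (c k - (q - p)).
have ME : M * `|c k - (q - p)| <= 4^-1 * x.
  apply: (@le_trans _ _ (M * (40 * C * d * x))); first by apply: ler_wpM2l => //; lra.
  have -> : M * (40 * C * d * x) = 4^-1 * (4 * (M * (40 * C)) * d * x) by field.
  by apply: ler_wpM2l; [rewrite invr_ge0|rewrite -[leRHS]mul1r; apply: ler_wpM2r].
have xE : `|q - p| <= `|c k - c k *m Q| + `|c k - (q - p) - (c k - (q - p)) *m Q|.
  have -> : c k - (q - p) - (c k - (q - p)) *m Q = (c k - c k *m Q) - (q - p).
    rewrite mulmxBl [(q - p) *m Q]mulmxBl pQ qQ subr0 subr0.
    by apply/rowP => i; rewrite !mxE; ring.
  by have := ler_normB (c k - c k *m Q) ((c k - c k *m Q) - (q - p)); rewrite opprB addrC subrK.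
apply/eqP; rewrite eq_sym -subr_eq0 -normr_le0 -/x.
move: xE near PE ME nk4; rewrite -/x.
by move: `|c k - c k *m Q| `|c k - _ - _| `|c k - _| `|c k| => a1 a2 a3 a4; lra.
Qed.

End transversal.

(** * The adjoint action *)

Lemma conj_arith (R : realFieldType) (p p' q x : R) :
  p <= p' -> p' <= 16^-1 * q -> q <= 2 * x -> 0 <= x -> p + q <= 4 * x.
Proof. lra. Qed.

Lemma perm_arith (R : realFieldType) (x b m d : R) :
  0 <= x -> b + m + d <= x + b + d + m.
Proof. lra. Qed.

Section adjoint.
Variables (R : realType) (G : topGroupType) (L : lie_coord R G).
Hypothesis cG : compact [set: G].

Let c := lc L.
Let ci := lc_inv L.
Let rho := lc_rad L.
Let C := lc_cst L.
Let n := lc_dim L.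
Let V := 'rV[R]_n.
Implicit Types (u v w : V) (g h : G) (K : set G) (Q : 'M[R]_n).

Let rho0 : 0 < rho. Proof. exact: lc_rad_gt0. Qed.
Let C0 : 0 <= C. Proof. exact: lc_cst_ge0. Qed.
Let Crho : C * rho <= 16^-1. Proof. exact: lc_small. Qed.
Let er := exp_rad L.
Let er0 : 0 < er. Proof. exact: exp_rad_gt0. Qed.
Let erE : er = rho / 128. Proof. by []. Qed.

Lemma conj_small (O : set G) : nbhs 1%g O ->
  \forall h \near (1%g : G), forall g, O (g * h * g^-1)%g.
Proof.
move=> O1; have /compact_near_coveringP cov := cG.
have := cov G (nbhs (1%g : G)) (fun h g => O (g * h * g^-1)%g) _.
have near g : \forall g' \near g & h \near (1%g : G), O (g' * h * g'^-1)%g.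
  have cc : {for (g, 1%g), continuous (fun p : G * G => (p.1 * p.2 * p.1^-1)%g)}.
    have c1 : {for (g, 1%g), continuous (fun p : G * G => p.1)} by exact: cvg_fst.
    have c2 : {for (g, 1%g), continuous (fun p : G * G => p.2)} by exact: cvg_snd.
    apply: mulg_continuous_at; last exact: invg_continuous_at.
    exact: mulg_continuous_at.
  by apply: cc; rewrite /= mulg1 mulgV.
move=> /(_ _ (fun g _ => near g)); apply: filterS => h H g; exact: H.
Qed.

Lemma lc_log : exists2 s, 0 < s & forall g, lc_ball L s g ->
  exists w, [/\ 16 * `|w| <= er, g = lc_exp w & `|w| <= 2 * `|c g|].
Proof.
have e0 : 0 < er / 16 by rewrite divr_gt0.
have [s s0 sP] := nbhs_lc_ball L (@exp_split_nbhs _ _ L (0 : 'M[R]_n) _ e0).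
exists s => // g /sP[u ue gE]; exists u.
have {}gE : g = lc_exp u by rewrite gE /exp_split mulmx0 subr0 lc_exp0 mulg1.
have u16 : 16 * `|u| <= er by lra.
have ur : `|u| <= er by have := normr_ge0 u; lra.
have z : `|0 : V| <= er by rewrite normr0 ltW.
have [_ cu _] := lc_exp_dom ur; have [_] := lc_e_lipschitz ur z.
by rewrite lc_e0 !subr0 gE /c cu.
Qed.

Lemma lc_exp_inj v w : `|v| <= er -> `|w| <= er -> lc_exp v = lc_exp w -> v = w.
Proof.
move=> vr wr E; have [_ cv _] := lc_exp_dom vr; have [_ cw _] := lc_exp_dom wr.
have [_] := lc_e_lipschitz vr wr; rewrite -cv -cw E subrr normr0 mulr0 normr_le0.
by rewrite subr_eq0 => /eqP.
Qed.

Lemma lc_exp_prod p q : 2 * `|p| <= er -> 2 * `|q| <= er ->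
  lc_ball L (rho / 8) (lc_exp p * lc_exp q)%g /\
  `|c (lc_exp p * lc_exp q)%g - (p + q)| <= 2 * C * (`|p| + `|q|) ^+ 2.
Proof.
move=> pr qr; have p0 := normr_ge0 p; have q0 := normr_ge0 q; have r0 := rho0.
have pr' : `|p| <= er by lra. have qr' : `|q| <= er by lra.
have [dp cp np] := lc_exp_dom pr'; have [dq cq nq] := lc_exp_dom qr'.
rewrite erE in pr qr.
have Bp : lc_ball L rho (lc_exp p) by split => //; apply: le_trans np _; lra.
have Bq : lc_ball L rho (lc_exp q) by split => //; apply: le_trans nq _; lra.
have [d E nn] := lc_mulP Bp Bq; split.
  split => //; apply: le_trans nn _; move: np nq.
  by move: `|lc L _| `|lc L _| => x y *; lra.
have Ep := lc_e_near pr'; have Eq := lc_e_near qr'.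
have := @norm_split3 _ _ L (c (lc_exp p * lc_exp q)%g - (p + q))
  (c (lc_exp p * lc_exp q)%g - (c (lc_exp p) + c (lc_exp q)))
  (lc_e p - p) (lc_e q - q).
move=> h; have {h} := h ltac:(by rewrite /c cp cq; apply/rowP => i; rewrite !mxE; ring).
move=> h; apply: le_trans h _; apply: le_trans (lerD (lerD E Ep) Eq) _.
have : C * (`|c (lc_exp p)| * `|c (lc_exp q)|) <= C * (2 * `|p| * (2 * `|q|)).
  by apply: ler_wpM2l => //; exact: ler_pM.
rewrite -/c -/C => h.
have -> : 2 * C * (`|p| + `|q|) ^+ 2 = C * (2 * `|p| * (2 * `|q|)) + 2 * C * `|p| ^+ 2 + 2 * C * `|q| ^+ 2.
  by ring.
by rewrite !lerD2r.
Qed.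

(** By compactness of the group, the conjugates of an element close to the
    identity are uniformly close to it, hence are exponentials. *)
Lemma Ad_local : exists2 r, 0 < r & r <= er / 16 /\ forall g, exists a : V -> V,
  forall v, `|v| <= r -> 16 * `|a v| <= er /\ (g * lc_exp v * g^-1)%g = lc_exp (a v).
Proof.
have [s s0 sP] := lc_log.
have [r r0 rP] := nbhs_lc_ball L (conj_small (@lc_ball_nbhs _ _ L _ s0)).
have m0 : 0 < Num.min (r / 2) (er / 16) by rewrite lt_min !divr_gt0.
exists (Num.min (r / 2) (er / 16)) => //; split; first by rewrite ge_min lexx orbT.
move=> g.
have ex v : exists w, `|v| <= Num.min (r / 2) (er / 16) ->
    16 * `|w| <= er /\ (g * lc_exp v * g^-1)%g = lc_exp w.
  have [vr|nvr] := pselect (`|v| <= Num.min (r / 2) (er / 16)); last by exists 0.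
  move: vr; rewrite le_min => /andP[v1 v2].
  have vr : `|v| <= er by have := normr_ge0 v; lra.
  have [dv cv nv] := lc_exp_dom vr.
  have Bv : lc_ball L r (lc_exp v) by split => //; apply: le_trans nv _; lra.
  have [w [w1 w2 _]] := sP _ (rP _ Bv g); by exists w.
by have [a aP] := choice ex; exists a.
Qed.

Section conjugation.
Variables (r : R) (g : G) (a : V -> V).
Hypotheses (r0 : 0 < r) (r16 : r <= er / 16).
Hypothesis aP : forall v, `|v| <= r ->
  16 * `|a v| <= er /\ (g * lc_exp v * g^-1)%g = lc_exp (a v).

Let N := er / (8 * r).
Let N0 : 0 <= N. Proof. by rewrite /N divr_ge0// ?mulr_ge0// ltW. Qed.

Lemma conjgnX (x y : G) m : (x * y ^+ m * x^-1 = (x * y * x^-1) ^+ m)%g.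
Proof.
elim: m => [|m ih]; first by rewrite !expg0 mulg1 mulgV.
by rewrite !expgS -ih !mulgA mulgVK.
Qed.

Lemma Ad_uniq v w : `|v| <= r -> `|w| <= er -> (g * lc_exp v * g^-1)%g = lc_exp w -> a v = w.
Proof.
move=> vr wr E; have [av aE] := aP vr; apply: lc_exp_inj => //; last by rewrite -aE.
by have := normr_ge0 (a v); lra.
Qed.

Lemma Ad0 : a 0 = 0.
Proof. by apply: Ad_uniq; rewrite ?normr0 ?ltW// lc_exp0 mulg1 mulgV. Qed.

Lemma Ad_half v : `|v| <= r -> a (2^-1 *: v) = 2^-1 *: a v.
Proof.
move=> vr; have h0 : 0 <= 2^-1 :> R by [].
have nv : `|2^-1 *: v| = 2^-1 * `|v| by rewrite normrZ ger0_norm.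
have v0 := normr_ge0 v; have e0 := er0.
have vr2 : `|2^-1 *: v| <= r by rewrite nv; lra.
have [av aE] := aP vr; have [ah ahE] := aP vr2.
have a0 := normr_ge0 (a v); have ah0 := normr_ge0 (a (2^-1 *: v)).
have nav : `|2^-1 *: a v| = 2^-1 * `|a v| by rewrite normrZ ger0_norm.
have two u : 2%:R *: (2^-1 *: u) = u by rewrite scalerA mulfV ?scale1r// pnatr_eq0.
have avr : `|2^-1 *: a v| <= er by rewrite nav; lra.
have ahr : `|a (2^-1 *: v)| <= er by lra.
have sq : (lc_exp (a (2^-1 *: v)) ^+ 2 = lc_exp (2^-1 *: a v) ^+ 2)%g.
  rewrite -ahE -conjgnX -!lc_expMn ?two//.
  - by rewrite nav -/er; lra.
  - by rewrite nv -/er; have := r16; lra.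
  - by rewrite nv -/er; have := r16; lra.
have [dx cx nx] := lc_exp_dom ahr; have [dy cy ny] := lc_exp_dom avr.
have m1 : `|lc L (lc_exp (a (2^-1 *: v)))| <= er / 8 by apply: le_trans nx _; lra.
have m2 : `|lc L (lc_exp (2^-1 *: a v))| <= er / 8 by apply: le_trans ny _; rewrite nav; lra.
have m3 : 2%:R * (er / 8) <= lc_rad L / 64 by rewrite erE -/rho; have := rho0; lra.
have [_] := lc_pow_lipschitz dx dy m1 m2 m3.
rewrite sq subrr normr0 mulr0 => h.
have : `|lc L (lc_exp (a (2^-1 *: v))) - lc L (lc_exp (2^-1 *: a v))| = 0.
  by apply/eqP; rewrite eq_le normr_ge0 andbT; move: h; lra.
move=> /normr0_eq0/eqP; rewrite subr_eq0 => /eqP E.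
exact/lc_exp_inj/(lc_dom_inj dx dy).
Qed.

Lemma Ad_dyadic v i : `|v| <= r -> a ((2 ^ i)%:R^-1 *: v) = (2 ^ i)%:R^-1 *: a v.
Proof.
move=> vr; elim: i => [|i ih]; first by rewrite expn0 invr1 !scale1r.
rewrite expnS natrM invfM -!scalerA Ad_half ?ih// normrZ ger0_norm//.
apply: le_trans vr; rewrite ler_piMl// invf_le1 ?ltr0n ?expn_gt0// ler1n expn_gt0//.
Qed.

Lemma Ad_bound v : `|v| <= r -> `|a v| <= N * `|v|.
Proof.
move=> vr; have [->|v0] := eqVneq v 0; first by rewrite Ad0 !normr0 mulr0.
have nv : 0 < `|v| by rewrite normr_gt0.
have x1 : 1 <= r / `|v| by rewrite ler_pdivlMr// mul1r.
have /andP[t1 t2] := truncn_itv (le_trans ler01 x1).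
set t := Num.truncn _ in t1 t2.
have t0 : (0 < t)%N by rewrite truncn_gt0.
have /andP[p1 p2] := trunc_log_bounds (isT : (1 < 2)%N) t0.
set i := trunc_log 2 t in p1 p2.
have P0 : 0 < (2 ^ i)%:R :> R by rewrite ltr0n expn_gt0.
have b1 : (2 ^ i)%:R * `|v| <= r.
  by rewrite -ler_pdivlMr//; apply: le_trans t1; rewrite ler_nat.
have b2 : r <= 2 * (2 ^ i)%:R * `|v|.
  rewrite -ler_pdivrMr//; apply: le_trans (ltW t2) _.
  by rewrite -natrM ler_nat -expnS.
have nw : `|(2 ^ i)%:R *: v| <= r by rewrite normrZ normr_nat.
have := Ad_dyadic i nw; rewrite scalerA mulVf ?gt_eqF// scale1r => ->.
have V0 : 0 <= (2 ^ i)%:R^-1 :> R by rewrite invr_ge0 ltW.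
rewrite normrZ (ger0_norm V0) [leLHS]mulrC ler_pdivrMr//.
have [aw _] := aP nw.
have le16 : `|a ((2 ^ i)%:R *: v)| <= er / 16 by rewrite ler_pdivlMr// mulrC.
apply: le_trans le16 _.
rewrite /N; have -> : er / (8 * r) * `|v| * (2 ^ i)%:R = er / 16 * (2 * (2 ^ i)%:R * `|v| / r).
  by move: (2 ^ i)%:R => P; field; rewrite gt_eqF.
rewrite -[leLHS]mulr1; apply: ler_wpM2l; first by rewrite divr_ge0// ltW.
by rewrite ler_pdivlMr// mul1r.
Qed.

Lemma dyadic_le0 (x k d : R) : 0 <= k -> 0 < d ->
  (forall i, k * (2 ^ i)%:R^-1 <= d -> (2 ^ i)%:R^-1 * x <= k * (2 ^ i)%:R^-1 ^+ 2) ->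
  x <= 0.
Proof.
move=> k0 d0 H; apply/ler_addgt0Pr => e e0; rewrite add0r.
have k1 : 0 < k + 1 by rewrite ltr_wpDl.
have e1 : 0 < Num.min (e / (k + 1)) (d / (k + 1)) by rewrite lt_min !divr_gt0.
have [i ie] := @filter_ex _ \oo _ _ (near_infty_natSinv_lt (PosNum e1)).
have {}ie : i.+1%:R^-1 < Num.min (e / (k + 1)) (d / (k + 1)) := ie.
have P0 : 0 < (2 ^ i)%:R :> R by rewrite ltr0n expn_gt0.
have Pi : (2 ^ i)%:R^-1 <= i.+1%:R^-1 :> R.
  by rewrite lef_pV2 ?posrE// ler_nat; exact: ltn_expl.
move: ie; rewrite lt_min => /andP[ie id].
have bnd y : i.+1%:R^-1 < y / (k + 1) -> k * (2 ^ i)%:R^-1 <= y.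
  move=> iy; apply: (@le_trans _ _ ((k + 1) * (y / (k + 1)))).
    by apply: ler_pM => //; [rewrite lerDl|exact: le_trans Pi (ltW iy)].
  by rewrite mulrCA mulfV ?mulr1// gt_eqF.
have := H i (bnd _ id); rewrite expr2 mulrA mulrC ler_pM2r ?invr_gt0// => h.
exact: le_trans h (bnd _ ie).
Qed.

(** Conjugation is multiplicative, and products of exponentials of small vectors
    are exponentials of sums up to a quadratic error; the bound on conjugates
    of small elements makes that error negligible after conjugation as well. *)
Lemma AdD v w : `|v| <= r / 2 -> `|w| <= r / 2 -> a (v + w) = a v + a w.
Proof.
move=> vr2 wr2; have v0 := normr_ge0 v; have w0 := normr_ge0 w; have e0 := er0.
have rr := r0; have rr16 := r16; have rh0 := rho0.
have le16 (t : R) : 0 <= t -> 16 * t <= er -> 2 * t <= er /\ t <= er by move=> t0 t16; split; lra.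
have rho2 (t : R) : 0 <= t -> 16 * t <= er -> 2 * t <= rho by rewrite erE => t0 t16; lra.
have r8 : rho / 8 <= rho by lra.
have half (t : R) : 0 <= t -> t <= r -> 2 * t <= er by move=> t0 tr; lra.
have vr : `|v| <= r by lra. have wr : `|w| <= r by lra.
have vwn : `|v + w| <= `|v| + `|w| by exact: ler_normD.
have vwr : `|v + w| <= r by lra.
have [s s0 sP] := lc_log.
pose sg := `|v| + `|w|; pose sg' := `|a v| + `|a w|; pose ta := `|a (v + w)|.
have [av avE] := aP vr; have [aw awE] := aP wr; have [avw avwE] := aP vwr.
have sg0 : 0 <= sg by rewrite addr_ge0.
pose k := 16 * C * sg ^+ 2 + 2 * C * ta ^+ 2 + 2 * C * sg' ^+ 2 + 4 * (N * (16 * C * sg ^+ 2)).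
have t0 b x : 0 <= b -> 0 <= b * C * x ^+ 2.
  by move=> b0; exact: mulr_ge0 (mulr_ge0 b0 C0) (sqr_ge0 x).
have t1 : 0 <= 16 * C * sg ^+ 2 by exact: t0.
have t2 : 0 <= 2 * C * ta ^+ 2 by exact: t0.
have t3 : 0 <= 2 * C * sg' ^+ 2 by exact: t0.
have t4 : 0 <= 4 * (N * (16 * C * sg ^+ 2)) by apply: mulr_ge0 => //; exact: mulr_ge0.
have k0 : 0 <= k by rewrite !addr_ge0.
have k1 : 16 * C * sg ^+ 2 <= k by rewrite /k -!addrA lerDl !addr_ge0.
have d0 : 0 < Num.min s r by rewrite lt_min s0.
apply/eqP; rewrite -subr_eq0 -normr_le0; apply: (@dyadic_le0 _ k _ k0 d0) => i kid.
set m := (2 ^ i)%:R^-1 in kid *.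
have m0 : 0 <= m by rewrite invr_ge0.
have m1 : m <= 1 by rewrite invf_le1 ?ltr0n ?expn_gt0// ler1n expn_gt0.
have nm u : `|m *: u| = m * `|u| by rewrite normrZ ger0_norm.
have mle u : m * `|u| <= `|u| by rewrite ler_piMl.
have sm b u : b * `|u| <= er -> 0 <= b -> b * `|m *: u| <= er.
  by move=> bu b0; rewrite nm; apply: le_trans bu; apply: ler_wpM2l.
have v2r : 2 * `|m *: v| <= er by apply: sm => //; exact: half.
have w2r : 2 * `|m *: w| <= er by apply: sm => //; exact: half.
have [Bx Ex] := lc_exp_prod v2r w2r.
have vw2r : 2 * `|m *: (v + w)| <= er by apply: sm => //; exact: half.
have z2r : 2 * `|0 : V| <= er by rewrite normr0 mulr0 ltW.
have [By Ey] := lc_exp_prod vw2r z2r.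
rewrite lc_exp0 mulg1 addr0 normr0 addr0 in By Ey.
set x := (lc_exp (m *: v) * lc_exp (m *: w))%g in Bx Ex; set y := lc_exp (m *: (v + w)) in By Ey.
have [dz nz _] := lc_ldivP By Bx.
set z := (x^-1 * y)%g in dz nz.
have m20 : 0 <= m ^+ 2 by rewrite exprn_ge0.
have Ey' : `|c y - m *: (v + w)| <= 2 * C * sg ^+ 2 * m ^+ 2.
  apply: le_trans Ey _; rewrite nm exprMn [m ^+ 2 * _]mulrC mulrA.
  apply: ler_wpM2r => //; apply: ler_wpM2l; first by rewrite mulr_ge0.
  by rewrite lerXn2r// nnegrE.
have Ex' : `|c x - m *: (v + w)| <= 2 * C * sg ^+ 2 * m ^+ 2.
  by rewrite scalerDr; apply: le_trans Ex _; rewrite !nm -mulrDr exprMn [m ^+ 2 * _]mulrC mulrA.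
have nz8 : `|c z| <= 8 * C * sg ^+ 2 * m ^+ 2.
  apply: le_trans nz _.
  have := @norm_split2 _ _ L (c y - c x) (c y - m *: (v + w)) (- (c x - m *: (v + w))).
  move=> h; have {h} := h ltac:(by apply/rowP => j; rewrite !mxE; ring).
  rewrite normrN -/c => h; have -> : 8 * C * sg ^+ 2 * m ^+ 2 = 2 * (2 * C * sg ^+ 2 * m ^+ 2 + 2 * C * sg ^+ 2 * m ^+ 2) by ring.
  apply: ler_wpM2l => //; apply: le_trans h _; exact: lerD.
have m2m : m ^+ 2 <= m by rewrite expr2 ler_piMl.
have kid' : 16 * C * sg ^+ 2 * m ^+ 2 <= Num.min s r.
  by apply: le_trans kid; apply: ler_pM.
have h816 : 8 * C * sg ^+ 2 * m ^+ 2 <= 16 * C * sg ^+ 2 * m ^+ 2.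
  by apply: ler_wpM2r => //; apply: ler_wpM2r; [rewrite exprn_ge0|apply: ler_wpM2r => //; rewrite ler_nat].
have ms : Num.min s r <= s by rewrite ge_min lexx.
have mr : Num.min s r <= r by rewrite ge_min lexx orbT.
have [u [u16 zE nu]] := sP z (conj dz (le_trans nz8 (le_trans h816 (le_trans kid' ms)))).
have nu16 : `|u| <= 16 * C * sg ^+ 2 * m ^+ 2.
  apply: le_trans nu _; have -> : 16 * C * sg ^+ 2 * m ^+ 2 = 2 * (8 * C * sg ^+ 2 * m ^+ 2) by ring.
  exact: ler_wpM2l.
have ur : `|u| <= r by apply: le_trans nu16 (le_trans kid' mr).
have [au auE] := aP ur.
have nau : `|a u| <= N * (16 * C * sg ^+ 2) * m ^+ 2.
  by apply: le_trans (Ad_bound ur) _; rewrite -mulrA; exact: ler_wpM2l.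
have amv := Ad_dyadic i vr; have amw := Ad_dyadic i wr; have amvw := Ad_dyadic i vwr.
rewrite -/m in amv amw amvw.
have mlr (q : V) : `|q| <= r -> `|m *: q| <= r by move=> qr; rewrite nm; apply: le_trans qr.
have [_ emv] := aP (mlr _ vr); have [_ emw] := aP (mlr _ wr); have [_ emvw] := aP (mlr _ vwr).
rewrite amv in emv; rewrite amw in emw; rewrite amvw in emvw.
have yE : (lc_exp (m *: a (v + w)) = lc_exp (m *: a v) * lc_exp (m *: a w) * lc_exp (a u))%g.
  rewrite -emvw -emv -emw -auE -zE -/y.
  have -> : y = (x * z)%g by rewrite /z mulVKg.
  by rewrite /x !mulgA !mulgVK.
have av2r : 2 * `|m *: a v| <= er by apply: sm => //; exact: (le16 _ _ av).1.
have aw2r : 2 * `|m *: a w| <= er by apply: sm => //; exact: (le16 _ _ aw).1.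
have avw2r : 2 * `|m *: a (v + w)| <= er by apply: sm => //; exact: (le16 _ _ avw).1.
have [Bx' Ex2] := lc_exp_prod av2r aw2r.
have [By' Ey2] := lc_exp_prod avw2r z2r.
rewrite lc_exp0 mulg1 addr0 normr0 addr0 in By' Ey2.
set x' := (lc_exp (m *: a v) * lc_exp (m *: a w))%g in yE Bx' Ex2; set y' := lc_exp (m *: a (v + w)) in yE By' Ey2.
clearbody x' y'.
have aur : `|a u| <= er by exact: (le16 _ _ au).2.
have [dau cau nau2] := lc_exp_dom aur.
have Bau : lc_ball L rho (lc_exp (a u)).
  by split => //; apply: le_trans nau2 _; exact: rho2.
have [_ E3 _] := @lc_mulP _ _ L x' (lc_exp (a u)) (lc_ballS r8 Bx') Bau.
rewrite -yE -/c -/C in E3.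
have E3' := absorb C0 (lc_ballS r8 Bx').2 (normr_ge0 (c (lc_exp (a u)))) Crho.
have E4 : `|c y' - c x'| <= 4 * (N * (16 * C * sg ^+ 2)) * m ^+ 2.
  have := @norm_split2 _ _ L (c y' - c x') (c y' - (c x' + c (lc_exp (a u)))) (c (lc_exp (a u))).
  move=> h; have {h} := h ltac:(by apply/rowP => j; rewrite !mxE; ring).
  move=> h; apply: le_trans h _; rewrite -mulrA; apply: (@le_trans _ _ (4 * `|a u|)); last exact: ler_wpM2l.
  move: E3 E3' nau2 (normr_ge0 (a u)); rewrite -/c.
  exact: conj_arith.
have tE : `|a (v + w) - (a v + a w)| * m = `|m *: a (v + w) - (m *: a v + m *: a w)|.
  by rewrite -scalerDr -scalerBr nm mulrC.
rewrite mulrC tE.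
have := @norm_split3 _ _ L (m *: a (v + w) - (m *: a v + m *: a w)) (- (c y' - m *: a (v + w)))
  (c y' - c x') (c x' - (m *: a v + m *: a w)).
move=> h; have {h} := h ltac:(by apply/rowP => j; rewrite !mxE; ring).
rewrite normrN => h; apply: le_trans h _.
have E5 : `|c y' - m *: a (v + w)| <= 2 * C * ta ^+ 2 * m ^+ 2.
  by apply: le_trans Ey2 _; rewrite nm exprMn [m ^+ 2 * _]mulrC mulrA.
have E6 : `|c x' - (m *: a v + m *: a w)| <= 2 * C * sg' ^+ 2 * m ^+ 2.
  by apply: le_trans Ex2 _; rewrite !nm -mulrDr exprMn [m ^+ 2 * _]mulrC mulrA.
apply: le_trans (lerD (lerD E5 E4) E6) _.
rewrite -!mulrDl; apply: ler_wpM2r => //; rewrite /k.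
exact: perm_arith.
Qed.

(** Dyadic multiples are known from halving and taking powers; they are dense,
    and the linear bound allows passing to the limit. *)
Lemma AdZ v t : `|v| <= r / 4 -> 0 <= t -> t <= 1 -> a (t *: v) = t *: a v.
Proof.
move=> vr4 t0 t1; have v0 := normr_ge0 v; have e0 := er0; have rr := r0; have rr16 := r16.
have vr : `|v| <= r by lra.
have [av avE] := aP vr; have avn := normr_ge0 (a v).
have K0 : 0 <= `|a v| + N * `|v| by rewrite addr_ge0// mulr_ge0.
apply/eqP; rewrite -subr_eq0 -normr_le0; apply/ler_addgt0Pr => e e_gt0; rewrite add0r.
have e1 : 0 < e / (`|a v| + N * `|v| + 1) by rewrite divr_gt0// ltr_wpDl.
have [i ie] := @filter_ex _ \oo _ _ (near_infty_natSinv_lt (PosNum e1)).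
have {}ie : i.+1%:R^-1 < e / (`|a v| + N * `|v| + 1) := ie.
have P0 : 0 < (2 ^ i)%:R :> R by rewrite ltr0n expn_gt0.
have Pi : (2 ^ i)%:R^-1 <= i.+1%:R^-1 :> R.
  by rewrite lef_pV2 ?posrE// ler_nat; exact: ltn_expl.
set m := (2 ^ i)%:R^-1 in Pi.
have m0 : 0 <= m by rewrite invr_ge0.
have m1 : m <= 1 by rewrite invf_le1// ler1n expn_gt0.
have /andP[k1 k2] := truncn_itv (mulr_ge0 t0 (ltW P0)).
set k := Num.truncn _ in k1 k2.
pose s := k%:R * m.
have s0 : 0 <= s by rewrite mulr_ge0.
have st : s <= t by rewrite /s ler_pdivrMr.
have ts : t - s <= m.
  have := ltW k2; rewrite -ler_pdivlMr// -natr1 mulrDl mul1r -/m -/s; lra.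
have nm u : `|m *: u| = m * `|u| by rewrite normrZ ger0_norm.
have sle u b : `|u| <= b -> s * `|u| <= b.
  by move=> ub; apply: le_trans ub; rewrite ler_piMl//; lra.
have ns u : `|s *: u| = s * `|u| by rewrite normrZ ger0_norm.
have mle u b : `|u| <= b -> m * `|u| <= b.
  by move=> ub; apply: le_trans ub; rewrite ler_piMl.
have aE : a (s *: v) = s *: a v.
  apply: Ad_uniq.
  - by rewrite ns; exact: sle.
  - by rewrite ns; apply: sle; lra.
  have sE u : s *: u = k%:R *: (m *: u) by rewrite scalerA.
  have mvr : `|m *: v| <= r by rewrite nm; exact: mle.
  have [_ amv] := aP mvr; rewrite Ad_dyadic// -/m in amv.
  rewrite !sE !lc_expMn ?conjgnX ?amv//.
  - by rewrite nm mulrA -/s -/er; apply: sle; lra.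
  - by rewrite nm -/er; apply: mle; lra.
  - by rewrite nm mulrA -/s -/er; apply: sle; lra.
  - by rewrite nm -/er; apply: mle; lra.
have nts : `|(t - s) *: v| = (t - s) * `|v| by rewrite normrZ ger0_norm// subr_ge0.
have h1 : `|s *: v| <= r / 2 by rewrite ns; apply: sle; lra.
have h2 : `|(t - s) *: v| <= r / 2.
  rewrite nts; apply: (@le_trans _ _ (1 * `|v|)); last by lra.
  by apply: ler_wpM2r => //; lra.
have -> : t *: v = s *: v + (t - s) *: v by rewrite -scalerDl addrC subrK.
rewrite AdD// aE.
have -> : s *: a v + a ((t - s) *: v) - t *: a v = a ((t - s) *: v) - (t - s) *: a v.
  by apply/rowP => j; rewrite !mxE; ring.
apply: le_trans (ler_normB _ _) _.
have h3 : `|(t - s) *: v| <= r by lra.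
rewrite normrZ ger0_norm ?subr_ge0//.
apply: le_trans (lerD (Ad_bound h3) (lexx _)) _.
rewrite nts mulrCA -mulrDr.
apply: (@le_trans _ _ (e / (`|a v| + N * `|v| + 1) * (`|a v| + N * `|v| + 1))).
  apply: ler_pM => //.
  - by rewrite subr_ge0.
  - by rewrite addr_ge0// mulr_ge0.
  - by apply: le_trans ts (le_trans Pi (ltW ie)).
  - by rewrite addrC lerDl.
by rewrite mulfVK// gt_eqF// ltr_wpDl.
Qed.

End conjugation.

(** In exponential coordinates conjugation by g is additive and homogeneous on
    small vectors, so it is given by a matrix: the adjoint action of g on row
    vectors. *)
Lemma Ad_mx : exists2 r, 0 < r & r <= er / 16 /\ exists2 N, 0 <= N & forall g,
  exists A : 'M[R]_n, (forall v, `|v| <= r ->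
    (g * lc_exp v * g^-1)%g = lc_exp (v *m A)) /\
    forall v, `|v *m A| <= N * `|v|.
Proof.
have [r r0 [r16 rP]] := Ad_local; have e0 := er0.
have r40 : 0 < r / 4 by rewrite divr_gt0.
have r4r : r / 4 <= r by lra.
exists (r / 4) => //; split; first by lra.
exists (er / (8 * r)); first by rewrite divr_ge0// ?mulr_ge0// ltW.
move=> g; have [a aP] := rP g.
pose s (v : V) := (r / 4) / (`|v| + 1).
have v10 (v : V) : 0 < `|v| + 1 by rewrite ltr_wpDl.
have s0 v : 0 < s v by rewrite divr_gt0.
have sv (v : V) : s v * `|v| <= r / 4.
  rewrite /s mulrAC ler_pdivrMr//; apply: ler_wpM2l; first exact: ltW.
  by rewrite lerDl.
pose f (v : V) : V := (s v)^-1 *: a (s v *: v).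
have scale (x y : R) (v : V) : 0 < x -> x <= y -> y * `|v| <= r / 4 ->
    a (x *: v) = (x / y) *: a (y *: v).
  move=> x0 xy yv; have y0 : 0 < y := lt_le_trans x0 xy.
  rewrite -(AdZ r0 r16 aP) ?scalerA ?mulfVK ?gt_eqF//.
  - by rewrite normrZ gtr0_norm.
  - by rewrite divr_ge0 ?ltW.
  - by rewrite ler_pdivrMr// mul1r.
have key (t : R) (v : V) : 0 < t -> t * `|v| <= r / 4 -> a (t *: v) = t *: f v.
  move=> t0 tv; rewrite /f scalerA; have [ts|st] := leP t (s v).
    exact: scale.
  rewrite (scale _ _ _ (s0 v) (ltW st) tv) scalerA.
  have -> : t / s v * (s v / t) = 1.
    by rewrite mulrA mulfVK ?gt_eqF// mulfV// gt_eqF.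
  by rewrite scale1r.
have smallt (v w : V) : exists2 t, 0 < t & t * `|v| <= r / 4 /\ t * `|w| <= r / 4.
  exists (Num.min (s v) (s w)); first by rewrite lt_min !s0.
  split; [apply: le_trans (sv v)|apply: le_trans (sv w)]; apply: ler_wpM2r => //.
    by rewrite ge_min lexx.
  by rewrite ge_min lexx orbT.
have fD v w : f (v + w) = f v + f w.
  have [t t0 [tv tw]] := smallt (`|v| *: v) w.
  pose x := r / 8 / (`|v| + `|w| + 1).
  have d0 : 0 < `|v| + `|w| + 1 by rewrite ltr_wpDl// addr_ge0.
  have x0 : 0 < x by rewrite divr_gt0// divr_gt0.
  have xE : x * (`|v| + `|w| + 1) = r / 8 by rewrite mulfVK// gt_eqF.
  have b u : `|u| <= `|v| + `|w| -> x * `|u| <= r / 8.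
    move=> uvw; rewrite -xE; apply: ler_wpM2l; [exact: ltW|].
    by apply: le_trans uvw _; rewrite lerDl.
  have r84 : r / 8 <= r / 4 by lra.
  have b1 : x * `|v| <= r / 8 by apply: b; rewrite lerDl.
  have b2 : x * `|w| <= r / 8 by apply: b; rewrite lerDr.
  have b3 : x * `|v + w| <= r / 8 by apply: b; exact: ler_normD.
  have r82 : r / 8 <= r / 2 by lra.
  have E := key x (v + w) x0 (le_trans b3 r84).
  have n1 : `|x *: v| <= r / 2 by rewrite normrZ gtr0_norm// (le_trans b1).
  have n2 : `|x *: w| <= r / 2 by rewrite normrZ gtr0_norm// (le_trans b2).
  rewrite scalerDr (AdD r0 r16 aP n1 n2) in E.
  rewrite (key x v x0 (le_trans b1 r84)) (key x w x0 (le_trans b2 r84)) in E.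
  rewrite -scalerDr in E; apply/esym.
  by apply: (scalerI (_ : x != 0)) E; rewrite gt_eqF.
have f0 : f 0 = 0 by rewrite /f scaler0 (Ad0 r0 aP) scaler0.
have fN v : f (- v) = - f v by apply/eqP; rewrite -addr_eq0 -fD addNr f0.
have fZpos b v : 0 < b -> f (b *: v) = b *: f v.
  move=> b0; have [t t0 [t1 _]] := smallt (b *: v) 0.
  have := key t (b *: v) t0 t1.
  rewrite normrZ (gtr0_norm b0) mulrA in t1.
  rewrite scalerA (key (t * b) v (mulr_gt0 t0 b0) t1) -scalerA => /esym E.
  by apply: (scalerI (_ : t != 0)) E; rewrite gt_eqF.
have fZ b v : f (b *: v) = b *: f v.
  have [b0|b0|->] := ltgtP b 0; last by rewrite !scale0r.
    have nb : 0 < - b by rewrite oppr_gt0.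
    by have := fZpos _ v nb; rewrite !scaleNr fN => /oppr_inj.
  exact: fZpos.
have flin : linear f by move=> b v w; rewrite fD fZ.
pose fL : {linear V -> V} := HB.pack f (GRing.isLinear.Build R V V *:%R f flin).
exists (lin1_mx fL); split.
  move=> v vr; rewrite mul_rV_lin1 /=.
  have [_ ->] := aP v (le_trans vr r4r).
  by rewrite -[v in LHS]scale1r key ?scale1r ?mul1r.
move=> v; rewrite mul_rV_lin1 /= /f normrZ.
have sV0 : 0 <= (s v)^-1 by rewrite invr_ge0 ltW.
rewrite (ger0_norm sV0).
have nsv : `|s v *: v| <= r by rewrite normrZ gtr0_norm// (le_trans (sv v)).
apply: le_trans (ler_wpM2l sV0 (Ad_bound r0 r16 aP nsv)) _.
rewrite normrZ gtr0_norm//.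
by rewrite mulrCA [(s v)^-1 * _]mulrA mulVf ?mul1r// gt_eqF.
Qed.

End adjoint.

(** * Invariant complements and transversals *)

Lemma mulmx_norm (R : realType) a b d (X : 'M[R]_(a, b)) (Y : 'M[R]_(b, d)) :
  `|X *m Y| <= b%:R * (`|X| * `|Y|).
Proof.
rewrite [leLHS]/Num.norm /= mx_normrE; apply/bigmax_leP; split.
  by rewrite !mulr_ge0.
move=> [i j] _ /=; rewrite mxE; apply: le_trans (ler_norm_sum _ _ _) _.
apply: (@le_trans _ _ (\sum_(k < b) `|X| * `|Y|)).
  apply: ler_sum => k _; rewrite normrM; apply: ler_pM => //.
    rewrite [leRHS]/Num.norm /= mx_normrE; apply/bigmax_geP; right.
    by exists (i, k).
  rewrite [leRHS]/Num.norm /= mx_normrE; apply/bigmax_geP; right.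
  by exists (k, j).
by rewrite sumr_const card_ord mulr_natl.
Qed.

Lemma mx_coord_le (R : realType) a b (X : 'M[R]_(a, b)) i j : `|X i j| <= `|X|.
Proof.
rewrite [leRHS]/Num.norm /= mx_normrE; apply/bigmax_geP; right.
by exists (i, j).
Qed.

Lemma mx_norm_le (R : realType) a b (X : 'M[R]_(a, b)) (B : R) :
  0 <= B -> (forall i j, `|X i j| <= B) -> `|X| <= B.
Proof.
move=> B0 XB; rewrite [leLHS]/Num.norm/= mx_normrE; by apply/bigmax_leP; split.
Qed.

Lemma subspace_matrix (R : realType) n (P : set 'rV[R]_n) :
  P 0 -> (forall v w, P v -> P w -> P (v + w)) -> (forall a v, P v -> P (a *: v)) ->
  exists S : 'M[R]_n, forall v, P v <-> (v <= S)%MS.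
Proof.
move=> P0 PD PZ.
pose good (r : nat) := `[< exists S : 'M[R]_n, (forall v, (v <= S)%MS -> P v) /\ \rank S = r >].
have g0 : exists r, good r.
  exists 0%N; apply/asboolP; exists 0; split; last exact: mxrank0.
  by move=> v; rewrite submx0 => /eqP ->.
have gb r : good r -> (r <= n)%N by move=> /asboolP[S [_ <-]]; exact: rank_leq_row.
have [r /asboolP[S [SP rS]] rmax] := ex_maxnP g0 gb.
exists S => v; split; last exact: SP.
move=> Pv; have sub : (S <= S + v)%MS by exact: addsmxSl.
have : good (\rank (S + v)%MS).
  apply/asboolP; exists (S + v)%MS; split => // w /sub_addsmxP[[x y] /= ->].
  apply: PD; first by apply: SP; exact: submxMl.
  by rewrite [y]mx11_scalar mul_scalar_mx; exact: PZ.
move=> /rmax; rewrite -rS => le.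
have /geq_leqif := mxrank_leqif_sup sub; rewrite le => /esym.
by apply: submx_trans; exact: addsmxSr.
Qed.

Section fixed_point.
Variables (R : realType) (a b : nat).
Let W := 'M[R]_(a, b).

Let q (x : W) : R := \sum_i \sum_j x i j ^+ 2.

Let q_ge0 x : 0 <= q x.
Proof. by apply: sumr_ge0 => i _; apply: sumr_ge0 => j _; exact: sqr_ge0. Qed.

Let norm_q x : `|x| ^+ 2 <= q x.
Proof.
have [->|x0] := eqVneq x 0; first by rewrite normr0 expr0n/= q_ge0.
have : `|x| != 0 by rewrite normr_eq0.
rewrite [`|x|]/Num.norm /= => /mx_norm_neq0[[i j] /= ->].
rewrite real_normK ?num_real// /q (bigD1 i)//= (bigD1 j)//= -addrA lerDl.
rewrite addr_ge0//; first by apply: sumr_ge0 => k _; exact: sqr_ge0.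
by apply: sumr_ge0 => k _; apply: sumr_ge0 => l _; exact: sqr_ge0.
Qed.

Let q_norm x : q x <= a%:R * b%:R * `|x| ^+ 2.
Proof.
rewrite /q; apply: (@le_trans _ _ (\sum_(i < a) \sum_(j < b) `|x| ^+ 2)).
  apply: ler_sum => i _; apply: ler_sum => j _.
  by rewrite -real_normK ?num_real// lerXn2r// ?nnegrE// mx_coord_le.
by rewrite !(sumr_const, card_ord) -natrM mulr_natl mulnC mulrnA.
Qed.

Let q_mid x y : q (2^-1 *: (x + y)) = 2^-1 * q x + 2^-1 * q y - 4^-1 * q (x - y).
Proof.
rewrite /q !mulr_sumr -!big_split /= -sumrN -big_split /=.
apply: eq_bigr => i _; rewrite !mulr_sumr -sumrN -!big_split /=.
by apply: eq_bigr => j _; rewrite !mxE; field.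
Qed.

(** A uniformly bounded group of linear maps has a fixed point in every closed
    convex set that it preserves: the supremum over the group of the Euclidean
    norm is an invariant, uniformly convex function, so that its minimising
    sequences converge, to a fixed point. *)
Lemma bounded_group_fixed_point (Phi : set (W -> W)) (CC : set W) (M : R) :
  0 < M -> (exists phi, Phi phi) ->
  (forall phi, Phi phi -> forall x y, phi (x - y) = phi x - phi y) ->
  (forall phi, Phi phi -> forall x y, phi (2^-1 *: (x + y)) = 2^-1 *: (phi x + phi y)) ->
  (forall phi, Phi phi -> forall x, `|phi x| <= M * `|x|) ->
  (forall phi psi, Phi phi -> Phi psi -> Phi (phi \o psi)) ->
  (forall phi, Phi phi -> exists2 psi, Phi psi & cancel phi psi) ->
  closed CC -> CC !=set0 ->
  (forall x y, CC x -> CC y -> CC (2^-1 *: (x + y))) ->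
  (forall phi x, Phi phi -> CC x -> CC (phi x)) ->
  exists2 w, CC w & forall phi, Phi phi -> phi w = w.
Proof.
move=> M0 [phi0 Phi0] PB Pmid PM Pcomp Pinv cC [w0 Cw0] Cmid CPhi.
have PM2 phi x : Phi phi -> `|phi x| ^+ 2 <= (M * `|x|) ^+ 2.
  move=> Pphi; have Mx : 0 <= M * `|x| by apply: mulr_ge0; [exact: ltW|].
  by rewrite ler_sqr ?nnegrE//; exact: PM.
pose F w := sup [set q (phi w) | phi in Phi].
have Fub w : has_sup [set q (phi w) | phi in Phi].
  split; first by exists (q (phi0 w)); exists phi0.
  exists (a%:R * b%:R * (M * `|w|) ^+ 2) => _ [phi Pphi <-].
  apply: le_trans (q_norm _) _; by apply: ler_wpM2l => //; exact: PM2.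
have Fle w phi : Phi phi -> q (phi w) <= F w.
  by move=> Pphi; apply: (ub_le_sup (Fub w).2); exists phi.
have F0 w : 0 <= F w by apply: le_trans (q_ge0 _) (Fle w _ Phi0).
have FPhi phi w : Phi phi -> F (phi w) <= F w.
  move=> Pphi; apply: ge_sup; first by exists (q (phi0 (phi w))); exists phi0.
  by move=> _ [psi Ppsi <-]; apply: (Fle w (psi \o phi)); exact: Pcomp.
pose m := inf [set F w | w in CC].
have Fhi : has_inf [set F w | w in CC].
  by split; [exists (F w0); exists w0|exists 0 => _ [w _ <-]].
have mF w : CC w -> m <= F w by move=> Cw; apply: (ge_inf Fhi.2); exists w.
pose K := 4 * (a%:R * b%:R + 1) * M ^+ 2.
have ab0 : 0 < a%:R * b%:R + 1 :> R by rewrite ltr_wpDl// mulr_ge0.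
have K0 : 0 < K by rewrite mulr_gt0 ?exprn_gt0// mulr_gt0.
have key w w' e : CC w -> CC w' -> F w <= m + e -> F w' <= m + e -> q (w - w') <= K * e.
  move=> Cw Cw' Fw Fw'.
  have : F (2^-1 *: (w + w')) <= m + e - q (w - w') / K.
    apply: ge_sup; first by exists (q (phi0 (2^-1 *: (w + w')))); exists phi0.
    move=> _ [phi Pphi <-]; rewrite Pmid// q_mid -PB//.
    have [psi Ppsi psiK] := Pinv _ Pphi.
    have h1 := le_trans (Fle w _ Pphi) Fw; have h2 := le_trans (Fle w' _ Pphi) Fw'.
    have h3 : q (w - w') / K <= 4^-1 * q (phi (w - w')).
      rewrite ler_pdivrMr//; set z := phi (w - w').
      have zE : w - w' = psi z by rewrite /z psiK.
      rewrite zE; apply: le_trans (q_norm _) _.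
      have : `|psi z| ^+ 2 <= (M * `|z|) ^+ 2.
        exact: PM2.
      move=> h; apply: le_trans (ler_wpM2l _ h) _; first by rewrite mulr_ge0.
      have -> : 4^-1 * q z * K = (a%:R * b%:R + 1) * (M ^+ 2 * q z) by rewrite /K; field.
      rewrite exprMn; apply: ler_pM => //.
      - exact: mulr_ge0 (sqr_ge0 _) (sqr_ge0 _).
      - by rewrite lerDl.
      - exact: ler_wpM2l (sqr_ge0 _) _ _ (norm_q z).
    lra.
  move=> h; have := le_trans (mF _ (Cmid _ _ Cw Cw')) h.
  by rewrite [K * e]mulrC -ler_pdivrMr//; move: (q _ / K) => y; lra.
have exw (j : nat) : exists w, CC w /\ F w <= m + j.+1%:R^-1.
  have j0 : 0 < j.+1%:R^-1 :> R by rewrite invr_gt0.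
  have [_ [w Cw <-] Fw] := inf_adherent j0 Fhi.
  by exists w; split => //; exact: ltW.
have [w wP] := choice exw.
have small e : 0 < e -> exists N, forall i, (N <= i)%N -> K * i.+1%:R^-1 <= e ^+ 2.
  move=> e0; have e1 : 0 < e ^+ 2 / K by rewrite divr_gt0// exprn_gt0.
  have [N _ NP] := near_infty_natSinv_lt (PosNum e1).
  exists N => i /NP /= /ltW; rewrite ler_pdivlMr// mulrC; exact.
have wij e N : (forall i, (N <= i)%N -> K * i.+1%:R^-1 <= e ^+ 2) -> 0 < e ->
    forall i, (N <= i)%N -> `|w N - w i| <= e.
  move=> NP e0 i Ni; have [C1 F1] := wP N; have [C2 F2] := wP i.
  have iN : i.+1%:R^-1 <= N.+1%:R^-1 :> R by rewrite lef_pV2 ?posrE// ler_nat.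
  have := key _ _ _ C1 C2 F1 (le_trans F2 _); rewrite lerD2l => /(_ iN) h.
  have := le_trans (norm_q _) (le_trans h (NP _ (leqnn N))).
  by rewrite ler_sqr ?nnegrE// ltW.
have cv : cvg (w i @[i --> \oo]).
  apply: cauchy_cvg; apply/cauchy_exP => e e0; have e2 : 0 < e / 2 by lra.
  have [N NP] := small _ e2; exists (w N); exists N => // i /= Ni.
  by rewrite -ball_normE/=; apply: le_lt_trans (wij _ _ NP e2 _ Ni) _; lra.
pose l : W := lim (w i @[i --> \oo]).
exists l.
  apply: cC => O lO; have [N _ NO] := cv _ lO.
  by exists (w N); split; [exact: (wP N).1|exact: (NO N (leqnn N))].
move=> phi Pphi; apply/eqP; rewrite -subr_eq0 -normr_le0.
apply/ler_addgt0Pr => e e0; rewrite add0r.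
pose e1 := e / (M + 2).
have M2 : 0 < M + 2 by lra.
have e10 : 0 < e1 by rewrite divr_gt0.
have [N NP] := small _ e10.
have near1 : \forall i \near \oo, `|l - w i| < e1 by move/cvgrPdist_lt: cv; apply.
have near2 : \forall i \near \oo, (N <= i)%N by exists N.
have [i [/= i1 i2]] := @filter_ex _ \oo _ _ (filterI near1 near2).
have [C1 F1] := wP i.
have h1 : `|phi (w i) - w i| <= e1.
  have := key _ _ _ (CPhi _ _ Pphi C1) C1 (le_trans (FPhi _ _ Pphi) F1) F1.
  move=> h; have := le_trans (norm_q _) (le_trans h (NP _ i2)).
  by rewrite ler_sqr ?nnegrE// ltW.
have dec (x y z t : W) : x - t = (x - y) + (y - z) - (t - z).
  by apply/matrixP => k1 k2; rewrite !mxE; ring.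
have -> : phi l - l = phi (l - w i) + (phi (w i) - w i) - (l - w i).
  by rewrite (PB _ Pphi l (w i)); exact: dec.
apply: le_trans (ler_normB _ _) _; apply: le_trans (lerD (ler_normD _ _) (lexx _)) _.
have h2 : `|phi (l - w i)| <= M * e1.
  by apply: le_trans (PM _ Pphi _) _; apply: ler_wpM2l; exact: ltW.
have -> : e = M * e1 + e1 + e1 by rewrite /e1; field; rewrite gt_eqF.
by apply: lerD; [exact: lerD|exact: ltW].
Qed.

End fixed_point.

Section closed_subgroups.
Variables (R : realType) (G : topGroupType) (L : lie_coord R G).
Hypothesis cG : compact [set: G].

Let c := lc L.
Let n := lc_dim L.
Let V := 'rV[R]_n.
Let er := exp_rad L.
Let er0 : 0 < er. Proof. exact: exp_rad_gt0. Qed.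
Implicit Types (u v w p : V) (g h : G) (K : set G) (Q : 'M[R]_n).

Lemma lc_exp_continuous v : `|v| < er -> {for v, continuous (@lc_exp R G L)}.
Proof.
move=> vr; apply: (@continuous_at_comp _ _ _ (@lc_e R G L) (lc_inv L)).
  move=> O /nbhs_ballP[e /= e0 eO].
  have d0 : 0 < Num.min (e / 2) (er - `|v|) by rewrite lt_min divr_gt0// subr_gt0.
  apply/nbhs_ballP; exists (Num.min (e / 2) (er - `|v|)) => //= w.
  rewrite -ball_normE/= lt_min => /andP[w1 w2]; apply: eO; rewrite -ball_normE /=.
  have wr : `|w| <= er.
    have := ler_normB v (v - w); rewrite opprB addrC subrK.
    by move: w2; rewrite ltrBrDl => /ltW w2 h; apply: le_trans h _.
  have [+ _] := lc_e_lipschitz (ltW vr) wr; move: w1; lra.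
apply: lc_inv_continuous; have [_ ce ne] := lc_exp_dom (ltW vr).
rewrite -ce; apply: le_trans ne _; move: vr; rewrite /er /exp_rad.
have := lc_rad_gt0 L; lra.
Qed.

Lemma mx_eq_small (A B : 'M[R]_n) (r : R) : 0 < r ->
  (forall v : V, `|v| <= r -> v *m A = v *m B) -> A = B.
Proof.
move=> r0 AB; apply/row_matrixP => i; rewrite !rowE.
set e := delta_mx 0 i; pose t := r / (`|e| + 1).
have e1 : 0 < `|e| + 1 by rewrite ltr_wpDl.
have t0 : 0 < t by rewrite divr_gt0.
have := AB (t *: e); rewrite normrZ gtr0_norm// -!scalemxAl.
have -> : t * `|e| <= r.
  rewrite /t mulrAC ler_pdivrMr//; apply: ler_wpM2l; first exact: ltW.
  by rewrite lerDl.
by move=> /(_ isT) E; apply: (scalerI (_ : t != 0)) E; rewrite gt_eqF.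
Qed.

(** The adjoint action of K permutes the projections onto its tangent space,
    which form a closed convex set; the kernel of a fixed projection is an
    invariant complement of the tangent space. *)
Lemma invariant_projection K : is_subgroup K -> closed K ->
  exists (Q : 'M[R]_n) (r M : R), [/\ 0 < r /\ r <= er / 16, 0 <= M,
    forall v, tangent K v <-> v *m Q = v,
    forall v, tangent K (v *m Q) &
    forall k, K k -> exists A : 'M[R]_n, [/\ A *m Q = Q *m A,
      forall v, `|v| <= r -> (k * lc_exp v * k^-1)%g = lc_exp (v *m A) &
      forall v, `|v *m A| <= M * `|v|]].
Proof.
move=> sK cK; have [K1 KM KV] := sK.
have [S SP] := subspace_matrix (tangent0 L sK)
  (fun v w => @tangentD _ _ L K v w sK cK) (fun a v => @tangentZ _ _ L K v a sK cK).
have [r r0 [r16 [N N0 AdP]]] := Ad_mx L cG.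
have [A AP] := choice AdP.
have e0 := er0.
have coker v : tangent K v <-> v *m cokermx S = 0.
  by rewrite SP submxE; split=> [/eqP //|->].
have N1 : 0 < N + 1 by rewrite ltr_wpDl.
have NN v g b : `|v| <= b / (N + 1) -> `|v *m A g| <= b.
  move=> vr; apply: le_trans ((AP g).2 v) _; rewrite ler_pdivlMr// in vr.
  by apply: le_trans vr; rewrite mulrC; apply: ler_wpM2l => //; rewrite lerDl.
have div_le b : 0 <= b -> b / (N + 1) <= b.
  by move=> b0; rewrite ler_pdivrMr// ler_peMr// lerDr.
have rN0 : 0 < r / (N + 1) by rewrite divr_gt0.
have rNN0 : 0 < r / (N + 1) / (N + 1) by rewrite divr_gt0.
have rNr : r / (N + 1) <= r by apply: div_le; exact: ltW.
have rNNr : r / (N + 1) / (N + 1) <= r / (N + 1) by apply: div_le; exact: ltW.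
have rer : r <= er by move: r16; rewrite -/er; lra.
have AM g h : A (g * h)%g = A h *m A g.
  apply: (mx_eq_small rNN0) => v vr; rewrite mulmxA.
  have vr1 : `|v| <= r / (N + 1) by exact: le_trans vr rNNr.
  have h1 : `|v *m A h| <= r / (N + 1) by exact: NN.
  apply: (@lc_exp_inj _ _ L).
  - by apply: le_trans (NN _ _ r vr1) rer.
  - by apply: le_trans (NN _ _ r h1) rer.
  rewrite -(AP (g * h)%g).1 ?(le_trans vr1)// -(AP g).1 ?(le_trans h1)//.
  by rewrite -(AP h).1 ?(le_trans vr1)// invgM !mulgA.
have A1 : A 1%g = 1%:M.
  apply: (mx_eq_small rN0) => v vr; rewrite mulmx1.
  apply: (@lc_exp_inj _ _ L).
  - by apply: le_trans (NN _ _ r vr) rer.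
  - by apply: le_trans vr _; apply: le_trans rNr rer.
  by rewrite -(AP 1%g).1 ?(le_trans vr)// mul1g invg1 mulg1.
have AV g : A g *m A g^-1%g = 1%:M by rewrite -AM mulVg A1.
have AV' g : A g^-1%g *m A g = 1%:M by rewrite -AM mulgV A1.
have KA k v : K k -> tangent K v -> tangent K (v *m A k).
  move=> Kk Kv.
  have small w : tangent K w -> `|w| <= r / (N + 1) -> tangent K (w *m A k).
    move=> Kw wr; apply: tangent_exp.
      by apply: le_trans (NN _ _ r wr) rer.
    move=> t t0 t1; rewrite scalemxAl.
    have tw : `|t *: w| <= r.
      by rewrite normrZ ger0_norm// (le_trans _ rNr)// (le_trans _ wr)// ler_piMl.
    rewrite -(AP k).1//; apply: (KM); last exact: KV.
    apply: (KM) => //; apply: exp_tangent => //; first exact: tangentZ_ge0.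
    by have := normr_ge0 (t *: w); move: r16 tw; rewrite -/er; lra.
  pose t := r / (N + 1) / (`|v| + 1).
  have v1 : 0 < `|v| + 1 by rewrite ltr_wpDl.
  have t0 : 0 < t by rewrite divr_gt0.
  have : tangent K ((t *: v) *m A k).
    apply: small; first by apply: tangentZ_ge0 => //; exact: ltW.
    rewrite normrZ gtr0_norm// /t mulrAC ler_pdivrMr//; apply: ler_wpM2l.
      exact: ltW.
    by rewrite lerDl.
  rewrite -scalemxAl => /(@tangentZ _ _ L K _ t^-1 sK cK).
  by rewrite scalerA mulVf ?scale1r// gt_eqF.
pose CC := [set P : 'M[R]_n | (forall v, tangent K v -> v *m P = v) /\
  forall v, tangent K (v *m P)].
pose phi k (P : 'M[R]_n) := A k *m P *m A k^-1%g.
pose Phi := [set f | exists2 k, K k & f = phi k].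
have An g : `|A g| <= N.
  apply: mx_norm_le => // i j.
  have := (AP g).2 (delta_mx 0 i); rewrite -rowE => h.
  have : `|delta_mx 0 i : V| <= 1.
    apply: rV_norm_le => // l; rewrite mxE; case: (_ && _); first by rewrite normr1.
    by rewrite normr0.
  move=> h1; have := rV_coord_le (row i (A g)) j; rewrite mxE => h2.
  apply: le_trans h2 (le_trans h _); rewrite -[leRHS]mulr1; exact: ler_wpM2l.
pose M := n%:R * (n%:R * (N * N)) + 1.
have M0 : 0 < M by rewrite ltr_wpDl// !mulr_ge0.
have [||||||||||Q [Q1 Q2] QP] := @bounded_group_fixed_point R n n Phi CC M M0.
- by exists (phi 1%g), 1%g.
- by move=> _ [k _ ->] x y; rewrite /phi mulmxBr mulmxBl.
- by move=> _ [k _ ->] x y; rewrite /phi -scalemxAr -scalemxAl mulmxDr mulmxDl.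
- move=> _ [k _ ->] x; rewrite /phi /M mulrDl mul1r.
  apply: le_trans (mulmx_norm _ _) _; apply: ler_wpDr => //.
  rewrite -mulrA; apply: ler_wpM2l => //.
  have h1 : `|A k *m x| <= n%:R * (N * `|x|).
    by apply: le_trans (mulmx_norm _ _) _; apply: ler_wpM2l => //; exact: ler_wpM2r.
  have -> : n%:R * (N * N) * `|x| = n%:R * (N * `|x|) * N by ring.
  exact: ler_pM.
- move=> _ _ [k Kk ->] [l Kl ->]; exists (l * k)%g; first exact: KM.
  by apply/funext => P; rewrite /phi /= AM invgM AM !mulmxA.
- move=> _ [k Kk ->]; exists (phi k^-1%g); first by exists k^-1%g => //; exact: KV.
  by move=> P; rewrite /phi invgK !mulmxA AV' mul1mx -mulmxA AV' mulmx1.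
- move=> P clP.
  have near e : 0 < e -> exists2 P', CC P' & `|P - P'| <= e.
    move=> e_gt0; have nP : nbhs P [set P' | `|P - P'| <= e].
      by apply/nbhs_ballP; exists e => //= P'; rewrite -ball_normE => /ltW.
    by have [P' [? ?]] := clP _ nP; exists P'.
  have zero (a b : nat) (x : 'M[R]_(a, b)) (k : R) : 0 <= k ->
      (forall e, 0 < e -> `|x| <= k * e) -> x = 0.
    move=> k0 H; apply/eqP; rewrite -normr_le0; apply/ler_addgt0Pr => e e_gt0.
    rewrite add0r; have k1 : 0 < k + 1 by rewrite ltr_wpDl.
    apply: le_trans (H (e / (k + 1)) _) _; first by rewrite divr_gt0.
    rewrite mulrA ler_pdivrMr// mulrC; apply: ler_wpM2l; first exact: ltW.
    by rewrite lerDl.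
  split=> v.
    move=> Kv; apply/eqP; rewrite -subr_eq0; apply/eqP.
    apply: (zero _ _ _ (n%:R * `|v|)); first by rewrite mulr_ge0.
    move=> e e_gt0; have [P' [P1 _] Pe] := near _ e_gt0.
    rewrite -{2}(P1 _ Kv) -mulmxBr; apply: le_trans (mulmx_norm _ _) _.
    by rewrite -mulrA; apply: ler_wpM2l => //; exact: ler_wpM2l.
  apply/coker; apply: (zero _ _ _ (n%:R * (n%:R * `|v| * `|cokermx S|))).
    by rewrite !mulr_ge0.
  move=> e e_gt0; have [P' [_ P2] Pe] := near _ e_gt0.
  have -> : v *m P *m cokermx S = v *m (P - P') *m cokermx S.
    by rewrite mulmxBr mulmxBl [v *m P' *m _](coker _).1 ?subr0.
  apply: le_trans (mulmx_norm _ _) _; rewrite -[leRHS]mulrA; apply: ler_wpM2l => //.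
  have -> : n%:R * `|v| * `|cokermx S| * e = n%:R * (`|v| * e) * `|cokermx S| by ring.
  apply: ler_wpM2r => //; apply: le_trans (mulmx_norm _ _) _.
  by apply: ler_wpM2l => //; exact: ler_wpM2l.
- exists (proj_mx S S^C%MS); split=> v.
    by move=> /SP; apply: proj_mx_id; exact: capmx_compl.
  by apply/SP; exact: proj_mx_sub.
- move=> x y [x1 x2] [y1 y2]; split=> v.
    move=> Kv; rewrite -scalemxAr mulmxDr x1// y1//.
    have half (w : V) : 2^-1 *: (w + w) = w by apply/rowP => i; rewrite !mxE; field.
    exact: half.
  by rewrite -scalemxAr mulmxDr; apply: tangentZ => //; exact: tangentD.
- move=> _ x [k Kk ->] [x1 x2]; split=> v.
    by move=> Kv; rewrite /phi !mulmxA x1; [rewrite -mulmxA AV mulmx1|exact: KA].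
  by rewrite /phi !mulmxA; apply: KA; [exact: KV|exact: x2].
exists Q, r, N; split => //.
- by move=> v; split; [exact: Q1|move=> <-; exact: Q2].
move=> k Kk; exists (A k); split; [|exact: (AP k).1|exact: (AP k).2].
have := QP (phi k) (ex_intro2 _ _ k Kk erefl); rewrite /phi => E.
by rewrite -[in RHS]E -(mulmxA (A k *m Q)) AV' mulmx1.
Qed.

(** The transversal consists of the conjugates under K of the exponentials of
    small vectors in an invariant complement of the tangent space. By invariance
    these conjugates are again exponentials of small vectors in the complement,
    so they lie in distinct cosets of K. *)
Lemma invariant_transversal K : is_subgroup K -> closed K ->
  exists T : set G, [/\ compact T, T 1%g,
    forall k t, K k -> T t -> T (k * t * k^-1)%g,
    forall t t', T t -> T t' -> K (t^-1 * t')%g -> t = t' &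
    nbhs 1%g [set g | exists t k, [/\ T t, K k & g = (t * k)%g]]].
Proof.
move=> sK cK; have [K1 KM KV] := sK; have e0 := er0.
have [Q [r [M [[r0 r16] M0 KQ QK AQ]]]] := invariant_projection sK cK.
have [d d0 dP] := @transversal_inj _ _ L K Q (fun v Kv => (KQ v).1 Kv).
have [d1 d10 d1P] := @exp_split_diff _ _ L Q.
have [N N0 NQ] := mulmx_norm_bound Q.
have M1 : 0 < M + 1 by rewrite ltr_wpDl.
pose e := Num.min r (d / (M + 1)).
have e_gt0 : 0 < e by rewrite lt_min r0 divr_gt0.
have er_le : e <= r by rewrite ge_min lexx.
have Me : M * e <= d.
  have : e <= d / (M + 1) by rewrite ge_min lexx orbT.
  rewrite ler_pdivlMr// mulrDr mulr1 mulrC; apply: le_trans.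
  by rewrite lerDl ltW.
pose D := [set p : V | `|p| <= e /\ p *m Q = 0].
pose F := fun kp : G * V => (kp.1 * lc_exp kp.2 * kp.1^-1)%g.
have FP k p : K k -> D p -> exists v : V, [/\ F (k, p) = lc_exp v, `|v| <= d & v *m Q = 0].
  move=> Kk [pe pQ]; have [B [BQ Bexp BM]] := AQ k Kk.
  exists (p *m B); split; first by rewrite /F /= Bexp// (le_trans pe).
    by apply: le_trans (BM p) (le_trans _ Me); exact: ler_wpM2l.
  by rewrite -mulmxA BQ mulmxA pQ mul0mx.
exists (F @` (K `*` D)); split.
- apply: continuous_compact.
    apply: continuous_in_subspaceT => -[k p] /set_mem[/= _ [pe _]].
    have ce : {for (k, p), continuous (fun kp : G * V => lc_exp kp.2 : G)}.
      apply: (@continuous_at_comp _ _ _ snd (@lc_exp R G L)); first exact: cvg_snd.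
      by apply: lc_exp_continuous => /=; lra.
    apply: (@mulg_continuous_at _ _ (fun kp : G * V => (kp.1 * lc_exp kp.2)%g)
      (fun kp => kp.1^-1%g)); last by apply: invg_continuous_at; exact: cvg_fst.
    by apply: mulg_continuous_at => //; exact: cvg_fst.
  apply: compact_setX; first exact: subclosed_compact cK cG _.
  apply: bounded_closed_compact.
    by exists e; split; [exact: num_real|move=> x ex p [pe _] /=; apply: le_trans pe (ltW ex)].
  move=> p clp.
  have near a : 0 < a -> exists2 p', D p' & `|p - p'| <= a.
    move=> a0; have nP : nbhs p [set p' | `|p - p'| <= a].
      by apply/nbhs_ballP; exists a => //= p'; rewrite -ball_normE => /ltW.
    by have [p' [? ?]] := clp _ nP; exists p'.
  split.
    apply/ler_addgt0Pr => a a0; have [p' [p'e _] pp'] := near a a0.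
    rewrite -[p](subrK p') addrC; apply: le_trans (ler_normD _ _) _; exact: lerD.
  apply/eqP; rewrite -normr_le0; apply/ler_addgt0Pr => a a0; rewrite add0r.
  have N1 : 0 < N + 1 by rewrite ltr_wpDl.
  have [|p' [_ p'Q] pp'] := near (a / (N + 1)); first by rewrite divr_gt0.
  have -> : p *m Q = (p - p') *m Q by rewrite mulmxBl p'Q subr0.
  apply: le_trans (NQ _) _; rewrite ler_pdivlMr// in pp'; apply: le_trans pp'.
  by rewrite mulrC; apply: ler_wpM2l => //; rewrite lerDl.
- exists (1%g, 0); last by rewrite /F /= lc_exp0 invg1 !mulg1.
  by split => //=; split; rewrite ?normr0 ?ltW// mul0mx.
- move=> k _ Kk [[l p] [/= Kl Dp] <-]; exists ((k * l)%g, p).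
    by split => //=; exact: KM.
  by rewrite /F /= invgM !mulgA.
- move=> _ _ [[k p] [/= Kk Dp] <-] [[k' p'] [/= Kk' Dp'] <-].
  have [v [-> vd vQ]] := FP k p Kk Dp; have [v' [-> vd' vQ']] := FP k' p' Kk' Dp'.
  by move=> /(dP _ _ vd vd' vQ vQ') ->.
pose b := Num.min d1 (e / (N + 1)).
have N1 : 0 < N + 1 by rewrite ltr_wpDl.
have b0 : 0 < b by rewrite lt_min d10 divr_gt0.
apply: filterS (@exp_split_nbhs _ _ L Q b b0) => g [u ub ->].
have bd1 : b <= d1 by rewrite ge_min lexx.
have be : b <= e / (N + 1) by rewrite ge_min lexx orbT.
have [u1 u2 _ _] := d1P u u (le_trans ub bd1) (le_trans ub bd1).
have ue : (N + 1) * `|u| <= e.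
  by have := le_trans ub be; rewrite ler_pdivlMr// mulrC.
exists (lc_exp (u - u *m Q)), (lc_exp (u *m Q)); split => //.
  exists (1%g, u - u *m Q); last by rewrite /F /= invg1 mul1g mulg1.
  split => //=; split.
    apply: le_trans (ler_normB _ _) (le_trans _ ue).
    by rewrite mulrDl mul1r addrC lerD2r.
  by rewrite mulmxBl ((KQ _).1 (QK u)) subrr.
by apply: exp_tangent => //; move: u2 (normr_ge0 (u *m Q)); rewrite -/er; lra.
Qed.

(** An element of K close to the identity is the product of the exponentials of
    a vector in the complement and of a tangent vector. The former is then also
    in K, hence trivial by [transversal_inj]; so the element lies on a
    one-parameter subgroup of K. *)
Lemma closed_subgroup_paths K (W : set G) : is_subgroup K -> closed K ->
  nbhs 1%g W -> nbhs 1%g [set n | K n -> exists u : R -> G,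
    [/\ continuous u, u 0 = 1%g, u 1 = n & forall s, K (u s) /\ W (u s)]].
Proof.
move=> sK cK W1; have [K1 KM KV] := sK; have e0 := er0.
have [Q [r [M [[r0 r16] M0 KQ QK AQ]]]] := invariant_projection sK cK.
have [d d0 dP] := @transversal_inj _ _ L K Q (fun v Kv => (KQ v).1 Kv).
have [d1 d10 d1P] := @exp_split_diff _ _ L Q.
have [N N0 NQ] := mulmx_norm_bound Q.
have N1 : 0 < N + 1 by rewrite ltr_wpDl.
have [a a0 aW] : exists2 a, 0 < a & forall v : V, `|v| < a -> W (lc_exp v).
  have z : `|0 : V| < er by rewrite normr0.
  have W0 : nbhs (lc_exp (0 : V)) W by rewrite (@lc_exp0 _ _ L).
  have /nbhs_ballP[a /= a0 aW] := lc_exp_continuous z W0.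
  by exists a => // v va; apply: aW; rewrite -ball_normE /= sub0r normrN.
pose b := Num.min (Num.min d1 d) (Num.min (er / 4) (Num.min d (a / 2)) / (N + 1)).
have m0 : 0 < Num.min (er / 4) (Num.min d (a / 2)) by rewrite !lt_min d0 (divr_gt0 e0)// divr_gt0.
have b0 : 0 < b by rewrite !lt_min d0 d10 divr_gt0.
apply: filterS (@exp_split_nbhs _ _ L Q b b0) => g [u].
rewrite /b !le_min => /andP[/andP[ud1 ud] ub] -> Kg.
have [u1 u2 _ _] := d1P u u ud1 ud1.
move: ub; rewrite ler_pdivlMr// !le_min => /and3P[ue1 ue2 ue3].
have uQ : `|u *m Q| <= `|u| * (N + 1).
  by apply: le_trans (NQ u) _; rewrite mulrC; apply: ler_wpM2l => //; rewrite lerDl.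
have uQ' : `|u - u *m Q| <= `|u| * (N + 1).
  apply: le_trans (ler_normB _ _) _; rewrite mulrDr mulr1 addrC lerD2r mulrC.
  exact: NQ.
have expK s : 0 <= s -> s <= 1 -> K (lc_exp (s *: (u *m Q))).
  move=> s0 s1; apply: exp_tangent => //; first exact: tangentZ_ge0.
  rewrite normrZ ger0_norm//; have : s * `|u *m Q| <= `|u *m Q| by rewrite ler_piMl.
  move: u2 (normr_ge0 (u *m Q)); rewrite -/er; lra.
have uE : u - u *m Q = 0.
  apply/esym/dP; rewrite ?normr0 ?mul0mx ?(ltW d0)//.
  - exact: le_trans uQ' ue2.
  - by rewrite mulmxBl ((KQ _).1 (QK u)) subrr.
  rewrite lc_exp0 invg1 mul1g; have := KM _ _ Kg (KV _ (expK 1 ler01 (lexx 1))).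
  by rewrite scale1r /exp_split mulgK.
exists (fun s => lc_exp (Num.max 0 (Num.min 1 s) *: (u *m Q))).
have c01 s : 0 <= Num.max 0 (Num.min 1 s) :> R /\ Num.max 0 (Num.min 1 s) <= 1 :> R.
  by rewrite le_max lexx ge_max ler01 ge_min lexx.
have csmall s : `|Num.max 0 (Num.min 1 s) *: (u *m Q)| <= `|u| * (N + 1).
  have [s0 s1] := c01 s; rewrite normrZ ger0_norm//; apply: le_trans uQ.
  by rewrite ler_piMl.
split.
- move=> s; apply: (@continuous_at_comp _ _ _
    (fun s : R => Num.max 0 (Num.min 1 s) *: (u *m Q)) (@lc_exp R G L)).
    apply: (@cvgZl _ V); apply: (@continuous_max _ _ (fun=> 0)); first exact: cvg_cst.
    by apply: (@continuous_min _ _ (fun=> 1)); [exact: cvg_cst|exact: cvg_id].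
  by apply: lc_exp_continuous; have := csmall s; lra.
- by rewrite (min_idPr ler01) maxxx scale0r lc_exp0.
- by rewrite minxx (max_idPr ler01) scale1r /exp_split uE lc_exp0 mul1g.
move=> s; have [s0 s1] := c01 s; split; first exact: expK.
by apply: aW; have := csmall s; lra.
Qed.

End closed_subgroups.

(** * Selections and paths *)

Section topology.
Implicit Types (S T U W : topologicalType).

Lemma cont_near S T (f : S -> T) s (O : set T) : {for s, continuous f} ->
  nbhs (f s) O -> \forall s' \near s, O (f s').
Proof. by move=> cf Of; exact: (cf O Of). Qed.

Lemma sub_nbhs T (A : set T) (a : A) (O : set A) : nbhs a O ->
  exists2 B, nbhs (set_val a) B & forall a' : A, B (set_val a') -> O a'.
Proof.
move=> aO; have [U [[B oB BU] Ua] UO] : exists2 U, open_nbhs a U & U `<=` O.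
  by move: aO; rewrite nbhsE.
exists B.
  by apply: open_nbhs_nbhs; split => //; move: Ua; rewrite -BU.
by move=> a' Ba'; apply: UO; rewrite -BU.
Qed.

Lemma set_val_continuous T (A : set T) : continuous (set_val : A -> T).
Proof. exact: (@initial_continuous A T set_val). Qed.

Lemma to_sub_continuous_at S T (A : set T) (f : S -> A) s :
  {for s, continuous (fun s => set_val (f s))} -> {for s, continuous f}.
Proof.
move=> cf O /sub_nbhs[B Bfs BO]; have := cont_near cf Bfs.
by apply: filterS => s' /BO.
Qed.

Lemma compact_sub T (A : set T) : compact A -> compact [set: A].
Proof.
move=> /compact_near_coveringP cA; apply/compact_near_coveringP => I F P FF locP.
have : \forall i \near F, A `<=` (fun x => forall a : A, set_val a = x -> P i a).
  apply: (cA I F (fun i x => forall a : A, set_val a = x -> P i a) FF) => x Ax.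
  have [[U V] /= [Ua FV] UV] := locP (SigSub (mem_set Ax) : A) Logic.I.
  have [B Bx BU] := sub_nbhs Ua; exists (B, V) => //= -[x' i] [/= Bx' Vi] a ax'.
  by apply: (UV (a, i)); split => //=; apply: BU; rewrite ax'.
apply: filterS => i AP a _; apply: (AP (set_val a)) => //; exact: set_valP.
Qed.

(** Functions into a Hausdorff space are continuous when they are selected, on a
    compact space of candidates, by a closed condition: of two candidates that
    give different values, one is excluded nearby. *)
Lemma closed_rel_continuous (C S W : topologicalType) (P : C -> S -> Prop)
    (k : C -> S -> W) (h : S -> W) (s : S) :
  compact [set: C] ->
  (forall c, ~ P c s -> \forall p \near (c, s), ~ P p.1 p.2) ->
  (forall c, P c s -> {for (c, s), continuous (fun p => k p.1 p.2)}) ->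
  (\forall s' \near s, exists c, P c s') ->
  (forall c s', P c s' -> h s' = k c s') -> {for s, continuous h}.
Proof.
move=> /compact_near_coveringP cC Pcl kc exP hk O Oh.
have : \forall s' \near s, [set: C] `<=` (fun c => P c s' -> O (k c s')).
  apply: cC => c _; have [Pc|/Pcl] := pselect (P c s).
    have Oc : nbhs (k (c, s).1 (c, s).2) O by rewrite -(hk _ _ Pc).
    by have := cont_near (kc c Pc) Oc; apply: filterS => -[].
  by apply: filterS => -[c' s'] /= nP /nP.
apply: filterS2 exP => s' [c Pc] kO.
by rewrite /= (hk _ _ Pc); exact: kO.
Qed.

Lemma neq_near S T (f g : S -> T) s : hausdorff_space T ->
  {for s, continuous f} -> {for s, continuous g} -> f s <> g s ->
  \forall s' \near s, f s' <> g s'.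
Proof.
rewrite open_hausdorff => hT cf cg /eqP fg.
have [[B1 B2] /= B12 [op1 op2 /eqP B0]] := hT _ _ fg.
have [b1 b2] : B1 (f s) /\ B2 (g s) by case: B12; rewrite !inE.
have n1 : nbhs (f s) B1 by exact: open_nbhs_nbhs.
have n2 : nbhs (g s) B2 by exact: open_nbhs_nbhs.
apply: filterS2 (cont_near cf n1) (cont_near cg n2) => s' b1' b2' e.
have : (B1 `&` B2) (f s') by split => //; rewrite e.
by rewrite B0.
Qed.

Lemma closed_cover_continuous S W (k : S -> W) (B : bool -> set S) :
  (forall b, closed (B b)) -> (forall s, exists b, B b s) ->
  (forall b, continuous (fun s : B b => k (set_val s))) -> continuous k.
Proof.
move=> clB cov ck s O Os.
have ok b : \forall s' \near s, B b s' -> O (k s').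
  have [Bs|nBs] := pselect (B b s).
    have [V Vs VO] := sub_nbhs (ck b (SigSub (mem_set Bs)) O Os).
    apply: filterS Vs => s' Vs' Bs'.
    exact: (VO (SigSub (mem_set Bs') : B b)).
  have oB : open (~` B b) by exact: closed_openC.
  by apply: filterS (open_nbhs_nbhs (conj oB nBs)) => s' nB /nB.
apply: filterS2 (ok true) (ok false) => s' o1 o2.
by have [[]] := cov s'.
Qed.

End topology.

Section real_line.
Variable R : realType.
Implicit Types (S T : topologicalType) (a b c t : R).

Lemma near_lt S (f : S -> R) s c : {for s, continuous f} -> f s < c ->
  \forall s' \near s, f s' < c.
Proof.
move=> cf fc; have d0 : 0 < c - f s by rewrite subr_gt0.
have nb : nbhs (f s) [set y | y < c].
  apply/nbhs_ballP; exists (c - f s) => //= y; rewrite -ball_normE /= => yb.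
  have := ler_norm (y - f s); rewrite distrC; move: yb; lra.
exact: (cf _ nb).
Qed.

Lemma near_gt S (f : S -> R) s c : {for s, continuous f} -> c < f s ->
  \forall s' \near s, c < f s'.
Proof.
move=> cf fc; have := @near_lt S (fun s => - f s) s (- c).
rewrite ltrN2 => /(_ _ fc) h.
have : \forall s' \near s, - f s' < - c by apply: h; exact: cvgN.
by apply: filterS => s'; rewrite ltrN2.
Qed.

Lemma near_itv t (P : R -> Prop) : (\forall s \near t, P s) ->
  exists2 d, 0 < d & forall s, `|s - t| < d -> P s.
Proof.
case/nbhs_ballP => d /= d0 dP; exists d => // s st; apply: dP.
by rewrite -ball_normE /= distrC.
Qed.

Lemma paste_continuous S T (tau : S -> R) (f g : S -> T) c :
  continuous tau -> continuous f -> continuous g ->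
  (forall s, tau s = c -> f s = g s) ->
  continuous (fun s => if tau s <= c then f s else g s).
Proof.
move=> ct cf cg fg s O; case: (ltgtP (tau s) c) => [tc|tc|tc] Os.
- have := near_lt (ct s) tc; apply: filterS2 (cont_near (cf s) Os) => s' Of s'c.
  by rewrite /= (ltW s'c).
- have := near_gt (ct s) tc; apply: filterS2 (cont_near (cg s) Os) => s' Og s'c.
  by rewrite /= leNgt s'c.
have Os' : nbhs (g s) O by rewrite -(fg _ tc).
by apply: filterS2 (cont_near (cf s) Os) (cont_near (cg s) Os') => s' o1 o2 /=; case: ifP.
Qed.

Definition clamp a b t := Num.max a (Num.min b t).

Lemma clamp_continuous a b : continuous (clamp a b).
Proof.
move=> t; apply: (@continuous_max _ _ (fun=> a)); first exact: cvg_cst.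
by apply: (@continuous_min _ _ (fun=> b)); [exact: cvg_cst|exact: cvg_id].
Qed.

Lemma clamp_id a b t : a <= t -> t <= b -> clamp a b t = t.
Proof. by move=> at_ tb; rewrite /clamp (min_idPr tb) (max_idPr at_). Qed.

Lemma clamp_itv a b t : a <= b -> a <= clamp a b t /\ clamp a b t <= b.
Proof. by move=> ab; rewrite /clamp le_max lexx ge_max ab ge_min lexx. Qed.

(** [Q] holds all along the path, while [Y] is the condition at the endpoints
    that allows a continuation. The supremum of the points that can be reached
    from [a] can itself be passed. *)
Lemma path_on_segment T (Y Q : R -> T -> Prop) a b :
  (forall c, a <= c -> c <= b -> exists2 d, 0 < d & forall t1 t2 y,
     a <= t1 -> t1 < t2 -> t2 <= b -> `|t1 - c| < d -> `|t2 - c| < d -> Y t1 y ->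
     exists s : R -> T, [/\ continuous s, s t1 = y, Y t2 (s t2) &
       forall t, t1 <= t -> t <= t2 -> Q t (s t)]) ->
  a < b -> forall y, Y a y ->
  exists s : R -> T, [/\ continuous s, s a = y, Y b (s b) &
    forall t, a <= t -> t <= b -> Q t (s t)].
Proof.
move=> loc ab y Yy.
pose E := [set t | [/\ a < t, t <= b & exists s : R -> T,
  [/\ continuous s, s a = y, Y t (s t) & forall u, a <= u -> u <= t -> Q u (s u)]]].
have Esup : has_sup E.
  split; last by exists b => t [].
  have [d d0 dP] := loc a (lexx _) (ltW ab).
  have a2 : a < Num.min b (a + d / 2) by rewrite lt_min ab ltrDl divr_gt0.
  exists (Num.min b (a + d / 2)); split => //; first by rewrite ge_min lexx.
  apply: dP => //; first by rewrite ge_min lexx.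
    by rewrite subrr normr0.
  rewrite gtr0_norm ?subr_gt0//.
  have : Num.min b (a + d / 2) <= a + d / 2 by rewrite ge_min lexx orbT.
  lra.
have Ele t : E t -> t <= sup E by move=> Et; apply: ub_le_sup => //; case: Esup.
have cb : sup E <= b by apply: ge_sup; [case: Esup|move=> t []].
have [t0 Et0] := Esup.1; have ac : a <= sup E.
  by apply: le_trans (Ele _ Et0); case: Et0 => /ltW.
have [d d0 dP] := loc _ ac cb.
have [t1 Et1 dt1] := sup_adherent d0 Esup.
have t1c := Ele _ Et1; have [at1 t1b [s1 [cs1 s1a Y1 Q1]]] := Et1.
have [<-|t1nb] := eqVneq t1 b; first by exists s1.
have t1b' : t1 < b by rewrite lt_neqAle t1nb.
pose t2 := Num.min b (sup E + d / 2).
have t12 : t1 < t2 by rewrite lt_min t1b' (le_lt_trans t1c)// ltrDl divr_gt0.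
have t2b : t2 <= b by rewrite ge_min lexx.
have t2d : t2 <= sup E + d / 2 by rewrite ge_min lexx orbT.
have n1 : `|t1 - sup E| < d by rewrite ltr_norml; apply/andP; split; lra.
have n2 : `|t2 - sup E| < d by rewrite ltr_norml; apply/andP; split; lra.
have [s2 [cs2 s2a Y2 Q2]] := dP t1 t2 _ (ltW at1) t12 t2b n1 n2 Y1.
have Et2 : E t2.
  split => //; first exact: lt_trans t12.
  exists (fun t => if t <= t1 then s1 t else s2 t); split.
  - apply: (@paste_continuous _ _ id) => //; first by move=> t; exact: cvg_id.
    by move=> t ->; rewrite s2a.
  - by rewrite (ltW at1).
  - by rewrite leNgt t12.
  move=> u au ut; case: leP => ut1; first exact: Q1.
  by apply: Q2 => //; exact: ltW.
have t2c := Ele _ Et2.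
have : t2 = b.
  by apply: le_anti; rewrite t2b /=; move: t2c; rewrite /t2 minElt; case: ifP; lra.
by move: Et2 => [_ _ [s [? ? ? ?]]] <-; exists s.
Qed.

Lemma path_on_ray T (b : nat -> R) (Y : nat -> T -> Prop)
    (Q : nat -> R -> T -> Prop) :
  (forall n, b n < b n.+1) -> (forall t, exists n, t < b n) ->
  (forall n y, Y n y -> exists s : R -> T, [/\ continuous s, s (b n) = y,
     Y n.+1 (s (b n.+1)) & forall t, b n <= t -> t <= b n.+1 -> Q n t (s t)]) ->
  forall y, Y 0%N y -> exists s : R -> T, [/\ continuous s, s (b 0%N) = y &
    forall n t, b n <= t -> t <= b n.+1 -> Q n t (s t)].
Proof.
move=> bS binf step y Y0.
have b_le n m : (n <= m)%N -> b n <= b m.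
  elim: m => [|m IH]; first by rewrite leqn0 => /eqP->.
  rewrite leq_eqVlt => /predU1P[->//|/IH h]; exact: le_trans h (ltW (bS m)).
pose P n (f : R -> T) := [/\ continuous f, f (b 0%N) = y, Y n (f (b n)) &
  forall k t, (k < n)%N -> b k <= t -> t <= b k.+1 -> Q k t (f t)].
have ex (nf : nat * (R -> T)) : exists f', P nf.1 nf.2 ->
    P nf.1.+1 f' /\ forall t, t <= b nf.1 -> f' t = nf.2 t.
  case: nf => n f /=; have [Pf|] := pselect (P n f); last by exists f.
  have [cf f0 Yf Qf] := Pf; have [s [cs sn Ys Qs]] := step _ _ Yf.
  exists (fun t => if t <= b n then f t else s t) => _.
  split; last by move=> t ->.
  split.
  - apply: (@paste_continuous _ _ id) => //; first by move=> t; exact: cvg_id.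
    by move=> t ->; rewrite sn.
  - by rewrite b_le.
  - by rewrite leNgt bS.
  move=> k t; rewrite ltnS leq_eqVlt => /predU1P[->|kn] kt tk.
    case: leP => tn; last exact: Qs.
    have -> : t = b n by apply/le_anti/andP.
    by rewrite -sn; apply: Qs => //; exact: ltW.
  by rewrite (le_trans tk (b_le _ _ kn)); exact: Qf.
have [F FP] := choice ex.
pose f := fix f n := if n is m.+1 then F (m, f m) else (fun=> y).
have Pf n : P n (f n).
  elim: n => [|n IH]; last by have [] := FP (n, f n) IH.
  by split => // t; exact: cvg_cst.
have fS n t : t <= b n -> f n.+1 t = f n t.
  by have [_] := FP (n, f n) (Pf n); exact.
have fle n m t : (n <= m)%N -> t <= b n -> f m t = f n t.
  move=> + tn; elim: m => [|m IH]; first by rewrite leqn0 => /eqP->.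
  rewrite leq_eqVlt => /predU1P[->//|nm]; rewrite -IH//; apply: fS.
  exact: le_trans tn (b_le _ _ (nm : (n <= m)%N)).
have [N NP] := choice binf.
pose s t := f (N t) t.
have sE n t : t <= b n -> s t = f n t.
  move=> tn; have := NP t => /ltW tN; rewrite /s.
  by case/orP: (leq_total n (N t)) => h; [rewrite (fle n)|rewrite (fle (N t) n)].
exists s; split.
- move=> t O Os; have [cf _ _ _] := Pf (N t).
  have : \forall u \near t, u < b (N t) by apply: (near_lt (f := id)) => //; exact: cvg_id.
  apply: filterS2 (cont_near (cf t) Os) => u Ou uN.
  by rewrite /= (sE (N t)) ?ltW.
- by rewrite (sE 0%N).
move=> n t nt tn; rewrite (sE n.+1)//.
by have [_ _ _] := Pf n.+1; apply.
Qed.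

End real_line.

Lemma near_forall_compact (C S : topologicalType) (P : C -> S -> Prop) (s : S) :
  compact [set: C] -> (forall c : C, \forall p \near (c, s), P p.1 p.2) ->
  \forall s' \near s, forall c, P c s'.
Proof.
move=> /compact_near_coveringP cC loc.
have h : \forall s' \near s, [set: C] `<=` (fun c => P c s').
  by apply: cC => c _; exact: loc.
by apply: filterS h => s' h c; exact: h.
Qed.

Lemma pair_continuous_at (S T U : topologicalType) (f : S -> T) (g : S -> U) s :
  {for s, continuous f} -> {for s, continuous g} ->
  {for s, continuous (fun s => (f s, g s))}.
Proof. by move=> cf cg; exact: cvg_pair. Qed.

(** * Local sections with constant isotropy group *)

Section actions.
Variables (R : realType) (G : compactLieGroupType R) (X : metricType R).
Variable A : isometric_action G X.
Implicit Types (H K : set G) (g h w : G) (x y : X).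

Lemma lie_transversal K : is_subgroup K -> closed K -> exists T : set G,
  [/\ compact T, T 1%g, forall k t, K k -> T t -> T (k * t * k^-1)%g,
    forall t t', T t -> T t' -> K (t^-1 * t')%g -> t = t' &
    nbhs 1%g [set g | exists t k, [/\ T t, K k & g = (t * k)%g]]].
Proof.
move=> sK cK; have [m [C CL]] := @lie_atlas R G; have [L _] := lie_coord_exists CL.
exact: (invariant_transversal L (@lie_compact R G) sK cK).
Qed.

Lemma lie_subgroup_paths K (W : set G) : is_subgroup K -> closed K ->
  nbhs 1%g W -> nbhs 1%g [set n | K n -> exists u : R -> G,
    [/\ continuous u, u 0 = 1%g, u 1 = n & forall s, K (u s) /\ W (u s)]].
Proof.
move=> sK cK W1; have [m [C CL]] := @lie_atlas R G.
have [L _] := lie_coord_exists CL.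
exact: (closed_subgroup_paths L (@lie_compact R G) sK cK W1).
Qed.

Lemma mdist_near (S : topologicalType) (f : S -> X) s (e : R) : 0 < e ->
  {for s, continuous f} -> \forall s' \near s, mdist (f s) (f s') < e.
Proof.
move=> e0 cf; have := cont_near cf (nbhsx_ballx (f s) e e0).
by apply: filterS => s'; rewrite ballEmdist.
Qed.

Lemma mdist_continuous_at (S : topologicalType) (f f' : S -> X) s :
  {for s, continuous f} -> {for s, continuous f'} ->
  {for s, continuous (fun s => mdist (f s) (f' s))}.
Proof.
move=> cf cf' O /nbhs_ballP[e /= e0 eO]; have e20 : 0 < e / 2 by rewrite divr_gt0.
have h1 := mdist_near e20 cf; have h2 := mdist_near e20 cf'.
have : \forall s' \near s, O (mdist (f s') (f' s')).
  apply: filterS2 h1 h2 => s' d1 d2; apply: eO; rewrite -ball_normE /= ltr_norml.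
  have t1 := metric_triangle (f s) (f s') (f' s).
  have t2 := metric_triangle (f s') (f' s') (f' s).
  have t3 := metric_triangle (f s') (f s) (f' s').
  have t4 := metric_triangle (f s) (f' s) (f' s').
  rewrite (metric_sym (f' s') (f' s)) in t2; rewrite (metric_sym (f s') (f s)) in t3.
  by apply/andP; split; lra.
exact.
Qed.

Lemma metric_continuous (S : topologicalType) (f : S -> X) s :
  (forall e, 0 < e -> \forall s' \near s, mdist (f s) (f s') < e) ->
  {for s, continuous f}.
Proof.
move=> h O /nbhs_ballP[e /= e0 eO].
have : \forall s' \near s, O (f s').
  by apply: filterS (h e e0) => s' d; apply: eO; rewrite ballEmdist.
exact.
Qed.

Lemma act_continuous_at (S : topologicalType) (f : S -> G) (y : S -> X) s :
  {for s, continuous f} -> {for s, continuous y} ->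
  {for s, continuous (fun s => A (f s) (y s))}.
Proof.
move=> cf cy; apply: (@continuous_at_comp _ _ _ (fun s => (f s, y s))
  (fun p : G * X => A p.1 p.2)); first exact: cvg_pair.
exact: act_continuous.
Qed.

Lemma actK g : cancel (A g) (A g^-1%g).
Proof. by move=> x; rewrite -actM mulVg act1. Qed.

Lemma actVK g : cancel (A g^-1%g) (A g).
Proof. by move=> x; rewrite -actM mulgV act1. Qed.

Lemma isotropy_subgroup x : is_subgroup (isotropy A x).
Proof.
split=> [|g h|g]; rewrite /isotropy /=; first exact: act1.
  by rewrite actM => gx ->.
by move=> gx; rewrite -{1}gx actK.
Qed.

Lemma isotropy_closed x : closed (isotropy A x).
Proof.
move=> g clg; apply: contrapT => gx.
have : \forall g' \near g, A g' x <> x.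
  apply: (@neq_near _ _ (fun g => A g x) (fun=> x)) gx; first exact: metric_hausdorff.
    by apply: act_continuous_at; [exact: cvg_id|exact: cvg_cst].
  exact: cvg_cst.
by move=> /clg[g' [h nh]].
Qed.

Lemma conj_setP H g k : conj_set H g k <-> H (g^-1 * k * g)%g.
Proof.
split=> [[h Hh <-]|Hk]; first by rewrite !mulgA mulVg mul1g mulgVK.
by exists (g^-1 * k * g)%g => //; rewrite !mulgA mulgV mul1g mulgK.
Qed.

Lemma isotropy_act g x : isotropy A (A g x) = conj_set (isotropy A x) g.
Proof.
apply/seteqP; split=> k; rewrite conj_setP /isotropy /= !actM.
  by move=> ->; rewrite actK.
by move=> /(congr1 (A g)); rewrite actVK.
Qed.

Lemma conj_setM H g h : conj_set (conj_set H h) g = conj_set H (g * h)%g.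
Proof.
by apply/seteqP; split=> k; rewrite !conj_setP invgM !mulgA.
Qed.

Lemma conj_set1 H : conj_set H 1%g = H.
Proof. by apply/seteqP; split=> k; rewrite !conj_setP invg1 mul1g mulg1. Qed.

(** In a compact group the powers of an element accumulate at its inverse. *)
Lemma closed_monoid_inv (S : set G) : closed S ->
  (forall g h, S g -> S h -> S (g * h)%g) -> S 1%g -> forall g, S g -> S g^-1%g.
Proof.
move=> clS SM S1 g Sg; have SX (i : nat) : S (g ^+ i)%g.
  by elim: i => [|n IH]; [rewrite expg0|rewrite expgS; exact: SM].
have [c [_ cl]] := @lie_compact R G ((fun n : nat => (g ^+ n)%g) @ \oo) _ filterT.
apply: clS => O nO.
have : {for (c, c), continuous (fun p : G * G => (p.1^-1 * p.2 * g^-1)%g)}.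
  apply: (@mulg_continuous_at _ _ (fun p : G * G => (p.1^-1 * p.2)%g) (fun=> g^-1%g));
    last exact: cvg_cst.
  apply: (@mulg_continuous_at _ _ (fun p : G * G => p.1^-1%g) snd); last exact: cvg_snd.
  by apply: invg_continuous_at; exact: cvg_fst.
have nO' : nbhs ((c, c).1^-1 * (c, c).2 * g^-1)%g O by rewrite /= mulVg mul1g.
move=> /cont_near/(_ nO')[[V1 V2] /= [cV1 cV2] V12].
have pow (n : nat) : \forall x \near (fun n : nat => (g ^+ n)%g) @ \oo, exists2 m, (n < m)%N & x = (g ^+ m)%g.
  have := nbhs_infty_gt n; move=> h; change (\forall k \near \oo, exists2 m, (n < m)%N & (g ^+ k)%g = (g ^+ m)%g).
  by apply: filterS h => k nk; exists k.
have [_ [[n _ ->] gn]] := cl _ _ (pow 0%N) (filterI cV1 cV2).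
have [_ [[m nm ->] gm]] := cl _ _ (pow n) (filterI cV1 cV2).
exists (g ^+ (m - n.+1))%g; split => //.
have := V12 ((g ^+ n)%g, (g ^+ m)%g) (conj gn.1 gm.2); rewrite /=.
have -> : (g ^+ m)%g = (g ^+ n * g ^+ (m - n.+1) * g)%g.
  by rewrite -expgnDr -expgSr -addSn subnKC.
by rewrite !mulgA mulVg mul1g mulgK.
Qed.

Section normalizer.
Variable H : set G.
Hypothesis clH : closed H.

Lemma conj_sub_closed : closed [set g | forall h, H h -> H (g * h * g^-1)%g].
Proof.
move=> g clg h Hh; apply: clH => O nO.
have : {for g, continuous (fun g => (g * h * g^-1)%g)}.
  apply: (@mulg_continuous_at _ _ (fun g => (g * h)%g) (fun g => g^-1%g)).
    by apply: mulg_continuous_at; [exact: cvg_id|exact: cvg_cst].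
  by apply: invg_continuous_at; exact: cvg_id.
move=> /cont_near/(_ nO)/clg[g' [gH gO]].
by exists (g' * h * g'^-1)%g; split => //; exact: gH.
Qed.

Lemma normalizerP n : normalizer H n <-> forall h, H h -> H (n * h * n^-1)%g.
Proof.
split=> [nH h Hh|nH]; first by rewrite -{1}nH; exists h.
have nV : forall h, H h -> H (n^-1 * h * n^-1^-1)%g.
  apply: (closed_monoid_inv conj_sub_closed) => //.
    by move=> g k gH kH h Hh; have := gH _ (kH _ Hh); rewrite invgM !mulgA.
  by move=> h Hh; rewrite mul1g invg1 mulg1.
apply/seteqP; split=> [_ [h Hh <-]|h Hh]; first exact: nH.
by apply/conj_setP; have := nV h Hh; rewrite invgK.
Qed.

Lemma normalizer_subgroup : is_subgroup (normalizer H).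
Proof.
split; rewrite /normalizer /=; first exact: conj_set1.
  by move=> g h gH hH; rewrite -conj_setM hH.
by move=> g gH; rewrite -[X in conj_set X _]gH conj_setM mulVg conj_set1.
Qed.

Lemma normalizer_closed : closed (normalizer H).
Proof.
have -> : normalizer H = [set g | forall h, H h -> H (g * h * g^-1)%g].
  by apply/seteqP; split=> g; rewrite normalizerP.
exact: conj_sub_closed.
Qed.

(** A conjugate of a closed subgroup of a compact group that is contained in
    another conjugate is equal to it, by [closed_monoid_inv]. So an isotropy group
    that is known to be conjugate to [H] is determined by the inclusion of a
    conjugate, which is a closed condition. *)
Lemma conj_set_eq g w : (forall h, H h -> conj_set H w (g * h * g^-1)%g) ->
  conj_set H w = conj_set H g.
Proof.
move=> gw; have : normalizer H (w^-1 * g)%g.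
  apply/normalizerP => h /gw/conj_setP; rewrite invgM invgK !mulgA; exact.
by move=> nwg; rewrite -{1}nwg conj_setM mulgA mulgV mul1g.
Qed.

Lemma conj_set_inj g w : conj_set H g = conj_set H w -> normalizer H (g^-1 * w)%g.
Proof. by move=> gw; rewrite /normalizer /= -conj_setM -gw conj_setM mulVg conj_set1. Qed.

Definition has_type y := exists g, isotropy A y = conj_set H g.

Lemma has_type_act g y : has_type y -> has_type (A g y).
Proof. by move=> [w yw]; exists (g * w)%g; rewrite isotropy_act yw conj_setM. Qed.

Lemma has_type_eq g y : has_type y ->
  (forall h, H h -> isotropy A y (g * h * g^-1)%g) -> isotropy A y = conj_set H g.
Proof. by move=> [w ->] /conj_set_eq. Qed.

Lemma near_not_fix (S : topologicalType) (c : S -> X) g s : {for s, continuous c} ->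
  ~ (forall h, H h -> isotropy A (c s) (g * h * g^-1)%g) ->
  \forall p \near (g, s), ~ (forall h, H h -> isotropy A (c p.2) (p.1 * h * p.1^-1)%g).
Proof.
move=> cc /existsNP[h /not_implyP[Hh gs]].
have c2 : {for (g, s), continuous (fun p : G * S => c p.2)}.
  by apply: (@continuous_at_comp _ _ _ snd c) => //; exact: cvg_snd.
have : \forall p \near (g, s), A (p.1 * h * p.1^-1)%g (c p.2) <> c p.2.
  apply: (@neq_near _ _ (fun p : G * S => A (p.1 * h * p.1^-1)%g (c p.2))
    (fun p => c p.2)) => //; first exact: metric_hausdorff.
  apply: act_continuous_at => //.
  apply: (@mulg_continuous_at _ _ (fun p : G * S => (p.1 * h)%g) (fun p => p.1^-1%g)).
    by apply: mulg_continuous_at; [exact: cvg_fst|exact: cvg_cst].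
  by apply: invg_continuous_at; exact: cvg_fst.
by apply: filterS => p np /(_ h Hh).
Qed.

Section section_over_curve.
Variable c : R -> X.
Hypothesis cc : continuous c.

(** The points of the orbit of [c t] whose isotropy group is exactly [H]; they
    form one orbit of the normalizer. *)
Definition exact_over t y := (exists g, y = A g (c t)) /\ isotropy A y = H.

Lemma exact_over_normalizer t y n : normalizer H n -> exact_over t y ->
  exact_over t (A n y).
Proof.
move=> nn [[g yg] yH]; split; first by exists (n * g)%g; rewrite yg actM.
by rewrite isotropy_act yH.
Qed.

Lemma exact_over_trans t y y' : exact_over t y -> exact_over t y' ->
  exists2 n, normalizer H n & y' = A n y.
Proof.
move=> [[g yg] yH] [[g' yg'] yH']; exists (g' * g^-1)%g.
  rewrite /normalizer /= -{1}yH -isotropy_act yg -actM mulgVK -yg'; exact: yH'.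
by rewrite yg -actM mulgVK.
Qed.

Lemma exact_over_exists t : has_type (c t) -> exists y, exact_over t y.
Proof.
move=> [g cg]; exists (A g^-1%g (c t)); split; first by exists g^-1%g.
by rewrite isotropy_act cg conj_setM mulVg conj_set1.
Qed.

(** A transversal of the normalizer meets the set of the [w] that conjugate [H]
    to the isotropy group of [c t] in exactly one point, which moves
    continuously because the isotropy group is upper semicontinuous. *)
Lemma local_section t0 y : (\forall t \near t0, has_type (c t)) -> exact_over t0 y ->
  exists s : R -> X, [/\ continuous s, s t0 = y &
    exists2 d, 0 < d & forall t, `|t - t0| <= d -> exact_over t (s t)].
Proof.
move=> typ [[g yg] yH]; pose c' t := A g (c t).
have cc' : continuous c'.
  by move=> t; apply: act_continuous_at; [exact: cvg_cst|exact: cc].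
have typ' : \forall t \near t0, has_type (c' t).
  by apply: filterS typ => t; exact: has_type_act.
have iso0 : isotropy A (c' t0) = H by rewrite /c' -yg.
have [T [cT T1 _ Tinj Tnbhs]] :=
  lie_transversal normalizer_subgroup normalizer_closed.
pose W : set G := [set g : G | exists t k : G, [/\ T t, normalizer H k & g = (t * k)%g]].
have nearW : \forall t \near t0, forall w,
    (forall h, H h -> isotropy A (c' t) (w * h * w^-1)%g) ->
    exists2 n, normalizer H n & W (w * n)%g.
  apply: (@near_forall_compact G R (fun w t =>
    (forall h, H h -> isotropy A (c' t) (w * h * w^-1)%g) ->
    exists2 n, normalizer H n & W (w * n)%g) t0 (@lie_compact R G)) => w0.
  have [fix0|/(near_not_fix (cc' t0))] :=
    pselect (forall h, H h -> isotropy A (c' t0) (w0 * h * w0^-1)%g).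
    have nw0 : normalizer H w0 by apply/normalizerP; rewrite -{2}iso0.
    have ct : {for (w0, t0), continuous (fun p : G * R => (p.1 * w0^-1)%g)}.
      by apply: mulg_continuous_at; [exact: cvg_fst|exact: cvg_cst].
    have nW : nbhs ((w0, t0).1 * w0^-1)%g W by rewrite /= mulgV.
    apply: filterS (cont_near ct nW) => -[w t] /= Ww _.
    by exists w0^-1%g => //; have [_ _] := normalizer_subgroup; exact.
  by apply: filterS => -[w t] /= nf /nf.
have [d d0 dP] := near_itv (filterI nearW typ').
have exT t : `|t - t0| < d -> exists2 w, T w & isotropy A (c' t) = conj_set H w.
  move=> /dP[wP [w tw]]; have [|n nn [tau [k [Tt nk wn]]]] := wP w.
    by move=> h Hh; rewrite tw; apply/conj_setP; rewrite !mulgA mulVg mul1g mulgVK.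
  exists tau => //; have -> : tau = (w * n * k^-1)%g by rewrite wn mulgK.
  have [_ NM NV] := normalizer_subgroup.
  have nk' : normalizer H (n * k^-1)%g by apply: NM => //; exact: NV.
  by rewrite -mulgA -conj_setM nk'.
have Tuniq t w w' : T w -> T w' -> isotropy A (c' t) = conj_set H w ->
    isotropy A (c' t) = conj_set H w' -> w = w'.
  move=> Tw Tw' e e'; apply: Tinj => //; apply: conj_set_inj; exact: etrans e'.
have exT' t : exists w : G, `|t - t0| < d ->
    T w /\ isotropy A (c' t) = conj_set H w.
  by have [/exT[w Tw tw]|nt] := pselect (`|t - t0| < d); [exists w|exists 1%g].
have [tau tauP] := choice exT'.
have ctau t : `|t - t0| < d -> {for t, continuous tau}.
  move=> td; pose P (w : T) (s : R) := `|s - t0| < d /\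
      forall h, H h -> isotropy A (c' s) (set_val w * h * (set_val w)^-1)%g.
  have cr := @closed_rel_continuous T R G P (fun (w : T) _ => set_val w) tau t.
  apply: cr.
  - exact: compact_sub.
  - move=> w nP; have nf : ~ (forall h, H h ->
        isotropy A (c' t) (set_val w * h * (set_val w)^-1)%g) by move=> h; exact: nP.
    have := near_not_fix (cc' t) nf => hn.
    have cv : {for (w, t), continuous (fun p : T * R => (set_val p.1 : G, p.2))}.
      apply: pair_continuous_at; last exact: cvg_snd.
      apply: (@continuous_at_comp _ _ _ fst (set_val : T -> G)); first exact: cvg_fst.
      exact: set_val_continuous.
    by apply: filterS (cont_near cv hn) => -[w' t'] /= nn [_] /nn.
  - move=> w _; apply: (@continuous_at_comp _ _ _ fst (set_val : T -> G)).
      exact: cvg_fst.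
    exact: set_val_continuous.
  - have ct : {for t, continuous (fun s : R => `|s - t0|)}.
      by apply: cvg_norm; apply: cvgB; [exact: cvg_id|exact: cvg_cst].
    apply: filterS (near_lt ct td) => s sd; have [Tw ws] := tauP s sd.
    exists (SigSub (mem_set Tw) : T); split => // h Hh /=; rewrite ws.
    by apply/conj_setP; rewrite !mulgA mulVg mul1g mulgVK.
  move=> w s [sd fix_s]; have [Tw ws] := tauP s sd.
  apply: Tuniq Tw (set_valP w) ws _; apply: has_type_eq => //.
  by have [] := dP s sd.
pose cl := clamp (t0 - d / 2) (t0 + d / 2).
have clP t : `|cl t - t0| < d.
  have [|c1 c2] := @clamp_itv _ (t0 - d / 2) (t0 + d / 2) t; first by lra.
  by rewrite ltr_norml; apply/andP; split; rewrite /cl; lra.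
exists (fun t => A (tau (cl t))^-1%g (c' (cl t))); split.
- move=> t; apply: (@continuous_at_comp _ _ _ cl (fun t => A (tau t)^-1%g (c' t))).
    exact: clamp_continuous.
  by apply: act_continuous_at; [apply: invg_continuous_at; exact: ctau|exact: cc'].
- have -> : cl t0 = t0 by apply: clamp_id; lra.
  have t0d : `|t0 - t0| < d by rewrite subrr normr0.
  have [Tt tt] := tauP t0 t0d; have <- : 1%g = tau t0.
    by apply: (Tuniq t0) => //; rewrite iso0 conj_set1.
  by rewrite invg1 act1 /c' -yg.
exists (d / 2); first by rewrite divr_gt0.
move=> t; rewrite ler_norml => /andP[t1 t2].
have -> : cl t = t by apply: clamp_id; lra.
have td : `|t - t0| < d by rewrite ltr_norml; apply/andP; split; lra.
have [Tt tt] := tauP t td; split; first by exists ((tau t)^-1 * g)%g; rewrite actM.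
by rewrite isotropy_act tt conj_setM mulVg conj_set1.
Qed.

(** A section through a given point is obtained from a fixed local section by
    applying an element of the normalizer, which preserves distances; hence [d]
    can be chosen independently of the point. *)
Lemma local_section_through t0 e : (\forall t \near t0, has_type (c t)) -> 0 < e ->
  exists2 d, 0 < d & forall t1 y, `|t1 - t0| < d -> exact_over t1 y ->
  exists s : R -> X, [/\ continuous s, s t1 = y &
    forall t, `|t - t0| < d -> exact_over t (s t) /\ mdist y (s t) < e].
Proof.
move=> typ e0; have [y0 y0P] := exact_over_exists (nbhs_singleton typ).
have [s [cs _ [d d0 sP]]] := local_section typ y0P.
have e20 : 0 < e / 2 by rewrite divr_gt0.
have [d' d'0 d'P] := near_itv (mdist_near e20 (cs t0)).
exists (Num.min d d'); first by rewrite lt_min d0.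
have osc t t' : `|t - t0| < Num.min d d' -> `|t' - t0| < Num.min d d' ->
    mdist (s t) (s t') < e.
  rewrite !lt_min => /andP[_ /d'P h] /andP[_ /d'P h'].
  have := metric_triangle (s t) (s t0) (s t'); rewrite (metric_sym (s t) (s t0)); lra.
move=> t1 y t1d t1y; have t1d' : `|t1 - t0| <= d.
  by move: t1d; rewrite lt_min => /andP[/ltW].
have [n nn yn] := exact_over_trans (sP t1 t1d') t1y.
exists (fun t => A n (s t)); split => //.
  by move=> t; apply: act_continuous_at; [exact: cvg_cst|exact: cs].
move=> t td; split; last by rewrite yn act_isom; exact: osc.
apply: exact_over_normalizer => //; apply: sP.
by move: td; rewrite lt_min => /andP[/ltW].
Qed.

Lemma section_on_segment a b y : a < b ->
  (forall t, a <= t -> t <= b -> \forall t' \near t, has_type (c t')) ->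
  exact_over a y -> exists s : R -> X, [/\ continuous s, s a = y &
    forall t, a <= t -> t <= b -> exact_over t (s t)].
Proof.
move=> ab typ ya.
have [|s [cs sa _ sP]] := @path_on_segment _ _ exact_over exact_over a b _ ab y ya.
  move=> t at_ tb; have [d d0 dP] := local_section_through (typ t at_ tb) ltr01.
  exists d => // t1 t2 y' at1 t12 t2b t1d t2d t1y.
  have [s [cs st1 sP]] := dP t1 y' t1d t1y; exists s; split => //.
    by have [] := sP t2 t2d.
  move=> u u1 u2; have [] // := sP u.
  by move: t1d t2d; rewrite !ltr_norml => /andP[? ?] /andP[? ?]; apply/andP; split; lra.
by exists s.
Qed.

End section_over_curve.
End normalizer.
End actions.

(** * Sections ending at a singular orbit *)

Section straightening.
Variables (R : realType) (G : compactLieGroupType R) (X : metricType R).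
Variable A : isometric_action G X.
Implicit Types (H K : set G) (g h w : G) (x y : X).

(** Away from the points [c] with [f c = x] the distance between [x] and [f c]
    is bounded below, by compactness. *)
Lemma small_displacement (C : topologicalType) (f : C -> X) x (P : C -> Prop) :
  compact [set: C] -> continuous f ->
  (forall c, f c = x -> \forall c' \near c, P c') ->
  exists2 r : R, 0 < r & forall c, mdist x (f c) < r -> P c.
Proof.
move=> cC cf loc.
have h : \forall r \near (0 : R), forall c, mdist x (f c) < r -> P c.
  apply: (@near_forall_compact C R (fun c r => mdist x (f c) < r -> P c)) => // c.
  have c1 : {for (c, 0 : R), continuous (fst : C * R -> C)} by exact: cvg_fst.
  have c2 : {for (c, 0 : R), continuous (snd : C * R -> R)} by exact: cvg_snd.
  have [fx|/eqP fx] := pselect (f c = x).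
    by apply: filterS (cont_near c1 (loc c fx)) => p Pp _.
  have D0 : 0 < mdist x (f c) by rewrite mdist_gt0 eq_sym.
  have e1 : \forall p \near (c, 0 : R), mdist x (f c) / 2 < mdist x (f p.1).
    apply: (@near_gt R _ (fun p : C * R => mdist x (f p.1))); last by rewrite /=; lra.
    apply: mdist_continuous_at; first exact: cvg_cst.
    by apply: (@continuous_at_comp _ _ _ fst f); [exact: c1|exact: cf].
  have e2 : \forall p \near (c, 0 : R), p.2 < mdist x (f c) / 2.
    by apply: (@near_lt R _ (snd : C * R -> R)) => //=; rewrite divr_gt0.
  by apply: filterS2 e1 e2 => p p1 p2 p3; exfalso; lra.
have [d d0 dP] := near_itv h; exists (d / 2); first by rewrite divr_gt0.
by move=> c; apply: dP; rewrite subr0 gtr0_norm ?divr_gt0//; lra.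
Qed.

Section near_fixed_point.
Variables (H : set G) (x : X).
Hypothesis clH : closed H.
Hypothesis Hx : forall h, H h -> A h x = x.

(** Since the transversal [T] is invariant under conjugation by [H], an element
    [t] of [T] for which [t x] is fixed by [H] commutes with [H]. *)
Lemma fixed_near_point (W : set G) : nbhs 1%g W -> exists2 r : R, 0 < r &
  forall g, mdist x (A g x) < r -> (forall h, H h -> A h (A g x) = A g x) ->
  exists m, [/\ normalizer H m, W m & A g x = A m x].
Proof.
move=> W1; have sK := isotropy_subgroup A x.
have [T [cT T1 TK Tinj Tnbhs]] := lie_transversal sK (@isotropy_closed _ _ _ A x).
have [r1 r10 r1P] : exists2 r : R, 0 < r & forall t : T,
    mdist x (A (set_val t) x) < r -> W (set_val t).
  apply: small_displacement; first exact: compact_sub.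
    move=> t; apply: (@act_continuous_at _ _ _ A T (fun t : T => set_val t) (fun=> x)).
      exact: set_val_continuous.
    exact: cst_continuous.
  move=> t tx; have t1 : 1%g = set_val t.
    by apply: Tinj => //; [exact: set_valP|rewrite invg1 mul1g].
  apply: (@cont_near _ _ (set_val : T -> G)); first exact: set_val_continuous.
  by rewrite -t1.
have [r2 r20 r2P] : exists2 r : R, 0 < r & forall g, mdist x (A g x) < r ->
    exists t k, [/\ T t, isotropy A x k & g = (t * k)%g].
  apply: small_displacement; first exact: lie_compact.
    by move=> g; apply: act_continuous_at; [exact: cvg_id|exact: cvg_cst].
  move=> g0 g0x; have cg : {for g0, continuous (fun g => (g * g0^-1)%g)}.
    by apply: mulg_continuous_at; [exact: cvg_id|exact: cvg_cst].
  have nb : nbhs (g0 * g0^-1)%g [set g | exists t k,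
      [/\ T t, isotropy A x k & g = (t * k)%g]] by rewrite mulgV.
  apply: filterS (cont_near cg nb) => g [t [k [Tt Kk e]]].
  exists t, (k * g0)%g; split => //; last by rewrite mulgA -e mulgVK.
  by have [_ KM _] := sK; apply: KM.
exists (Num.min r1 r2); first by rewrite lt_min r10.
move=> g; rewrite lt_min => /andP[g1 g2] gH.
have [t [k [Tt Kk gtk]]] := r2P g g2.
have gx : A g x = A t x by rewrite gtk actM (Kk : A k x = x).
exists t; split => //; last first.
  by apply: (r1P (SigSub (mem_set Tt) : T)); rewrite /= -gx.
apply/(normalizerP clH) => h Hh; suff -> : (t * h * t^-1)%g = h by [].
suff e : (h * t * h^-1)%g = t by rewrite -[X in (X * h)%g]e mulgVK mulgK.
have Hh' : isotropy A x h by exact: Hx.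
apply/esym; apply: Tinj => //; first exact: TK.
have hV : A h^-1%g x = x by rewrite -{1}(Hx Hh) actK.
rewrite /isotropy /= !actM hV.
by rewrite -gx gH// gx actK.
Qed.

Section curve.
Variable c : R -> X.
Hypotheses (cc : continuous c) (c0 : c 0 = x).

(** Otherwise, by compactness of the group, elements [g] that violate the claim
    for smaller and smaller [t] would accumulate at some [g0] for which [g0 x] is
    close to [x] and fixed by [H]. Then [g0 x = m x] for a small element [m] of
    the normalizer, and the inverse of [m] proves the claim near [g0]. *)
Lemma fixed_gap (W : set G) : nbhs 1%g W -> exists2 r : R, 0 < r &
  forall e : R, 0 < e -> exists2 d : R, 0 < d & forall t, `|t| < d ->
  forall g, (forall h, H h -> A h (A g (c t)) = A g (c t)) ->
    mdist x (A g (c t)) <= r ->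
  exists m, [/\ normalizer H m, W m & mdist x (A m (A g (c t))) < e].
Proof.
move=> W1; have cV : {for 1%g, continuous (fun g : G => g^-1%g)}.
  by apply: invg_continuous_at; exact: cvg_id.
have W1' : nbhs (1^-1)%g W by rewrite invg1.
have [r r0 rP] := fixed_near_point (cont_near cV W1').
exists (r / 2); first by rewrite divr_gt0.
move=> e e0.
pose P g t := (forall h, H h -> A h (A g (c t)) = A g (c t)) ->
  mdist x (A g (c t)) <= r / 2 ->
  exists m, [/\ normalizer H m, W m & mdist x (A m (A g (c t))) < e].
have ca g0 : {for (g0, 0 : R), continuous (fun p : G * R => A p.1 (c p.2))}.
  apply: act_continuous_at; first exact: cvg_fst.
  by apply: (@continuous_at_comp _ _ _ snd c); [exact: cvg_snd|exact: cc].
have ch g0 h : {for (g0, 0 : R), continuous (fun p : G * R => A h (A p.1 (c p.2)))}.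
  by apply: act_continuous_at; [exact: cvg_cst|exact: ca].
have : \forall t \near (0 : R), forall g, P g t.
  apply: near_forall_compact; first exact: lie_compact.
  move=> g0; have [fix0|/existsNP[h /not_implyP[Hh nh]]] :=
      pselect (forall h, H h -> A h (A g0 (c 0)) = A g0 (c 0)); last first.
    have := neq_near (@metric_hausdorff R X) (ch g0 h) (ca g0) nh.
    by apply: filterS => -[g t] /= ngt /(_ h Hh).
  have [gr|gr] := ltP (mdist x (A g0 (c 0))) r; last first.
    have : \forall p \near (g0, 0 : R), r / 2 < mdist x (A p.1 (c p.2)).
      apply: (@near_gt R _ (fun p : G * R => mdist x (A p.1 (c p.2)))).
        2: by rewrite /=; lra.
      by apply: mdist_continuous_at; [exact: cvg_cst|exact: ca].
    by apply: filterS => -[g t] /= l _; rewrite leNgt l.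
  rewrite c0 in fix0 gr; have [m [nm Wm gm]] := rP g0 gr fix0.
  have cm := ch g0 m^-1%g.
  have : \forall p \near (g0, 0 : R), mdist x (A m^-1%g (A p.1 (c p.2))) < e.
    apply: (@near_lt R _ (fun p : G * R => mdist x (A m^-1%g (A p.1 (c p.2))))).
      by apply: mdist_continuous_at; [exact: cvg_cst|exact: cm].
    by rewrite /= c0 gm actK mdistxx.
  apply: filterS => -[g t] /= l _ _; exists m^-1%g; split => //.
  by have [_ _] := normalizer_subgroup H; exact.
move=> /near_itv[d d0 dP]; exists d => // t td; apply: dP.
by rewrite subr0.
Qed.

End curve.

(** A section that is close to [x] can be kept close to [x]: by [fixed_gap] it is
    corrected by small elements of the normalizer, which are joined to 1 by
    small paths. The parameter is [s = 1/t], so that the end of the curve lies at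
    infinity. *)
Lemma tracking (c : R -> X) (s0 rho : R) : continuous c -> c 0 = x -> 0 < s0 ->
  (forall s, has_type A H (c (Num.max s0 s)^-1)) -> 0 < rho ->
  let c' s := c (Num.max s0 s)^-1 in
  exists2 r : R, 0 < r & forall e : R, 0 < e -> exists M : R, forall s1 s2 y,
    M < s1 -> s1 < s2 -> exact_over A H c' s1 y -> mdist x y <= r ->
    exists s : R -> X, [/\ continuous s, s s1 = y, mdist x (s s2) <= e &
      forall t, s1 <= t -> t <= s2 ->
        exact_over A H c' t (s t) /\ mdist x (s t) < 2 * rho].
Proof.
move=> cc c0 s00 typ rho0 c'.
have m0 s : 0 < Num.max s0 s by rewrite lt_max s00.
have cc' : continuous c'.
  move=> s; apply: (@continuous_at_comp _ _ _ (fun s => (Num.max s0 s)^-1) c); last exact: cc.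
  apply: cvgV; first by rewrite gt_eqF.
  by apply: (@continuous_max _ _ (fun=> s0)); [exact: cvg_cst|exact: cvg_id].
have rho2 : 0 < rho / 2 by rewrite divr_gt0.
have W1 : nbhs 1%g [set w | mdist x (A w x) < rho / 2].
  have c1 : {for 1%g, continuous (fun w => A w x)}.
    by apply: act_continuous_at; [exact: cvg_id|exact: cvg_cst].
  by have := mdist_near rho2 c1; rewrite act1.
have W2 := lie_subgroup_paths (normalizer_subgroup H) (normalizer_closed clH) W1.
have [r0 r00 gap] := fixed_gap cc c0 W2.
pose r := Num.min (r0 / 2) (rho / 8).
have r_gt0 : 0 < r by rewrite lt_min !divr_gt0.
have rr0 : 2 * r <= r0.
  have : r <= r0 / 2 by rewrite ge_min lexx.
  lra.
have rrho : 2 * r <= rho / 4.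
  have : r <= rho / 8 by rewrite ge_min lexx orbT.
  lra.
exists r => // e e0; have e'0 : 0 < Num.min r e by rewrite lt_min r_gt0.
have [d d0 dP] := gap _ e'0.
exists d^-1.
have c'E s : d^-1 < s -> `|(Num.max s0 s)^-1| < d.
  move=> ds; rewrite gtr0_norm ?invr_gt0// invf_plt ?posrE//.
  by rewrite lt_max ds orbT.
(* A section whose right end is within reach of [fixed_gap] is multiplied by a
   path in the normalizer, which leaves its left end where it is and brings its
   right end back to [x]. *)
have push s1 s2 (s : R -> X) rho' : d^-1 < s1 -> s1 < s2 -> continuous s ->
    (forall t, s1 <= t -> t <= s2 -> exact_over A H c' t (s t) /\ mdist x (s t) < rho') ->
    mdist x (s s2) <= 2 * r -> exists s' : R -> X, [/\ continuous s', s' s1 = s s1,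
      mdist x (s' s2) <= Num.min r e & forall t, s1 <= t -> t <= s2 ->
      exact_over A H c' t (s' t) /\ mdist x (s' t) < rho / 2 + rho'].
  move=> ds1 s12 cs sP s2r; have [[[g sg] sH2] _] := sP s2 (ltW s12) (lexx _).
  have [||m [nm Wm mr]] := dP _ (c'E s2 (lt_trans ds1 s12)) g.
  - by move=> h Hh; rewrite -[A g _]sg; move: Hh; rewrite -sH2.
  - by rewrite -[A g _]sg; apply: le_trans s2r rr0.
  have [u [cu u0 u1 uP]] := Wm nm.
  exists (fun t => A (u ((t - s1) / (s2 - s1))) (s t)); split.
  - move=> t; apply: act_continuous_at; last exact: cs.
    apply: (@continuous_at_comp _ _ _ (fun t => (t - s1) / (s2 - s1)) u); last exact: cu.
    by apply: cvgMl; apply: cvgB; [exact: cvg_id|exact: cvg_cst].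
  - by rewrite subrr mul0r u0 act1.
  - rewrite divff ?u1; last by rewrite subr_eq0 gt_eqF.
    by rewrite sg; exact: ltW.
  move=> t t1 t2; have [ex st] := sP t t1 t2; have [nu ux] := uP ((t - s1) / (s2 - s1)).
  split; first exact: exact_over_normalizer.
  apply: le_lt_trans (metric_triangle _ (A (u ((t - s1) / (s2 - s1))) x) _) _.
  by rewrite act_isom; exact: ltrD.
move=> s1 s2 y ds1 s12 yex yr.
have [||s [cs ss1 [_ ss2] sP]] := @path_on_segment R X
    (fun s y => exact_over A H c' s y /\ mdist x y <= r)
    (fun s y => exact_over A H c' s y /\ mdist x y < rho) s1 s2 _ s12 y.
- move=> t t1 t2; have typt : \forall t' \near t, has_type A H (c' t') :=
    @filterE R (nbhs t) (nbhs_filter t) _ typ.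
  have [d' d'0 d'P] := local_section_through clH cc' typt r_gt0.
  exists d' => // u1 u2 z su1 u12 u2s u1t u2t [zex zr].
  have [s [cs su sP]] := d'P u1 z u1t zex.
  have tri v : `|v - t| < d' -> mdist x (s v) < 2 * r.
    move=> /sP[_ zs]; apply: le_lt_trans (metric_triangle _ z _) _; lra.
  have vt v : u1 <= v -> v <= u2 -> `|v - t| < d'.
    move=> v1 v2; move: u1t u2t; rewrite !ltr_norml => /andP[? ?] /andP[? ?].
    by apply/andP; split; lra.
  have [||s' [cs' s'1 s'2 s'P]] := push u1 u2 s (rho / 4) (lt_le_trans ds1 su1) u12 cs.
  - move=> v v1 v2; have vd := vt v v1 v2; split; first by have [] := sP v vd.
    exact: lt_le_trans (tri v vd) rrho.
  - by apply: ltW; exact: tri.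
  exists s'; split => //; first by rewrite s'1.
    split; first by have [] := s'P u2 (ltW u12) (lexx _).
    by apply: le_trans s'2 _; rewrite ge_min lexx.
  by move=> v v1 v2; have [h1 h2] := s'P v v1 v2; split => //; lra.
- by split.
have [|s' [cs' s'1 s'2 s'P]] := push s1 s2 s rho ds1 s12 cs sP.
- by apply: le_trans ss2 _; lra.
exists s'; split => //; first by rewrite s'1.
  by apply: le_trans s'2 _; rewrite ge_min lexx orbT.
by move=> v v1 v2; have [h1 h2] := s'P v v1 v2; split => //; lra.
Qed.

End near_fixed_point.

(** Let [w t] conjugate [H] to the isotropy group of [c t], and let [g] be an
    accumulation point of [w t] as [t] tends to 0. Then [g w(t)^-1 c(t)] has
    isotropy group [g H g^-1], and it is close to [x] when [w t] is close to
    [g]. *)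
Lemma limit_conjugate H (c : R -> X) (e : R) : continuous c -> 0 < e ->
  (forall t, 0 < t -> t <= e -> has_type A H (c t)) ->
  exists g, forall r d : R, 0 < r -> 0 < d -> exists t y, [/\ 0 < t, t < d &
    exact_over A (conj_set H g) c t y /\ mdist (c 0) y < r].
Proof.
move=> cc e0 typ.
have exw t : exists w, 0 < t -> t <= e -> isotropy A (c t) = conj_set H w.
  have [t0|t0] := pselect (0 < t /\ t <= e); last first.
    by exists 1%g => t1 t2; exfalso; apply: t0.
  by have [w tw] := typ t t0.1 t0.2; exists w.
have [w wP] := choice exw.
have [g [_ cl]] := @lie_compact R G ((fun n : nat => w n.+1%:R^-1) @ \oo) _ filterT.
exists g => r d r0 d0; have r20 : 0 < r / 2 by rewrite divr_gt0.
have cg : {for g, continuous (fun w => A (g * w^-1)%g (c 0))}.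
  apply: act_continuous_at; last exact: cvg_cst.
  apply: mulg_continuous_at; first exact: cvg_cst.
  by apply: invg_continuous_at; exact: cvg_id.
have nearg : nbhs g [set v | mdist (c 0) (A (g * v^-1)%g (c 0)) < r / 2].
  by have := mdist_near r20 cg; rewrite mulgV act1.
have [d1 d10 d1P] := near_itv (mdist_near r20 (cc 0)).
pose d' := Num.min e (Num.min d d1).
have d'0 : 0 < d' by rewrite !lt_min e0 d0.
have nearoo : \forall v \near (fun n : nat => w n.+1%:R^-1) @ \oo,
    exists2 t, (0 < t) && (t < d') & v = w t.
  have h := near_infty_natSinv_lt (PosNum d'0).
  change (\forall n \near \oo, exists2 t, (0 < t) && (t < d') & w n.+1%:R^-1 = w t).
  by apply: filterS h => n /= nd; exists n.+1%:R^-1; rewrite // invr_gt0 ltr0n nd.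
have [_ [[t /andP[t0 td] ->] gv]] := cl _ _ nearoo nearg.
move: td; rewrite !lt_min => /and3P[te td td1].
exists t, (A (g * (w t)^-1)%g (c t)); split => //; split.
  split; first by exists (g * (w t)^-1)%g.
  by rewrite isotropy_act wP ?ltW// conj_setM mulgVK.
apply: le_lt_trans (metric_triangle _ (A (g * (w t)^-1)%g (c 0)) _) _.
have ct : mdist (c 0) (c t) < r / 2 by apply: d1P; rewrite subr0 gtr0_norm.
by rewrite act_isom; move: gv ct; rewrite /=; lra.
Qed.

(** In the parameter 1/t, sections given by [tracking] are put end to end on
    intervals [b n, b n.+1]. On the n-th interval the section stays within
    2/(n+1) of [c 0], and it ends close enough to [c 0] for the next one to
    begin. *)
Theorem straight_section H (c : R -> X) (e : R) : continuous c -> 0 < e ->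
  (forall t, 0 < t -> t <= e -> has_type A H (c t)) ->
  exists g t1 (s : R -> X), [/\ 0 < t1 <= e, continuous s, s 0 = c 0 &
    forall t, 0 < t -> t <= t1 -> exact_over A (conj_set H g) c t (s t)].
Proof.
move=> cc e0 typ; have [g gP] := limit_conjugate cc e0 typ.
set x := c 0 in gP *; set H' := conj_set H g in gP *.
have [_ [y0 [_ _ [[_ y0H] _]]]] := gP 1 1 ltr01 ltr01.
have clH : closed H' by rewrite -y0H; exact: isotropy_closed.
have Hx h : H' h -> A h x = x.
  move=> Hh; apply/eqP; rewrite eq_sym -[_ == _]negbK -mdist_gt0; apply/negP => D0.
  have D20 : 0 < mdist x (A h x) / 2 by rewrite divr_gt0.
  have [t [y [_ _ [[_ yH] xy]]]] := gP _ 1 D20 ltr01.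
  have hy : A h y = y by move: Hh; rewrite -yH.
  have := metric_triangle x y (A h x); rewrite -{2}hy act_isom (metric_sym y).
  by rewrite -/x in xy; lra.
pose s0 := e^-1; have s00 : 0 < s0 by rewrite invr_gt0.
have m0 s : 0 < Num.max s0 s by rewrite lt_max s00.
have typ' s : has_type A H' (c (Num.max s0 s)^-1).
  have [||w wP] := typ (Num.max s0 s)^-1; first by rewrite invr_gt0.
    by rewrite -[leRHS]invrK lef_pV2 ?posrE ?invr_gt0// le_max lexx.
  exists (w * g^-1)%g; rewrite wP /H' conj_setM mulgVK; reflexivity.
pose rho (n : nat) : R := n.+1%:R^-1.
have rho0 n : 0 < rho n by rewrite invr_gt0.
pose c' s := c (Num.max s0 s)^-1.
have exr n := @tracking H' x clH Hx c s0 (rho n) cc erefl s00 typ' (rho0 n).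
have exr' n : exists r : R, 0 < r /\ forall e : R, 0 < e -> exists M : R,
    forall s1 s2 y, M < s1 -> s1 < s2 -> exact_over A H' c' s1 y -> mdist x y <= r ->
    exists s : R -> X, [/\ continuous s, s s1 = y, mdist x (s s2) <= e &
      forall t, s1 <= t -> t <= s2 ->
        exact_over A H' c' t (s t) /\ mdist x (s t) < 2 * rho n].
  by have [r r0 rP] := exr n; exists r.
have [r rP] := choice exr'.
have [M MP] := choice (fun n => (rP n).2 _ (rP n.+1).1).
have Mm0 : 0 < Num.max s0 (M 0%N) by rewrite lt_max s00.
have [|t1 [y1 [t10 t1M [y1ex y1r]]]] := gP (r 0%N) (Num.max s0 (M 0%N))^-1 (rP 0%N).1.
  by rewrite invr_gt0.
have Mt1 : Num.max s0 (M 0%N) < t1^-1.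
  by rewrite -[ltLHS]invrK ltf_pV2 ?posrE// invr_gt0.
pose b := fix b n := if n is m.+1 then Num.max (b m) (M n) + 1 else t1^-1.
have bS n : b n + 1 <= b n.+1 by rewrite /= lerD2r le_max lexx.
have bM n : M n < b n.
  case: n => [|n]; first by apply: le_lt_trans Mt1; rewrite le_max lexx orbT.
  by apply: (@le_lt_trans _ _ (Num.max (b n) (M n.+1))); rewrite ?le_max ?lexx ?orbT//= ltrDl.
have bSlt n : b n < b n.+1 by have := bS n; lra.
have b0 : b 0%N = t1^-1 by [].
have b00 : 0 < b 0%N by rewrite b0 invr_gt0.
clearbody b.
have b_ge n : b 0%N + n%:R <= b n.
  elim: n => [|n IH]; first by rewrite addr0.
  by have := bS n; rewrite -natr1; move: IH; lra.
have binf u : exists n, u < b n.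
  have := archi_boundP (normr_ge0 u) => uP; exists (Num.bound `|u|).
  apply: lt_le_trans (b_ge _); have := ler_norm u; move: uP b00; lra.
have c'E t : 0 < t -> t <= t1 -> c' t^-1 = c t.
  move=> t0 tt1; rewrite /c' (max_idPr _) ?invrK// ltW//.
  apply: lt_le_trans (_ : t1^-1 <= _).
    by apply: le_lt_trans Mt1; rewrite le_max lexx.
  by rewrite lef_pV2 ?posrE.
have [||s [cs sb0 sP]] := @path_on_ray R X b
    (fun n y => exact_over A H' c' (b n) y /\ mdist x y <= r n)
    (fun n s y => exact_over A H' c' s y /\ mdist x y < 2 * rho n) bSlt binf _ y1.
- move=> n y [yex yr]; have [s [cs sy s2 sP]] := MP n _ _ _ (bM n) (bSlt n) yex yr.
  by exists s; split => //; split => //; have [] := sP _ (ltW (bSlt n)) (lexx _).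
- by split; [rewrite /exact_over b0 c'E|exact: ltW].
have locate n u : b n <= u -> exists k, [/\ (n <= k)%N, b k <= u & u <= b k.+1].
  move=> nu; have [m um] := binf u.
  have ex : exists k, u < b k by exists m.
  case: (ex_minnP ex) => k ku kmin; case: k ku kmin => [|k] ku kmin.
    have := b_ge n; have : 0 <= n%:R :> R by []; move: ku nu; lra.
  exists k; split; [|rewrite leNgt; apply/negP => uk|exact: ltW].
    rewrite leqNgt; apply/negP => kn.
    have : b k.+1 <= b n by elim: {nu} n kn => // n IH; rewrite leq_eqVlt
      => /predU1P[[->]//|/IH h]; exact: le_trans h (ltW (bSlt n)).
    by move: ku nu; lra.
  by have := kmin k uk; rewrite ltnn.
have bpos n : 0 < b n.
  by apply: lt_le_trans (b_ge n); exact: ltr_wpDr.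
pose f t := s (Num.min t t1)^-1.
pose sg t := if t <= 0 then x else f t.
have sgE t : 0 < t -> t <= t1 -> sg t = s t^-1.
  by move=> t0 tt1; rewrite /sg leNgt t0 /f (min_idPl tt1).
have le1 : t1 <= e.
  have : s0 <= t1^-1 by apply: ltW; apply: le_lt_trans Mt1; rewrite le_max lexx.
  by rewrite /s0 lef_pV2 ?posrE.
have sg0 : sg 0 = x by rewrite /sg lexx.
exists g, t1, sg; split => //.
- by rewrite t10.
- move=> t; case: (ltgtP t 0) => [t0|t0|->].
  + have nt : \forall u \near t, u < 0 by apply: (near_lt (f := id)) => //; exact: cvg_id.
    move=> O; rewrite /sg (ltW t0) => Ox.
    have : \forall u \near t, O (sg u).
      by apply: filterS nt => u u0; rewrite /sg (ltW u0); exact: nbhs_singleton.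
    exact.
  + have nt : \forall u \near t, 0 < u by apply: (near_gt (f := id)) => //; exact: cvg_id.
    have mt : 0 < Num.min t t1 by rewrite lt_min t0.
    have cf : {for t, continuous f}.
      apply: (@continuous_at_comp _ _ _ (fun t => (Num.min t t1)^-1) s); last exact: cs.
      apply: cvgV; first by rewrite gt_eqF.
      by apply: (@continuous_min _ _ id (fun=> t1)); [exact: cvg_id|exact: cvg_cst].
    move=> O; rewrite {1}/sg leNgt t0 /= => Ox.
    have : \forall u \near t, O (sg u).
      by apply: filterS2 nt (cont_near cf Ox) => u u0; rewrite /sg leNgt u0.
    exact.
  apply: metric_continuous => d d0; rewrite sg0.
  have d20 : 0 < d / 2 by rewrite divr_gt0.
  have [n nd] := @filter_ex _ \oo _ _ (near_infty_natSinv_lt (PosNum d20)).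
  have nt : \forall u \near (0 : R), u < (b n)^-1.
    by apply: (near_lt (f := id)); [exact: cvg_id|rewrite /= invr_gt0].
  apply: filterS nt => u un; have [u0|u0] := leP u 0.
    by rewrite /sg u0 mdistxx.
  have bnu : b n <= u^-1.
    by rewrite -[leLHS]invrK lef_pV2 ?posrE ?invr_gt0// ltW.
  have [k [nk bk1 bk2]] := locate n _ bnu.
  have ut1 : u <= t1.
    have : t1^-1 <= u^-1.
      apply: le_trans bnu; have := b_ge n; rewrite b0.
      by have : 0 <= n%:R :> R by []; lra.
    by rewrite lef_pV2 ?posrE.
  rewrite sgE//; have [_ h] := sP k _ bk1 bk2; apply: lt_le_trans h _.
  have : rho k <= rho n by rewrite lef_pV2 ?posrE// ler_nat.
  by move: nd; rewrite /= -/(rho n); lra.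
move=> t t0 tt1; rewrite sgE//.
have [|k [_ k1 k2]] := locate 0%N t^-1; first by rewrite b0 lef_pV2 ?posrE.
have [+ _] := sP k _ k1 k2.
by rewrite /exact_over c'E.
Qed.

End straightening.

(** * Geodesics transverse to the orbits, and boundary points *)

Lemma subr_continuous_at (R : realType) (S : topologicalType) (f g : S -> R) s :
  {for s, continuous f} -> {for s, continuous g} ->
  {for s, continuous (fun s => f s - g s)}.
Proof. by move=> cf cg; exact: cvgB. Qed.

Lemma real_neq_near (R : realType) (S : topologicalType) (f g : S -> R) s :
  {for s, continuous f} -> {for s, continuous g} -> f s <> g s ->
  \forall s' \near s, f s' <> g s'.
Proof.
move=> cf cg fg; have c : {for s, continuous (fun s => `|f s - g s|)}.
  by apply: cvg_norm; exact: subr_continuous_at.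
have lt : 0 < `|f s - g s| by rewrite normr_gt0 subr_eq0; exact/eqP.
by apply: filterS (near_gt c lt) => s' + e; rewrite e subrr normr0 ltxx.
Qed.

Lemma sub_comp_continuous (S T : topologicalType) (B : set S) (f : S -> T) :
  continuous f -> continuous (fun b : B => f (set_val b)).
Proof.
move=> cf b; apply: (@continuous_at_comp _ _ _ (set_val : B -> S) f).
  exact: set_val_continuous.
exact: cf.
Qed.

Section lifts.
Variables (R : realType) (G : compactLieGroupType R) (X : completeMetricType R).
Variable A : isometric_action G X.
Implicit Types (x y : X) (g : G).

Lemma orb_continuous : continuous (orb A).
Proof.
move=> x; apply: (@metric_continuous R (orbit_space A)) => e e0.
have := @mdist_near R X X id x e e0; move=> /(_ (@cvg_id _ _)).
by apply: filterS => y xy; apply: le_lt_trans (orbit_dist_le _ _ _) xy.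
Qed.

Lemma orbit_closest x y : exists g, mdist x (A g y) = orbit_dist (orb A x) (orb A y).
Proof.
set D := orbit_dist _ _; have Dle g : D <= mdist x (A g y).
  by rewrite /D -(orb_act A g y); exact: orbit_dist_le.
apply: contrapT => nog; have Dlt g : D < mdist x (A g y).
  rewrite lt_neqAle Dle andbT; apply/negP => /eqP e; apply: nog.
  by exists g.
have cd g : {for (g, 0 : R), continuous (fun p : G * R => mdist x (A p.1 y) - p.2)}.
  apply: (@subr_continuous_at R _ (fun p : G * R => mdist x (A p.1 y)) snd);
    last exact: cvg_snd.
  apply: mdist_continuous_at; first exact: cvg_cst.
  by apply: act_continuous_at; [exact: cvg_fst|exact: cvg_cst].
have : \forall r \near (0 : R), forall g, D < mdist x (A g y) - r.
  apply: (@near_forall_compact G R (fun g r => D < mdist x (A g y) - r)).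
    exact: lie_compact.
  by move=> g; apply: near_gt (cd g) _; rewrite /= subr0.
move=> /near_itv[d d0 dP]; have d20 : 0 < d / 2 by rewrite divr_gt0.
have [g] := orbit_dist_adherent A x y d20; have := dP (d / 2).
rewrite subr0 gtr0_norm// => /(_ _ g) h; have := h _; rewrite -/D.
by move=> /(_ ltac:(lra)); lra.
Qed.

(** A geodesic between nearest points of two orbits meets each orbit at most
    once, since otherwise the orbits would be closer to each other. *)
Lemma orbit_geodesic x y : geodesic_space X -> orb A x <> orb A y ->
  exists c : R -> X, [/\ continuous c, c 0 = x, orb A (c 1) = orb A y,
    forall t, 0 <= t -> t <= 1 -> mdist x (c t) <= orbit_dist (orb A x) (orb A y) &
    forall s t, 0 <= s -> s <= 1 -> 0 <= t -> t <= 1 -> orb A (c s) = orb A (c t) ->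
      s = t].
Proof.
move=> geo xy; have [g gD] := orbit_closest x y.
set D := orbit_dist _ _ in gD *.
have D0 : 0 < D.
  have : (0 : R) < mdist (orb A x) (orb A y) by rewrite mdist_gt0; exact/eqP.
  exact.
have [c [c0 c1]] := geo x (A g y).
have cl0 t : 0 <= clamp 0 1 t :> R by have [] := @clamp_itv R 0 1 t ler01.
have cl1 t : clamp 0 1 t <= 1 :> R by have [] := @clamp_itv R 0 1 t ler01.
pose c' t := c (Itv01 (cl0 t) (cl1 t)).
have c'd s t : mdist (c' s) (c' t) = `|clamp 0 1 s - clamp 0 1 t| * D.
  by rewrite /c' geoP c0 c1 gD.
have c'0 : c' 0 = x.
  by rewrite -c0 /c'; congr (c _); apply/val_inj => /=; rewrite clamp_id.
have c'1 : c' 1 = A g y.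
  by rewrite -c1 /c'; congr (c _); apply/val_inj => /=; rewrite clamp_id.
exists c'; split => //.
- move=> t; apply: metric_continuous => e e0.
  have h : \forall s \near t, `|clamp 0 1 t - clamp 0 1 s| < e / D.
    have cc : {for t, continuous (fun s : R => `|clamp 0 1 t - clamp 0 1 s|)}.
      apply: cvg_norm; apply: cvgB; first exact: cvg_cst.
      exact: clamp_continuous.
    by apply: near_lt cc _; rewrite subrr normr0 divr_gt0.
  by apply: filterS h => s; rewrite c'd ltr_pdivlMr.
- by rewrite c'1 orb_act.
- move=> t t0 t1; rewrite -{1}c'0 c'd !clamp_id// sub0r normrN ger0_norm//.
  by rewrite ler_piMl// ltW.
suff lt_case s t : 0 <= s -> s < t -> t <= 1 -> orb A (c' s) <> orb A (c' t).
  move=> s t s0 s1 t0 t1 e; have [st|st|//] := ltgtP s t.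
    by case: (lt_case s t s0 st t1).
  by case: (lt_case t s t0 st s1).
move=> s0 st t1 e; have s1 : s <= 1 by lra.
have t0 : 0 <= t by lra.
have := orbit_dist_triangle (orb A (c' s)) (orb A x) (orb A y).
have := orbit_dist_le A x (c' s).
have := orbit_dist_le A (c' t) (c' 1); rewrite -e c'1 orb_act -c'1 -{2}c'0 !c'd !clamp_id//.
have -> : `|0 - s| = s by rewrite sub0r normrN ger0_norm.
have -> : `|t - 1| = 1 - t by rewrite distrC ger0_norm// subr_ge0.
have : 0 < (t - s) * D by rewrite mulr_gt0// subr_gt0.
rewrite -/D; lra.
Qed.

(** The inverse of [tau] along [c] is continuous, being selected from a segment
    by a closed condition. *)
Lemma lift_path (tau : X -> R) (c : R -> X) : continuous c ->
  (forall t, 0 <= t -> t <= 1 -> {for c t, continuous tau}) ->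
  (forall s t, 0 <= s -> s <= 1 -> 0 <= t -> t <= 1 -> tau (c s) = tau (c t) -> s = t) ->
  exists f : R -> X, [/\ continuous f, f (tau (c 0)) = c 0 &
    forall u, Num.min (tau (c 0)) (tau (c 1)) <= u ->
      u <= Num.max (tau (c 0)) (tau (c 1)) ->
      tau (f u) = u /\ exists t, [/\ 0 <= t, t <= 1 & f u = c t]].
Proof.
move=> cc ct inj; set a := Num.min _ _; set b := Num.max _ _.
have ab : a <= b by rewrite /a /b ge_min le_max lexx.
have phic t : 0 <= t -> t <= 1 -> {for t, continuous (fun t => tau (c t))}.
  by move=> t0 t1; apply: continuous_at_comp; [exact: cc|exact: ct].
have exs u : exists s, [/\ 0 <= s, s <= 1 & tau (c s) = clamp a b u].
  have [||s] := @IVT R (fun t => tau (c t)) 0 1 (clamp a b u) ler01.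
  - apply: continuous_in_subspaceT => t /set_mem /=; rewrite in_itv /= => /andP[t0 t1].
    exact: phic.
  - by have [-> ->] := @clamp_itv R a b u ab.
  by rewrite in_itv /= => /andP[s0 s1] e; exists s.
have [s sP] := choice exs.
pose C := (`[0, 1]%classic : set R).
have C01 (t : C) : 0 <= set_val t /\ set_val t <= 1.
  by have := set_valP t; rewrite /C /= in_itv /= => /andP.
exists (fun u => c (s u)); split.
- move=> u; pose P (t : C) (u : R) := tau (c (set_val t)) = clamp a b u.
  have cr := @closed_rel_continuous C R X P (fun (t : C) _ => c (set_val t))
    (fun u => c (s u)) u.
  have cv (t : C) : {for (t, u), continuous (fun p : C * R => set_val p.1)}.
    apply: (@continuous_at_comp _ _ _ fst (set_val : C -> R)); first exact: cvg_fst.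
    exact: set_val_continuous.
  apply: cr.
  - by apply: compact_sub; exact: segment_compact.
  - move=> t nP; have [t0 t1] := C01 t.
    suff : \forall p \near (t, u), tau (c (set_val p.1)) <> clamp a b p.2 by [].
    apply: (@real_neq_near R _ (fun p : C * R => tau (c (set_val p.1)))
      (fun p => clamp a b p.2)) => //.
      apply: (@continuous_at_comp _ _ _ (fun p : C * R => set_val p.1)
        (fun t => tau (c t))); first exact: cv.
      exact: phic.
    apply: (@continuous_at_comp _ _ _ snd (clamp a b)); first exact: cvg_snd.
    exact: clamp_continuous.
  - move=> t _; apply: (@continuous_at_comp _ _ _ (fun p : C * R => set_val p.1) c).
      exact: cv.
    exact: cc.
  - apply: filterE => u'; have [s0 s1 su] := sP u'.
    have Cs : C (s u') by rewrite /C /= in_itv /= s0.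
    by exists (SigSub (mem_set Cs) : C).
  move=> t u' Pt; have [s0 s1 su] := sP u'; have [t0 t1] := C01 t.
  by congr c; apply: inj => //; rewrite su -Pt.
- have [s0 s1 su] := sP (tau (c 0)); congr c; apply: inj => //.
  by rewrite su clamp_id// /a /b ?ge_min ?le_max lexx.
move=> u au ub; have [s0 s1 su] := sP u; rewrite su clamp_id//; split => //.
by exists (s u).
Qed.

End lifts.

Section boundary.
Variables (R : realType) (T : topologicalType).

(** Punctured neighbourhoods of a boundary point of a 1-manifold can be chosen
    connected, whereas an interior point separates its neighbourhoods. *)
Lemma not_boundary (b : T) (D : set T) (tau : T -> R) : nbhs b D ->
  (forall c, D c -> {for c, continuous tau}) ->
  (forall c, D c -> tau c = tau b -> c = b) ->
  (forall W, nbhs b W -> exists c c', [/\ W c, W c', tau c < tau b & tau b < tau c']) ->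
  ~ is_boundary R b.
Proof.
move=> nD ct inj sep [U [oU Ub [f [cf [g [fK gK cg]]] f0]]].
pose J := (`[0%R, 1%R[%classic : set R).
have J0 : J 0 by rewrite /J /= in_itv /= lexx ltr01.
pose z : J := SigSub (mem_set J0).
have JP (r : J) : 0 <= set_val r /\ set_val r < 1.
  by have := set_valP r; rewrite /J /= in_itv /= => /andP.
pose ub : U := SigSub (mem_set Ub).
have fb : f ub = z by apply: val_inj; exact: f0.
have gz : g z = ub by rewrite -fb fK.
pose phi (r : J) := set_val (g r).
have cphi : continuous phi.
  move=> r; apply: (@continuous_at_comp _ _ _ g (set_val : U -> T)); first exact: cg.
  exact: set_val_continuous.
have phiz : phi z = b by rewrite /phi gz.
have nDz : nbhs (phi z) D by rewrite phiz.
have [B Bz BD] := sub_nbhs (cont_near (cphi z) nDz).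
have [d d0 dB] := near_itv Bz.
have phiD (r : J) : set_val r < d -> D (phi r).
  move=> rd; apply: BD; apply: dB => /=; rewrite subr0 ger0_norm//.
  by have [] := JP r.
have nW : nbhs b [set c | exists2 u : U, set_val u = c & set_val (f u) < d].
  have cfu : {for ub, continuous (fun u : U => set_val (f u) : R)}.
    by apply: continuous_at_comp; [exact: cf|exact: set_val_continuous].
  have lt : \forall u \near ub, set_val (f u) < d.
    by apply: near_lt cfu _; rewrite fb.
  have [V Vb VO] := sub_nbhs lt; have nU := open_nbhs_nbhs (conj oU Ub).
  apply: filterS2 nU Vb => c Uc Vc; exists (SigSub (mem_set Uc) : U) => //.
  exact: VO.
have [c1 [c2 [[u1 u1c f1d] [u2 u2c f2d] c1b c2b]]] := sep _ nW.
pose r1 := f u1; pose r2 := f u2.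
have p1 : phi r1 = c1 by rewrite /phi fK.
have p2 : phi r2 = c2 by rewrite /phi fK.
pose m := Num.min (set_val r1) (set_val r2); pose M := Num.max (set_val r1) (set_val r2).
have mM : m <= M by rewrite /m /M ge_min le_max lexx.
have Md : M < d by rewrite gt_max f1d.
have M1 : M < 1 by rewrite gt_max (JP r1).2 (JP r2).2.
have m0 : 0 <= m by rewrite le_min (JP r1).1 (JP r2).1.
have cJ t : J (clamp m M t).
  have [h1 h2] := @clamp_itv R m M t mM.
  by rewrite /J /= in_itv /= (le_trans m0 h1) (le_lt_trans h2 M1).
pose psi t := phi (SigSub (mem_set (cJ t)) : J).
have psi_lt t : D (psi t) by apply: phiD; exact: le_lt_trans (@clamp_itv R m M t mM).2 Md.
have cpsi : continuous (fun t => tau (psi t)).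
  move=> t; apply: (@continuous_at_comp _ _ _ psi tau); last by apply: ct; exact: psi_lt.
  apply: (@continuous_at_comp _ _ _ (fun t => SigSub (mem_set (cJ t)) : J) phi).
    by apply: to_sub_continuous_at; exact: clamp_continuous.
  exact: cphi.
have psiE (r : J) : m <= set_val r -> set_val r <= M -> psi (set_val r) = phi r.
  by move=> h1 h2; congr phi; apply: val_inj => /=; rewrite clamp_id.
have psi1 : psi (set_val r1) = c1 by rewrite psiE// /m /M ?ge_min ?le_max lexx.
have psi2 : psi (set_val r2) = c2.
  by rewrite psiE// /m /M ?ge_min ?le_max lexx orbT.
have ends : Num.min (tau (psi m)) (tau (psi M)) <= tau b <=
    Num.max (tau (psi m)) (tau (psi M)).
  have : (psi m = c1 /\ psi M = c2) \/ (psi m = c2 /\ psi M = c1).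
    rewrite /m /M; case: (leP (set_val r1) (set_val r2)) => h.
      by left.
    by right.
  by case=> -[-> ->]; rewrite ge_min le_max (ltW c1b) (ltW c2b) ?orbT.
have [t _ te] : exists2 t, t \in `[m, M] & tau (psi t) = tau b.
  by apply: IVT ends => //; apply: continuous_in_subspaceT => t _; exact: cpsi.
have tb := inj _ (psi_lt t) te.
have t0 : clamp m M t = 0.
  have : (SigSub (mem_set (cJ t)) : J) = z.
    by rewrite -[LHS]gK -[RHS]gK; congr f; apply: val_inj; rewrite gz.
  by move=> /(congr1 set_val).
have [h1 _] := @clamp_itv R m M t mM; rewrite t0 in h1.
have mE : m = 0 by apply/le_anti; rewrite h1.
have bz (r : J) : set_val r = 0 -> phi r = b.
  by move=> r0; rewrite -phiz; congr phi; apply: val_inj.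
move: mE; rewrite /m; case: leP => _ /bz; rewrite ?p1 ?p2 => e.
  by move: c1b; rewrite e ltxx.
by move: c2b; rewrite e ltxx.
Qed.

(** The coordinate [tau] itself is a chart onto [[0,1[] near [b]. *)
Lemma end_boundary (b : T) (tau : T -> R) (rho : R -> T) : continuous tau ->
  continuous rho -> (forall c, 0 <= tau c) ->
  (forall c, tau c < 1 -> rho (tau c) = c) ->
  (forall r, 0 <= r -> r < 1 -> tau (rho r) = r) -> tau b = 0 -> is_boundary R b.
Proof.
move=> ct cr t0 tK rK b0; pose U := [set c | tau c < 1].
exists U; split; last 1 first.
- pose J := (`[0%R, 1%R[%classic : set R).
  have tJ (u : U) : J (tau (set_val u)).
    by rewrite /J /= in_itv /= t0; exact: (set_valP u).
  have JP (r : J) : 0 <= set_val r /\ set_val r < 1.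
    by have := set_valP r; rewrite /J /= in_itv /= => /andP.
  have rU (r : J) : U (rho (set_val r)) by have [r0 r1] := JP r; rewrite /U /= rK.
  exists (fun u => SigSub (mem_set (tJ u)) : J); last first.
    by move=> u ub; change (tau (set_val u) = 0); rewrite ub.
  split.
    move=> u; apply: to_sub_continuous_at => /=.
    exact: sub_comp_continuous.
  exists (fun r => SigSub (mem_set (rU r)) : U); split.
  - by move=> u; apply: val_inj => /=; apply: tK; exact: (set_valP u).
  - by move=> r; apply: val_inj => /=; have [r0 r1] := JP r; exact: rK.
  move=> r; apply: to_sub_continuous_at => /=.
  exact: (@sub_comp_continuous _ _ J rho).
- rewrite openE => c Uc; rewrite /interior; exact: near_lt (ct c) Uc.
- by rewrite /U /= b0.
Qed.

End boundary.

(** * Sections over intervals of the orbit space *)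

Section coordinate.
Variables (R : realType) (G : compactLieGroupType R) (X : metricType R).
Variable A : isometric_action G X.
Variable tau : X -> R.
Hypothesis tauP : forall x y, tau x = tau y -> exists g, y = A g x.
Hypothesis tauG : forall g x, tau (A g x) = tau x.
Implicit Types (H : set G) (g : G) (x y : X).

Definition over H (t : R) y := tau y = t /\ isotropy A y = H.

Definition lifted (a b : R) := exists2 c : R -> X, continuous c &
  forall t, a <= t -> t <= b -> tau (c t) = t.

Lemma has_type_conj H g x : has_type A H x -> has_type A (conj_set H g) x.
Proof. by move=> [w e]; exists (w * g^-1)%g; rewrite e conj_setM mulgVK. Qed.

Lemma exact_over_over H c t y : tau (c t) = t -> exact_over A H c t y <-> over H t y.
Proof.
move=> ct; split=> [[[g ->] yH]|[yt yH]]; first by split; rewrite ?tauG.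
by split => //; apply: tauP; rewrite ct.
Qed.

Lemma segment_section H a b e y : closed H -> a < b -> 0 < e ->
  lifted (a - e) (b + e) ->
  (forall z, a - e <= tau z -> tau z <= b + e -> has_type A H z) -> over H a y ->
  exists s : R -> X, [/\ continuous s, s a = y &
    forall t, a <= t -> t <= b -> over H t (s t)].
Proof.
move=> clH ab e0 [c cc cP] typ ya.
have ca : tau (c a) = a by apply: cP; lra.
have [||s [cs sa sP]] := @section_on_segment _ _ _ A H clH c cc a b y ab.
- move=> t at_ tb.
  have n1 : \forall u \near t, a - e < u.
    by apply: (near_gt (f := id)); [exact: cvg_id|rewrite /=; lra].
  have n2 : \forall u \near t, u < b + e.
    by apply: (near_lt (f := id)); [exact: cvg_id|rewrite /=; lra].
  apply: filterS2 n1 n2 => u u1 u2; apply: typ; rewrite cP; lra.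
- exact/exact_over_over.
exists s; split => // t at_ tb.
by have /exact_over_over := sP t at_ tb; apply; apply: cP; lra.
Qed.

Lemma lifted_sub a b a' b' : lifted a b -> a <= a' -> b' <= b -> lifted a' b'.
Proof. by move=> [c cc cP] aa bb; exists c => // t t1 t2; apply: cP; lra. Qed.

(** Sections over consecutive unit intervals are put end to end. *)
Lemma ray_section H a e y : closed H -> 0 < e -> (forall b, lifted (a - e) b) ->
  (forall z, a - e <= tau z -> has_type A H z) -> over H a y ->
  exists s : R -> X, [/\ continuous s, s a = y & forall t, a <= t -> over H t (s t)].
Proof.
move=> clH e0 lft typ ya; pose b (n : nat) := a + n%:R.
have bS n : b n.+1 = b n + 1 by rewrite /b -natr1 addrA.
have binf t : exists n, t < b n.
  exists (Num.bound `|t - a|); have := archi_boundP (normr_ge0 (t - a)).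
  by have := ler_norm (t - a); rewrite /b; lra.
have b_ge n : a <= b n by rewrite /b lerDl.
have bS' n : b n < b n.+1 by rewrite bS; lra.
have [n z [zt zH]||s [cs sa sP]] := @path_on_ray R X b (fun n y => over H (b n) y)
    (fun _ t y => over H t y) bS' binf _ y.
- have [|||s [cs sz sP]] := @segment_section H (b n) (b n.+1) e z clH (bS' n) e0.
  + by apply: (lifted_sub (lft (b n.+1 + e))) => //; have := b_ge n; lra.
  + by move=> v v1 v2; apply: typ; have := b_ge n; lra.
  + by split.
  by exists s; split => //; exact: (sP _ (ltW (bS' n)) (lexx _)).
- by rewrite /b addr0.
exists s; split => //; first by rewrite -sa /b addr0.
move=> t at_; have [m tm] := binf t; have ex : exists k, t < b k by exists m.
case: (ex_minnP ex) => -[|k] tk kmin; first by move: tk; rewrite /b addr0; lra.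
apply: (sP k) => //; last exact: ltW.
by rewrite leNgt; apply/negP => /kmin; rewrite ltnn.
Qed.

(** The section that converges at the end of the interval exists near that end
    only; it is continued over the remaining interior. *)
Lemma end_section H b e : 0 < b -> 0 < e -> lifted 0 (b + e) ->
  (forall z, 0 < tau z -> tau z <= b + e -> has_type A H z) ->
  exists g (s : R -> X), [/\ continuous s, tau (s 0) = 0 &
    forall t, 0 < t -> t <= b -> over (conj_set H g) t (s t)].
Proof.
move=> b0 e0 lft typ; have [c cc cP] := lft.
have [|g [t1 [s [/andP[t10 t1b] cs s0 sP]]]] := @straight_section _ _ _ A H c b cc b0.
  by move=> t t0 tb; apply: typ; rewrite cP; lra.
have sP' t : 0 < t -> t <= t1 -> over (conj_set H g) t (s t).
  move=> t0 tt; have /exact_over_over := sP t t0 tt; apply; apply: cP; lra.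
have s00 : tau (s 0) = 0 by rewrite s0 cP//; lra.
exists g; have [<-|t1nb] := eqVneq t1 b; first by exists s.
have t1b' : t1 < b by rewrite lt_neqAle t1nb.
have [_ st1] := sP' t1 t10 (lexx _).
have m0 : 0 < Num.min e (t1 / 2) by rewrite lt_min e0 divr_gt0.
have me : Num.min e (t1 / 2) <= e by rewrite ge_min lexx.
have mt : Num.min e (t1 / 2) <= t1 / 2 by rewrite ge_min lexx orbT.
have [||||s' [cs' s't1 s'P]] := @segment_section (conj_set H g) t1 b _ (s t1) _ t1b' m0.
- by rewrite -st1; exact: isotropy_closed.
- by apply: (lifted_sub lft); lra.
- by move=> z z1 z2; apply: has_type_conj; apply: typ; lra.
- exact: sP'.
exists (fun t => if t <= t1 then s t else s' t); split.
- apply: (@paste_continuous _ _ _ id) => //; first by move=> t; exact: cvg_id.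
  by move=> t ->.
- by rewrite (ltW t10).
by move=> t t0 tb; case: leP => tt1; [exact: sP'|apply: s'P => //; exact: ltW].
Qed.

Lemma end_fixed H b (s : R -> X) : continuous s -> 0 < b ->
  (forall t, 0 < t -> t <= b -> isotropy A (s t) = H) -> H `<=` isotropy A (s 0).
Proof.
move=> cs b0 sH h Hh; apply: contrapT => nh.
have : \forall t \near (0 : R), A h (s t) <> s t.
  apply: (@neq_near _ _ (fun t => A h (s t)) s) => //; first exact: metric_hausdorff.
    by apply: act_continuous_at; [exact: cvg_cst|exact: cs].
  exact: cs.
move=> /near_itv[d d0 dP]; pose t := Num.min b (d / 2).
have t0 : 0 < t by rewrite lt_min b0 divr_gt0.
have td : t <= d / 2 by rewrite ge_min lexx orbT.
apply: (dP t); first by rewrite subr0 gtr0_norm//; lra.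
by have := sH t t0; rewrite ge_min lexx => /(_ isT) e; move: Hh; rewrite -e.
Qed.

End coordinate.

Lemma cls_invariant (T : topologicalType) (e : T -> T -> Prop) (W : Type)
    (F : T -> W) : (forall x y, e x y -> F x = F y) ->
  forall x, F (rep (cls e x)) = F x.
Proof.
move=> eF x; have /clsP : cls e (rep (cls e x)) = cls e x by rewrite repK.
by move: (rep _) => y; elim=> [u v /eF|u|u v _ ->|u v w _ -> _ ->].
Qed.

Lemma quot_continuous (T W : topologicalType) (e : T -> T -> Prop)
    (F : topquot e -> W) : continuous (fun x => F (cls e x)) -> continuous F.
Proof. by move=> cF; apply/(@quotient_continuous _ (quot e)). Qed.

Lemma cls_rel (T : topologicalType) (e : T -> T -> Prop) x y :
  e x y -> cls e x = cls e y.
Proof. by move=> exy; apply/clsP; exact: Relation_Operators.rst_step. Qed.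

Section orbit_bundle.
Variables (R : realType) (G : compactLieGroupType R) (X : metricType R).
Variable A : isometric_action G X.

(** A transversal to the isotropy group of [x] supplies exactly one element that
    carries [x] to a given nearby point of its orbit. *)
Lemma orbit_local_section x (b : orbit_set A x) :
  exists (U : set (orbit_set A x)) (chi : orbit_set A x -> G), [/\ open U, U b,
    forall u, U u -> A (chi u) x = set_val u &
    forall u, U u -> {for u, continuous chi}].
Proof.
have [g0 _ g0b] := set_valP b; have sK := isotropy_subgroup A x.
have [T [cT T1 _ Tinj Tnbhs]] := lie_transversal sK (@isotropy_closed _ _ _ A x).
have [r r0 rP] : exists2 r : R, 0 < r & forall g, mdist x (A g x) < r ->
    exists t k, [/\ T t, isotropy A x k & g = (t * k)%g].
  apply: small_displacement; first exact: lie_compact.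
    by move=> g; apply: act_continuous_at; [exact: cvg_id|exact: cvg_cst].
  move=> g1 g1x; have cg : {for g1, continuous (fun g => (g * g1^-1)%g)}.
    by apply: mulg_continuous_at; [exact: cvg_id|exact: cvg_cst].
  have nb : nbhs (g1 * g1^-1)%g [set g | exists t k,
      [/\ T t, isotropy A x k & g = (t * k)%g]] by rewrite mulgV.
  apply: filterS (cont_near cg nb) => g [t [k [Tt Kk e]]].
  exists t, (k * g1)%g; split => //; last by rewrite mulgA -e mulgVK.
  by have [_ KM _] := sK; apply: KM.
pose U : set (orbit_set A x) := [set u | mdist (set_val b) (set_val u) < r].
have nU u : U u -> \forall v \near u, U v.
  move=> Uu; apply: (@near_lt R _ (fun v : orbit_set A x => mdist (set_val b) (set_val v))) Uu.
  apply: mdist_continuous_at; first exact: cst_continuous.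
  exact: set_val_continuous.
have ext (u : orbit_set A x) : exists t, U u -> T t /\ A t x = A g0^-1%g (set_val u).
  have [Uu|] := pselect (U u); last by exists 1%g.
  have [g _ gu] := set_valP u.
  have [|t [k [Tt Kk e]]] := rP (g0^-1 * g)%g.
    by rewrite -(act_isom A g0) actM actVK g0b gu.
  exists t => _; split => //; have -> : set_val u = A g x by [].
  rewrite -actM e actM.
  by rewrite (Kk : A k x = x).
have [t tP] := choice ext.
exists U, (fun u => (g0 * t u)%g); split.
- by rewrite openE => u /nU.
- by rewrite /U /= mdistxx.
- by move=> u Uu; have [_ tx] := tP u Uu; rewrite actM tx actVK.
move=> u Uu; apply: mulg_continuous_at; first exact: cst_continuous.
pose P (w : T) (v : orbit_set A x) := U v /\ A (set_val w) x = A g0^-1%g (set_val v).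
have cr := @closed_rel_continuous T (orbit_set A x) G P (fun (w : T) _ => set_val w) t u.
have cv (w : T) : {for (w, u), continuous (fun p : T * orbit_set A x => set_val p.1)}.
  apply: (@continuous_at_comp _ _ _ fst (set_val : T -> G)); first exact: cvg_fst.
  exact: set_val_continuous.
apply: cr.
- exact: compact_sub.
- move=> w nP; have nw : A (set_val w) x <> A g0^-1%g (set_val u) by move=> e; exact: nP.
  have : \forall p \near (w, u), A (set_val p.1) x <> A g0^-1%g (set_val p.2).
    apply: (@neq_near _ _ (fun p : T * orbit_set A x => A (set_val p.1) x)
      (fun p => A g0^-1%g (set_val p.2))) => //; first exact: metric_hausdorff.
      by apply: act_continuous_at; [exact: cv|exact: cst_continuous].
    apply: act_continuous_at; first exact: cst_continuous.
    apply: (@continuous_at_comp _ _ _ snd (set_val : orbit_set A x -> X)).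
      exact: cvg_snd.
    exact: set_val_continuous.
  by apply: filterS => p np [_ /np].
- by move=> w _; exact: cv.
- apply: filterS (nU u Uu) => v Uv; have [Tt tv] := tP v Uv.
  by exists (SigSub (mem_set Tt) : T).
move=> w v [Uv wv]; have [Tt tv] := tP v Uv; apply: Tinj => //.
  exact: set_valP.
by rewrite /isotropy /= actM wv -tv actK.
Qed.

End orbit_bundle.

(** * The cone bundle around an orbit *)

(** The section [s] over the interval [J] has isotropy group [H] except at its
    end [x = s 0], where the isotropy group [K] may be larger. *)
Section tube.
Variables (R : realType) (G : compactLieGroupType R) (X : metricType R).
Variable A : isometric_action G X.
Variables (tau : X -> R) (J : set R) (s : R -> X) (H : set G).
Hypothesis ctau : continuous tau.
Hypothesis tauG : forall g x, tau (A g x) = tau x.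
Hypotheses (J0 : J 0) (J1 : J 1) (Jge : forall t, J t -> 0 <= t).
Hypothesis cs : continuous s.
Hypothesis tauK : forall t, J t -> tau (s t) = t.
Hypothesis orbJ : forall y, J (tau y) -> exists g, y = A g (s (tau y)).
Hypothesis isoJ : forall t, J t -> 0 < t -> isotropy A (s t) = H.
Hypothesis HK : H `<=` isotropy A (s 0).
Hypothesis nearJ : forall y, tau y = 0 -> nbhs y [set z | J (tau z)].

Let x := s 0.
Let K := isotropy A x.
Let sK : is_subgroup K := isotropy_subgroup A x.

Definition tube_slice : set X :=
  [set y | exists k t, [/\ K k, J t & y = A k (s t)]].
Definition tube : set X := [set y | J (tau y)].

Let S := tube_slice.
Let U := tube.

Let cst : continuous (fun y => s (tau y)).
Proof. by move=> y; apply: (@continuous_at_comp _ _ _ tau s); [exact: ctau|exact: cs]. Qed.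

Lemma isotropy_sub t : J t -> isotropy A (s t) `<=` K.
Proof.
move=> Jt; have := Jge Jt; rewrite le_eqVlt => /predU1P[<-//|t0].
by rewrite isoJ.
Qed.

Lemma slice_stable k y : K k -> S y -> S (A k y).
Proof.
move=> Kk [l [t [Kl Jt ->]]]; exists (k * l)%g, t; split => //.
  by have [_ KM _] := sK; exact: KM.
by rewrite actM.
Qed.

Lemma slice_sub y : S y -> J (tau y).
Proof. by move=> [k [t [_ Jt ->]]]; rewrite tauG tauK. Qed.

Lemma slice_curve t : J t -> S (s t).
Proof. by move=> Jt; exists 1%g, t; split; rewrite ?act1//; have [] := sK. Qed.

Definition tube_val (c : twisted A K S) : X := A (rep c).1 (set_val (rep c).2).

Lemma tube_valE g (y : S) : tube_val (tw A K g y) = A g (set_val y).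
Proof.
apply: (@cls_invariant _ (@twisted_rel _ _ _ A K S) _
  (fun p : G * S => A p.1 (set_val p.2)) _ (g, y)).
by move=> p q [k _ [-> ->]]; rewrite actM.
Qed.

Lemma tube_val_continuous : continuous tube_val.
Proof.
apply: quot_continuous => p.
have -> : (fun p => tube_val (cls (@twisted_rel _ _ _ A K S) p)) =
    (fun p : G * S => A p.1 (set_val p.2)).
  by apply/funext => -[g y]; exact: tube_valE.
apply: act_continuous_at; first exact: cvg_fst.
apply: (@continuous_at_comp _ _ _ snd (set_val : S -> X)); first exact: cvg_snd.
exact: set_val_continuous.
Qed.

Lemma tube_val_act g c : tube_val (tw_act g c) = A g (tube_val c).
Proof. by rewrite /tw_act tube_valE actM. Qed.

Lemma tw_rep (c : twisted A K S) : tw A K (rep c).1 (rep c).2 = c.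
Proof. by rewrite /tw -surjective_pairing; exact: repK. Qed.

Lemma tube_val_sub c : U (tube_val c).
Proof. by rewrite /U /tube /tube_val /= tauG; exact: slice_sub (set_valP (rep c).2). Qed.

Definition to_tube (c : twisted A K S) : U := SigSub (mem_set (tube_val_sub c)).

Lemma curve_sub (u : U) : S (s (tau (set_val u))).
Proof. by apply: slice_curve; exact: (set_valP u). Qed.

Let curve (u : U) : S := SigSub (mem_set (curve_sub u)).

Let curve_continuous : continuous curve.
Proof.
move=> u; apply: to_sub_continuous_at => /=.
exact: (@sub_comp_continuous _ _ U (fun y => s (tau y))).
Qed.

(** The quotient of [g] and [g'] fixes the point of the section, hence belongs to
    [K]. *)
Lemma tube_fiber (u : U) g g' : A g (s (tau (set_val u))) = set_val u ->
  A g' (s (tau (set_val u))) = set_val u -> tw A K g (curve u) = tw A K g' (curve u).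
Proof.
move=> gu gu'; apply/esym; apply: cls_rel.
have k : isotropy A (s (tau (set_val u))) (g^-1 * g')%g.
  transitivity (A g^-1%g (A g (s (tau (set_val u))))); first by rewrite actM gu' gu.
  exact: actK.
exists (g^-1 * g')%g; first by apply: isotropy_sub k; exact: (set_valP u).
by split => /=; [rewrite mulgA mulgV mul1g|rewrite k].
Qed.

(** The inverse maps [u] to the class of [(g, s (tau u))] for any [g] that carries
    [s (tau u)] to [u]: a selection by a closed condition on [G]. *)
Lemma tube_homeo : is_homeo to_tube.
Proof.
split; first by move=> c; apply: to_sub_continuous_at; exact: tube_val_continuous.
have exg (u : U) : exists g, A g (s (tau (set_val u))) = set_val u.
  by have [g e] := orbJ (set_valP u); exists g; exact/esym.
have [g gP] := choice exg.
have hE (u : U) g' : A g' (s (tau (set_val u))) = set_val u ->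
    tw A K (g u) (curve u) = tw A K g' (curve u) by move=> e; exact: tube_fiber.
exists (fun u => tw A K (g u) (curve u)); split.
- move=> c; transitivity (tw A K (rep c).1 (rep c).2); last exact: tw_rep.
  set a := (rep c).1; set y := (rep c).2.
  have [k [t [Kk Jt yt]]] := set_valP y; have ya : set_val y = A k (s t) := yt.
  have ct : set_val (to_tube c) = A (a * k)%g (s t).
    by rewrite actM -ya; reflexivity.
  have tc : tau (set_val (to_tube c)) = t by rewrite ct tauG tauK.
  rewrite (hE _ (a * k)%g); last by rewrite tc ct.
  apply/esym; apply: cls_rel; exists k^-1%g; first by have [_ _] := sK; exact.
  split; first by rewrite /= mulgK.
  change (s (tau (set_val (to_tube c))) = A k^-1%g (set_val y)).
  by rewrite ya actK tc.
- by move=> u; apply: val_inj; rewrite /= tube_valE; exact: gP.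
move=> u; pose P (a : G) (u : U) := A a (s (tau (set_val u))) = set_val u.
have cr := @closed_rel_continuous G U (twisted A K S) P (fun a u => tw A K a (curve u))
  (fun u => tw A K (g u) (curve u)) u.
apply: cr.
- exact: lie_compact.
- move=> a nP.
  suff : \forall p \near (a, u), A p.1 (s (tau (set_val p.2))) <> set_val p.2 by [].
  have cu (f : X -> X) : continuous f ->
      {for (a, u), continuous (fun p : G * U => f (set_val p.2))}.
    move=> cf; apply: (@continuous_at_comp _ _ _ snd (fun u : U => f (set_val u))).
      exact: cvg_snd.
    exact: sub_comp_continuous.
  apply: (@neq_near _ _ (fun p : G * U => A p.1 (s (tau (set_val p.2))))
    (fun p => set_val p.2)) => //; first exact: metric_hausdorff.
    apply: act_continuous_at; first exact: cvg_fst.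
    exact: (cu (fun y => s (tau y))).
  by apply: (cu id) => y; exact: cvg_id.
- move=> a _; apply: (@continuous_at_comp _ _ _ (fun p : G * U => (p.1, curve p.2))
    (cls (@twisted_rel _ _ _ A K S))); last exact: cls_continuous.
  apply: pair_continuous_at; first exact: cvg_fst.
  by apply: (@continuous_at_comp _ _ _ snd curve); [exact: cvg_snd|exact: curve_continuous].
- apply: filterE => v; have [a av] := exg v; by exists a.
by move=> a v; exact: hE.
Qed.

Lemma tube_is_slice : is_slice A x S.
Proof.
split.
- by exists 1%g, 0; split; rewrite ?act1//; have [] := sK.
- by move=> k y; exact: slice_stable.
exists U; split.
  by move=> y [g _ <-]; apply: nearJ; rewrite tauG tauK.
exists to_tube; first exact: tube_homeo.
by move=> g y; exact: tube_valE.
Qed.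

Definition link_set : set X := [set y | exists2 k, K k & y = A k (s 1)].
Let L : set X := link_set.

Let link_lift (f : L) : exists k, K k /\ set_val f = A k (s 1).
Proof. by have [k Kk e] := set_valP f; exists k. Qed.

Let lk := projT1 (choice link_lift).
Let lkP (f : L) : K (lk f) /\ set_val f = A (lk f) (s 1).
Proof. exact: (projT2 (choice link_lift) f). Qed.

(** Apart from [t = 0], where [K] fixes [s t], the points [s t] and [s 1] have the
    same isotropy group. *)
Lemma link_fiber k k' t : K k -> K k' -> J t -> A k (s 1) = A k' (s 1) ->
  A k (s t) = A k' (s t).
Proof.
move=> Kk Kk' Jt e; have := Jge Jt; rewrite le_eqVlt => /predU1P[<-|t0].
  by rewrite (Kk : A k x = x) (Kk' : A k' x = x).
have : isotropy A (s t) (k^-1 * k')%g.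
  by rewrite isoJ// -(isoJ J1 ltr01) /isotropy /= actM -e actK.
by move=> h; rewrite -[in LHS]h actM actVK.
Qed.

Definition cone_val (q : cone L J) : X := A (lk (rep q).1) (s (set_val (rep q).2)).

Lemma cone_valE k (f : L) (t : J) : K k -> set_val f = A k (s 1) ->
  cone_val (cone_pt f t) = A k (s (set_val t)).
Proof.
move=> Kk fk; transitivity (A (lk f) (s (set_val t))).
  apply: (@cls_invariant _ (@cone_rel R L J) _
    (fun p : L * J => A (lk p.1) (s (set_val p.2))) _ (f, t)) => p q [-> ->].
  by rewrite ((lkP p.1).1 : A _ x = x) ((lkP q.1).1 : A _ x = x).
have [Kl lkf] := lkP f; apply: link_fiber => //; first exact: (set_valP t).
by rewrite -lkf.
Qed.

Lemma cone_val_sub q : S (cone_val q).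
Proof.
exists (lk (rep q).1), (set_val (rep q).2); split => //.
  by have [] := lkP (rep q).1.
exact: (set_valP (rep q).2).
Qed.

Definition to_slice (q : cone L J) : S := SigSub (mem_set (cone_val_sub q)).

Lemma to_sliceE q : set_val (to_slice q) = cone_val q.
Proof. by []. Qed.

Let compact_K : compact [set: K].
Proof.
apply: compact_sub; apply: subclosed_compact (@lie_compact R G) _ => //.
exact: isotropy_closed.
Qed.

Lemma cone_val_continuous : continuous cone_val.
Proof.
apply: quot_continuous => -[f t].
pose P (k : K) (p : L * J) := A (set_val k) (s 1) = set_val p.1.
have cr := @closed_rel_continuous K (L * J)%type X P
  (fun k p => A (set_val k) (s (set_val p.2)))
  (fun p => cone_val (cls (@cone_rel R L J) p)) (f, t).
have ck (k : K) : {for (k, (f, t)), continuous (fun p : K * (L * J) => set_val p.1)}.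
  apply: (@continuous_at_comp _ _ _ fst (set_val : K -> G)); first exact: cvg_fst.
  exact: set_val_continuous.
have c2 (k : K) : {for (k, (f, t)), continuous (snd : K * (L * J) -> L * J)}.
  exact: cvg_snd.
apply: cr => //.
- move=> k nP.
  suff : \forall p \near (k, (f, t)), A (set_val p.1) (s 1) <> set_val p.2.1 by [].
  apply: (@neq_near _ _ (fun p : K * (L * J) => A (set_val p.1) (s 1))
    (fun p => set_val p.2.1)) => //; first exact: metric_hausdorff.
    by apply: act_continuous_at; [exact: ck|exact: cst_continuous].
  apply: (@continuous_at_comp _ _ _ (fun p : K * (L * J) => p.2.1) (set_val : L -> X)).
    by apply: (@continuous_at_comp _ _ _ snd fst); [exact: c2|exact: cvg_fst].
  exact: set_val_continuous.
- move=> k _; apply: act_continuous_at; first exact: ck.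
  apply: (@continuous_at_comp _ _ _ (fun p : K * (L * J) => p.2.2)
    (fun t : J => s (set_val t))).
    by apply: (@continuous_at_comp _ _ _ snd snd); [exact: c2|exact: cvg_snd].
  exact: sub_comp_continuous.
- apply: filterE => -[g u]; have [Kl e] := lkP g.
  by exists (SigSub (mem_set Kl) : K); exact/esym.
move=> k [g u] Pk; apply: cone_valE; first exact: set_valP.
exact/esym.
Qed.

Lemma slice_lift (y : S) : exists k : K, A (set_val k) (s (tau (set_val y))) = set_val y.
Proof.
have [k [t [Kk Jt e]]] := set_valP y; have e' : set_val y = A k (s t) := e.
by exists (SigSub (mem_set Kk) : K); rewrite /= e' tauG tauK.
Qed.

Let link_pt_sub (k : K) : L (A (set_val k) (s 1)).
Proof. by exists (set_val k) => //; exact: (set_valP k). Qed.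
Let link_pt (k : K) : L := SigSub (mem_set (link_pt_sub k)).
Let height (y : S) : J := SigSub (mem_set (slice_sub (set_valP y))).

Let slice_fiber (y : S) (k k' : K) : A (set_val k) (s (tau (set_val y))) = set_val y ->
  A (set_val k') (s (tau (set_val y))) = set_val y ->
  cone_pt (link_pt k) (height y) = cone_pt (link_pt k') (height y).
Proof.
move=> ky ky'; have Jt := slice_sub (set_valP y).
have := Jge Jt; rewrite le_eqVlt => /predU1P[t0|t0].
  by apply: cls_rel; split; rewrite /= t0.
suff -> : link_pt k = link_pt k' by [].
apply: val_inj => /=.
have : isotropy A (s 1) ((set_val k)^-1 * set_val k')%g.
  rewrite (isoJ J1 ltr01) -(isoJ Jt t0) /isotropy /=.
  transitivity (A (set_val k)^-1%g (A (set_val k) (s (tau (set_val y))))).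
    by rewrite actM ky' ky.
  exact: actK.
by move=> h; rewrite -[in LHS]h actM actVK.
Qed.

Lemma slice_homeo : is_homeo to_slice.
Proof.
split; first by move=> q; apply: to_sub_continuous_at; exact: cone_val_continuous.
have [k kP] := choice slice_lift.
have hE (y : S) (k' : K) : A (set_val k') (s (tau (set_val y))) = set_val y ->
    cone_pt (link_pt (k y)) (height y) = cone_pt (link_pt k') (height y).
  by move=> e; exact: slice_fiber.
exists (fun y => cone_pt (link_pt (k y)) (height y)); split.
- move=> q; set f := (rep q).1; set t := (rep q).2.
  have [Kf fE] := lkP f; have Jt : J (set_val t) := set_valP t.
  have qE : set_val (to_slice q) = A (lk f) (s (set_val t)) by [].
  have tq : tau (set_val (to_slice q)) = set_val t by rewrite qE tauG tauK.
  rewrite (hE _ (SigSub (mem_set Kf) : K)); last by rewrite tq qE.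
  rewrite -[RHS](repK q) [rep q]surjective_pairing -/f -/t.
  congr (cls _ (_, _)); apply: val_inj; [exact/esym|exact: tq].
- move=> y; apply: val_inj => /=.
  by rewrite (@cone_valE (set_val (k y)))//=; exact: (set_valP (k y)).
move=> y; pose P (k : K) (y : S) := A (set_val k) (s (tau (set_val y))) = set_val y.
have cr := @closed_rel_continuous K S (cone L J) P
  (fun k y => cone_pt (link_pt k) (height y))
  (fun y => cone_pt (link_pt (k y)) (height y)) y.
have ck (l : K) : {for (l, y), continuous (fun p : K * S => set_val p.1)}.
  apply: (@continuous_at_comp _ _ _ fst (set_val : K -> G)); first exact: cvg_fst.
  exact: set_val_continuous.
have cy (W : topologicalType) (l : K) (f : X -> W) : continuous f ->
    {for (l, y), continuous (fun p : K * S => f (set_val p.2))}.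
  move=> cf; apply: (@continuous_at_comp _ _ _ snd (fun u : S => f (set_val u))).
    exact: cvg_snd.
  exact: sub_comp_continuous.
apply: cr => //.
- move=> l nP.
  suff : \forall p \near (l, y), A (set_val p.1) (s (tau (set_val p.2))) <> set_val p.2.
    by [].
  apply: (@neq_near _ _ (fun p : K * S => A (set_val p.1) (s (tau (set_val p.2))))
    (fun p => set_val p.2)) => //; first exact: metric_hausdorff.
    apply: act_continuous_at; first exact: ck.
    exact: (cy _ l (fun z => s (tau z))).
  by apply: (cy _ l id) => z; exact: cvg_id.
- move=> l _; apply: (@continuous_at_comp _ _ _
    (fun p : K * S => (link_pt p.1, height p.2)) (cls (@cone_rel R L J)));
    last exact: cls_continuous.
  apply: pair_continuous_at; apply: to_sub_continuous_at => /=.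
    by apply: act_continuous_at; [exact: ck|exact: cst_continuous].
  exact: cy.
- apply: filterE => z; exact: slice_lift.
by move=> l z; exact: hE.
Qed.

Let link_act_sub k (f : L) : K k -> L (A k (set_val f)).
Proof.
move=> Kk; have [l Kl e] := set_valP f; have e' : set_val f = A l (s 1) := e.
exists (k * l)%g; first by have [_ KM _] := sK; exact: KM.
by rewrite e' actM.
Qed.

(** The link is acted upon by the isotropy group only; other elements of [G]
    are made to act trivially. *)
Definition link_act (k : G) (f : L) : L :=
  if pselect (K k) is left Kk then SigSub (mem_set (link_act_sub f Kk)) else f.

Lemma link_actE k f : K k -> set_val (link_act k f) = A k (set_val f).
Proof. by move=> Kk; rewrite /link_act; case: pselect. Qed.

Lemma link_act1 f : link_act 1%g f = f.
Proof. by apply: val_inj; rewrite [LHS]link_actE ?act1//; have [] := sK. Qed.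

Lemma link_actM k k' f : isotropy A x k -> isotropy A x k' ->
  link_act (k * k')%g f = link_act k (link_act k' f).
Proof.
move=> Kk Kk'; apply: val_inj; rewrite [LHS]link_actE.
  by rewrite actM [RHS]link_actE// link_actE.
by have [_ KM _] := sK; exact: KM.
Qed.

Lemma link_act_continuous :
  continuous (fun p : isotropy A x * L => link_act (set_val p.1) p.2).
Proof.
move=> p; apply: to_sub_continuous_at.
have -> : (fun p : K * L => set_val (link_act (set_val p.1) p.2)) =
    (fun p => A (set_val p.1) (set_val p.2)).
  by apply/funext => q; rewrite link_actE//; exact: (set_valP q.1).
apply: act_continuous_at.
  apply: (@continuous_at_comp _ _ _ fst (set_val : K -> G)); first exact: cvg_fst.
  exact: set_val_continuous.
apply: (@continuous_at_comp _ _ _ snd (set_val : L -> X)); first exact: cvg_snd.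
exact: set_val_continuous.
Qed.

Lemma to_slice_apex f (t : J) : set_val t = 0 -> set_val (to_slice (cone_pt f t)) = x.
Proof.
move=> t0; have [Kf fE] := lkP f.
by rewrite to_sliceE (cone_valE t Kf fE) t0; exact: Kf.
Qed.

Lemma to_slice_equivariant k f (t : J) : isotropy A x k ->
  set_val (to_slice (cone_pt (link_act k f) t)) = A k (set_val (to_slice (cone_pt f t))).
Proof.
move=> Kk; have [Kf fE] := lkP f; rewrite !to_sliceE (cone_valE t Kf fE) -actM.
apply: cone_valE; first by have [_ KM _] := sK; exact: KM.
by rewrite link_actE// fE actM.
Qed.

Let proj_sub (c : twisted A K S) : orbit_set A x (A (rep c).1 x).
Proof. by exists (rep c).1. Qed.

Definition tube_proj (c : twisted A K S) : orbit_set A x :=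
  SigSub (mem_set (proj_sub c)).

Lemma tube_projE g (y : S) : set_val (tube_proj (tw A K g y)) = A g x.
Proof.
apply: (@cls_invariant _ (@twisted_rel _ _ _ A K S) _
  (fun p : G * S => A p.1 x) _ (g, y)) => p q [k Kk [-> _]].
by rewrite actM (Kk : A k x = x).
Qed.

Lemma tube_proj_continuous : continuous tube_proj.
Proof.
apply: quot_continuous => p; apply: to_sub_continuous_at.
have -> : (fun p => set_val (tube_proj (cls (@twisted_rel _ _ _ A K S) p))) =
    (fun p : G * S => A p.1 x).
  by apply/funext => -[g y]; exact: tube_projE.
by apply: act_continuous_at; [exact: cvg_fst|exact: cst_continuous].
Qed.

(** Over the domain of a local section [chi] of the orbit map, a point of the
    tube over [u] is [chi u] times a point of the slice. *)
Lemma tube_bundle : is_fiber_bundle S tube_proj.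
Proof.
split; first exact: tube_proj_continuous.
move=> b; have [V [chi [oV Vb chiP cchi]]] := orbit_local_section b.
exists V; split => //.
have hV (p : V * S) : V (tube_proj (tw A K (chi (set_val p.1)) p.2)).
  suff -> : tube_proj (tw A K (chi (set_val p.1)) p.2) = set_val p.1 by exact: set_valP.
  by apply: val_inj; rewrite [LHS]tube_projE chiP//; exact: set_valP.
pose h (p : V * S) : tube_proj @^-1` V :=
  SigSub (mem_set (hV p : (tube_proj @^-1` V) (tw A K (chi (set_val p.1)) p.2))).
have hS (c : tube_proj @^-1` V) :
    S (A (chi (tube_proj (set_val c)))^-1%g (tube_val (set_val c))).
  have Vc : V (tube_proj (set_val c)) := set_valP c.
  have e := chiP _ Vc; rewrite /tube_val -actM.
  apply: slice_stable; last exact: set_valP.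
  by rewrite /K /isotropy /= actM -[A (rep _).1 x]/(set_val (tube_proj (set_val c))) -e actK.
pose h' (c : tube_proj @^-1` V) : V * S :=
  (SigSub (mem_set (set_valP c : V (tube_proj (set_val c)))),
   SigSub (mem_set (hS c))).
have proj_h p : tube_proj (set_val (h p)) = set_val p.1.
  by apply: val_inj; rewrite [LHS]tube_projE chiP//; exact: set_valP.
exists h; last by move=> u y; exact: proj_h.
have cval : continuous (fun c : tube_proj @^-1` V => tube_proj (set_val c)).
  by apply: sub_comp_continuous; exact: tube_proj_continuous.
split.
  move=> p; apply: to_sub_continuous_at.
  apply: (@continuous_at_comp _ _ _ (fun p : V * S => (chi (set_val p.1), p.2))
    (cls (@twisted_rel _ _ _ A K S))); last exact: cls_continuous.
  apply: pair_continuous_at; last exact: cvg_snd.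
  apply: (@continuous_at_comp _ _ _ (fun p : V * S => set_val p.1) chi).
    apply: (@continuous_at_comp _ _ _ fst (set_val : V -> orbit_set A x)).
      exact: cvg_fst.
    exact: set_val_continuous.
  by apply: cchi; exact: set_valP.
exists h'; split.
- move=> [u y]; rewrite /h' /=; congr pair; apply: val_inj => /=.
    exact: (proj_h (u, y)).
  rewrite [X in chi X](proj_h (u, y)) /=.
  by rewrite tube_valE actK.
- move=> c; apply: val_inj => /=.
  rewrite -[RHS](tw_rep (set_val c)); apply/esym; apply: cls_rel.
  set g := (rep (set_val c)).1; set a := chi _.
  have Vc : V (tube_proj (set_val c)) := set_valP c.
  have e : A a x = A g x := chiP _ Vc.
  exists (a^-1 * g)%g; first by rewrite /K /isotropy /= actM -e actK.
  by split => /=; [rewrite mulgA mulgV mul1g|rewrite actM].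
move=> c; apply: pair_continuous_at; apply: to_sub_continuous_at => /=.
  exact: cval.
apply: (@act_continuous_at R G X A _
  (fun c : tube_proj @^-1` V => (chi (tube_proj (set_val c)))^-1%g)
  (fun c => tube_val (set_val c))).
  apply: invg_continuous_at.
  apply: (@continuous_at_comp _ _ _ (fun c : tube_proj @^-1` V =>
    tube_proj (set_val c)) chi); first exact: cval.
  by apply: cchi; exact: (set_valP c).
by apply: sub_comp_continuous; exact: tube_val_continuous.
Qed.

Definition tube_cone_bundle : cone_bundle A J x :=
  @ConeBundle R G X A J x S tube_is_slice L link_act link_act1 link_actM
    link_act_continuous to_slice slice_homeo to_slice_apex to_slice_equivariant
    tube_proj tube_projE tube_bundle.

Lemma tube_boundaryP (c : twisted A K S) : tau (tube_val c) = 1 <->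
  exists g f (t : J), set_val t = 1 /\ c = tw A K g (to_slice (cone_pt f t)).
Proof.
split=> [c1|[g [f [t [t1 ->]]]]].
  set y := (rep c).2; have ty : tau (set_val y) = 1 by rewrite -c1 [RHS]tauG.
  have [k ky] := slice_lift y.
  pose t : J := SigSub (mem_set J1).
  exists (rep c).1, (link_pt k), t; split => //.
  rewrite -[LHS]tw_rep -/y; congr tw; apply: val_inj.
  transitivity (A (set_val k) (s (tau (set_val y)))); first exact/esym.
  rewrite [RHS]to_sliceE ty; apply/esym.
  exact: (@cone_valE (set_val k) (link_pt k) t (set_valP k) erefl).
have [Kf fE] := lkP f.
by rewrite tube_valE to_sliceE (cone_valE t Kf fE) !tauG tauK// t1.
Qed.

End tube.

(** * Orbit space a line or a half-line *)

Section homogeneous_bundles.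
Variables (R : realType) (G : compactLieGroupType R) (X : metricType R).
Variable A : isometric_action G X.
Variable H : set G.
Hypothesis sH : is_subgroup H.

Let e (g g' : G) := exists2 h, H h & g' = (g * h)%g.

Lemma coset_eq g g' : cls e g = cls e g' -> exists2 h, H h & g' = (g * h)%g.
Proof.
have [H1 HM HV] := sH; move=> /clsP; elim=> {g g'} [//|g|g g' _ [h Hh ->]|].
- by exists 1%g; rewrite ?mulg1.
- by exists h^-1%g; [exact: HV|rewrite mulgK].
move=> g1 g2 g3 _ [h Hh ->] _ [k Hk ->]; exists (h * k)%g; first exact: HM.
by rewrite mulgA.
Qed.

(** The saturation of an open set is a union of its right translates. *)
Lemma coset_open g (V : set G) : nbhs g V -> nbhs (cls e g : coset_space H) (cls e @` V).
Proof.
move=> gV; have [V' [oV' V'g] V'V] : exists2 V', open_nbhs g V' & V' `<=` V.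
  by move: gV; rewrite nbhsE.
suff oC : open (cls e @` V' : set (coset_space H)).
  by apply: filterS (open_nbhs_nbhs (conj oC (imageP _ V'g))) => _ [k Vk <-];
     exists k => //; exact: V'V.
change (open (cls e @^-1` (cls e @` V'))); rewrite openE => k [l Vl lk].
have [h Hh kl] := coset_eq lk.
have ch : {for k, continuous (fun k => (k * h^-1)%g)}.
  by apply: mulg_continuous_at; [exact: cvg_id|exact: cst_continuous].
have nV : nbhs (k * h^-1)%g V' by rewrite kl mulgK; exact: open_nbhs_nbhs.
apply: filterS (cont_near ch nV) => m Vm; exists (m * h^-1)%g => //.
by apply: cls_rel; exists h => //; rewrite mulgVK.
Qed.

(** Over any base, a section with constant isotropy group [H] identifies the
    union of the orbits that it meets with a product with [G/H]. *)
Lemma product_chart (B : topologicalType) (D : set X) (p : D -> B) (s : B -> X) :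
  continuous p -> continuous s -> (forall b, isotropy A (s b) = H) ->
  forall (Ds : forall g b, D (A g (s b))),
  (forall g b, p (SigSub (mem_set (Ds g b))) = b) ->
  (forall y : D, exists g, set_val y = A g (s (p y))) ->
  exists2 h : (B * coset_space H)%type -> D, is_homeo h &
    forall b g, set_val (h (b, cls e g)) = A g (s b).
Proof.
move=> cp cs sH' Ds ps Dex.
pose hX (q : B * coset_space H) := A (rep q.2) (s q.1).
have hXE b g : hX (b, cls e g) = A g (s b).
  apply: (@cls_invariant _ e _ (fun g => A g (s b))) => k k' [h Hh ->].
  by rewrite actM; congr (A k _); apply/esym; move: Hh; rewrite -(sH' b).
have hD q : D (hX q) by exact: Ds.
pose h q : D := SigSub (mem_set (hD q)).
have ph b g : p (h (b, cls e g)) = b.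
  by rewrite -[RHS](ps g b); congr p; apply: val_inj => /=; exact: hXE.
have clsK (c : coset_space H) : cls e (rep c) = c by exact: repK.
exists h; last exact: hXE.
have [g gP] := choice Dex.
have geq (y : D) k k' : set_val y = A k (s (p y)) -> set_val y = A k' (s (p y)) ->
    cls e k = cls e k'.
  move=> ky ky'; have : isotropy A (s (p y)) (k^-1 * k')%g.
    rewrite /isotropy /=; transitivity (A k^-1%g (A k (s (p y)))).
      by rewrite actM -ky' -ky.
    exact: actK.
  rewrite sH' => kk; apply: cls_rel; exists (k^-1 * k')%g => //.
  by rewrite mulgA mulgV mul1g.
split.
  move=> [b c]; apply: to_sub_continuous_at; rewrite -(clsK c).
  set k := rep c; move=> O; rewrite [set_val _]hXE => Ok.
  have ca : {for (b, k), continuous (fun q : B * G => A q.2 (s q.1))}.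
    apply: act_continuous_at; first exact: cvg_snd.
    apply: (@continuous_at_comp _ _ _ fst s); first exact: cvg_fst.
    exact: cs.
  have [[V1 V2] /= [bV1 kV2] V12] := cont_near ca Ok.
  exists (V1, cls e @` V2); first by split => //; exact: coset_open.
  move=> [b' c'] [/= Vb [k' Vk' <-]]; rewrite [set_val _]hXE.
  exact: (V12 (b', k')).
exists (fun y => (p y, cls e (g y))); split.
- move=> [b c]; rewrite -(clsK c) ph; congr pair.
  by apply: (geq (h (b, cls e (rep c)))); [exact: gP|rewrite ph [LHS]hXE].
- by move=> y; apply: val_inj; rewrite /= [LHS]hXE -gP.
move=> y; apply: (@pair_continuous_at D B (coset_space H) p (fun y => cls e (g y)));
  first exact: cp.
pose P k (y : D) := set_val y = A k (s (p y)).
have cr := @closed_rel_continuous G D (coset_space H) P (fun k _ => cls e k)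
  (fun y => cls e (g y)) y.
apply: cr.
- exact: lie_compact.
- move=> k nP.
  suff : \forall q \near (k, y), set_val q.2 <> A q.1 (s (p q.2)) by [].
  apply: (@neq_near _ _ (fun q : G * D => set_val q.2)
    (fun q : G * D => A q.1 (s (p q.2)))) => //; first exact: metric_hausdorff.
    apply: (@continuous_at_comp _ _ _ snd (set_val : D -> X)); first exact: cvg_snd.
    exact: set_val_continuous.
  apply: act_continuous_at; first exact: cvg_fst.
  apply: (@continuous_at_comp _ _ _ (fun q : G * D => p q.2) s); last exact: cs.
  by apply: (@continuous_at_comp _ _ _ snd p); [exact: cvg_snd|exact: cp].
- move=> k _; apply: (@continuous_at_comp _ _ _ fst (cls e)); first exact: cvg_fst.
  exact: cls_continuous.
- by apply: filterE => z; exists (g z); exact: gP.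
by move=> k z Pk; apply: geq Pk; exact: gP.
Qed.

End homogeneous_bundles.

(** The retraction [r] of the line onto [J] turns the inverse of a coordinate with
    values in [J] into a function on the line. *)
Lemma homeo_coordinate (R : realType) (T : topologicalType) (J : set R) (r : R -> R) :
  continuous r -> (forall t, J (r t)) -> (forall t, J t -> r t = t) ->
  homeomorphic T J -> exists (f : T -> R) (f' : R -> T), [/\ continuous f,
    continuous f', forall o, J (f o), forall o, f' (f o) = o &
    forall t, J t -> f (f' t) = t].
Proof.
move=> cr rJ rK [h [ch [k [hK kK ck]]]].
exists (fun o => set_val (h o)), (fun t => k (SigSub (mem_set (rJ t)))); split.
- move=> o; apply: (@continuous_at_comp _ _ _ h (set_val : J -> R)); first exact: ch.
  exact: set_val_continuous.
- move=> t; apply: (@continuous_at_comp _ _ _ (fun t => SigSub (mem_set (rJ t)) : J) k).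
    by apply: to_sub_continuous_at; exact: cr.
  exact: ck.
- by move=> o; exact: set_valP.
- move=> o; rewrite -[RHS]hK; congr k; apply: val_inj => /=.
  by apply: rK; exact: (set_valP (h o)).
move=> t Jt; transitivity (r t); last exact: rK.
exact: (congr1 set_val (kK _)).
Qed.

Lemma homeomorphic_sym (S T : topologicalType) : homeomorphic S T -> homeomorphic T S.
Proof. by move=> [f [cf [g [fK gK cg]]]]; exists g; split => //; exists f. Qed.

Lemma homeomorphic_trans (S T U : topologicalType) :
  homeomorphic S T -> homeomorphic T U -> homeomorphic S U.
Proof.
move=> [f [cf [g [fK gK cg]]]] [f' [cf' [g' [fK' gK' cg']]]].
exists (f' \o f); split.
  by move=> x; apply: (@continuous_at_comp _ _ _ f f'); [exact: cf|exact: cf'].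
exists (g \o g'); split; [exact: can_comp|exact: can_comp|].
by move=> x; apply: (@continuous_at_comp _ _ _ g' g); [exact: cg'|exact: cg].
Qed.

Lemma homeomorphic_full (T : topologicalType) (B : set T) : (forall x, B x) ->
  homeomorphic T B.
Proof.
move=> BT; exists (fun x => SigSub (mem_set (BT x))); split.
  by move=> x; apply: to_sub_continuous_at; exact: cvg_id.
exists set_val; split => //; last exact: set_val_continuous.
by move=> x; apply: val_inj.
Qed.

Section model.
Variables (R : realType) (G : compactLieGroupType R) (X : completeMetricType R).
Variables (A : isometric_action G X) (H : set G).
Hypothesis geo : geodesic_space X.
Hypothesis prin : is_principal_isotropy A H.

Lemma principal_closed : closed H.
Proof. by have [[x [_ <-]] _] := prin; exact: isotropy_closed. Qed.

Lemma principal_subgroup : is_subgroup H.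
Proof. by have [[x [_ <-]] _] := prin; exact: isotropy_subgroup. Qed.

Lemma nonsingular_type x : ~ singular A x -> has_type A H x.
Proof. by have [_] := prin; apply. Qed.

Section interval.
Variables (J : set R) (t : orbit_space A -> R) (rho : R -> orbit_space A).
Hypotheses (ct : continuous t) (crho : continuous rho).
Hypothesis tK : forall o, rho (t o) = o.
Hypothesis rhoK : forall u, J u -> t (rho u) = u.
Hypothesis Jconv : forall a b u, J a -> J b -> a <= u -> u <= b -> J u.

Definition coord (x : X) := t (orb A x).

Lemma coord_continuous : continuous coord.
Proof.
move=> x; apply: (@continuous_at_comp _ _ _ (orb A) t); last exact: ct.
exact: orb_continuous.
Qed.

Lemma coordG g x : coord (A g x) = coord x.
Proof. by rewrite /coord orb_act. Qed.

Lemma coordP x y : coord x = coord y -> exists g, y = A g x.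
Proof. by move=> xy; apply/orbP; rewrite -(tK (orb A x)) -/(coord x) xy tK. Qed.

Lemma coord_exists u : J u -> exists x, coord x = u.
Proof. by move=> Ju; exists (repr (rho u)); rewrite /coord Defs.orbK rhoK. Qed.

(** The coordinate is injective along an orbit geodesic that joins the orbits
    over [p] and [q]. *)
Lemma coord_lifted p q : J p -> J q -> lifted coord p q.
Proof.
move=> Jp Jq; have [x xp] := coord_exists Jp; have [y yq] := coord_exists Jq.
have [pq|qp] := ltP p q; last first.
  exists (fun=> x) => [|u u1 u2]; first exact: cst_continuous.
  by rewrite xp; apply/le_anti/andP; split => //; exact: le_trans u2 qp.
have xy : orb A x <> orb A y.
  by move=> /(congr1 t) e; move: pq; rewrite -xp -yq /coord e ltxx.
have [c [cc c0 c1 _ cinj]] := orbit_geodesic geo xy.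
have [||f [cf _ fP]] := @lift_path R X coord c cc.
- by move=> u _ _; exact: coord_continuous.
- move=> u v u0 u1 v0 v1 e; apply: cinj => //.
  by rewrite -(tK (orb A (c u))) -/(coord (c u)) e tK.
have e0 : coord (c 0) = p by rewrite c0.
have e1 : coord (c 1) = q by rewrite /coord c1.
rewrite e0 e1 (min_idPl (ltW pq)) (max_idPr (ltW pq)) in fP.
by exists f => // u u1 u2; have [] := fP u u1 u2.
Qed.

Lemma interior_nonsingular x e : 0 < e -> J (coord x - e) -> J (coord x + e) ->
  ~ singular A x.
Proof.
move=> e0 Jm Jp; apply: (@not_boundary R _ _ setT t); first exact: filterT.
- by move=> o _; exact: ct.
- by move=> o _ /(congr1 rho); rewrite !tK.
move=> W Wx; rewrite -(tK (orb A x)) -/(coord x) in Wx.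
have [d d0 dW] := near_itv (cont_near (@crho (coord x)) Wx).
pose m := Num.min e (d / 2).
have m0 : 0 < m by rewrite lt_min e0 divr_gt0.
have me : m <= e by rewrite ge_min lexx.
have md : m <= d / 2 by rewrite ge_min lexx orbT.
exists (rho (coord x - m)), (rho (coord x + m)); split.
- apply: dW; have -> : coord x - m - coord x = - m by ring.
  by rewrite normrN gtr0_norm//; lra.
- by apply: dW; rewrite addrC addKr gtr0_norm//; lra.
- by rewrite rhoK -/(coord x); [lra|apply: (Jconv Jm Jp); lra].
- by rewrite rhoK -/(coord x); [lra|apply: (Jconv Jm Jp); lra].
Qed.

Lemma over_exists u : J u -> (forall x, coord x = u -> has_type A H x) ->
  exists y, over A coord H u y.
Proof.
move=> Ju typ; have [x xu] := coord_exists Ju; have [g gH] := typ x xu.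
exists (A g^-1%g x); split; first by rewrite coordG.
by rewrite isotropy_act gH conj_setM mulVg conj_set1.
Qed.

End interval.

(** Two sections from the same point over opposite rays form a global
    section. *)
Lemma real_line_case : homeomorphic (orbit_space A) R ->
  homeomorphic X (R * coset_space H)%type.
Proof.
move=> hR; have [t [rho [ct crho _ tK rhoK]]] := homeo_coordinate
  (r := id) (fun u => @cvg_id _ (nbhs u)) (fun=> I) (fun _ _ => erefl)
  (homeomorphic_trans hR (homeomorphic_full (fun u : R => I : [set: R] u))).
have rhoK' u : t (rho u) = u by exact: rhoK.
pose tau := coord t.
have tauP := coordP tK; have tauG := @coordG t.
have typ x : has_type A H x.
  apply: nonsingular_type.
  exact: (@interior_nonsingular setT t rho ct crho tK rhoK
    (fun _ _ _ _ _ _ _ => I) x 1 ltr01 I I).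
have clH := principal_closed.
have [y [yt yH]] : exists y, over A tau H 0 y.
  by apply: (over_exists rhoK) => // x _; exact: typ.
have lft a b : lifted tau a b by exact: (@coord_lifted setT t rho ct tK rhoK).
have lft' a b : lifted (fun x => - tau x) a b.
  have [c cc cP] := lft (- b) (- a); exists (fun u => c (- u)).
    move=> u; apply: (@continuous_at_comp _ _ _ (fun u : R => - u) c); last exact: cc.
    by apply: cvgN; exact: cvg_id.
  by move=> u u1 u2; rewrite cP ?opprK// lerN2.
have [s1 [cs1 s10 s1P]] := ray_section tauP tauG clH ltr01 (lft _)
  (fun z _ => typ z) (conj yt yH).
have tauP' x z : - tau x = - tau z -> exists g, z = A g x by move=> /oppr_inj/tauP.
have tauG' g x : - tau (A g x) = - tau x by congr (- _); exact: tauG.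
have yt' : - tau y = 0 by rewrite yt oppr0.
have [s2 [cs2 s20 s2P]] := @ray_section _ _ _ A _ tauP' tauG' H 0 1 y clH ltr01 (lft' _)
  (fun z _ => typ z) (conj yt' yH).
pose s u := if u <= 0 then s2 (- u) else s1 u.
have cs : continuous s.
  apply: (@paste_continuous _ _ _ id) => //; first by move=> u; exact: cvg_id.
    move=> u; apply: (@continuous_at_comp _ _ _ (fun u : R => - u) s2); last exact: cs2.
    by apply: cvgN; exact: cvg_id.
  by move=> u ->; rewrite oppr0 s10.
have sP u : over A tau H u (s u).
  rewrite /s; case: leP => u0; last by apply: s1P; exact: ltW.
  have [|h1 h2] := s2P (- u); first by rewrite oppr_ge0.
  by split => //; exact: oppr_inj.
have Ds (g : G) (u : R) : [set: X] (A g (s u)) by [].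
have [||||h hh _] := @product_chart R G X A H principal_subgroup R setT
    (fun y => tau (set_val y)) s _ cs _ Ds.
- by apply: sub_comp_continuous; exact: coord_continuous.
- by move=> u; have [] := sP u.
- by move=> g u; transitivity (tau (s u)); [exact: tauG|have [] := sP u].
- by move=> z; apply: tauP; have [] := sP (tau (set_val z)).
apply: homeomorphic_trans (homeomorphic_full (fun x : X => I : [set: X] x)) _.
by apply: homeomorphic_sym; exists h.
Qed.

(** A section that converges to the singular orbit is continued to infinity; the
    tube around the singular orbit is then the whole space. *)
Lemma half_line_case : homeomorphic (orbit_space A) (`[0, +oo[%classic : set R) ->
  is_a_cone_bundle A.
Proof.
set J := (`[0, +oo[%classic : set R).
have JE u : J u <-> 0 <= u by rewrite /J /= in_itv /= andbT.
have cmax : continuous (fun u : R => Num.max 0 u).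
  by move=> u; apply: (@continuous_max _ _ (fun=> 0)); [exact: cst_continuous|exact: cvg_id].
have Jmax u : J (Num.max 0 u) by apply/JE; rewrite le_max lexx.
have Jid u : J u -> Num.max 0 u = u by move=> /JE u0; exact/max_idPr.
move=> /(homeo_coordinate cmax Jmax Jid)[t [rho [ct crho tJ tK rhoK]]].
have Jconv (a b u : R) : J a -> J b -> a <= u -> u <= b -> J u.
  by move=> /JE a0 _ au _; apply/JE; exact: le_trans au.
pose tau := coord t; have tau0 x : 0 <= tau x by exact/JE/tJ.
have tauP := coordP tK; have tauG := @coordG t; have ctau := coord_continuous ct.
have nons x : 0 < tau x -> ~ singular A x.
  move=> x0; apply: (@interior_nonsingular J t rho ct crho tK rhoK Jconv x (tau x)) => //.
    by apply/JE; rewrite subrr.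
  by apply/JE; rewrite addr_ge0.
have sing x : tau x = 0 -> singular A x.
  move=> x0; apply: (@end_boundary R _ _ t rho) => //.
  - by move=> o; exact/JE.
  - by move=> u u0 _; apply: rhoK; exact/JE.
have lft b : 0 <= b -> lifted tau 0 b.
  by move=> b0; apply: (@coord_lifted J t rho) => //; apply/JE.
have b2 : 0 <= 1 + 1 :> R by lra.
have [z z0 _|g [s1 [cs1 s10 s1P]]] := @end_section _ _ _ A _ tauP tauG H 1 1 ltr01 ltr01 (lft _ b2).
  by apply: nonsingular_type; exact: nons.
set H' := conj_set H g in s1P.
have iso1 u (u0 : 0 < u) (u1 : u <= 1) : isotropy A (s1 u) = H' := (s1P u u0 u1).2.
have clH' : closed H' by rewrite -(iso1 1 ltr01 (lexx _)); exact: isotropy_closed.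
have h2 : 0 < 2^-1 :> R by rewrite invr_gt0.
have [|||s2 [cs2 s21 s2P]] := @ray_section _ _ _ A _ tauP tauG H' 1 2^-1 (s1 1) clH' h2.
- by move=> b; apply: lifted_sub (lft (Num.max 0 b) _) _ _; rewrite ?le_max ?lexx ?orbT//; lra.
- move=> z z1; apply: has_type_conj; apply: nonsingular_type; apply: nons.
  by move: z1; rewrite -/(tau z); lra.
- exact: s1P ltr01 (lexx _).
pose s u := if u <= 1 then s1 u else s2 u.
have cs : continuous s.
  apply: (@paste_continuous _ _ _ id) => //; first by move=> u; exact: cvg_id.
  by move=> u ->.
have sP u : 0 < u -> over A tau H' u (s u).
  by move=> u0; rewrite /s; case: leP => u1; [exact: s1P|apply: s2P; exact: ltW].
have s0 : s 0 = s1 0 by rewrite /s ler01.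
have tauK u : J u -> tau (s u) = u.
  move=> /JE; rewrite le_eqVlt => /predU1P[<-|u0]; first by rewrite s0.
  by have [] := sP u u0.
have isoJ u : J u -> 0 < u -> isotropy A (s u) = H' by move=> _ u0; have [] := sP u u0.
have HK : H' `<=` isotropy A (s 0).
  by apply: (end_fixed cs ltr01) => u u0 _; apply: isoJ => //; exact/JE/ltW.
have orbJ y : J (tau y) -> exists a, y = A a (s (tau y)).
  by move=> Jy; apply: tauP; exact: tauK.
have J0 : J 0 by exact/JE.
have J1 : J 1 by apply/JE; exact: ler01.
have Jge u : J u -> 0 <= u by move=> /JE.
have nearJ y : tau y = 0 -> nbhs y [set z | J (tau z)].
  by move=> _; apply: filterE => z; exact/JE.
exists (s 0); split.
- by apply: sing; exact: tauK.
- move=> y sy; apply/esym/orbP; apply: tauP.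
  transitivity (0 : R); first exact: tauK.
  have := tau0 y; rewrite le_eqVlt => /predU1P[//|y0].
  by case: (nons y y0).
exists (tube_cone_bundle ctau tauG J0 J1 Jge cs tauK orbJ isoJ HK nearJ).
apply: homeomorphic_trans (homeomorphic_full (B := tube tau J) (fun y => (JE _).2 (tau0 y))) _.
apply: homeomorphic_sym; exists (to_tube tauG tauK).
exact: tube_homeo ctau tauG Jge cs tauK orbJ isoJ HK.
Qed.

End model.

(** * Orbit space a segment *)

Lemma continuous_compose (S T U : topologicalType) (f : S -> T) (g : T -> U) :
  continuous f -> continuous g -> continuous (fun x => g (f x)).
Proof. by move=> cf cg x; apply: (@continuous_at_comp _ _ _ f g); [exact: cf|exact: cg]. Qed.

Lemma sub_lift_continuous (S T : topologicalType) (B : set T) (f : S -> T)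
    (fB : forall s, B (f s)) : continuous f ->
  continuous (fun s => SigSub (mem_set (fB s)) : B).
Proof. by move=> cf s; apply: to_sub_continuous_at; exact: cf. Qed.

(** The tube number [b] is the set where [tau b] is at most 1. As the two
    coordinates add up to 2, the tubes cover the space and meet in their
    boundaries, where both coordinates are 1. *)
Section glued_tubes.
Variables (R : realType) (G : compactLieGroupType R) (X : completeMetricType R).
Variable A : isometric_action G X.
Variables (tau : bool -> X -> R) (s : bool -> R -> X) (H : bool -> set G).
Let J := (`[0%R, 1%R]%classic : set R).
Hypothesis ctau : forall b, continuous (tau b).
Hypothesis tauG : forall b g x, tau b (A g x) = tau b x.
Hypothesis tauP : forall b x y, tau b x = tau b y -> exists g, y = A g x.
Hypothesis cs : forall b, continuous (s b).
Hypothesis tauK : forall b t, J t -> tau b (s b t) = t.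
Hypothesis isoJ : forall b t, J t -> 0 < t -> isotropy A (s b t) = H b.
Hypothesis tau_ge0 : forall b x, 0 <= tau b x.
Hypothesis tauN : forall b x, tau (~~ b) x = 2 - tau b x.

Let JE t : J t <-> 0 <= t /\ t <= 1.
Proof. by rewrite /J /= in_itv /=; split => [/andP|[-> ->]]. Qed.
Let J0 : J 0. Proof. by apply/JE; rewrite lexx ler01. Qed.
Let J1 : J 1. Proof. by apply/JE; rewrite lexx ler01. Qed.
Let Jge t : J t -> 0 <= t. Proof. by move=> /JE[]. Qed.

Let orbJ b y : J (tau b y) -> exists g, y = A g (s b (tau b y)).
Proof. by move=> Jy; apply: (tauP (b := b)); exact: tauK. Qed.

Let HK b : H b `<=` isotropy A (s b 0).
Proof.
apply: (end_fixed (@cs b) ltr01) => t t0 t1; apply: isoJ => //.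
by apply/JE; split => //; exact: ltW.
Qed.

Let nearJ b y : tau b y = 0 -> nbhs y [set z | J (tau b z)].
Proof.
move=> y0; have lt : tau b y < 1 by rewrite y0 ltr01.
apply: filterS (near_lt (@ctau b y) lt) => z z1.
by apply/JE; split; [exact: tau_ge0|exact: ltW].
Qed.

Definition tube_of (b : bool) : closed_cone_bundle A (s b 0) :=
  tube_cone_bundle (@ctau b) (@tauG b) J0 J1 Jge (@cs b) (@tauK b) (@orbJ b)
    (@isoJ b) (@HK b) (@nearJ b).

Definition tval (b : bool) : cb_total (tube_of b) -> X := @tube_val R G X A J (s b).

Let homeo b : is_homeo (to_tube (@tauG b) (@tauK b)) :=
  tube_homeo (@ctau b) (@tauG b) Jge (@cs b) (@tauK b) (@orbJ b) (@isoJ b) (@HK b).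

Lemma tval_inj b : injective (@tval b).
Proof.
move=> c c' cc'; have [_ [k [kK _ _]]] := homeo b.
by rewrite -(kK c) -(kK c'); congr k; apply: val_inj.
Qed.

Lemma tval_section b : exists k : tube (tau b) J -> cb_total (tube_of b),
  continuous k /\ forall u, tval (k u) = set_val u.
Proof.
have [_ [k [_ kK ck]]] := homeo b; exists k; split => // u.
exact: (congr1 set_val (kK u)).
Qed.

Let k b := projT1 (cid (tval_section b)).
Let kc b : continuous (@k b). Proof. by rewrite /k; case: cid => ? []. Qed.
Let kE b u : tval (@k b u) = set_val u. Proof. by rewrite /k; case: cid => ? []. Qed.

Lemma tval_continuous b : continuous (@tval b).
Proof. exact: tube_val_continuous. Qed.

Lemma tval_act b g (c : cb_total (tube_of b)) : tval (tw_act g c) = A g (tval c).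
Proof. exact: tube_val_act. Qed.

Lemma boundaryP b (c : cb_total (tube_of b)) :
  @cb_boundary _ _ _ _ _ (tube_of b) c <-> tau b (tval c) = 1.
Proof.
exact: iff_sym (tube_boundaryP (@tauG b) J1 Jge (@tauK b) (@isoJ b) c).
Qed.

Let swap_sub b (c : @cb_boundary _ _ _ _ _ (tube_of b)) : tube (tau (~~ b)) J (tval (set_val c)).
Proof.
have /boundaryP c1 : @cb_boundary _ _ _ _ _ (tube_of b) (set_val c) by exact: set_valP.
by apply/JE; rewrite tauN c1; split; lra.
Qed.

Let swap_bd b (c : @cb_boundary _ _ _ _ _ (tube_of b)) :
  @cb_boundary _ _ _ _ _ (tube_of (~~ b)) (k (SigSub (mem_set (swap_sub c)))).
Proof.
have /boundaryP c1 : @cb_boundary _ _ _ _ _ (tube_of b) (set_val c) by exact: set_valP.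
by apply/boundaryP; rewrite kE /= tauN c1; lra.
Qed.

(** Both boundaries have the same image in [X], which identifies them. *)
Definition swap b (c : @cb_boundary _ _ _ _ _ (tube_of b)) : @cb_boundary _ _ _ _ _ (tube_of (~~ b)) :=
  SigSub (mem_set (swap_bd c)).

Lemma swapE b (c : @cb_boundary _ _ _ _ _ (tube_of b)) :
  tval (set_val (swap c)) = tval (set_val c).
Proof. exact: kE. Qed.

Lemma swap_continuous b : continuous (@swap b).
Proof.
have c1 : continuous (fun c : @cb_boundary _ _ _ _ _ (tube_of b) => tval (set_val c)).
  by apply: sub_comp_continuous; exact: tval_continuous.
have c2 := @sub_lift_continuous _ _ _ _ (@swap_sub b) c1.
have c3 := continuous_compose c2 (@kc (~~ b)).
exact: (@sub_lift_continuous _ _ _ _ (@swap_bd b) c3).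
Qed.

Definition gluing : @cb_boundary _ _ _ _ _ (tube_of false) -> @cb_boundary _ _ _ _ _ (tube_of true) :=
  @swap false.

Lemma gluing_homeo : is_homeo gluing.
Proof.
split; first exact: swap_continuous.
exists (@swap true); split; last exact: swap_continuous.
  by move=> c; apply: val_inj; apply: tval_inj;
    exact: (etrans (@swapE true (gluing c)) (@swapE false c)).
by move=> c; apply: val_inj; apply: tval_inj;
  exact: (etrans (@swapE false (@swap true c)) (@swapE true c)).
Qed.

Lemma gluing_equivariant : boundary_equivariant gluing.
Proof.
move=> g c c' cc'; apply: (@tval_inj true).
transitivity (tval (set_val c')); first exact: (@swapE false).
by rewrite cc' !tval_act; congr (A g _); exact/esym/(@swapE false).
Qed.

Let E : forall b, closed_cone_bundle A (s b 0) := tube_of.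
Let gv (p : {b : bool & cb_total (E b)}) : X := tval (projT2 p).

Definition glue_val (q : Defs.glue gluing) : X := gv (rep q).

Lemma glue_valE b c : glue_val (glue_in gluing c) = @tval b c.
Proof.
apply: (@cls_invariant _ (glue_rel gluing) _ gv) => p q [d [-> ->]].
exact: (esym (@swapE false d)).
Qed.

(** Points of different tubes with the same image lie on the boundaries, where
    they are identified. *)
Lemma glue_in_eq b b' (c : cb_total (E b)) (c' : cb_total (E b')) :
  tval c = tval c' -> glue_in gluing c = glue_in gluing c'.
Proof.
have sym (d : cb_total (E false)) (d' : cb_total (E true)) : tval d = tval d' ->
    glue_in gluing d = glue_in gluing d'.
  move=> dd'; have Jd : J (tau false (tval d)) :=
    tube_val_sub (@tauG false) (@tauK false) d.
  have Jd' : J (tau true (tval d')) := tube_val_sub (@tauG true) (@tauK true) d'.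
  have [_ d1] := (JE _).1 Jd; have [_ d1'] := (JE _).1 Jd'.
  have bd : @cb_boundary _ _ _ _ _ (E false) d.
    apply/boundaryP; apply/le_anti; rewrite d1 /=.
    by have := tauN false (tval d); rewrite dd' /= in d1 *; lra.
  apply: cls_rel; exists (SigSub (mem_set bd)); split => //; congr existT.
  apply: tval_inj.
    exact: (etrans (esym dd') (esym (@swapE false (SigSub (mem_set bd))))).
case: b c => c; case: b' c' => c' e.
- by congr glue_in; exact: tval_inj.
- by apply/esym; apply: sym.
- exact: sym.
- by congr glue_in; exact: tval_inj.
Qed.

Lemma glue_homeo : is_homeo glue_val.
Proof.
split.
  apply: quot_continuous.
  have -> : (fun p => glue_val (cls (glue_rel gluing) p)) = gv.
    by apply/funext => -[b c]; exact: (glue_valE c).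
  by apply: (@sigT_continuous _ (fun b => cb_total (E b)) X (fun b c => tval c)) => b;
    exact: tval_continuous.
have cov y : exists b, tube (tau b) J y.
  have [y1|y1] := leP (tau false y) 1.
    by exists false; apply/JE; split => //; exact: tau_ge0.
  exists true; apply/JE; split; first exact: tau_ge0.
  by rewrite (tauN false); lra.
have exh y : exists q : Defs.glue gluing, forall b (yb : tube (tau b) J y),
    q = glue_in gluing (k (SigSub (mem_set yb))).
  have [b yb] := cov y; exists (glue_in gluing (k (SigSub (mem_set yb)))) => b' yb'.
  by apply: glue_in_eq; rewrite !kE.
have [h hP] := choice exh.
exists h; split.
- move=> q; rewrite -(repK q); case: (rep q) => b c.
  have yb : tube (tau b) J (tval c) := tube_val_sub (@tauG b) (@tauK b) c.
  have -> : glue_val (cls (glue_rel gluing) (existT _ b c)) = tval c by exact: glue_valE.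
  rewrite (hP _ _ yb); congr (cls _ (existT _ b _)).
  by apply: tval_inj; rewrite kE.
- by move=> y; have [b yb] := cov y; rewrite (hP _ _ yb) glue_valE kE.
apply: (@closed_cover_continuous X (Defs.glue gluing) h (fun b => tube (tau b) J)) => //.
  move=> b y cl; apply/JE; split; first exact: tau_ge0.
  rewrite leNgt; apply/negP => y1.
  by have [z [/JE[_ z1] z2]] := cl _ (near_gt (@ctau b y) y1); move: z2; rewrite /= ltNge z1.
move=> b u.
have -> : (fun u : tube (tau b) J => h (set_val u)) = (fun u => glue_in gluing (k u)).
  apply/funext => v; have vb : tube (tau b) J (set_val v) by exact: set_valP.
  by rewrite (hP _ _ vb); congr (glue_in _ (k _)); apply: val_inj.
apply: (@continuous_at_comp _ _ _ (fun u : tube (tau b) J =>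
  existT (fun b => cb_total (E b)) b (k u)) (cls (glue_rel gluing))); last exact: cls_continuous.
apply: (@continuous_at_comp _ _ _ (@k b) (existT (fun b => cb_total (E b)) b)).
  exact: kc.
exact: (@existT_continuous _ (fun b => cb_total (E b))).
Qed.

Lemma glue_equivariant : equivariant_from_glue glue_val.
Proof. by move=> g b c; rewrite !glue_valE tval_act. Qed.

End glued_tubes.

Section segment.
Variables (R : realType) (G : compactLieGroupType R) (X : completeMetricType R).
Variables (A : isometric_action G X) (H : set G).
Hypothesis geo : geodesic_space X.
Hypothesis prin : is_principal_isotropy A H.

Lemma segment_case : homeomorphic (orbit_space A) (`[0, 1]%classic : set R) ->
  union_of_two_cone_bundles A.
Proof.
set J := (`[0, 1]%classic : set R).
have JE u : J u <-> 0 <= u /\ u <= 1.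
  by rewrite /J /= in_itv /=; split => [/andP|[-> ->]].
have Jcl u : J (clamp 0 1 u) by apply/JE; exact: clamp_itv ler01.
have Jid u : J u -> clamp 0 1 u = u by move=> /JE[]; exact: clamp_id.
move=> /(homeo_coordinate (@clamp_continuous R 0 1) Jcl Jid).
move=> [t1 [rho1 [ct1 crho1 t1J t1K rho1K]]].
(* The coordinate on the orbit space is made to range over [0,2], so that each
   of the two cone bundles has height 1. *)
pose t b o : R := if b then 2 - t1 o * 2 else t1 o * 2.
pose rho b u := if b then rho1 (1 - u / 2) else rho1 (u / 2).
pose J2 := [set u : R | 0 <= u /\ u <= 2].
have ct b : continuous (t b).
  have c2 : continuous (fun o => t1 o * 2).
    move=> o; apply: (@continuous_at_comp _ _ _ t1 (fun u : R => u * 2)); first exact: ct1.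
    by apply: cvgMl; exact: cvg_id.
  case: b => [u|]; last exact: c2.
  by apply: (@subr_continuous_at R _ (fun=> 2) (fun o => t1 o * 2)); [exact: cst_continuous|exact: c2].
have crho b : continuous (rho b).
  have c2 : continuous (fun u : R => u / 2) by move=> u; apply: cvgMl; exact: cvg_id.
  case: b => u.
    apply: (@continuous_at_comp _ _ _ (fun u : R => 1 - u / 2) rho1); last exact: crho1.
    by apply: subr_continuous_at; [exact: cst_continuous|exact: c2].
  by apply: (@continuous_at_comp _ _ _ (fun u : R => u / 2) rho1); [exact: c2|exact: crho1].
have tJ b o : J2 (t b o) by have /JE[? ?] := t1J o; case: b; split => /=; lra.
have tK b o : rho b (t b o) = o.
  by rewrite -[RHS]t1K /rho /t; case: b; congr rho1; field.
have rhoK b u : J2 u -> t b (rho b u) = u.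
  by move=> [u0 u2]; rewrite /t /rho; case: b; rewrite rho1K; [lra|apply/JE; lra|lra|apply/JE; lra].
have Jconv (a b u : R) : J2 a -> J2 b -> a <= u -> u <= b -> J2 u.
  by move=> [a0 _] [_ b2] au ub; split; lra.
pose tau b := coord (t b).
have tauE b x : tau b x = t b (orb A x) by [].
have tauG b g x : tau b (A g x) = tau b x by exact: coordG.
have tauP b x y : tau b x = tau b y -> exists g, y = A g x by exact: (coordP (tK b)).
have ctau b : continuous (tau b) by exact: coord_continuous (ct b).
have tau0 b x : 0 <= tau b x by have [] := tJ b (orb A x).
have tauN b x : tau (~~ b) x = 2 - tau b x by rewrite !tauE /t; case: b => /=; lra.
have tau2 b x : tau b x <= 2 by have [] := tJ b (orb A x).
have nons b x : 0 < tau b x -> tau b x < 2 -> ~ singular A x.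
  move=> x0 x2; pose e := Num.min (tau b x) (2 - tau b x).
  have e0 : 0 < e by rewrite lt_min x0 subr_gt0.
  have e1 : e <= tau b x by rewrite ge_min lexx.
  have e2 : e <= 2 - tau b x by rewrite ge_min lexx orbT.
  apply: (@interior_nonsingular R G X A J2 (t b) (rho b) (ct b) (crho b) (tK b)
    (rhoK b) Jconv x e e0); rewrite -/(tau b x); split; lra.
have sing b x : tau b x = 0 -> singular A x.
  move=> x0; apply: (@end_boundary R _ _ (t b) (rho b)) => //.
  - by move=> o; have [] := tJ b o.
  - by move=> u u0 u1; apply: rhoK; split; lra.
have lft b : lifted (tau b) 0 (1 + 2^-1).
  by apply: (@coord_lifted R G X A geo J2 (t b) (rho b) (ct b) (tK b) (rhoK b)); split; lra.
have h2 : 0 < 2^-1 :> R by rewrite invr_gt0.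
have exs b : exists gs : G * (R -> X), [/\ continuous gs.2, tau b (gs.2 0) = 0 &
    forall u, 0 < u -> u <= 1 -> over A (tau b) (conj_set H gs.1) u (gs.2 u)].
  have [z z0 z1|g [s [cs s0 sP]]] := @end_section _ _ _ A _ (tauP b) (tauG b) H 1 2^-1
    ltr01 h2 (lft b); last by exists (g, s).
  by apply: (nonsingular_type prin); apply: (nons b) => //; lra.
have [gs gsP] := choice exs.
pose s b := (gs b).2; pose H' b := conj_set H (gs b).1.
have cs b : continuous (s b) by have [] := gsP b.
have tauK b u : J u -> tau b (s b u) = u.
  move=> /JE[]; rewrite le_eqVlt => /predU1P[<- _|u0 u1]; first by have [] := gsP b.
  by have [_ _ h] := gsP b; have [] := h u u0 u1.
have isoJ b u : J u -> 0 < u -> isotropy A (s b u) = H' b.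
  by move=> /JE[_ u1] u0; have [_ _ h] := gsP b; have [] := h u u0 u1.
have s0 b : tau b (s b 0) = 0 by apply: tauK; apply/JE; rewrite lexx ler01.
exists (fun b => s b 0); split.
- by move=> b; exact: (sing b).
- move=> e; have := s0 true; rewrite (tauN false) tauE -e -tauE s0; lra.
- move=> y sy; have [y0|y0] := eqVneq (tau false y) 0.
    by exists false; apply/esym/orbP; apply: (tauP false); rewrite s0.
  exists true; apply/esym/orbP; apply: (tauP true); rewrite s0.
  apply/esym/eqP; rewrite (tauN false) subr_eq0 eq_sym; apply/negPn/negP => y2.
  apply: (nons false y) sy; first by rewrite lt_neqAle eq_sym y0 tau0.
  by rewrite lt_neqAle y2 tau2.
exists (tube_of ctau tauG tauP cs tauK isoJ tau0).
exists (gluing tauN).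
split; first exact: gluing_homeo; first exact: gluing_equivariant.
by eexists; [exact: glue_homeo|exact: glue_equivariant].
Qed.

End segment.

(** * Orbit space a circle *)

Section circle_bundle.
Variables (R : realType) (G : compactLieGroupType R) (X : completeMetricType R).
Variables (A : isometric_action G X) (H : set G).
Hypothesis geo : geodesic_space X.
Hypothesis prin : is_principal_isotropy A H.

Section arc.
Variable hc : orbit_space A -> circle R.
Variable kc : circle R -> orbit_space A.
Hypotheses (chc : continuous hc) (ckc : continuous kc).
Hypotheses (hcK : cancel hc kc) (kcK : cancel kc hc).
Variable z : orbit_space A.

Let q (o : orbit_space A) : R * R := set_val (hc o).
Let a := (q z).1.
Let b := (q z).2.
Let dot o := a * (q o).1 + b * (q o).2.
Let arc o := a * (q o).2 - b * (q o).1.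

Let qC o : (q o).1 ^+ 2 + (q o).2 ^+ 2 = 1.
Proof. exact: (set_valP (hc o)). Qed.

Let abC : a ^+ 2 + b ^+ 2 = 1. Proof. exact: qC. Qed.

Let lin_continuous (u v : R) : continuous (fun p : R * R => u * p.1 + v * p.2).
Proof.
by move=> p; apply: cvgD; apply: cvgM; try exact: cvg_cst; [exact: cvg_fst|exact: cvg_snd].
Qed.

Let cdot : continuous dot.
Proof.
move=> o; apply: (@continuous_at_comp _ _ _ q (fun p => a * p.1 + b * p.2));
  last exact: lin_continuous.
by apply: (@continuous_at_comp _ _ _ hc set_val); [exact: chc|exact: set_val_continuous].
Qed.

Let carc : continuous arc.
Proof.
have -> : arc = fun o => (- b) * (q o).1 + a * (q o).2.
  by apply/funext => o; rewrite /arc; ring.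
move=> o; apply: (@continuous_at_comp _ _ _ q (fun p => (- b) * p.1 + a * p.2));
  last exact: lin_continuous.
by apply: (@continuous_at_comp _ _ _ hc set_val); [exact: chc|exact: set_val_continuous].
Qed.

Let dot_arc o : dot o ^+ 2 + arc o ^+ 2 = 1.
Proof.
transitivity ((a ^+ 2 + b ^+ 2) * ((q o).1 ^+ 2 + (q o).2 ^+ 2)).
  by rewrite /dot /arc; ring.
by rewrite abC qC mulr1.
Qed.

Let dotz : dot z = 1. Proof. by rewrite /dot -!expr2. Qed.
Let arcz : arc z = 0. Proof. by rewrite /arc -/a -/b; ring. Qed.

(* The point on the same side as [z] whose component in the tangent direction
   [(-b, a)] at [z] is [v]. *)
Let pt (v : R) : R * R :=
  (Num.sqrt (1 - v ^+ 2) * a - v * b, Num.sqrt (1 - v ^+ 2) * b + v * a).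

Let sqr_le1 (v : R) : -1 <= v -> v <= 1 -> 0 <= 1 - v ^+ 2.
Proof.
move=> v1 v2; have -> : 1 - v ^+ 2 = (1 - v) * (1 + v) by ring.
by apply: mulr_ge0; lra.
Qed.

Let le11 : -1 <= 1 :> R. Proof. lra. Qed.

Let pt_circle v : circle R (pt (clamp (-1) 1 v)).
Proof.
have [v1 v2] := @clamp_itv R (-1) 1 v le11; set w := clamp _ _ _ in v1 v2 *.
have := sqr_sqrtr (sqr_le1 v1 v2); rewrite /circle /pt /=; set r := Num.sqrt _ => rE.
transitivity ((r ^+ 2 + w ^+ 2) * (a ^+ 2 + b ^+ 2)); first by ring.
by rewrite abC rE; ring.
Qed.

Let rho (v : R) : orbit_space A := kc (SigSub (mem_set (pt_circle v))).

Let q_rho v : -1 <= v -> v <= 1 -> q (rho v) = pt v.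
Proof.
move=> v1 v2; transitivity (pt (clamp (-1) 1 v)); last by rewrite clamp_id.
exact: (congr1 set_val (kcK _)).
Qed.

Let arc_rho v : -1 <= v -> v <= 1 -> arc (rho v) = v.
Proof.
move=> v1 v2; rewrite /arc q_rho// /pt /=.
transitivity (v * (a ^+ 2 + b ^+ 2)); first by ring.
by rewrite abC mulr1.
Qed.

Let rho_arc o : 0 < dot o -> rho (arc o) = o.
Proof.
move=> d0; have da := dot_arc o.
have a2 : arc o ^+ 2 <= 1 by rewrite -da lerDr sqr_ge0.
have : `|arc o| <= 1 by rewrite -(@expr_le1 _ 2) ?real_normK ?num_real.
rewrite ler_norml => /andP[a1 a3].
rewrite -[RHS]hcK -[LHS]hcK; congr kc; apply: val_inj.
rewrite -[LHS]/(q (rho (arc o))) -[RHS]/(q o) q_rho// /pt.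
have -> : Num.sqrt (1 - arc o ^+ 2) = dot o.
  by rewrite -da addrK sqrtr_sqr gtr0_norm.
rewrite [RHS]surjective_pairing; congr pair; rewrite /dot /arc.
  transitivity ((a ^+ 2 + b ^+ 2) * (q o).1); first by ring.
  by rewrite abC mul1r.
transitivity ((a ^+ 2 + b ^+ 2) * (q o).2); first by ring.
by rewrite abC mul1r.
Qed.

Let rho0 : rho 0 = z.
Proof. by rewrite -arcz rho_arc// dotz. Qed.

Let crho : continuous rho.
Proof.
apply: continuous_compose ckc; apply: sub_lift_continuous.
apply: continuous_compose; first exact: clamp_continuous.
have csq : continuous (fun v : R => Num.sqrt (1 - v ^+ 2)).
  apply: continuous_compose; last exact: sqrt_continuous.
  move=> v; apply: (@subr_continuous_at R R (fun=> 1) (fun v => v ^+ 2)).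
    exact: cst_continuous.
  exact: exprn_continuous.
move=> v; apply: (@pair_continuous_at R R R
  (fun v => Num.sqrt (1 - v ^+ 2) * a - v * b)
  (fun v => Num.sqrt (1 - v ^+ 2) * b + v * a)).
  apply: (@subr_continuous_at R R (fun v => Num.sqrt (1 - v ^+ 2) * a)
    (fun v => v * b)); first by apply: cvgMl; exact: csq.
  by apply: cvgMl; exact: cvg_id.
by apply: cvgD; apply: cvgMl; [exact: csq|exact: cvg_id].
Qed.

Let near_dot : \forall o \near z, 0 < dot o.
Proof. by apply: near_gt (@cdot z) _; rewrite dotz ltr01. Qed.

Lemma circle_nonboundary : ~ is_boundary R z.
Proof.
apply: (@not_boundary R _ z [set o | 0 < dot o] arc) => //.
- by move=> o _; exact: carc.
- by move=> o d0 e; rewrite -(rho_arc d0) e rho_arc// dotz.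
move=> W Wz; have Wr : nbhs (rho 0) W by rewrite rho0.
have [d d0 dW] := near_itv (cont_near (@crho 0) Wr).
pose m := Num.min 1 (d / 2).
have m0 : 0 < m by rewrite lt_min ltr01 divr_gt0.
have m1 : m <= 1 by rewrite ge_min lexx.
have md : m <= d / 2 by rewrite ge_min lexx orbT.
exists (rho (- m)), (rho m); rewrite arcz; split.
- by apply: dW; rewrite subr0 normrN gtr0_norm//; lra.
- by apply: dW; rewrite subr0 gtr0_norm//; lra.
- by rewrite arc_rho; lra.
- by rewrite arc_rho; lra.
Qed.

(** A geodesic from the orbit over [z] to a nearby orbit is so short that it stays
    over the half-circle around [z], where [arc] is a coordinate. Two such
    geodesics, one on each side, lift an arc around [z]. *)
Lemma circle_section : (forall x, has_type A H x) ->
  exists (U : set (orbit_space A)) (s : orbit_space A -> X),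
  [/\ open U, U z, continuous s &
    forall o, U o -> orb A (s o) = o /\ isotropy A (s o) = H].
Proof.
move=> typ; have clH := principal_closed prin.
pose x := repr z; have xz : orb A x = z by exact: Defs.orbK.
have [r r0 rD] : exists2 r : R, 0 < r & forall o, mdist z o < r -> 0 < dot o.
  by have /nbhs_ballP[r /= r0 rD] := near_dot; exists r.
have nr : \forall v \near (0 : R), mdist z (rho v) < r.
  by have := mdist_near r0 (@crho 0); rewrite rho0.
have [d d0 dr] := near_itv nr.
pose e := Num.min 1 (d / 2).
have e0 : 0 < e by rewrite lt_min ltr01 divr_gt0.
have e1 : e <= 1 by rewrite ge_min lexx.
have ed : e <= d / 2 by rewrite ge_min lexx orbT.
have lift v : v != 0 -> `|v| <= e -> exists f : R -> X, [/\ continuous f, f 0 = x &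
    forall u, Num.min 0 v <= u -> u <= Num.max 0 v -> orb A (f u) = rho u].
  move=> v0 ve; have : `|v| <= 1 by exact: le_trans ve e1.
  rewrite ler_norml => /andP[v1 v2].
  pose y := repr (rho v); have yv : orb A y = rho v by exact: Defs.orbK.
  have xy : orb A x <> orb A y.
    rewrite xz yv => /(congr1 arc); rewrite arcz arc_rho// => /esym/eqP.
    by rewrite (negbTE v0).
  have [c [cc c0 c1 cd cinj]] := orbit_geodesic geo xy.
  have cD u : 0 <= u -> u <= 1 -> 0 < dot (orb A (c u)).
    move=> u0 u1; apply: rD; rewrite -xz; apply: le_lt_trans (orbit_dist_le A x (c u)) _.
    apply: le_lt_trans (cd u u0 u1) _; rewrite xz yv; apply: dr.
    by rewrite subr0; lra.
  have carc' : continuous (fun x => arc (orb A x)).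
    exact: continuous_compose (@orb_continuous R G X A) carc.
  have [||f [cf f0 fP]] := @lift_path R X (fun x => arc (orb A x)) c cc.
  - by move=> u _ _; exact: carc'.
  - move=> u w u0 u1 w0 w1 uw; apply: cinj => //.
    by rewrite -(rho_arc (cD u u0 u1)) uw rho_arc//; exact: cD.
  rewrite c0 c1 xz yv arcz arc_rho// in f0 fP.
  exists f; split => // u u1 u2; have [fu [w [w0 w1 fw]]] := fP u u1 u2.
  by rewrite -[LHS]rho_arc ?fu// fw; exact: cD.
have [||f1 [cf1 f10 f1P]] := lift e; rewrite ?gt_eqF// ?gtr0_norm//.
have [||f2 [cf2 f20 f2P]] := lift (- e); rewrite ?oppr_eq0 ?gt_eqF// ?normrN ?gtr0_norm//.
pose c u := if u <= 0 then f2 u else f1 u.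
have cc : continuous c.
  apply: (@paste_continuous _ _ _ id) => //; first by move=> u; exact: cvg_id.
  by move=> u ->; rewrite f10 f20.
have cP u : `|u| <= e -> orb A (c u) = rho u.
  rewrite ler_norml => /andP[u1 u2]; rewrite /c; case: leP => u0.
    apply: f2P; last by rewrite le_max u0.
    by rewrite ge_min u1 orbT.
  by apply: f1P; [rewrite ge_min (ltW u0)|rewrite le_max u2 orbT].
have [y yP] := exact_over_exists (typ (c 0)).
have typ0 : \forall u \near (0 : R), has_type A H (c u) :=
  @filterE R (nbhs (0 : R)) (nbhs_filter _) _ (fun u => typ (c u)).
have [s [cs _ [d' d'0 sP]]] := local_section clH cc typ0 yP.
pose e' := Num.min d' e; have e'0 : 0 < e' by rewrite lt_min d'0.
have ca : continuous (fun o => `|arc o|).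
  by apply: (continuous_compose carc) => u; apply: cvg_norm; exact: cvg_id.
exists [set o | 0 < dot o /\ `|arc o| < e'], (fun o => s (arc o)); split.
- rewrite openE => w [w1 w2]; rewrite /interior.
  by apply: filterI; [exact: near_gt (@cdot w) w1|exact: near_lt (ca w) w2].
- by rewrite /= dotz arcz normr0.
- exact: continuous_compose carc cs.
move=> w [w1]; rewrite lt_min => /andP[w2 w3].
have [|[g sg] sH] := sP (arc w); first by rewrite subr0 ltW.
by split => //; rewrite sg orb_act cP ?rho_arc// ltW.
Qed.

End arc.

(** Where the sections [s i] and [s j] are both defined, [s j = n (s i)] for an
    element [n] of the normalizer that is unique modulo [H], since the isotropy
    groups are equal to [H]. The class of [n] is the transition function. *)
Lemma circle_case : homeomorphic (orbit_space A) (circle R) ->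
  is_fiber_bundle_with_group (@weyl_act G H) (orb A).
Proof.
move=> [hc [chc [kc [hcK kcK ckc]]]]; split; first exact: orb_continuous.
have clH := principal_closed prin; have sH := principal_subgroup prin.
have typ x : has_type A H x.
  by apply: (nonsingular_type prin); exact: (circle_nonboundary chc ckc hcK kcK).
have exU (z : orbit_space A) :
    exists Us : set (orbit_space A) * (orbit_space A -> X),
    [/\ open Us.1, Us.1 z, continuous Us.2 &
      forall o, Us.1 o -> orb A (Us.2 o) = o /\ isotropy A (Us.2 o) = H].
  have [U [s [oU Uz cs sP]]] := circle_section chc ckc hcK kcK z typ.
  by exists (U, s).
have [Us UsP] := choice exU.
pose U z := (Us z).1; pose s z := (Us z).2.
have oU z : open (U z) by have [] := UsP z.
have Uz z : U z z by have [] := UsP z.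
have cs z : continuous (s z) by have [] := UsP z.
have sO z o : U z o -> orb A (s z o) = o by have [_ _ _ h] := UsP z => /h[].
have sI z o : U z o -> isotropy A (s z o) = H by have [_ _ _ h] := UsP z => /h[].
pose e (g g' : G) := exists2 h, H h & g' = (g * h)%g.
have chart z : exists h : (U z * coset_space H)%type -> orb A @^-1` (U z),
    is_homeo h /\ forall u g, set_val (h (u, cls e g)) = A g (s z (set_val u)).
  have Ds g (u : U z) : (orb A @^-1` (U z)) (A g (s z (set_val u))).
    by rewrite /= orb_act sO; exact: set_valP.
  have pU (y : orb A @^-1` (U z)) : U z (orb A (set_val y)) by exact: (set_valP y).
  have [|||||h hh hE] := @product_chart R G X A H sH (U z) (orb A @^-1` (U z))
      (fun y => SigSub (mem_set (pU y))) (fun u => s z (set_val u)) _ _ _ Ds.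
  - apply: sub_lift_continuous; apply: sub_comp_continuous; exact: orb_continuous.
  - by apply: sub_comp_continuous; exact: cs.
  - by move=> u; apply: sI; exact: set_valP.
  - by move=> g u; apply: val_inj; rewrite /= orb_act sO//; exact: set_valP.
  - by move=> y; apply/orbP; rewrite sO//; exact: pU.
  by exists h.
pose h z := projT1 (cid (chart z)).
have hH z : is_homeo (h z) by rewrite /h; case: cid => ? [].
have hE z u g : set_val (h z (u, cls e g)) = A g (s z (set_val u)).
  by rewrite /h; case: cid => ? [].
exists (orbit_space A), U, h; split => //.
- by apply/seteqP; split => // z _; exists z.
- move=> z; split; first exact: hH.
  move=> u f; have -> : f = cls e (rep f) by rewrite repK.
  by rewrite hE orb_act sO//; exact: set_valP.
move=> i j; pose N := normalizer H.
pose eN (n n' : N) := exists2 h, H h & set_val n' = (set_val n * h)%g.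
have Ui (u : U i `&` U j) : U i (set_val u) by have [] := set_valP u.
have Uj (u : U i `&` U j) : U j (set_val u) by have [] := set_valP u.
have exn (u : U i `&` U j) : exists n : N, A (set_val n) (s i (set_val u)) = s j (set_val u).
  have [g sg] : exists g, s j (set_val u) = A g (s i (set_val u)).
    by apply/orbP; rewrite !sO.
  have Ng : N g by rewrite /N /normalizer /= -(sI i _ (Ui u)) -isotropy_act -sg !sI.
  by exists (SigSub (mem_set Ng) : N).
have [n nP] := choice exn.
have nE u (n' : N) : A (set_val n') (s i (set_val u)) = s j (set_val u) ->
    cls eN (n u) = cls eN n'.
  move=> n'P; apply: cls_rel; exists ((set_val (n u))^-1 * set_val n')%g; last first.
    by rewrite mulgA mulgV mul1g.
  by rewrite -(sI i _ (Ui u)) /isotropy /= actM n'P -nP actK.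
exists (fun u => cls eN (n u)).
  move=> u; pose P (m : N) (u : U i `&` U j) :=
    A (set_val m) (s i (set_val u)) = s j (set_val u).
  have cr := @closed_rel_continuous N (U i `&` U j) (weyl_group H) P
    (fun m _ => cls eN m) (fun u => cls eN (n u)) u.
  apply: cr.
  - apply: compact_sub; apply: subclosed_compact (@lie_compact R G) _ => //.
    exact: normalizer_closed.
  - move=> m nPm.
    suff : \forall p \near (m, u), A (set_val p.1) (s i (set_val p.2)) <> s j (set_val p.2).
      by [].
    have cw k : {for (m, u), continuous (fun p : N * (U i `&` U j) => s k (set_val p.2))}.
      apply: (@continuous_at_comp _ _ _ snd (fun v : U i `&` U j => s k (set_val v))).
        exact: cvg_snd.
      exact: sub_comp_continuous.
    apply: (@neq_near _ _ (fun p : N * (U i `&` U j) =>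
      A (set_val p.1) (s i (set_val p.2))) (fun p => s j (set_val p.2))) => //.
      exact: metric_hausdorff.
    apply: act_continuous_at => //.
    apply: (@continuous_at_comp _ _ _ fst (set_val : N -> G)); first exact: cvg_fst.
    exact: set_val_continuous.
  - move=> m _; apply: (@continuous_at_comp _ _ _ fst (cls eN)); first exact: cvg_fst.
    exact: cls_continuous.
  - by apply: filterE => v; exists (n v).
  by move=> m v; exact: nE.
move=> u ui uj f uiu uju; have -> : f = cls e (rep f) by rewrite repK.
rewrite hE uiu.
have -> : weyl_act (cls eN (n u)) (cls e (rep f)) =
    cls e (rep f * (set_val (rep (cls eN (n u))))^-1)%g by rewrite repK.
rewrite hE uju actM; congr (A _ _).
rewrite (@cls_invariant _ eN _ (fun m : N => A (set_val m)^-1%g (s j (set_val u)))).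
  by rewrite -nP actK.
move=> m m' [k Hk ->]; rewrite invgM actM.
have NV : normalizer H (set_val m)^-1%g.
  by have [_ _] := normalizer_subgroup H; apply; exact: set_valP.
have : isotropy A (A (set_val m)^-1%g (s j (set_val u))) k^-1%g.
  by rewrite isotropy_act sI// NV; have [_ _] := sH; exact.
by move=> ->.
Qed.

End circle_bundle.

(** * The structure theorem *)

Unset Implicit Arguments.
Set Strict Implicit.

Theorem theorem4p12 (R : realType) (X : completeMetricType R)
    (m : {measure set (borel X) -> \bar R})
    (G : compactLieGroupType R) (A : isometric_action G X) (H : set G) :
  separable X -> finite_on_balls m ->
  geodesic_space X -> essentially_non_branching m ->
  one_dimensional_model (orbit_space A) ->
  is_principal_isotropy A H ->
  [/\ (homeomorphic (orbit_space A) (`[0, 1]%classic : set R) ->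
         union_of_two_cone_bundles A),
      (homeomorphic (orbit_space A) (`[0, +oo[%classic : set R) ->
         is_a_cone_bundle A),
      (homeomorphic (orbit_space A) (circle R) ->
         is_fiber_bundle_with_group (@weyl_act G H) (orb A)) &
      (homeomorphic (orbit_space A) R ->
         homeomorphic X (R * coset_space H)%type)].
Proof.
move=> _ _ geo _ _ prin; split.
- exact: segment_case geo prin.
- exact: half_line_case geo prin.
- exact: circle_case geo prin.
- exact: real_line_case geo prin.
Qed.
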